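(* Let the families $\{\mathcal{S}_{TF}^{\rm i}\}_{T\in\mathcal{T}_h,F\in\mathcal{F}_T}$ and $\{\mathcal{S}_F^{\rm b}\}_{F\in\mathcal{F}_h^{\rm b}}$ of Hermitian positive (semidefinite) fields $\mathcal{S}_{TF}^{\rm i},\mathcal{S}_F^{\rm b}\in L^\infty(F;\mathbb{C}^{m\times m})$ be such that, for some constant $C_{\mathcal S}$ (itself depending only on $d$, $\Omega$, the mesh regularity parameter, $C_{\mathcal{A}}$, $k$), for all $T\in\mathcal{T}_h$ and all $F\in\mathcal{F}_T$, \[ (\mathcal{S}_{TF}^{\rm i}v,v)_F\le C_{\mathcal S}\,\mathfrak{a}_T\|v\|_{L^2(F;\mathbb{C}^m)}^2\qquad\text{for all } v\in\mathcal{P}^k(F;\mathbb{C}^m), \] \[ |(w,\mathcal{N}_Fv)_F|\le C_{\mathcal S}\,\mathfrak{a}_T^{1/2}\|w\|_{L^2(F;\mathbb{C}^m)}(\mathcal{S}_{TF}^{\rm i}v,v)_F^{1/2}\qquad\text{for all } w,v\in L^2(F;\mathbb{C}^m), \] and, for all $F\in\mathcal{F}_h^{\rm b}$, \[ \mathrm{Ker}(\mathcal{M}_F-\mathcal{N}_F)\subset\mathrm{Ker}(\mathcal{M}_F+\mathcal{S}_F^{\rm b}-\mathcal{N}_F), \] \[ |((\mathcal{M}_F+\mathcal{S}_F^{\rm b}+\mathcal{N}_F)w,v)_F|\le C_{\mathcal S}\,\mathfrak{a}_{T_F}^{1/2}\|w\|_{L^2(F;\mathbb{C}^m)}\big[\Re((\mathcal{M}_F+\mathcal{S}_F^{\rm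 b})v,v)_F\big]^{1/2}\qquad\text{for all } w,v\in L^2(F;\mathbb{C}^m). \] Then there is a constant $C>0$, depending only on $d$, $\Omega$, the mesh regularity parameter, the constant $C_{\mathcal{A}}$, the polynomial degree $k$, and the constant $C_{\mathcal S}$ in the four conditions just stated (and not otherwise on $h$, $\mathcal{A}$, $\mathcal{K}$, $\mathcal{M}$), such that, for all $\underline{v}_h\in\underline{U}_h^k$, \[ |||\underline{v}_h|||_h \le C\,\rho^2 \sup_{\underline{w}_h\in\underline{U}_h^k\setminus\{\underline{0}\}} \frac{|a_h(\underline{v}_h,\underline{w}_h)|}{|||\underline{w}_h|||_h}, \] where \[ \rho := \frac{\mathfrak{r}_\sharp}{\mathfrak{r}_\flat},\qquad \mathfrak{r}_\sharp := \|\mathcal{K}\|_{L^\infty(\Omega;\mathbb{C}^{m\times m})} + \|\nabla\cdot\mathcal{A}\|_{L^\infty(\Omega;\mathbb{C}^{m\times m})}. \] As a consequence, for every $f\in L^2(\Omega;\mathbb{C}^m)$ the discrete problem: find $\underline{u}_h\in\underline{U}_h^k$ such that $a_h(\underline{u}_h,\underline{v}_h)=(f,v_h)_\Omega$ for all $\underline{v}_h\in\underline{U}_h^k$, is well-posed.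
   Context: **Continuous data.** $\Omega\subset\mathbb{R}^d$, $d\ge1$, is a bounded polytopal domain with outward unit normal $n$ on $\partial\Omega$; $m\ge1$ is an integer. $(\alpha,\beta)_{\mathbb{C}^m}:=\beta^{\mathsf H}\alpha$, and $(w,v)_Y:=\int_Y (w,v)_{\mathbb{C}^m}$ for a domain or face $Y$. Matrix norms are those induced by the Euclidean norm of $\mathbb{C}^m$; $\mathcal{I}_m$ is the identity matrix. $\mathcal{K}\in L^\infty(\Omega;\mathbb{C}^{m\times m})$; $\mathcal{A}=\{\mathcal{A}^i\}_{1\le i\le d}$ with $\mathcal{A}^i=(\mathcal{A}^i)^{\mathsf H}\in L^\infty(\Omega;\mathbb{C}^{m\times m})\cap C^{0,\frac12}(\Omega;\mathbb{C}^{m\times m})$ and $\nabla\cdot\mathcal{A}:=\sum_{i=1}^d\partial_i\mathcal{A}^i\in L^\infty(\Omega;\mathbb{C}^{m\times m})$. There is a fixed real $\mathfrak{r}_\flat>0$ with $\mathcal{K}+\mathcal{K}^{\mathsf H}-\nabla\cdot\mathcal{A}\ge 2\mathfrak{r}_\flat\mathcal{I}_m$ a.e. in $\Omega$. Set $A_1:=\sum_{i=1}^d\mathcal{A}^i\partial_i$ and $A:=\mathcal{K}+A_1$. On $\partial\Omega$, $\mathcal{N}:=\sum_{i=1}^d n_i\mathcal{A}^i_{|\partial\Omega}$, and $\mathcal{M}\in L^\infty(\partial\Omega;\mathbb{C}^{m\times m})$ is a non-negative field ($\Re(\xi^{\mathsf H}\mathcal{M}\xi)\ge0$ for all $\xi\in\mathbb{C}^m$)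 such that $\mathrm{Ker}(\mathcal{M}-\mathcal{N})+\mathrm{Ker}(\mathcal{M}+\mathcal{N})=\mathbb{C}^m$. **Mesh.** $(\mathcal{T}_h,\mathcal{F}_h)$ is a polytopal mesh: $\mathcal{T}_h$ is a finite set of disjoint open polytopal elements whose closures cover $\overline\Omega$; $\mathcal{F}_h$ is a finite set of disjoint flat, relatively open, connected faces such that each $F\in\mathcal{F}_h$ is either an interface contained in $\partial T_1\cap\partial T_2$ for two distinct elements, or a boundary face contained in $\partial T\cap\partial\Omega$ for one element $T$, and such that each $\partial T$ is the union of the closures of the faces in $\mathcal{F}_T:=\{F\in\mathcal{F}_h: F\subset\partial T\}$. $\mathcal{F}_h^{\rm b}$ is the set of boundary faces; for $F\in\mathcal{F}_h^{\rm b}$, $T_F$ is the unique element with $F\in\mathcal{F}_{T_F}$. $h_Y$ is the diameter of $Y\in\mathcal{T}_h\cup\mathcal{F}_h$ and $h:=\max_T h_T$. The mesh regularity parameter is a number $\varrho\in(0,1)$ for which there is a matching simplicial submesh such that every simplex $\tau$ of it, of diameter $h_\tau$ and inradius $r_\tau$, satisfies $\varrho h_\tau\le r_\tau$ and, if $\tau\subset T\in\mathcal{T}_h$, $\varrho h_T\le h_\tau$. Each $F$ has a fixed unit normal $n_F$, equal to $n$ on boundary faces; $\omega_{TF}\in\{-1,1\}$ is such that $\omega_{TF}n_F$ points out of $T$. $\mathcal{N}_F:=\sum_{i=1}^d n_{F,i}\mathcal{A}^i_{|F}$ and, for $F\in\mathcal{F}_h^{\rm b}$, $\mathcal{M}_F:=\mathcal{M}_{|F}$.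 **Discrete space.** $\mathcal{P}^k(Y;\mathbb{C}^m)$ denotes $\mathbb{C}^m$-valued polynomials of total degree $\le k$ on $Y$, and $\pi^k_Y$ the $L^2$-orthogonal projector onto it (or its $\mathbb{C}^{m\times m}$-valued analogue). For a fixed integer $k\ge0$, $\underline{U}_h^k:=\{\underline{v}_h=((v_T)_{T\in\mathcal{T}_h},(v_F)_{F\in\mathcal{F}_h}): v_Y\in\mathcal{P}^k(Y;\mathbb{C}^m)\ \forall Y\in\mathcal{T}_h\cup\mathcal{F}_h\}$. For $\underline{v}_h\in\underline{U}_h^k$, $v_h\in L^2(\Omega;\mathbb{C}^m)$ is given by $(v_h)_{|T}:=v_T$, and $\underline{v}_T$ collects the components attached to $T$ and its faces. **Reference quantities.** $\mathfrak{a}_T:=\max_{1\le i\le d}\|\mathcal{A}^i\|_{L^\infty(T;\mathbb{C}^{m\times m})}$, $\mathfrak{t}_T:=\max(\mathfrak{a}_Th_T^{-1},\mathfrak{r}_\flat)^{-1}$. $C_{\mathcal{A}}>0$ is a constant such that $\|\pi^0_T\mathcal{A}^i-\mathcal{A}^i\|_{L^\infty(T;\mathbb{C}^{m\times m})}\le C_{\mathcal{A}}(\mathfrak{r}_\flat\mathfrak{a}_Th_T)^{\frac12}$ for all $T\in\mathcal{T}_h$ and all $i$. **Sesquilinear forms.** With $\mathcal{S}_{TF}^{\rm i},\mathcal{S}_F^{\rm b}\in L^\infty(F;\mathbb{C}^{m\times m})$ Hermitian positive (semidefinite) stabilization fields, \[ \begin{aligned} a_h(\underline{w}_h,\underline{v}_h)&:=\sum_{T\in\mathcal{T}_h}(Aw_T,v_T)_T+\mathfrak{r}_\flat\sum_{T\in\mathcal{T}_h}h_T\sum_{F\in\mathcal{F}_T}(w_F-w_T,v_F-v_T)_F\\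 &\quad+\sum_{T\in\mathcal{T}_h}\sum_{F\in\mathcal{F}_T}\omega_{TF}\Big(\mathcal{N}_F(w_F-w_T),\frac{v_F+v_T}{2}\Big)_F\\ &\quad+\frac12\sum_{F\in\mathcal{F}_h^{\rm b}}((\mathcal{M}_F+\mathcal{S}_F^{\rm b}-\mathcal{N}_F)w_F,v_F)_F+j_h(\underline{w}_h,\underline{v}_h),\\ j_h(\underline{w}_h,\underline{v}_h)&:=\sum_{T\in\mathcal{T}_h}\sum_{F\in\mathcal{F}_T}(\mathcal{S}_{TF}^{\rm i}(w_F-w_T),v_F-v_T)_F. \end{aligned} \] **Norms.** $|\underline{v}_h|_{{\rm b},h}^2:=\sum_{F\in\mathcal{F}_h^{\rm b}}\Re((\mathcal{M}_F+\mathcal{S}_F^{\rm b})v_F,v_F)_F$; $|\underline{v}_h|_{j,h}^2:=j_h(\underline{v}_h,\underline{v}_h)$; $\|\underline{v}_T\|_{0,T}^2:=\|v_T\|_{L^2(T;\mathbb{C}^m)}^2+|\underline{v}_T|_{0,\partial T}^2$ with $|\underline{v}_T|_{0,\partial T}^2:=h_T\sum_{F\in\mathcal{F}_T}\|v_F-v_T\|_{L^2(F;\mathbb{C}^m)}^2$; \[ |||\underline{v}_h|||_{\flat,h}^2:=\mathfrak{r}_\flat\sum_{T\in\mathcal{T}_h}\|\underline{v}_T\|_{0,T}^2+\frac12|\underline{v}_h|_{{\rm b},h}^2+|\underline{v}_h|_{j,h}^2,\qquad |||\underline{v}_h|||_h^2:=|||\underline{v}_h|||_{\flat,h}^2+\sum_{T\in\mathcal{T}_h}\mathfrak{t}_T\|A_1v_T\|_{L^2(T;\mathbb{C}^m)}^2.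 \] *)

(* Defs.v *)
(* Points of R^d are row vectors 'rV[R]_d over R : realType; the values of the
   unknowns are columns 'cV[R[i]]_m. *)
From HB Require Import structures.
From mathcomp Require Import all_boot all_order all_algebra.
From mathcomp Require Import all_classical all_reals all_analysis.
From mathcomp Require Import measurable_realfun ess_sup_inf complex.

Set Implicit Arguments.
Unset Strict Implicit.
Unset Printing Implicit Defensive.

Import Order.TTheory GRing.Theory Num.Theory.
Import numFieldNormedType.Exports.
Local Open Scope classical_set_scope.
Local Open Scope ring_scope.
Local Open Scope sesquilinear_scope.

Definition rV_display : measure_display.
Proof. exact: default_measure_display. Qed.

(* The Borel sigma-algebra of R^n, generated by the coordinate maps. *)
Section measurable_rV.
Variables (R : realType) (n : nat).

Let coors : 'I_n -> 'rV[R]_n -> R := fun i x => x 0 i.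

Let rV_set0 : g_sigma_preimage coors set0.
Proof. exact: sigma_algebra0. Qed.

Let rV_setC A : g_sigma_preimage coors A -> g_sigma_preimage coors (~` A).
Proof. exact: sigma_algebraC. Qed.

Let rV_bigcup (F : _^nat) : (forall i, g_sigma_preimage coors (F i)) ->
  g_sigma_preimage coors (\bigcup_i (F i)).
Proof. exact: sigma_algebra_bigcup. Qed.

HB.instance Definition _ := @isMeasurable.Build rV_display
  'rV[R]_n (g_sigma_preimage coors) rV_set0 rV_setC rV_bigcup.

End measurable_rV.

Lemma measurable_rV_coord (R : realType) n (i : 'I_n) :
  measurable_fun [set: 'rV[R]_n] (fun x : 'rV[R]_n => x 0 i).
Proof.
move=> _ Y mY; rewrite setTI; apply: sub_sigma_algebra => /=.
rewrite -bigcup_seq/=; exists i => /=; first by rewrite mem_index_enum.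
by exists Y => //; rewrite setTI.
Qed.

Lemma measurable_fun_rV d (T : measurableType d) (R : realType) n
    (f : T -> 'rV[R]_n) :
  (forall i, measurable_fun [set: T] (fun x => f x 0 i)) ->
  measurable_fun [set: T] f.
Proof.
move=> mf.
suff mfS : g_sigma_preimage (fun i x => f x 0 i) `<=` measurable.
  move=> _ A mA; rewrite setTI; apply: mfS.
  move: (g_sigma_preimage_comp (fun (i : 'I_n) (x : 'rV[R]_n) => x 0 i) f).
  by move=> ->; exists A => //; rewrite setTI.
apply: smallest_sub; first exact: sigma_algebra_measurable.
case: n => [|n] in f mf *; first by rewrite big_ord0.
rewrite -bigcup_mkord_ord; apply: bigcup_sub => i Ii.
by move=> A [B mB <-]; exact: mf.
Qed.

(* The n-dimensional Lebesgue measure, by iterated product with the Lebesgue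
   measure of the line (the new coordinate comes first). *)
Section lebesgue_rV.
Variable R : realType.

Definition rV_cons n (z : 'rV[R]_n * measurableTypeR R) : 'rV[R]_n.+1 :=
  \row_i (if unlift ord0 i is Some j then z.1 0 j else z.2).

Lemma measurable_rV_cons n : measurable_fun [set: _] (@rV_cons n).
Proof.
apply: measurable_fun_rV => i.
under eq_fun do rewrite mxE.
case: (unlift ord0 i) => [j|]; last exact: measurable_snd.
exact: (measurableT_comp (@measurable_rV_coord R n j) measurable_fst).
Qed.

Definition lebesgue_cons n (mu : {measure set 'rV[R]_n -> \bar R}) :
    {measure set 'rV[R]_n.+1 -> \bar R} :=
  measure_function_pushforward__canonical__measure_function_Measure
    (mu \x @lebesgue_measure R)%E (@measurable_rV_cons n).

Fixpoint lebesgue_rV n : {measure set 'rV[R]_n -> \bar R} :=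
  if n is n'.+1 then lebesgue_cons (lebesgue_rV n') else \d_ (0 : 'rV[R]_0).

End lebesgue_rV.

Section euclidean.
Variables (R : realType) (d : nat).
Implicit Types (x y n : 'rV[R]_d) (c : R) (A : set 'rV[R]_d).

Definition edot x y : R := \sum_i x 0 i * y 0 i.
(* The norm of the library on 'rV is the sup norm; it induces the same topology
   but not the same distances. *)
Definition enorm x : R := Num.sqrt (edot x x).
Definition diam A : R := sup [set enorm (x - y) | x in A & y in A].
Definition bnd A : set 'rV[R]_d := closure A `\` interior A.

Definition hyperplane n c : set 'rV[R]_d := [set x | edot x n = c].
Definition hproj n c x : 'rV[R]_d := x - (edot x n - c) *: n.
Definition slab n c : set 'rV[R]_d := [set x | c <= edot x n <= c + 1].

Lemma measurable_edot n : measurable_fun [set: 'rV[R]_d] (edot^~ n).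
Proof.
apply: measurable_sum => i; apply: measurable_funM => //.
exact: measurable_rV_coord.
Qed.

Lemma measurable_hproj n c : measurable_fun [set: 'rV[R]_d] (hproj n c).
Proof.
apply: measurable_fun_rV => i.
under eq_fun do rewrite !mxE.
apply: measurable_funB; first exact: measurable_rV_coord.
apply: measurable_funM => //; apply: measurable_funB => //.
exact: measurable_edot.
Qed.

Lemma measurable_slab n c : measurable (slab n c).
Proof.
have -> : slab n c = [set: _] `&` edot^~ n @^-1` `[c, c + 1]%classic.
  by rewrite setTI; apply/seteqP; split=> x /=; rewrite in_itv.
exact: (measurable_edot n) measurableT _ (measurable_itv _).
Qed.

(* The (d-1)-dimensional measure on the hyperplane edot x n = c, for a unit
   vector n: the measure of a subset E of the hyperplane is the Lebesgue
   measure of the cylinder of height one {x + t *: n | x in E, 0 <= t <= 1},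
   i.e. the measure is the image by the orthogonal projection of the Lebesgue
   measure restricted to a slab of thickness one.  When d = 1 it is the unit
   mass at the point c *: n. *)
Definition surface n c : {measure set 'rV[R]_d -> \bar R} :=
  measure_function_pushforward__canonical__measure_function_Measure
    (mrestr (lebesgue_rV R d) (measurable_slab n c)) (measurable_hproj n c).

(* n points out of A at the boundary point x.  Outward normals to a face are
   only required to satisfy this almost everywhere on the face: other parts of
   a non-convex polytope may touch the face along a null set. *)
Definition outward_at A n x :=
  \forall t \near 0^'+, ~ A (x + t *: n) /\ A (x - t *: n).

End euclidean.

Section fields.
Variables (R : realType) (d : nat).
Local Notation C := R[i].
Local Notation rV := 'rV[R]_d.
Implicit Types (mu : {measure set rV -> \bar R}) (D : set rV).

Definition adjoint p q (B : 'M[C]_(p, q)) : 'M[C]_(q, p) := map_mx conjc B^T.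

(* For columns, this is beta^H * alpha. *)
Definition cdot p q (alpha beta : 'M[C]_(p, q)) : C :=
  \tr (adjoint beta *m alpha).
Definition cnorm p q (alpha : 'M[C]_(p, q)) : R :=
  Num.sqrt (complex.Re (cdot alpha alpha)).
Definition opnorm p q (B : 'M[C]_(p, q)) : R :=
  sup [set cnorm (B *m xi) | xi in [set xi : 'cV[C]_q | cnorm xi <= 1]].

Definition qform m (B : 'M[C]_m) (xi : 'cV[C]_m) : C := cdot (B *m xi) xi.

Definition hermitian_psd m (B : 'M[C]_m) :=
  adjoint B = B /\ forall xi, 0 <= qform B xi.

Definition cint mu D (f : rV -> C) : C :=
  Complex (\int[mu]_(x in D) complex.Re (f x))%R
          (\int[mu]_(x in D) complex.Im (f x))%R.

Definition ip p q mu D (w v : rV -> 'M[C]_(p, q)) : C :=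
  cint mu D (fun x => cdot (w x) (v x)).

Definition measurable_field p q D (f : rV -> 'M[C]_(p, q)) :=
  forall a b, measurable_fun D (fun x => complex.Re (f x a b)) /\
              measurable_fun D (fun x => complex.Im (f x a b)).

Definition L2norm p q mu D (f : rV -> 'M[C]_(p, q)) : R :=
  Num.sqrt (\int[mu]_(x in D) cnorm (f x) ^+ 2)%R.
Definition inL2 p q mu D (f : rV -> 'M[C]_(p, q)) :=
  measurable_field D f /\ (\int[mu]_(x in D) (cnorm (f x) ^+ 2)%:E < +oo)%E.

Definition Linf_enorm p q mu D (f : rV -> 'M[C]_(p, q)) : \bar R :=
  Lnorm mu +oo (fun x => (opnorm (f x) * \1_D x)%:E).
Definition Linf_norm p q mu D (f : rV -> 'M[C]_(p, q)) : R :=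
  fine (Linf_enorm mu D f).
Definition inLinf p q mu D (f : rV -> 'M[C]_(p, q)) :=
  measurable_field D f /\ (Linf_enorm mu D f < +oo)%E.

Definition evec (i : 'I_d) : rV := delta_mx 0 i.

Definition pderiv p q (i : 'I_d) (f : rV -> 'M[C]_(p, q)) (x : rV) :
    'M[C]_(p, q) :=
  \matrix_(a, b) Complex ('D_(evec i) (fun y => complex.Re (f y a b)) x)
                          ('D_(evec i) (fun y => complex.Im (f y a b)) x).

(* P^k(Y): a polynomial function on Y is represented by its trace on the closure
   of Y, extended by zero outside.  Two functions of P^k(Y) are thus equal as
   soon as they agree on Y, and the restriction of v_T to a face F of T is
   given by its values on F. *)
Definition Pk p q (k : nat) (Y : set rV) (f : rV -> 'M[C]_(p, q)) :=
  exists c : {ffun 'I_d -> 'I_k.+1} -> 'M[C]_(p, q),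
    (forall x, closure Y x ->
       f x = \sum_(al : {ffun 'I_d -> 'I_k.+1} | (\sum_i al i <= k)%N)
               (\prod_i x 0 i ^+ al i)%:C%C *: c al) /\
    (forall x, ~ closure Y x -> f x = 0).

Definition is_L2proj p q mu k (Y : set rV) (f P : rV -> 'M[C]_(p, q)) :=
  Pk k Y P /\ forall Q, Pk k Y Q -> ip mu Y (fun x => f x - P x) Q = 0.

Definition hoelder_half p q D (f : rV -> 'M[C]_(p, q)) :=
  exists L : R, forall x y, D x -> D y ->
    opnorm (f x - f y) <= L * Num.sqrt (enorm (x - y)).

Fixpoint Cn (n : nat) (phi : rV -> R) : Prop :=
  if n is n'.+1 then
    continuous phi /\ forall i, (forall x, derivable phi x (evec i)) /\
                                Cn n' (fun x => 'D_(evec i) phi x)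
  else continuous phi.

Definition test_function D (phi : rV -> R) :=
  (forall n, Cn n phi) /\
  exists2 K : set rV, compact K /\ K `<=` D & forall x, ~ K x -> phi x = 0.

(* G = sum_i d_i A^i in D, in the sense of distributions *)
Definition is_weak_div m D (A : 'I_d -> rV -> 'M[C]_m) (G : rV -> 'M[C]_m) :=
  forall phi, test_function D phi -> forall a b,
    cint (lebesgue_rV R d) D
      (fun x => \sum_i ('D_(evec i) phi x)%:C%C * A i x a b) =
    - cint (lebesgue_rV R d) D (fun x => (phi x)%:C%C * G x a b).

End fields.

Section mesh.
Variables (R : realType) (d : nat).
Local Notation rV := 'rV[R]_d.
Local Notation simplex := 'M[R]_(d.+1, d).

(* A simplex is given by its d+1 vertices (the rows of S), a point of it by
   its barycentric coordinates l. *)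
Definition nondegenerate (S : simplex) :=
  forall l : 'rV[R]_d.+1, l *m S = 0 -> \sum_i l 0 i = 0 -> l = 0.
Definition barycentric (l : 'rV[R]_d.+1) :=
  (forall i, 0 <= l 0 i) /\ \sum_i l 0 i = 1.
Definition csimplex (S : simplex) : set rV :=
  [set l *m S | l in [set l | barycentric l]].
Definition osimplex (S : simplex) : set rV :=
  [set l *m S | l in [set l | barycentric l /\ forall i, 0 < l 0 i]].
(* The relatively open (d-1)-face opposite to vertex j. *)
Definition oface (S : simplex) (j : 'I_d.+1) : set rV :=
  [set l *m S | l in
    [set l | barycentric l /\ forall i, (0 < l 0 i) = (i != j)]].
(* The convex hull of the vertices common to S and S'. *)
Definition common_face (S S' : simplex) : set rV :=
  [set l *m S | l in [set l | barycentric l /\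
     forall i, 0 < l 0 i -> exists j, row i S = row j S']].

Definition inradius (D : set rV) : R :=
  sup [set r | 0 <= r /\
    exists c, forall y, enorm (y - c) < r -> D y].

(* A nonempty open set which is the interior of a finite union of closed
   simplices. *)
Definition polytopal (P : set rV) :=
  P !=set0 /\ exists (n : nat) (S : 'I_n -> simplex),
    (forall i, nondegenerate (S i)) /\
    P = interior (\bigcup_i csimplex (S i)).

Definition polytopal_domain (Om : set rV) :=
  [/\ polytopal Om, bounded_set Om & connected Om].

(* face_normal F is n_F and the face F lies in the hyperplane
   edot x (face_normal F) = face_offset F. *)
Record mesh := Mesh {
  elt : finType;
  face : finType;
  elt_set : elt -> set rV;
  face_set : face -> set rV;
  face_normal : face -> rV;
  face_offset : face -> R;
  orient : elt -> face -> R }.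

Variables (Om : set rV) (Th : mesh).
Implicit Types (T : elt Th) (F : face Th).

Definition hT T : R := diam (elt_set T).
Definition face_plane F : set rV :=
  hyperplane (face_normal F) (face_offset F).
Definition face_measure F : {measure set rV -> \bar R} :=
  surface (face_normal F) (face_offset F).

Definition face_of T F : Prop := face_set F `<=` bnd (elt_set T).
Definition interface F := exists T1 T2, [/\ T1 <> T2, face_of T1 F & face_of T2 F].
Definition bface F :=
  face_set F `<=` bnd Om /\ exists! T, face_of T F.

Definition elements_ok :=
  [/\ forall T, polytopal (elt_set T),
      trivIset setT (@elt_set Th) &
      \bigcup_(T : elt Th) closure (elt_set T) = closure Om].

Definition faces_ok :=
  [/\ forall F, [/\ face_set F !=set0, face_set F `<=` face_plane F,
                 exists2 U, open U & face_set F = face_plane F `&` U &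
                 connected (face_set F)],
      trivIset setT (@face_set Th),
      forall F, interface F \/ bface F &
      forall T, bnd (elt_set T) =
        \bigcup_(F in [set F : face Th | face_of T F]) closure (face_set F)].

Definition outward_on (A : set rV) (n : rV) F :=
  {ae face_measure F, forall x, face_set F x -> outward_at A n x}.

Definition normals_ok :=
  [/\ forall F, enorm (face_normal F) = 1,
      forall F, bface F -> outward_on Om (face_normal F) F &
      forall T F, face_of T F ->
        (orient T F = 1 \/ orient T F = -1) /\
        outward_on (elt_set T) (orient T F *: face_normal F) F].

Definition is_mesh := [/\ elements_ok, faces_ok & normals_ok].

Definition matching_simplicial_submesh (I : finType) (S : I -> simplex) :=
  [/\ forall i, nondegenerate (S i),
      trivIset setT (fun i => osimplex (S i)) /\
      (forall i j, csimplex (S i) `&` csimplex (S j) = common_face (S i) (S j)),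
      \bigcup_i csimplex (S i) = closure Om,
      forall i, exists T, osimplex (S i) `<=` elt_set T &
      forall i j F, oface (S i) j `&` face_set F = set0 \/
                    oface (S i) j `<=` face_set F].

Definition mesh_regularity (rho : R) :=
  exists (I : finType) (S : I -> simplex),
    [/\ matching_simplicial_submesh S,
        forall i, rho * diam (osimplex (S i)) <= inradius (osimplex (S i)) &
        forall i T, osimplex (S i) `<=` elt_set T ->
          rho * hT T <= diam (osimplex (S i))].

End mesh.

Section friedrichs.
Variables (R : realType) (d m : nat).
Local Notation C := R[i].
Local Notation rV := 'rV[R]_d.
Local Notation field := (rV -> 'M[C]_m).
Local Notation lam := (lebesgue_rV R d).

(* Of fA, only the values on the closure of the domain matter, and of fM only
   the values on its boundary; fdivA is the weak divergence of fA. *)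
Record friedrichs := Friedrichs {
  fK : field;
  fA : 'I_d -> field;
  fdivA : field;
  fM : field;
  rflat : R }.

Variables (Om : set rV) (D : friedrichs).

Definition bnd_matrix (n x : rV) : 'M[C]_m := \sum_i (n 0 i)%:C%C *: fA D i x.

(* Fields on the boundary are dealt with hyperplane by hyperplane, so that the
   data do not refer to any mesh.  fA is Hoelder continuous up to the boundary,
   where it is the trace of its restriction to Om. *)
Definition friedrichs_ok :=
  [/\ inLinf lam Om (fK D),
      forall i, [/\ forall x, Om x -> adjoint (fA D i x) = fA D i x,
                    inLinf lam Om (fA D i) &
                    hoelder_half (closure Om) (fA D i)],
      inLinf lam Om (fdivA D) /\ is_weak_div Om (fA D) (fdivA D),
      0 < rflat D /\
      {ae lam, forall x, Om x -> forall xi : 'cV[C]_m,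
         (2 * rflat D)%:C%C * cdot xi xi <=
         qform (fK D x + adjoint (fK D x) - fdivA D x) xi} &
      forall (n : rV) (c : R), enorm n = 1 ->
        let Y := bnd Om `&` hyperplane n c in
        [/\ inLinf (surface n c) Y (fM D),
            {ae surface n c, forall x, Y x -> forall xi : 'cV[C]_m,
               0 <= complex.Re (qform (fM D x) xi)} &
            {ae surface n c, forall x, Y x -> outward_at Om n x ->
               forall xi : 'cV[C]_m, exists xi1 xi2 : 'cV[C]_m,
                 [/\ xi = xi1 + xi2,
                     (fM D x - bnd_matrix n x) *m xi1 = 0 &
                     (fM D x + bnd_matrix n x) *m xi2 = 0]}]].

Definition rsharp : R := Linf_norm lam Om (fK D) + Linf_norm lam Om (fdivA D).

Definition A1 (w : rV -> 'cV[C]_m) : rV -> 'cV[C]_m :=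
  fun x => \sum_i fA D i x *m pderiv i w x.
Definition Aop (w : rV -> 'cV[C]_m) : rV -> 'cV[C]_m :=
  fun x => fK D x *m w x + A1 w x.

Variable Th : mesh R d.
Implicit Types (T : elt Th) (F : face Th).

Definition aT T : R :=
  \big[Num.max/0]_(i < d) Linf_norm lam (elt_set T) (fA D i).
Definition tT T : R := (Num.max (aT T * (hT T)^-1) (rflat D))^-1.

Definition NF F : field := bnd_matrix (face_normal F).

Definition hoelder_constant (CA : R) :=
  forall T i (P : field), is_L2proj lam 0 (elt_set T) (fA D i) P ->
    Linf_norm lam (elt_set T) (fun x => P x - fA D i x) <=
    CA * Num.sqrt (rflat D * aT T * hT T).

Record hybrid := Hybrid {
  ucell : elt Th -> rV -> 'cV[C]_m;
  uface : face Th -> rV -> 'cV[C]_m }.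

Definition hybrid0 : hybrid := Hybrid (fun _ _ => 0) (fun _ _ => 0).

Definition Uh (k : nat) (v : hybrid) :=
  (forall T, Pk k (elt_set T) (ucell v T)) /\
  (forall F, Pk k (face_set F) (uface v F)).

Definition vh (v : hybrid) : rV -> 'cV[C]_m :=
  fun x => \sum_(T : elt Th) (\1_(elt_set T) x : R)%:C%C *: ucell v T x.

Definition ipF F (w v : rV -> 'cV[C]_m) : C :=
  ip (face_measure F) (face_set F) w v.
Definition normF F (v : rV -> 'cV[C]_m) : R :=
  L2norm (face_measure F) (face_set F) v.
Definition inL2F F (v : rV -> 'cV[C]_m) :=
  inL2 (face_measure F) (face_set F) v.

Definition jump (v : hybrid) T F : rV -> 'cV[C]_m :=
  fun x => uface v F x - ucell v T x.

Variables (Si : elt Th -> face Th -> field) (Sb : face Th -> field).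

Definition mulf (B : field) (v : rV -> 'cV[C]_m) : rV -> 'cV[C]_m :=
  fun x => B x *m v x.

Definition MSF F : field := fun x => fM D x + Sb F x.

Definition jh (w v : hybrid) : C :=
  \sum_(T : elt Th) \sum_(F : face Th | `[< face_of T F >])
    ipF F (mulf (Si T F) (jump w T F)) (jump v T F).

Definition ah (w v : hybrid) : C :=
  \sum_(T : elt Th) ip lam (elt_set T) (Aop (ucell w T)) (ucell v T)
  + (rflat D)%:C%C *
    (\sum_(T : elt Th) (hT T)%:C%C * \sum_(F : face Th | `[< face_of T F >])
       ipF F (jump w T F) (jump v T F))
  + \sum_(T : elt Th) \sum_(F : face Th | `[< face_of T F >])
      (orient T F)%:C%C *
      ipF F (mulf (NF F) (jump w T F))
        (fun x => 2^-1 *: (uface v F x + ucell v T x))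
  + 2^-1 * (\sum_(F : face Th | `[< bface Om F >])
      ipF F (mulf (fun x => MSF F x - NF F x) (uface w F)) (uface v F))
  + jh w v.

Definition bnorm2 (v : hybrid) : R :=
  \sum_(F : face Th | `[< bface Om F >])
    complex.Re (ipF F (mulf (MSF F) (uface v F)) (uface v F)).

Definition local_norm2 (v : hybrid) T : R :=
  L2norm lam (elt_set T) (ucell v T) ^+ 2
  + hT T * \sum_(F : face Th | `[< face_of T F >]) normF F (jump v T F) ^+ 2.

Definition flat_norm2 (v : hybrid) : R :=
  rflat D * (\sum_(T : elt Th) local_norm2 v T) + 2^-1 * bnorm2 v
  + complex.Re (jh v v).

Definition hnorm (v : hybrid) : R :=
  Num.sqrt (flat_norm2 v +
    \sum_(T : elt Th) tT T * L2norm lam (elt_set T) (A1 (ucell v T)) ^+ 2).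

Definition stabilization_field F (S : field) :=
  inLinf (face_measure F) (face_set F) S /\
  {ae face_measure F, forall x, face_set F x -> hermitian_psd (S x)}.

Definition stabilization_ok (k : nat) (CS : R) :=
  [/\ (forall T F, face_of T F -> stabilization_field F (Si T F)) /\
      (forall F, bface Om F -> stabilization_field F (Sb F)),
      forall T F, face_of T F -> forall v, Pk k (face_set F) v ->
        complex.Re (ipF F (mulf (Si T F) v) v) <= CS * aT T * normF F v ^+ 2,
      forall T F, face_of T F -> forall w v, inL2F F w -> inL2F F v ->
        complex.Re `|ipF F w (mulf (NF F) v)| <=
        CS * Num.sqrt (aT T) * normF F w *
          Num.sqrt (complex.Re (ipF F (mulf (Si T F) v) v)),
      forall F, bface Om F ->
        {ae face_measure F, forall x, face_set F x -> forall xi : 'cV[C]_m,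
           (fM D x - NF F x) *m xi = 0 -> (MSF F x - NF F x) *m xi = 0} &
      forall T F, bface Om F -> face_of T F ->
        forall w v, inL2F F w -> inL2F F v ->
        complex.Re `|ipF F (mulf (fun x => MSF F x + NF F x) w) v| <=
        CS * Num.sqrt (aT T) * normF F w *
          Num.sqrt (complex.Re (ipF F (mulf (MSF F) v) v))].

Definition inf_sup (k : nat) (c : R) :=
  forall v, Uh k v ->
    ((hnorm v)%:E <= c%:E *
       ereal_sup [set (complex.Re `|ah v w| / hnorm w)%:E
                 | w in [set w | Uh k w /\ w <> hybrid0]])%E.

Definition solves (k : nat) (f : rV -> 'cV[C]_m) (u : hybrid) :=
  Uh k u /\ forall v, Uh k v -> ah u v = ip lam Om f (vh v).

Definition well_posed (k : nat) :=
  (forall f, inL2 lam Om f -> exists! u, solves k f u) /\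
  exists c : R, forall f u, inL2 lam Om f -> solves k f u ->
    hnorm u <= c * L2norm lam Om f.

End friedrichs.

(* Main.v *)
(* The sesquilinear form is coercive for the flat norm: the integration by parts
   on each element turns A_1 into the flux of N through the faces minus half of
   the divergence of A, the fluxes cancel at the interfaces since N is
   Hermitian, and the hypothesis on K and div A controls the remaining volume
   term.  Integration by parts for Hoelder continuous A with a weak divergence
   is obtained by testing the weak divergence with a polynomial multiplied by a
   smooth cut-off which vanishes near the hyperplanes carrying the boundary, and
   letting the width of the cut-off go to zero.
   The transport term is recovered with the test function
   t_T * sum_i (mean of A^i on T) d_i v_T, zero on the faces.  The Hoelder bound
   on A, the inverse inequalities and the discrete trace inequality, whose
   constants depend only on d, k and the mesh regularity because each element
   contains and is contained in comparable cubes, bound its norm and show that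
   it yields sum_T t_T |A_1 v_T|^2 up to multiples of the energy, with a factor
   quadratic in rho >= 1.
   Well-posedness follows in finite dimension: by coercivity an element in the
   kernel of the form vanishes. *)
From HB Require Import structures.
Require Import Defs.
From mathcomp Require Import all_boot all_order all_algebra.
From mathcomp Require Import all_classical all_reals all_analysis.
From mathcomp Require Import measurable_realfun ess_sup_inf complex.
From mathcomp Require Import ring lra.

Set Implicit Arguments.
Unset Strict Implicit.
Unset Printing Implicit Defensive.

Import Order.TTheory GRing.Theory Num.Theory.
Import numFieldNormedType.Exports.
Local Open Scope classical_set_scope.
Local Open Scope ring_scope.

(** * Lebesgue and hyperplane measures *)

(** The fields [fA D i] are only Hoelder continuous and their weak divergence sees only test
    functions supported in the open domain, so no classical divergence theorem applies on an
    element. The cut-off is a product of functions of the signed distances to the hyperplanes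
    carrying the faces: it is smooth although the element has edges, its gradient is integrated
    along one normal at a time, and in the limit each hyperplane contributes the jump of the
    indicator of the element across it. Where a hyperplane crosses the element this jump is zero.
    Defining the hyperplane measure by a slab yields Fubini along the normal without rotating
    coordinates. Estimates and linear algebra use real parts only; multiplying the test function by
    the imaginary unit recovers the imaginary part of the form. The square of rho comes from the
    reaction term: Cauchy-Schwarz bounds it by rho times the energy norm of the unknown times the
    size of the test function, and Young's inequality squares rho. The polynomial inequalities all
    rest on one interpolation estimate on an interval, extended to boxes coordinate by
    coordinate. *)

Definition box (R : realType) n (c : 'rV[R]_n) (r : R) : set 'rV[R]_n :=
  [set x | forall i, `|x 0 i - c 0 i| <= r].

Lemma measurable_box (R : realType) n (c : 'rV[R]_n) r : measurable (box c r).
Proof.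
have -> : box c r = \bigcap_(i in [set: 'I_n])
    ([set: _] `&` (fun x : 'rV[R]_n => x 0 i) @^-1` `[c 0 i - r, c 0 i + r]%classic).
  apply/seteqP; split => x /= h i.
    move=> _; split => //=; move: (h i).
    by rewrite in_itv/= ler_norml => /andP[? ?]; apply/andP; split; lra.
  by have [_ /=] := h i I; rewrite in_itv/= ler_norml => /andP[? ?]; apply/andP; split; lra.
apply: fin_bigcap_measurable => // i _.
exact: measurable_rV_coord.
Qed.

(** The sigma-algebra is generated by the coordinates and not by the topology, so an open set is
    written as the countable union of the boxes with rational centre and radius 1/(n+1) that it
    contains. *)
Lemma open_measurable_rV (R : realType) n (U : set 'rV[R]_n) :
  open U -> measurable U.
Proof.
move=> oU.
pose F (p : 'rV[rat]_n * nat) : set 'rV[R]_n :=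
  if `[< box (map_mx ratr p.1) (p.2.+1%:R)^-1 `<=` U >] then
    box (map_mx ratr p.1) (p.2.+1%:R)^-1 else set0.
suff -> : U = \bigcup_p F p.
  apply: countable_bigcupT_measurable; first exact: countableP.
  by move=> p; rewrite /F; case: ifP => // _; exact: measurable_box.
apply/seteqP; split => [x Ux|x [p _]]; last first.
  by rewrite /F; case: asboolP => // + ?; exact.
have [e /= e0 eU] : nbhs_ball x U by apply/nbhs_ballP; exact: open_nbhs_nbhs.
have [m hm] : exists m : nat, (m.+1%:R)^-1 < e / 2.
  have := near_infty_natSinv_lt (PosNum (divr_gt0 e0 (ltr0n _ 2))).
  by move=> [m _ /(_ m (leqnn m)) h]; exists m.
have q_ i : exists q : rat, `|x 0 i - ratr q| <= (m.+1%:R)^-1.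
  have m0 : 0 < (m.+1%:R)^-1 :> R by rewrite invr_gt0.
  set r := (m.+1%:R)^-1 in m0 *.
  have /rat_in_itvoo[q] : x 0 i - r < x 0 i + r by lra.
  rewrite in_itv/= => /andP[? ?]; exists q.
  by rewrite ler_norml; apply/andP; split; lra.
have [q hq] := choice q_.
exists (\row_i q i, m) => //; rewrite /F; case: asboolP => [_ i|[]].
  by rewrite !mxE.
move=> y yb; apply: eU; split => // i j; rewrite (ord1 i).
rewrite -ball_normE/=; have := yb j; rewrite !mxE => yb'.
have -> : x 0 j - y 0 j = (x 0 j - ratr (q j)) - (y 0 j - ratr (q j)) by lra.
apply: (le_lt_trans (ler_normB _ _)); have := hq j; move: hm yb'.
by set r := _^-1; lra.
Qed.

Lemma continuous_measurable_rV (R : realType) n (f : 'rV[R]_n -> R) :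
  continuous f -> measurable_fun setT f.
Proof.
move=> cf; apply: (measurability _ (RGenOpens.measurableE R)) => //.
move=> _ [_ [a [b ->] <-]]; rewrite setTI; apply: open_measurable_rV.
by apply: open_comp; [move=> x _; exact: cf|exact: interval_open].
Qed.

(** An alias of [lebesgue_rV] on which the sigma-finite structure required by the Fubini theorems is
    declared. *)
Definition lamS (R : realType) (n : nat) : set 'rV[R]_n -> \bar R := lebesgue_rV R n.
Arguments lamS : clear implicits.
HB.instance Definition _ (R : realType) n := Measure.copy (lamS R n) (lebesgue_rV R n).

Section lebesgue_rV_theory.
Variable R : realType.
Local Notation lam := (lebesgue_rV R).
Local Notation leb := (@lebesgue_measure R).

Lemma rV_consE n (z : 'rV[R]_n) (s : R) :
  (rV_cons (z, s) 0 ord0 = s) * (forall i, rV_cons (z, s) 0 (lift ord0 i) = z 0 i).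
Proof. by split=> [|i]; rewrite mxE ?liftK// unlift_none. Qed.

Lemma measure_rV_cons n A : 
  lam n.+1 A = (lam n \x leb)%E (@rV_cons R n @^-1` A).
Proof. by []. Qed.

Lemma lebesgue_rV_box n (c : 'rV[R]_n) r : 0 <= r ->
  lam n (box c r) = ((2 * r) ^+ n)%:E.
Proof.
move=> r0; elim: n c => [|n IH] c.
  rewrite /= expr0 diracE mem_set//; by move=> [].
rewrite measure_rV_cons.
have -> : @rV_cons R n @^-1` (box c r) =
   box (\row_i c 0 (lift ord0 i)) r `*` `[c 0 ord0 - r, c 0 ord0 + r]%classic.
  apply/seteqP; split => -[z s] /=.
    move=> h; split=> [i|]; first by have := h (lift ord0 i); rewrite rV_consE mxE.
    have := h ord0; rewrite rV_consE in_itv/= ler_norml => /andP[? ?].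
    by apply/andP; split; lra.
  move=> [h1]; rewrite in_itv /= => h2 i.
  case: (unliftP ord0 i) => [j ->|->]; rewrite rV_consE.
    by have := h1 j; rewrite mxE.
  by rewrite ler_norml; apply/andP; split; move: h2 => /andP[? ?]; lra.
rewrite product_measure1E//; last exact: measurable_box.
rewrite [X in (X * _)%E]IH.
rewrite [X in (_ * X)%E](lebesgue_measure_itv `[c 0 ord0 - r, c 0 ord0 + r])/= lte_fin.
have [r1|r1] := ltP (c 0 ord0 - r) (c 0 ord0 + r).
  rewrite -EFinD -EFinM exprS mulrC; congr (_ %:E); congr (_ * _); lra.
have -> : r = 0 by lra.
by rewrite mule0 mulr0 expr0n.
Qed.

Lemma sigma_finite_lebesgue_rV n : sigma_finite setT (lam n).
Proof.
exists (fun k => box 0 k%:R).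
  apply/esym/seteqP; split=> // x _.
  exists (Num.truncn (\sum_i `|x 0 i|)).+1 => // i; rewrite mxE subr0.
  apply: (@le_trans _ _ (\sum_i `|x 0 i|)); last by rewrite ltW// truncnS_gt.
  by rewrite (bigD1 i)//= lerDl sumr_ge0.
move=> k; split; first exact: measurable_box.
by rewrite lebesgue_rV_box// ltry.
Qed.

HB.instance Definition _ n :=
  Measure_isSigmaFinite.Build _ _ _ (lamS R n) (@sigma_finite_lebesgue_rV n).

Lemma integral_rV_cons n (f : 'rV[R]_n.+1 -> \bar R) :
  measurable_fun setT f -> (forall x, 0 <= f x)%E ->
  (\int[lam n.+1]_x f x = \int[lam n]_z \int[leb]_s f (rV_cons (z, s)))%E.
Proof.
move=> mf f0.
rewrite (@ge0_integral_pushforward _ _ _ _ _ _ (@measurable_rV_cons R n) (lam n \x leb)%E setT f)//.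
rewrite preimage_setT.
rewrite (@fubini_tonelli1 _ _ _ _ _ (lamS R n) leb (f \o @rV_cons R n))//.
  by apply: measurableT_comp => //; exact: measurable_rV_cons.
by move=> x; exact: f0.
Qed.

Lemma lebesgue_shift1 (a : R) (f : R -> \bar R) :
  measurable_fun setT f -> (forall x, 0 <= f x)%E ->
  (\int[leb]_x f (x + a)%R = \int[leb]_x f x)%E.
Proof.
move=> mf f0.
have ma : measurable_fun [set: measurableTypeR R] (fun x : measurableTypeR R => x + a : measurableTypeR R).
  exact: measurable_funD.
rewrite -(@ge0_integral_pushforward _ _ _ _ _ _ ma leb setT f)//.
apply: eq_measure_integral => A mA _.
apply/esym; apply: (@lebesgue_measure_unique R (measure_function_pushforward__canonical__measure_function_Measure leb ma)) => // X.
move=> [[x y] /= xy <-].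
rewrite /pushforward /=.
have -> : (fun x0 : R => x0 + a) @^-1` `]x, y]%classic = `]x - a, y - a]%classic.
  by apply/seteqP; split => z /=; rewrite !in_itv /= => /andP[? ?]; apply/andP; split; lra.
rewrite [LHS]lebesgue_measure_itv [RHS](lebesgue_measure_itv `]x - a, y - a]) /= !lte_fin ltrD2r.
case: ifP => // _; rewrite -!EFinB; congr EFin; lra.
Qed.

Lemma measurable_shift n (a : 'rV[R]_n) :
  measurable_fun [set: 'rV[R]_n] (fun x : 'rV[R]_n => x + a).
Proof.
apply: measurable_fun_rV => i; under eq_fun do rewrite mxE.
by apply: measurable_funD => //; exact: measurable_rV_coord.
Qed.

(** Induction on the dimension: the first coordinate of [a] is removed by translation invariance on
    the line in the inner integral, the others by the induction hypothesis in the outer one. *)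
Lemma lebesgue_rV_shift n (a : 'rV[R]_n) (f : 'rV[R]_n -> \bar R) :
  measurable_fun setT f -> (forall x, 0 <= f x)%E ->
  (\int[lam n]_x f (x + a)%R = \int[lam n]_x f x)%E.
Proof.
elim: n a f => [|n IH] a f mf f0.
  by apply: eq_integral => x _; congr f; apply/rowP => -[].
have mfa : measurable_fun [set: 'rV[R]_n.+1] (fun x : 'rV[R]_n.+1 => f (x + a)).
  by apply: measurableT_comp => //; exact: measurable_shift.
rewrite (integral_rV_cons mfa (fun x => f0 _)) (integral_rV_cons mf f0).
pose a' : 'rV[R]_n := \row_i a 0 (lift ord0 i).
have E z s : rV_cons (z, s) + a = rV_cons (z + a', s + a 0 ord0).
  apply/rowP => i; rewrite [LHS]mxE; case: (unliftP ord0 i) => [j ->|->].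
    by rewrite !rV_consE !mxE.
  by rewrite !rV_consE.
have mc : measurable_fun [set: 'rV[R]_n * measurableTypeR R] (f \o @rV_cons R n).
  by apply: measurableT_comp => //; exact: measurable_rV_cons.
transitivity (\int[lam n]_z \int[leb]_s f (rV_cons (z + a', s)%R))%E.
  apply: eq_integral => z _; under eq_integral do rewrite E.
  apply: (lebesgue_shift1 (a 0 ord0) (f := fun s => f (rV_cons (z + a', s)))) => //.
  exact: (measurableT_comp mc (measurable_pair1 (z + a'))).
apply: (IH a' (fun z => \int[leb]_s f (rV_cons (z, s)))%E).
  by apply: (measurable_fun_fubini_tonelli_F (m2 := leb) (f \o @rV_cons R n)) => // ?; exact: f0.
by move=> z; apply: integral_ge0.
Qed.

End lebesgue_rV_theory.

Lemma ge0_integral_mrestr d (T : measurableType d) (R : realType)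
    (mu : {measure set T -> \bar R}) (D : set T) (mD : measurable D)
    (f : T -> \bar R) : measurable_fun setT f -> (forall x, 0 <= f x)%E ->
  (\int[mrestr mu mD]_x f x = \int[mu]_(x in D) f x)%E.
Proof.
move=> mf f0.
have mDC : measurable (~` D) by exact: measurableC.
rewrite (@ge0_negligible_integral _ _ _ _ setT (~` D) f)//; last first.
  by rewrite /= /mrestr setICl measure0.
rewrite setTD setCK; apply: eq_measure_integral => A mA AD.
by rewrite /= /mrestr setIidl.
Qed.

Section surface_theory.
Variables (R : realType) (d : nat).
Local Notation lam := (lebesgue_rV R d).
Local Notation leb := (@lebesgue_measure R).
Implicit Types (n x y : 'rV[R]_d) (c : R).

Lemma edotC x y : edot x y = edot y x.
Proof. by apply: eq_bigr => i _; rewrite mulrC. Qed.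

Lemma edotDl x y n : edot (x + y) n = edot x n + edot y n.
Proof. by rewrite -big_split; apply: eq_bigr => i _; rewrite mxE mulrDl. Qed.

Lemma edotZl a x n : edot (a *: x) n = a * edot x n.
Proof. by rewrite /edot mulr_sumr; apply: eq_bigr => i _; rewrite mxE mulrA. Qed.

Lemma edotNl x n : edot (- x) n = - edot x n.
Proof. by rewrite -scaleN1r edotZl mulN1r. Qed.

Lemma edotBl x y n : edot (x - y) n = edot x n - edot y n.
Proof. by rewrite edotDl edotNl. Qed.

Lemma edotDr x y n : edot n (x + y) = edot n x + edot n y.
Proof. by rewrite !(edotC n) edotDl. Qed.

Lemma edotZr a x n : edot n (a *: x) = a * edot n x.
Proof. by rewrite !(edotC n) edotZl. Qed.

Lemma edotNr x n : edot n (- x) = - edot n x.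
Proof. by rewrite !(edotC n) edotNl. Qed.

Lemma edotBr x y n : edot n (x - y) = edot n x - edot n y.
Proof. by rewrite edotDr edotNr. Qed.

Lemma edot_ge0 x : 0 <= edot x x.
Proof. by apply: sumr_ge0 => i _; rewrite -expr2 sqr_ge0. Qed.

Lemma enorm1_edot n : enorm n = 1 -> edot n n = 1.
Proof. by move=> h; rewrite -[RHS](expr1n _ 2) -h sqr_sqrtr// edot_ge0. Qed.

Lemma edot_eq0 x : edot x x = 0 -> x = 0.
Proof.
move/eqP; rewrite psumr_eq0; last by move=> i _; rewrite -expr2 sqr_ge0.
move=> /allP h; apply/rowP => i; rewrite mxE; apply/eqP.
by have := h i (mem_index_enum _); rewrite /= mulf_eq0 orbb.
Qed.

Lemma measurable_line n :
  measurable_fun [set: 'rV[R]_d * measurableTypeR R] (fun p => p.1 + p.2 *: n : 'rV[R]_d).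
Proof.
apply: measurable_fun_rV => i; under eq_fun do rewrite !mxE.
apply: measurable_funD.
  exact: (measurableT_comp (@measurable_rV_coord R d i) measurable_fst).
by apply: measurable_funM => //; exact: measurable_snd.
Qed.

Lemma measurable_lineN n :
  measurable_fun [set: 'rV[R]_d * measurableTypeR R] (fun p => p.1 + (- p.2) *: n : 'rV[R]_d).
Proof.
apply: measurable_fun_rV => i; under eq_fun do rewrite !mxE.
apply: measurable_funD.
  exact: (measurableT_comp (@measurable_rV_coord R d i) measurable_fst).
by apply: measurable_funM => //; apply: measurableT_comp => //; exact: measurable_snd.
Qed.

Lemma integral_surface n c (g : 'rV[R]_d -> \bar R) :
  measurable_fun setT g -> (forall x, 0 <= g x)%E ->
  (\int[surface n c]_y g y = \int[lam]_(x in slab n c) g (hproj n c x))%E.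
Proof.
move=> mg g0.
rewrite (@ge0_integral_pushforward _ _ _ _ _ _ (measurable_hproj n c)
  (mrestr lam (measurable_slab n c)) setT g)// preimage_setT.
rewrite (@ge0_integral_mrestr _ _ _ lam _ (measurable_slab n c) (g \o hproj n c))//.
  by apply: measurableT_comp => //; exact: measurable_hproj.
by move=> x; exact: g0.
Qed.

Lemma measurable_line_integral n (f : 'rV[R]_d -> \bar R) :
  measurable_fun setT f -> (forall x, 0 <= f x)%E ->
  measurable_fun [set: 'rV[R]_d]
    (fun y : 'rV[R]_d => (\int[leb]_s f (y + s *: n)%R)%E).
Proof.
move=> mf f0.
apply: (measurable_fun_fubini_tonelli_F (m2 := leb)
  (fun p : 'rV[R]_d * measurableTypeR R => f (p.1 + p.2 *: n))) => [|p].
  by apply: measurableT_comp => //; exact: measurable_line.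
exact: f0.
Qed.

(** Lebesgue measure disintegrates along [n] because translations preserve it: integrating [f] over
    all lines that start in the slab counts each point [x] once for every [s] such that [x - s n]
    lies in the slab, and these [s] form an interval of length one. No change of basis is
    involved. *)
Lemma surface_fubini n c (f : 'rV[R]_d -> \bar R) : enorm n = 1 ->
  measurable_fun setT f -> (forall x, 0 <= f x)%E ->
  (\int[lam]_x f x = \int[surface n c]_y \int[leb]_s f (y + s *: n)%R)%E.
Proof.
move=> n1 mf f0.
have nn := enorm1_edot n1.
have mfl : measurable_fun [set: 'rV[R]_d * measurableTypeR R]
    (fun p => f (p.1 + p.2 *: n : 'rV[R]_d)).
  by apply: measurableT_comp => //; exact: measurable_line.
rewrite integral_surface; last 2 first.
- exact: measurable_line_integral.
- by move=> x; apply: integral_ge0 => s _; exact: f0.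
(* Projecting [x] only shifts the parameter of its line, so the line integral does not see the
   projection. *)
have E1 x : (\int[leb]_s f (hproj n c x + s *: n)%R =
    \int[leb]_s f (x + s *: n)%R)%E.
  rewrite -(lebesgue_shift1 (edot x n - c)
    (f := fun s => f (hproj n c x + s *: n))); last by move=> ?; exact: f0.
    apply: eq_integral => s _; congr f.
    by rewrite [(s + _)%R]addrC scalerDl addrA subrK.
  exact: (measurableT_comp mfl (measurable_pair1 (hproj n c x))).
under [RHS]eq_integral do rewrite E1.
pose S x : \bar R := (\1_(slab n c) x)%:E.
have mS : measurable_fun [set: 'rV[R]_d] S.
  by apply/measurable_EFinP; exact: measurable_indic (measurable_slab n c).
have S0 x : (0 <= S x)%E by rewrite lee_fin.
have mSf : measurable_fun [set: 'rV[R]_d * measurableTypeR R]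
    (fun p => S p.1 * f (p.1 + p.2 *: n)%R)%E.
  by apply: emeasurable_funM => //; apply: measurableT_comp => //; exact: measurable_fst.
have mSf' : measurable_fun [set: 'rV[R]_d * measurableTypeR R]
    (fun p => S (p.1 + (- p.2) *: n)%R * f p.1)%E.
  apply: emeasurable_funM; last by apply: measurableT_comp => //; exact: measurable_fst.
  by apply: (measurableT_comp mS); exact: measurable_lineN.
transitivity (\int[lam]_x \int[leb]_s (S x * f (x + s *: n)%R))%E; last first.
  rewrite integral_mkcond; apply: eq_integral => x _.
  rewrite ge0_integralZl//; last first.
    exact: (measurableT_comp mfl (measurable_pair1 x)).
  by rewrite /S patchE indicE; case: ifP => _; rewrite ?mul1e ?mul0e.
rewrite [RHS](@fubini_tonelli _ _ _ _ R (lamS R d) leb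
  (fun p => S p.1 * f (p.1 + p.2 *: n)%R)%E mSf); last first.
  by move=> p; apply: mule_ge0; [exact: S0|exact: f0].
(* For fixed [s], translating by [s n] moves the slab instead of [f], so that [f x] can leave the
   integral in [s]. *)
transitivity (\int[leb]_s \int[lam]_x (S (x + (- s) *: n)%R * f x))%E; last first.
  apply: eq_integral => s _.
  rewrite -(lebesgue_rV_shift (s *: n) (f := fun x => S (x + (- s) *: n)%R * f x)%E).
  - by apply: eq_integral => x _; rewrite scaleNr addrK.
  - exact: (measurableT_comp mSf' (measurable_pair2 s)).
  - by move=> x; apply: mule_ge0; [exact: S0|exact: f0].
rewrite -(@fubini_tonelli _ _ _ _ R (lamS R d) leb
  (fun p => S (p.1 + (- p.2) *: n)%R * f p.1)%E mSf'); last first.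
  by move=> p; apply: mule_ge0; [exact: S0|exact: f0].
apply: eq_integral => x _ /=.
rewrite ge0_integralZr//; last first.
  exact: (measurableT_comp mS (measurableT_comp (measurable_lineN n) (measurable_pair1 x))).
rewrite -[LHS]mul1e; congr (_ * _)%E.
transitivity (\int[leb]_s (\1_(`[edot x n - c - 1, edot x n - c]%classic) s)%:E)%E; last first.
  apply: eq_integral => s _; rewrite /S !indicE; congr (_%:R%:E).
  apply: congr1; apply/idP/idP; rewrite !inE /= /slab /= in_itv/= edotDl edotZl nn.
    by move=> /andP[? ?]; apply/andP; split; lra.
  by move=> /andP[? ?]; apply/andP; split; lra.
rewrite integral_indic// setIT [RHS](lebesgue_measure_itv `[edot x n - c - 1, edot x n - c]) /=.
rewrite lte_fin (_ : _ < _ = true); last by apply/idP; lra.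
by rewrite -EFinD; congr EFin; ring.
Qed.
End surface_theory.

Section line_scale.
Variables (R : realType).
Local Notation leb := (@lebesgue_measure R).

Lemma lebesgue_scale1 (e : R) (f : R -> \bar R) : 0 < e ->
  measurable_fun setT f -> (forall x, 0 <= f x)%E ->
  (\int[leb]_x (e%:E * f (e * x)%R) = \int[leb]_x f x)%E.
Proof.
move=> e0 mf f0.
have me : measurable_fun [set: measurableTypeR R] (fun x : measurableTypeR R => e * x : measurableTypeR R).
  exact: measurable_funM.
have mfe : measurable_fun [set: measurableTypeR R] (fun x : measurableTypeR R => f (e * x)).
  exact: (measurableT_comp mf me).
rewrite ge0_integralZl//; last by rewrite lee_fin ltW.
pose nu := measure_function_pushforward__canonical__measure_function_Measure leb me.
have -> : (\int[leb]_x f (e * x)%R = \int[nu]_x f x)%E.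
  by rewrite [RHS](@ge0_integral_pushforward _ _ _ _ _ _ me leb setT f).
pose e' : {nonneg R} := NngNum (ltW e0).
have -> : e%:E = e'%:num%:E by [].
rewrite -ge0_integral_mscale//.
apply: eq_measure_integral => A mA _.
apply/esym; apply: (@lebesgue_measure_unique R (measure_function_mscale__canonical__measure_function_Measure e' nu)) => // X.
move=> [[x y] /= xy <-].
rewrite /mscale /nu /= /pushforward /=.
have -> : (fun x0 : R => e * x0) @^-1` `]x, y]%classic = `]x / e, y / e]%classic.
  by apply/seteqP; split => z /=; rewrite !in_itv /= ltr_pdivrMr// ler_pdivlMr// ![e * z]mulrC.
rewrite [LHS]lebesgue_measure_itv [X in (_ = _ * X)%E](lebesgue_measure_itv `]x / e, y / e]) /= !lte_fin.
rewrite ltr_pM2r ?invr_gt0//.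
case: ifP => // _; last by rewrite mule0.
by rewrite -!EFinB -EFinM; congr EFin; field; lra.
Qed.

End line_scale.

(** * Null sets and size of the hyperplane measures *)

Section surface_measure.
Variables (R : realType) (d : nat).
Local Notation lam := (lebesgue_rV R d).
Local Notation leb := (@lebesgue_measure R).
Implicit Types (n x y a : 'rV[R]_d) (c b : R).

Lemma measurable_hyperplane a b : measurable (hyperplane a b).
Proof.
rewrite (_ : hyperplane a b = [set: 'rV[R]_d] `&` (fun x => edot x a) @^-1` [set b]).
  exact: (measurable_edot a).
by rewrite setTI.
Qed.

Lemma surfaceE n c A : surface n c A = lam (hproj n c @^-1` A `&` slab n c).
Proof. by []. Qed.

Lemma hproj_in n c x : enorm n = 1 -> hyperplane n c (hproj n c x).
Proof.
move=> /enorm1_edot nn; rewrite /hyperplane/= /hproj edotBl edotZl nn mulr1; lra.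
Qed.

Lemma hproj_id n c x : hyperplane n c x -> hproj n c x = x.
Proof. by rewrite /hyperplane/= /hproj => ->; rewrite subrr scale0r subr0. Qed.

Lemma edot_line n c y s : enorm n = 1 -> hyperplane n c y ->
  edot (y + s *: n) n = c + s.
Proof. by move=> /enorm1_edot nn yn; rewrite edotDl edotZl nn yn mulr1. Qed.

Lemma hproj_line n c y s : enorm n = 1 -> hyperplane n c y ->
  hproj n c (y + s *: n) = y.
Proof.
move=> n1 yn; rewrite /hproj (edot_line s n1 yn).
by apply/rowP => i; rewrite !mxE; ring.
Qed.

Lemma surface_off_hyperplane n c A : enorm n = 1 ->
  A `&` hyperplane n c = set0 -> surface n c A = 0.
Proof.
move=> n1 A0; rewrite surfaceE (_ : _ @^-1` _ = set0) ?set0I ?measure0//.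
apply/seteqP; split => x //= Ax.
have : (A `&` hyperplane n c) (hproj n c x) by split => //; exact: hproj_in.
by rewrite A0.
Qed.

Lemma ae_surface_hyperplane n c : enorm n = 1 ->
  {ae surface n c, forall x, hyperplane n c x}.
Proof.
move=> n1; exists (~` hyperplane n c); split => //.
  by apply: measurableC; exact: measurable_hyperplane.
by apply: surface_off_hyperplane => //; rewrite setICl.
Qed.

(** By [surface_fubini] along the normalised [a]: every line in that direction meets the hyperplane
    in a single point. *)
Lemma lebesgue_hyperplane a b : a != 0 -> lam (hyperplane a b) = 0.
Proof.
move=> a0.
have ea : 0 < edot a a.
  by rewrite lt_neqAle edot_ge0 andbT eq_sym; apply: contraNneq a0 => /edot_eq0 ->.
pose n := (enorm a)^-1 *: a.
have na0 : 0 < enorm a by rewrite sqrtr_gt0.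
have n1 : enorm n = 1.
  rewrite /enorm /n edotZl edotZr -[edot a a](sqr_sqrtr (ltW ea)) -/(enorm a).
  by rewrite expr2 mulKf ?gt_eqF// mulVf ?gt_eqF// sqrtr1.
have mH := measurable_hyperplane a b.
rewrite -[hyperplane a b]setIT -integral_indic//.
rewrite (@surface_fubini _ _ n 0)//; last first.
  by apply/measurable_EFinP; exact: measurable_indic.
apply: integral0_eq => y _.
transitivity (\int[leb]_s (\1_[set ((b - edot y a) / enorm a)%R] s)%:E)%E.
  apply: eq_integral => s _; rewrite !indicE; congr (_%:R%:E).
  apply: congr1; apply/idP/idP; rewrite !inE /hyperplane /=.
    rewrite edotDl /n !edotZl => <-.
    rewrite addrC addKr -[edot a a](sqr_sqrtr (ltW ea)) -/(enorm a).
    by field; rewrite gt_eqF.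
  move=> ->; rewrite edotDl /n !edotZl -[edot a a](sqr_sqrtr (ltW ea)) -/(enorm a).
  by field; rewrite gt_eqF.
by rewrite integral_indic// setIT [LHS]lebesgue_measure_set1.
Qed.

(** The preimage of the second hyperplane under the projection onto the first is a hyperplane with
    normal [a'], the part of [a] orthogonal to [n], hence Lebesgue null. If [a'] is zero the two are
    parallel, and [y] shows that the preimage is empty. *)
Lemma surface_hyperplane n c a b : enorm n = 1 ->
  (exists2 y, hyperplane n c y & ~ hyperplane a b y) ->
  surface n c (hyperplane a b) = 0.
Proof.
move=> n1 [y yn ya]; rewrite surfaceE.
pose a' := a - edot a n *: n.
have E x : edot (hproj n c x) a = edot x a' + c * edot a n.
  by rewrite /hproj /a' edotBl edotZl edotBr edotZr (edotC n a); ring.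
have [a0|a0] := eqVneq a' 0.
  rewrite (_ : _ @^-1` _ = set0) ?set0I ?measure0//; apply/seteqP; split=> x //=.
  rewrite /hyperplane/= E a0 => xb; apply: ya; rewrite /hyperplane/=.
  rewrite -(hproj_id yn) E a0 -xb; congr (_ + _).
  by rewrite /edot !big1// => i _; rewrite mxE mulr0.
apply/eqP; rewrite eq_le measure_ge0 andbT.
rewrite -(lebesgue_hyperplane (b - c * edot a n) a0).
apply: le_measure; rewrite ?inE.
- apply: measurableI; last exact: measurable_slab.
  rewrite -[_ @^-1` _]setTI; apply: measurable_hproj => //.
  exact: measurable_hyperplane.
- exact: measurable_hyperplane.
move=> x [/=]; rewrite /hyperplane/= E => <- _; lra.
Qed.

Lemma measurable_hproj_preimage n c A : measurable A -> measurable (hproj n c @^-1` A).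
Proof. by move=> mA; rewrite -[_ @^-1` _]setTI; exact: measurable_hproj. Qed.

(** The two slabs lie on opposite sides of the hyperplane; translation by [n] maps one onto the
    other and does not change the projection. *)
Lemma surface_opp n c A : enorm n = 1 -> measurable A ->
  surface (- n) (- c) A = surface n c A.
Proof.
move=> n1 mA; have nn := enorm1_edot n1.
have E : hproj (- n) (- c) = hproj n c.
  by apply/funext => x; rewrite /hproj edotNr -opprD scalerN scaleNr opprK.
have E2 x : hproj n c (x + n) = hproj n c x.
  by rewrite /hproj edotDl nn; apply/rowP => i; rewrite !mxE; ring.
have m1 : measurable (hproj n c @^-1` A `&` slab n c).
  by apply: measurableI; [exact: measurable_hproj_preimage|exact: measurable_slab].
have m2 : measurable (hproj n c @^-1` A `&` slab (- n) (- c)).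
  by apply: measurableI; [exact: measurable_hproj_preimage|exact: measurable_slab].
rewrite !surfaceE E -[_ `&` slab n c]setIT -[_ `&` slab (- n) _]setIT -!integral_indic//.
rewrite -(lebesgue_rV_shift n (f := fun x => (\1_(hproj n c @^-1` A `&` slab n c) x)%:E)).
- apply: eq_integral => x _; rewrite !indicE; congr (_%:R%:E).
  apply: congr1; apply/idP/idP; rewrite !inE /slab /= E2 edotNr edotDl nn.
    by move=> [? /andP[? ?]]; split => //; apply/andP; split; lra.
  by move=> [? /andP[? ?]]; split => //; apply/andP; split; lra.
- by apply/measurable_EFinP; exact: measurable_indic.
- by move=> x; rewrite lee_fin.
Qed.

Lemma surface_fubini_scaled n c e (f : 'rV[R]_d -> \bar R) : enorm n = 1 ->
  0 < e -> measurable_fun setT f -> (forall x, 0 <= f x)%E ->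
  (\int[lam]_x f x =
   \int[surface n c]_y \int[leb]_s (e%:E * f (y + (e * s) *: n)%R))%E.
Proof.
move=> n1 e0 mf f0; rewrite (surface_fubini c n1 mf f0).
apply: eq_integral => y _.
rewrite -(lebesgue_scale1 (f := fun s => f (y + s *: n)%R) e0)//.
have := measurableT_comp mf (measurable_line n).
by move=> /measurableT_comp /(_ (measurable_pair1 y)).
Qed.

Lemma surface_box_le n c y h (E : set 'rV[R]_d) : enorm n = 1 -> 0 < h ->
  measurable E -> E `<=` hyperplane n c `&` box y h ->
  (surface n c E <= ((4 * h) ^+ d / h)%:E)%E.
Proof.
move=> n1 h0 mE EH; have nn := enorm1_edot n1.
(* A cylinder of height [h] instead of one: it fits in a box of size comparable to [h], so the
   quotient of its volume by [h] has the homogeneity d-1 of a face measure. *)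
pose Z := hproj n c @^-1` E `&` ((fun x : 'rV[R]_d => edot x n) @^-1` `[c, c + h]%classic).
have mZ : measurable Z.
  apply: measurableI; first exact: measurable_hproj_preimage.
  by rewrite -[_ @^-1` _]setTI; exact: (measurable_edot n).
have H1 : lam Z = (h%:E * surface n c E)%E.
  rewrite -[Z]setIT -integral_indic// (@surface_fubini _ _ n c)//; last first.
    by apply/measurable_EFinP; exact: measurable_indic.
  rewrite -[E in RHS]setIT -integral_indic// -ge0_integralZl//; first last.
  - by rewrite lee_fin ltW.
  - by apply/measurable_EFinP; exact: measurable_indic.
  apply: ae_eq_integral => //.
  - apply: (measurable_line_integral n (f := fun x => (\1_Z x)%:E)) => [|x]; last by rewrite lee_fin.
    by apply/measurable_EFinP; exact: measurable_indic.
  - apply: emeasurable_funM => //.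
    by apply/measurable_EFinP; exact: measurable_indic.
  apply: filterS (ae_surface_hyperplane c n1) => z yn _ /=.
  transitivity (\int[leb]_s ((\1_E z)%:E * (\1_`[0%R, h]%classic s)%:E))%E.
    apply: eq_integral => s _; rewrite -EFinM !indicE -natrM mulnb; congr (_%:R%:E).
    apply: congr1; apply/idP/idP.
      rewrite inE /Z /= in_itv/= (edot_line _ n1 yn) (hproj_line _ n1 yn) => -[? /andP[? ?]].
      by apply/andP; split; rewrite inE//= in_itv/=; apply/andP; split; lra.
    move=> /andP[]; rewrite !inE /Z /= !in_itv/= (edot_line _ n1 yn) (hproj_line _ n1 yn) => ? /andP[? ?].
    by split => //; apply/andP; split; lra.
  rewrite ge0_integralZl//; last by apply/measurable_EFinP; exact: measurable_indic.
  rewrite integral_indic// setIT [X in (_ * X)%E](lebesgue_measure_itv `[0, h]) /= lte_fin h0 sube0.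
  exact: muleC.
have H2 : (lam Z <= ((4 * h) ^+ d)%:E)%E.
  rewrite (_ : 4 * h = 2 * (2 * h)); last lra.
  rewrite -(lebesgue_rV_box y); last lra.
  apply: le_measure; rewrite ?inE//; first exact: measurable_box.
  move=> x [/= xE]; rewrite in_itv/= => /andP[xc1 xc2] i.
  have [_ /(_ i)] := EH _ xE; rewrite /hproj !mxE.
  have ni : `|n 0 i| <= 1.
    rewrite -(expr_le1 (n := 2))// -normrX ger0_norm ?sqr_ge0// -nn /edot (bigD1 i)//= -expr2 lerDl.
    by apply: sumr_ge0 => j _; rewrite -expr2 sqr_ge0.
  move=> hb; rewrite (_ : x 0 i - y 0 i = (x 0 i - (edot x n - c) * n 0 i - y 0 i) + (edot x n - c) * n 0 i); last ring.
  rewrite (le_trans (ler_normD _ _))// (_ : 2 * h = h + h * 1); last lra.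
  apply: lerD => //; rewrite normrM; apply: ler_pM => //.
  by rewrite ler_norml; apply/andP; split; lra.
rewrite EFinM lee_pdivlMr// muleC -H1; exact: H2.
Qed.

Lemma measure_open_gt0 (U : set 'rV[R]_d) : open U -> U !=set0 -> (0 < lam U)%E.
Proof.
move=> oU [x Ux].
have [e /= e0 eU] : nbhs_ball x U by apply/nbhs_ballP; exact: open_nbhs_nbhs.
apply: (@lt_le_trans _ _ (lam (box x (e / 2)))).
  by rewrite lebesgue_rV_box ?lte_fin ?exprn_gt0//; lra.
apply: le_measure; rewrite ?inE; [exact: measurable_box|exact: open_measurable_rV|].
move=> y yb; apply: eU; split => // i j; rewrite (ord1 i) -ball_normE/=.
by have := yb j; rewrite distrC; lra.
Qed.

Lemma continuous_sum_fin (T : topologicalType) (I : Type) (r : seq I) (P : pred I)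
    (f : I -> T -> R) :
  (forall i, continuous (f i)) -> continuous (fun t : T => \sum_(i <- r | P i) f i t).
Proof.
move=> cf x; elim: r => [|i r IH].
  by under eq_fun do rewrite big_nil; exact: cvg_cst.
under eq_fun do rewrite big_cons.
by case: (P i) => //; exact: (cvgD (cf i x) IH).
Qed.

Lemma continuous_rV (T : topologicalType) (f : T -> 'rV[R]_d) :
  (forall i, continuous (fun t : T => f t 0 i)) -> continuous f.
Proof.
move=> cf x; apply/cvg_ballP => e e0.
have h : \forall y \near x, forall j, ball (f x 0 j) e (f y 0 j).
  apply: filter_forall => j.
  by have /cvg_ballP/(_ e e0) := cf j x.
near=> y; split => // i j; rewrite (ord1 i).
by move: j; near: y.
Unshelve. all: by end_near. Qed.

Lemma continuous_edot a : continuous (fun x : 'rV[R]_d => edot x a).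
Proof.
apply: continuous_sum_fin => i x.
have h : {for x, continuous (fun t : 'rV[R]_d => t 0 i)} by exact: coord_continuous.
exact: (cvgM h (cvg_cst _)).
Qed.

Lemma continuous_hproj n c : continuous (hproj n c : 'rV[R]_d -> 'rV[R]_d).
Proof.
apply: continuous_rV => i x; under eq_fun do rewrite !mxE.
have h : {for x, continuous (fun t : 'rV[R]_d => t 0 i)} by exact: coord_continuous.
exact: (cvgB h (cvgM (cvgB (@continuous_edot n x) (cvg_cst _)) (cvg_cst _))).
Qed.

Lemma surface_open_gt0 n c (U : set 'rV[R]_d) : enorm n = 1 -> open U ->
  hyperplane n c `&` U !=set0 -> (0 < surface n c (hyperplane n c `&` U))%E.
Proof.
move=> n1 oU [y [yn Uy]]; have nn := enorm1_edot n1.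
pose V : set 'rV[R]_d := (hproj n c @^-1` U) `&` ((fun x => edot x n) @^-1` `]c, c + 1[%classic).
have oV : open V.
  apply: openI; apply: open_comp => //.
  - by move=> x _; exact: continuous_hproj.
  - by move=> x _; exact: continuous_edot.
rewrite surfaceE; apply: (lt_le_trans (measure_open_gt0 oV _)).
  exists (y + (1/2) *: n); split => /=.
    by rewrite (hproj_line _ n1 yn).
  by rewrite in_itv/= (edot_line _ n1 yn); apply/andP; split; lra.
apply: le_measure; rewrite ?inE; first exact: open_measurable_rV.
  apply: measurableI; last exact: measurable_slab.
  rewrite -[_ @^-1` _]setTI; apply: measurable_hproj => //.
  by apply: measurableI; [exact: measurable_hyperplane|exact: open_measurable_rV].
move=> x [/= Ux]; rewrite in_itv/= => /andP[? ?]; split => /=.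
  by split => //; exact: hproj_in.
by apply/andP; split; rewrite ltW.
Qed.

Lemma surface_box_lty n c y h : enorm n = 1 -> (surface n c (box y h) < +oo)%E.
Proof.
move=> n1; have mH := measurable_hyperplane n c.
rewrite -(setUIDK (box y h) (hyperplane n c)) measureU; last 3 first.
- by apply: measurableI => //; exact: measurable_box.
- by apply: measurableD => //; exact: measurable_box.
- by apply/seteqP; split => x // -[[_ ?] []].
rewrite [X in (_ + X)%E](_ : _ = 0) ?adde0; last first.
  apply: surface_off_hyperplane => //.
  by apply/seteqP; split => x // -[[_ ?] ?].
have h1 : 0 < `|h| + 1 by rewrite ltr_wpDl.
apply: (le_lt_trans (surface_box_le (y := y) (h := `|h| + 1) n1 h1 _ _)).
- by apply: measurableI => //; exact: measurable_box.
- move=> x [xb xH]; split => // i; apply: (le_trans (xb i)).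
  by rewrite (le_trans (ler_norm h))// lerDl.
- exact: ltry.
Qed.

Lemma sigma_finite_surface n c : enorm n = 1 -> sigma_finite setT (surface n c).
Proof.
move=> n1; exists (fun k => box 0 k%:R).
  apply/esym/seteqP; split=> // x _.
  exists (Num.truncn (\sum_i `|x 0 i|)).+1 => // i; rewrite mxE subr0.
  apply: (@le_trans _ _ (\sum_i `|x 0 i|)); last by rewrite ltW// truncnS_gt.
  by rewrite (bigD1 i)//= lerDl sumr_ge0.
by move=> k; split; [exact: measurable_box|exact: surface_box_lty].
Qed.

(** The unit length of [n] is an argument because sigma-finiteness depends on it; the structure can
    then be declared on this alias. *)
Definition surfS n c (n1 : enorm n = 1) : set 'rV[R]_d -> \bar R := surface n c.

End surface_measure.

HB.instance Definition _ (R : realType) d (n : 'rV[R]_d) c (n1 : enorm n = 1) :=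
  Measure.copy (surfS c n1) (surface n c).
HB.instance Definition _ (R : realType) d (n : 'rV[R]_d) c (n1 : enorm n = 1) :=
  Measure_isSigmaFinite.Build _ _ _ (surfS c n1) (@sigma_finite_surface R d n c n1).

Section normal_change.
Variables (R : realType) (d : nat) (n : 'rV[R]_d) (c : R) (n1 : enorm n = 1).
Local Notation lam := (lebesgue_rV R d).
Local Notation leb := (@lebesgue_measure R).

(** Coordinates [(y, s)] for the point [y + e s n], where [e] will be the width of the cut-off: in
    these coordinates a cut-off of width [e] across the hyperplane becomes a fixed function of
    [s]. *)
Lemma ge0_integral_normal e (f : 'rV[R]_d -> \bar R) : 0 < e ->
  measurable_fun setT f -> (forall x, 0 <= f x)%E ->
  (\int[lam]_x f x =
   \int[surfS c n1 \x leb]_p (e%:E * f (p.1 + (e * p.2) *: n)%R))%E.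
Proof.
move=> e0 mf f0; rewrite (surface_fubini_scaled c n1 e0 mf f0).
rewrite (@fubini_tonelli1 _ _ _ _ R (surfS c n1) leb
   (fun p => e%:E * f (p.1 + (e * p.2) *: n)%R)%E)//.
- apply: emeasurable_funM => //; apply: measurableT_comp => //.
  apply: measurable_fun_rV => i; under eq_fun do rewrite !mxE.
  apply: measurable_funD.
    exact: (measurableT_comp (@measurable_rV_coord R d i) measurable_fst).
  by apply: measurable_funM => //; apply: measurable_funM => //; exact: measurable_snd.
- by move=> p; apply: mule_ge0; [rewrite lee_fin ltW|exact: f0].
Qed.

Lemma integral_normal e (f : 'rV[R]_d -> R) : 0 < e ->
  measurable_fun setT f ->
  (\int[lam]_x (f x)%:E =
   \int[surfS c n1 \x leb]_p (e * f (p.1 + (e * p.2) *: n)%R)%:E)%E.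
Proof.
move=> e0 mf.
have mfE : measurable_fun setT (fun x => (f x)%:E) by exact/measurable_EFinP.
pose F p := (e * f (p.1 + (e * p.2) *: n))%:E.
have hp : (\int[lam]_x (fun x => (f x)%:E)^\+ x = \int[surfS c n1 \x leb]_p F^\+ p)%E.
  rewrite (ge0_integral_normal e0 (measurable_funepos mfE)); last by [].
  apply: eq_integral => p _; rewrite !funeposE /F EFinM.
  by rewrite maxe_pMr ?lee_fin ?(ltW e0)// mule0.
have hn : (\int[lam]_x (fun x => (f x)%:E)^\- x = \int[surfS c n1 \x leb]_p F^\- p)%E.
  rewrite (ge0_integral_normal e0 (measurable_funeneg mfE)); last by [].
  apply: eq_integral => p _; rewrite !funenegE /F EFinM -muleN.
  by rewrite maxe_pMr ?lee_fin ?(ltW e0)// mule0.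
by rewrite [LHS]integralE [RHS]integralE hp hn.
Qed.

End normal_change.

(** * Cut-off functions and the boundary limit *)

Section smooth_functions.
Variable R : realType.

Definition flat (p : {poly R}) (x : R) : R :=
  if 0 < x then p.[x^-1] * expR (- x^-1) else 0.

Lemma expR_poly_bound (p : {poly R}) :
  exists C : R, 0 <= C /\ forall y, 0 <= y -> `|p.[y]| <= C * expR y.
Proof.
have hn n (y : R) : 0 <= y -> y ^+ n <= n%:R ^+ n * expR y.
  case: n => [|n] y0; first by rewrite !expr0 mul1r -expR0 ler_expR.
  have n0 : 0 < n.+1%:R :> R by rewrite ltr0n.
  have h : y <= n.+1%:R * expR (y / n.+1%:R).
    have := expR_ge1Dx (y / n.+1%:R); rewrite -(ler_pM2l n0) mulrDr mulr1 mulrCA divff ?gt_eqF// mulr1.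
    by apply: le_trans; rewrite lerDr ltW.
  apply: (le_trans (lerXn2r n.+1 _ _ h)).
  - exact: y0.
  - by apply: mulr_ge0; [exact: ltW|exact: expR_ge0].
  - by rewrite exprMn -expRM_natl mulrCA divff ?gt_eqF// mulr1.
exists (\sum_(i < size p) `|p`_i| * i%:R ^+ i); split.
  by apply: sumr_ge0 => i _; rewrite mulr_ge0// exprn_ge0.
move=> y y0; rewrite horner_coef mulr_suml.
apply: (le_trans (ler_norm_sum _ _ _)); apply: ler_sum => i _.
rewrite normrM -mulrA ler_wpM2l// normrX ger0_norm//; exact: hn.
Qed.

Lemma is_derive_flat p (x : R) :
  is_derive x (1 : R) (flat p) (flat ('X^2 * (p - p^`())) x).
Proof.
have [x0|x0|->] := ltgtP x 0.
- apply: (@near_eq_is_derive _ _ _ (cst 0)); last first.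
    by rewrite /flat ltNge (ltW x0) /=; exact: is_derive_cst.
  near=> y; rewrite /flat ltNge (_ : y <= 0)//; near: y.
  by have := lt_nbhsl x0; apply: filterS => y /ltW.
- apply: (@near_eq_is_derive _ _ _ (fun y : R => p.[y^-1] * expR (- y^-1) : R)).
    near=> y; rewrite /flat (_ : 0 < y)//; near: y.
    exact: lt_nbhsr x0.
  have xn : x != 0 by rewrite gt_eqF.
  have dV : is_derive x 1 (fun y : R => y^-1) (- x ^- 2).
    by have := is_deriveV xn (is_derive_id x 1); rewrite /= scaler1.
  have d1 : is_derive x 1 (fun y => p.[y^-1]) (p^`().[x^-1] * - x ^- 2).
    exact: (@is_derive1_comp _ (horner p) (fun y => y^-1)).
  have d2 : is_derive x 1 (fun y => expR (- y^-1)) (expR (- x^-1) * x ^- 2).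
    have dN : is_derive x 1 (fun y : R => - y^-1) (x ^- 2).
      by have := is_deriveN dV; rewrite opprK.
    exact: (@is_derive1_comp _ expR (fun y => - y^-1)).
  apply: is_derive_eq (is_deriveM d1 d2) _.
  rewrite /flat x0 !hornerE /GRing.scale /= -exprVn.
  ring.
- apply/is_derive1_caratheodory.
  (* The factor ['X^3] gives [flat p z = O(z^3)], hence a difference quotient at zero bounded by
     [C * z ^+ 2]. *)
  have [C [C0 hC]] := expR_poly_bound ('X^3 * p).
  have nle (r : R) : 0 < r -> \forall z \near (0 : R), z <= r.
    move=> r0; exists r => //= z; rewrite /ball_/= sub0r normrN => /ltW.
    exact: le_trans (ler_norm _).
  exists (fun z => if 0 < z then z^-1 * flat p z else 0); split.
  + move=> z; rewrite /flat ltxx !subr0; case: ifP => // z0.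
    by rewrite mulrAC mulVf ?gt_eqF// mul1r.
    by rewrite mul0r.
  + apply/cvgrPdist_le => e e0; rewrite ltxx.
    near=> z; rewrite sub0r normrN; case: ifP => z0; last by rewrite normr0 ltW.
    have zV : 0 <= z^-1 by rewrite invr_ge0 ltW.
    have := hC _ zV; rewrite /flat z0 !hornerE => h.
    apply: (@le_trans _ _ (C * z ^+ 2)).
      rewrite mulrA normrM (ger0_norm (expR_ge0 _)) expRN.
      rewrite ler_pdivrMr ?expR_gt0// normrM (ger0_norm zV).
      move: h; rewrite normrM normrX (ger0_norm zV) => h.
      have z2 : 0 <= z ^+ 2 by rewrite sqr_ge0.
      have := ler_wpM2r z2 h.
      have -> : z^-1 ^+ 3 * `|p.[z^-1]| * z ^+ 2 = z^-1 * `|p.[z^-1]|.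
        by field; rewrite gt_eqF.
      by rewrite (_ : C * expR z^-1 * z ^+ 2 = C * z * z * expR z^-1) // expr2; ring.
    apply: (@le_trans _ _ (C * z)).
      rewrite ler_wpM2l// expr2 ler_piMl ?(ltW z0)//.
      near: z; exact: nle ltr01.
    have z1 : z <= e / (C + 1) by near: z; apply: nle; rewrite divr_gt0// ltr_wpDl.
    apply: (le_trans (ler_wpM2l C0 z1)).
    rewrite mulrCA ler_piMr ?(ltW e0)// ler_pdivrMr ?ltr_wpDl// mul1r lerDl.
    exact: ler01.
  + by rewrite ltxx /flat ltxx.
Unshelve. all: by end_near. Qed.

(* Closed under differentiation. *)
Inductive sm1 : (R -> R) -> Prop :=
| sm1_cst c : sm1 (fun=> c)
| sm1_id : sm1 (fun x => x)
| sm1_flat p : sm1 (flat p)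
| sm1_add f g : sm1 f -> sm1 g -> sm1 (fun x => f x + g x)
| sm1_mul f g : sm1 f -> sm1 g -> sm1 (fun x => f x * g x)
| sm1_comp f g : sm1 f -> sm1 g -> sm1 (fun x => f (g x)).

Lemma sm1_derive f : sm1 f -> exists2 f', sm1 f' & forall x : R, is_derive x (1 : R) f (f' x).
Proof.
elim => [c||p|{}f g sf [f' sf' df] sg [g' sg' dg]|{}f g sf [f' sf' df] sg [g' sg' dg]|
  {}f g sf [f' sf' df] sg [g' sg' dg]].
- by exists (fun=> 0); [exact: sm1_cst|move=> x; exact: is_derive_cst].
- by exists (fun=> 1); [exact: sm1_cst|move=> x; exact: is_derive_id].
- exists (flat ('X^2 * (p - p^`()))); first exact: sm1_flat.
  by move=> x; exact: is_derive_flat.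
- exists (fun x => f' x + g' x); first exact: sm1_add.
  by move=> x; exact: (is_deriveD (df x) (dg x)).
- exists (fun x => f x * g' x + g x * f' x).
    by apply: sm1_add; exact: sm1_mul.
  by move=> x; exact: (is_deriveM (df x) (dg x)).
- exists (fun x => f' (g x) * g' x).
    by apply: sm1_mul => //; exact: sm1_comp.
  by move=> x; exact: (is_derive1_comp (df (g x)) (dg x)).
Qed.

Lemma sm1_continuous f : sm1 f -> continuous f.
Proof.
move=> /sm1_derive[f' _ df] x.
by apply/differentiable_continuous/derivable1_diffP; case: (df x).
Qed.

Lemma flat1_gt0 x : 0 < x -> 0 < flat 1 x.
Proof. by move=> x0; rewrite /flat x0 hornerC mul1r expR_gt0. Qed.

Lemma flat1_le x y : x <= y -> flat 1 x <= flat 1 y.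
Proof.
move=> xy; rewrite /flat; case: ifP => [x0|_].
  rewrite (lt_le_trans x0 xy) !hornerC !mul1r ler_expR lerN2.
  by rewrite lef_pV2// posrE// (lt_le_trans x0 xy).
by case: ifP => // _; rewrite hornerC mul1r expR_ge0.
Qed.

(** The inner [flat 1] vanishes once [x^2 >= 1] and is at least [flat 1 1] once [2 x^2 <= 1]; the
    outer one turns these two regimes into the values 1 and 0. Composition replaces the usual
    quotient of flat functions, since [sm1] is closed under composition but contains no
    quotients. *)
Definition cutoff (x : R) : R :=
  (flat 1 (flat 1 1))^-1 * flat 1 (flat 1 1 - flat 1 (1 - (2 * (x * x) - 1))).

Lemma sm1_cutoff : sm1 cutoff.
Proof.
apply: sm1_mul; first exact: sm1_cst.
apply: (@sm1_comp (flat 1)); first exact: sm1_flat.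
apply: sm1_add; first exact: sm1_cst.
rewrite (_ : (fun x => _) = (fun x => -1 * flat 1 (2 + -2 * (x * x)))); last first.
  apply/funext => x; rewrite mulN1r; congr (- flat _ _); ring.
apply: sm1_mul; first exact: sm1_cst.
apply: (@sm1_comp (flat 1)); first exact: sm1_flat.
apply: sm1_add; first exact: sm1_cst.
apply: sm1_mul; first exact: sm1_cst.
by apply: sm1_mul; exact: sm1_id.
Qed.

Lemma cutoff_even x : cutoff (- x) = cutoff x.
Proof. by rewrite /cutoff mulrNN. Qed.

Lemma cutoff_near x : `|x| <= 1 / 2 -> cutoff x = 0.
Proof.
move=> hx; rewrite /cutoff.
have xx : x * x <= 1 / 4.
  by rewrite -[x * x]expr2 -real_normK ?num_real// expr2; have := normr_ge0 x; nra.
rewrite [X in _ * X](_ : _ = 0) ?mulr0//.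
rewrite /flat ltNge (_ : _ <= 0)// subr_le0.
by apply: flat1_le; lra.
Qed.

Lemma cutoff_far x : 1 <= `|x| -> cutoff x = 1.
Proof.
move=> hx; rewrite /cutoff.
have xx : 1 <= x * x.
  by rewrite -[x * x]expr2 -real_normK ?num_real// expr2; have := normr_ge0 x; nra.
rewrite (_ : flat 1 (1 - (2 * (x * x) - 1)) = 0) ?subr0 ?mulVf ?gt_eqF//.
  by apply: flat1_gt0; exact: flat1_gt0.
by rewrite /flat ltNge (_ : _ <= 0)//; lra.
Qed.

Lemma cutoff_bound x : 0 <= cutoff x <= 1.
Proof.
have h0 y : 0 <= flat 1 y.
  by rewrite /flat; case: ifP => // _; rewrite hornerC mul1r expR_ge0.
have h : 0 < flat 1 (flat 1 1) by apply: flat1_gt0; exact: flat1_gt0.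
rewrite /cutoff mulr_ge0 ?invr_ge0 ?h0//= mulrC ler_pdivrMr// mul1r.
by apply: flat1_le; rewrite gerBl.
Qed.

Variable d : nat.

(** Contains the polynomials and the cut-offs along hyperplanes, which is all that the test
    functions are made of, and is closed under partial derivatives, so that every order of
    smoothness follows by induction. *)
Inductive sm : ('rV[R]_d -> R) -> Prop :=
| sm_cst c : sm (fun=> c)
| sm_aff h a c : sm1 h -> sm (fun x => h (edot x a - c))
| sm_add f g : sm f -> sm g -> sm (fun x => f x + g x)
| sm_mul f g : sm f -> sm g -> sm (fun x => f x * g x).

Lemma edot_evec (x : 'rV[R]_d) i : edot x (@evec R d i) = x 0 i.
Proof.
rewrite /edot (bigD1 i)//= mxE !eqxx mulr1 big1 ?addr0// => j ji.
by rewrite mxE (negbTE ji) andbF mulr0.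
Qed.

Lemma is_derive_aff (h : R -> R) (dh : R) (a x : 'rV[R]_d) c i :
  is_derive (edot x a - c) 1 h dh ->
  is_derive x (@evec R d i) (fun y => h (edot y a - c)) (dh * a 0 i).
Proof.
move=> hd.
pose l t : R := edot x a - c + t * a 0 i.
have dl : is_derive (0 : R) 1 l (a 0 i).
  have h1 := is_deriveD (is_derive_cst (edot x a - c) (0 : R) (1 : R))
     (is_deriveM (is_derive_id (0 : R) (1 : R)) (is_derive_cst (a 0 i) (0 : R) (1 : R))).
  by apply: is_derive_eq h1 _; rewrite scaler0 !add0r /GRing.scale /= mulr1.
have hl : is_derive (0 : R) 1 (h \o l) (dh * a 0 i).
  by apply: is_derive1_comp => //; rewrite /l mul0r addr0.
have E : (fun t : R => t^-1 *: (((fun y => h (edot y a - c)) \o shift x) (t *: @evec R d i) - h (edot x a - c))) =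
   (fun t : R => t^-1 *: (((h \o l) \o shift 0) (t *: (1 : R)) - (h \o l) 0)).
  apply/funext => t; rewrite /= /l mul0r !addr0 edotDl edotZl [t%:A]mulr1.
  by rewrite (edotC _ a) edot_evec [t * _ + _]addrC addrAC.
case: hl => h1 h2; split.
  by move: h1; rewrite /derivable -E.
by move: h2; rewrite /derive -E.
Qed.

Lemma sm_derive f i : sm f ->
  exists2 f', sm f' & forall x, is_derive x (@evec R d i) f (f' x).
Proof.
elim => [c|h a c sh|{}f g sf [f' sf' df] sg [g' sg' dg]|{}f g sf [f' sf' df] sg [g' sg' dg]].
- by exists (fun=> 0); [exact: sm_cst|move=> x; exact: is_derive_cst].
- have [h' sh' dh] := sm1_derive sh.
  exists (fun x => h' (edot x a - c) * a 0 i).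
    by apply: sm_mul; [exact: sm_aff|exact: sm_cst].
  by move=> x; exact: is_derive_aff.
- exists (fun x => f' x + g' x); first exact: sm_add.
  by move=> x; exact: (is_deriveD (df x) (dg x)).
- exists (fun x => f x * g' x + g x * f' x).
    by apply: sm_add; exact: sm_mul.
  by move=> x; exact: (is_deriveM (df x) (dg x)).
Qed.

Lemma sm_continuous f : sm f -> continuous f.
Proof.
elim => [c|h a c sh|{}f g _ cf _ cg|{}f g _ cf _ cg] x.
- exact: cst_continuous.
- apply: (@continuous_comp _ _ _ (fun x => edot x a - c) h); last exact: sm1_continuous.
  exact: (cvgB (@continuous_edot R d a x) (cvg_cst _)).
- exact: cvgD (cf x) (cg x).
- exact: cvgM (cf x) (cg x).
Qed.

Lemma sm_sum (I : Type) (r : seq I) (P : pred I) (f : I -> 'rV[R]_d -> R) :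
  (forall i, sm (f i)) -> sm (fun x => \sum_(i <- r | P i) f i x).
Proof.
move=> sf; elim: r => [|i r IH].
  by under eq_fun do rewrite big_nil; exact: sm_cst.
under eq_fun do rewrite big_cons.
by case: (P i) => //; exact: sm_add.
Qed.

Lemma sm_prod (I : Type) (r : seq I) (P : pred I) (f : I -> 'rV[R]_d -> R) :
  (forall i, sm (f i)) -> sm (fun x => \prod_(i <- r | P i) f i x).
Proof.
move=> sf; elim: r => [|i r IH].
  by under eq_fun do rewrite big_nil; exact: sm_cst.
under eq_fun do rewrite big_cons.
by case: (P i) => //; exact: sm_mul.
Qed.

End smooth_functions.

Section cutoff_derivative.
Variable R : realType.
Local Notation leb := (@lebesgue_measure R).

Definition dcutoff (x : R) : R := 'D_1 (@cutoff R) x.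

Lemma is_derive_cutoff (x : R) : is_derive x (1 : R) (@cutoff R) (dcutoff x).
Proof.
have [f _ df] := sm1_derive (@sm1_cutoff R).
by split; case: (df x).
Qed.

Lemma sm1_dcutoff : sm1 dcutoff.
Proof.
have [f sf df] := sm1_derive (@sm1_cutoff R).
suff -> : dcutoff = f by [].
by apply/funext => x; rewrite /dcutoff; case: (df x).
Qed.

Lemma dcutoff_far (x : R) : 1 < `|x| -> dcutoff x = 0.
Proof.
move=> x1; have h : is_derive x (1 : R) (@cutoff R) 0.
  apply: (@near_eq_is_derive _ _ _ (fun=> 1 : R)).
  have : \forall y \near x, 1 < `|y|.
    apply: (@cvgr_gt _ _ (nbhs x) _ _ `|x|) => //.
    by apply: cvg_norm.
  by apply: filterS => y /ltW /cutoff_far ->.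
by rewrite /dcutoff; case: h.
Qed.

Lemma dcutoff_bound : exists2 M : R, 0 <= M & forall x, `|dcutoff x| <= M.
Proof.
have h : bounded_set (dcutoff @` `[-1, 1]%classic).
  apply: compact_bounded; apply: continuous_compact; last exact: segment_compact.
  apply: continuous_subspaceT; exact: (sm1_continuous sm1_dcutoff).
have [M [Mr hM]] := h.
exists (`|M| + 1); first by rewrite addr_ge0.
move=> x; have [x1|x1] := leP `|x| 1; last by rewrite dcutoff_far// normr0 addr_ge0.
apply: hM; first by rewrite (le_lt_trans (ler_norm M))// ltrDl.
exists x => //=; by rewrite in_itv/= -ler_norml.
Qed.

Lemma integral_dcutoff (a b : R) : a < b ->
  (\int[leb]_(x in `[a, b]) (dcutoff x)%:E = (cutoff b - cutoff a)%:E)%E.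
Proof.
move=> ab; have cd : continuous (@cutoff R) := sm1_continuous (@sm1_cutoff R).
have h1 : {within `[a, b], continuous dcutoff}.
  by apply: continuous_subspaceT; exact: (sm1_continuous sm1_dcutoff).
have h2 : derivable_oo_LRcontinuous (@cutoff R) a b.
  split.
  + by move=> x _; case: (is_derive_cutoff x).
  + exact: cvg_at_right_filter (cd a).
  + exact: cvg_at_left_filter (cd b).
have h3 : {in `]a, b[, (@cutoff R)^`()%classic =1 dcutoff} by move=> x _; rewrite derive1E.
by have := @continuous_FTC2 R dcutoff (@cutoff R) a b ab h1 h2 h3.
Qed.

Lemma dcutoff_odd (x : R) : dcutoff (- x) = - dcutoff x.
Proof.
have h : is_derive x (1 : R) (@cutoff R) (dcutoff (- x) * -1).
  rewrite (_ : @cutoff R = @cutoff R \o -%R); last first.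
    by apply/funext => y /=; rewrite cutoff_even.
  by apply: is_derive1_comp; exact: is_derive_cutoff.
by case: h => _; rewrite -/(dcutoff x) => ->; rewrite mulrN1 opprK.
Qed.

Lemma dcutoff0 : dcutoff 0 = 0.
Proof. by have := dcutoff_odd 0; rewrite oppr0; lra. Qed.

(** The derivative of the cut-off has integral 1 over the positive half-line and -1 over the
    negative one: after rescaling it acts on a function as the jump between its two one-sided
    values. *)
Lemma integral_dcutoff_jump (a b : R) :
  (\int[leb]_s (dcutoff s * (if 0 < s then a else b))%:E = (a - b)%:E)%E.
Proof.
have cd : continuous dcutoff := sm1_continuous sm1_dcutoff.
have ci (x y : R) : leb.-integrable `[x, y] (EFin \o dcutoff).
  apply: continuous_compact_integrable; first exact: segment_compact.
  exact: continuous_subspaceT.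
pose h k (x y : R) := (fun s => (k * dcutoff s)%:E) \_ `[x, y]%classic.
have hi k x y : leb.-integrable [set: R] (h k x y).
  have H : leb.-integrable `[x, y] (fun s => (k * dcutoff s)%:E).
    apply: (@continuous_compact_integrable R (fun s => k * dcutoff s)); first exact: segment_compact.
    apply: continuous_subspaceT => s; exact: (cvgM (cvg_cst k) (cd s)).
  exact: (proj1 (@integrable_mkcond _ _ R leb _ (fun s => (k * dcutoff s)%:E) (measurable_itv `[x, y])) H).
have hI k x y : x < y -> (\int[leb]_s h k x y s = (k * (cutoff y - cutoff x))%:E)%E.
  move=> xy; rewrite -integral_mkcond; under eq_integral do rewrite EFinM.
  have ci' : leb.-integrable `[x, y] (fun s => (dcutoff s)%:E) := ci x y.
  have mI : measurable (`[x, y]%classic : set (measurableTypeR R)) by exact: measurable_itv.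
  by rewrite (integralZl mI ci' k) integral_dcutoff// EFinM.
transitivity (\int[leb]_s (h a 0%R 1%R s + h b (-1)%R 0%R s))%E.
  apply: eq_integral => s _; rewrite /h !patchE.
  have [s0|s0|->] := ltgtP s 0; last by rewrite dcutoff0 !mulr0 mul0r !if_same adde0.
  - rewrite !mem_setE !in_itv/= (_ : 0 <= s = false) ?(ltW s0) ?andbT/=; last by apply/negbTE; rewrite -ltNge.
    rewrite add0e; case: leP => s1; first by rewrite mulrC.
    by rewrite dcutoff_far ?mul0r// ltr0_norm//; lra.
  - rewrite !mem_setE !in_itv/= (ltW s0) (_ : s <= 0 = false) ?andbF/=; last by apply/negbTE; rewrite -ltNge.
    rewrite adde0; case: leP => s1; first by rewrite mulrC.
    by rewrite dcutoff_far ?mul0r// gtr0_norm//; lra.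
rewrite integralD// !hI// ?ltrN10//.
rewrite cutoff_far ?normr1// (cutoff_near (x := 0)) ?normr0; last by lra.
rewrite cutoff_far ?normrN1// -EFinD; congr EFin; ring.
Qed.

End cutoff_derivative.

Lemma is_derive_prod (R : realType) (V : normedModType R) (I : eqType) (r : seq I)
    (f : I -> V -> R) (df : I -> R) (x v : V) : uniq r ->
  (forall i, is_derive x v (f i) (df i)) ->
  is_derive x v (fun y => \prod_(i <- r) f i y)
    (\sum_(i <- r) df i * \prod_(l <- r | l != i) f l x).
Proof.
move=> + fd; elim: r => [|i r IH] /= => [_|/andP[ir ur]].
  by under eq_fun do rewrite big_nil; rewrite big_nil; exact: is_derive_cst.
under eq_fun do rewrite big_cons.
apply: is_derive_eq (is_deriveM (fd i) (IH ur)) _.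
rewrite big_cons addrC; congr (_ + _).
  rewrite big_cons eqxx /= /GRing.scale /= mulrC; congr (_ * _).
  by rewrite big_seq [RHS]big_seq_cond; apply: eq_bigl => l;
    case: (boolP (l \in r)) => //= lr; apply/esym; apply: contraNneq ir => <-.
rewrite /GRing.scale /= mulr_sumr !big_seq; apply: eq_bigr => l lr.
rewrite big_cons (_ : i != l); last by apply: contraNneq ir => ->.
by rewrite mulrCA.
Qed.

Section cutoff_domain.
Variables (R : realType) (d : nat) (T : set 'rV[R]_d).
Hypotheses (oT : open T).
Local Notation ev := (@evec R d).
Implicit Types (f g q : 'rV[R]_d -> R) (x : 'rV[R]_d).

Definition restr1 f x : R := (\1_T x : R) * f x.

Variable V : set 'rV[R]_d.
Hypotheses (oV : open V) (TV : closure T `\` T `<=` V).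

(** As [f] vanishes on an open set containing the boundary points, every point has a neighbourhood
    on which the extension by zero is either [f] or zero, and so inherits all the regularity of
    [f]. *)
Lemma restr1_local f x : (forall y, V y -> f y = 0) ->
  [\/ T x /\ (\forall y \near x, f y = restr1 f y),
      ~ T x /\ (\forall y \near x, 0 = restr1 f y) |
      V x /\ (\forall y \near x, f y = restr1 f y)].
Proof.
move=> f0; have [Tx|Tx] := pselect (T x).
  apply: Or31; split => //; have : \forall y \near x, T y by exact: open_nbhs_nbhs.
  by apply: filterS => y Ty; rewrite /restr1 indicE mem_set// mul1r.
have [cx|cx] := pselect (closure T x); last first.
  apply: Or32; split => //.
  have : \forall y \near x, (~` closure T) y.
    by apply: open_nbhs_nbhs; split => //; apply: closed_openC; exact: closed_closure.
  apply: filterS => y Ty; rewrite /restr1 indicE memNset ?mul0r// => Ty'.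
  by apply: Ty; exact: subset_closure.
have Vx : V x by apply: TV.
apply: Or33; split => //; have : \forall y \near x, V y by exact: open_nbhs_nbhs.
by apply: filterS => y Vy; rewrite /restr1 f0// mulr0.
Qed.

Lemma restr1_continuous f : (forall y, V y -> f y = 0) -> continuous f ->
  continuous (restr1 f).
Proof.
move=> f0 cf x; case: (restr1_local x f0) => -[h E].
- rewrite /continuous_at -(nbhs_singleton E); apply: cvg_trans (cf x).
  exact: near_eq_cvg E.
- rewrite /continuous_at -(nbhs_singleton E); apply: (@cvg_trans _ (cst 0 @ x)).
    exact: near_eq_cvg E.
  exact: (@cst_continuous _ _ (0 : R) x).
- rewrite /continuous_at -(nbhs_singleton E); apply: cvg_trans (cf x).
  exact: near_eq_cvg E.
Qed.

Lemma restr1_derive f (f' : R) i x : (forall y, V y -> f y = 0) ->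
  is_derive x (ev i) f f' -> is_derive x (ev i) (restr1 f) ((\1_T x : R) * f').
Proof.
move=> f0 df; case: (restr1_local x f0) => -[h E].
- rewrite indicE mem_set// mul1r; exact: near_eq_is_derive E df.
- rewrite indicE memNset// mul0r; exact: near_eq_is_derive E (is_derive_cst _ _ _).
- have df0 : is_derive x (ev i) f 0.
    apply: (@near_eq_is_derive _ _ _ (cst 0)).
    have : \forall y \near x, V y by exact: open_nbhs_nbhs.
    by apply: filterS => y /f0 ->.
  have -> : f' = 0 by case: df => _ <-; case: df0.
  by rewrite mulr0; exact: near_eq_is_derive E df0.
Qed.

Lemma restr1_Cn n f : (forall y, V y -> f y = 0) -> sm f -> Cn n (restr1 f).
Proof.
elim: n f => [|n IH] f f0 sf.
  by apply: restr1_continuous => //; exact: sm_continuous.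
split; first by apply: restr1_continuous => //; exact: sm_continuous.
move=> i; have [f' sf' df] := sm_derive i sf.
split=> [x|]; first by case: (restr1_derive f0 (df x)).
(* Since [V] is open, the vanishing hypothesis passes to the derivatives and the induction can
   continue. *)
have f'0 y : V y -> f' y = 0.
  move=> Vy; have : is_derive y (ev i) f 0.
    apply: (@near_eq_is_derive _ _ _ (cst 0)).
    have : \forall z \near y, V z by exact: open_nbhs_nbhs.
    by apply: filterS => z /f0 ->.
  by case: (df y) => _ <- [_ <-].
rewrite (_ : (fun x => _) = restr1 f'); first exact: IH.
by apply/funext => x; case: (restr1_derive f0 (df x)).
Qed.

End cutoff_domain.

Lemma ae_prod1 d1 d2 (T1 : measurableType d1) (T2 : measurableType d2) (R : realType)
    (m1 : {sigma_finite_measure set T1 -> \bar R})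
    (m2 : {sigma_finite_measure set T2 -> \bar R}) (P : T1 -> Prop) :
  {ae m1, forall x, P x} -> {ae (m1 \x m2)%E, forall p : T1 * T2, P p.1}.
Proof.
move=> [N [mN N0 NP]]; exists (N `*` setT); split.
- exact: measurableX.
- transitivity (m1 N * m2 setT)%E; first exact: product_measure1E.
  by rewrite (_ : m1 N = 0%E) ?mul0e//; exact: N0.
- by move=> p /= Pp; split => //; apply: NP.
Qed.

Lemma normal_coord_le1 (R : realType) d (n : 'rV[R]_d) i : enorm n = 1 -> `|n 0 i| <= 1.
Proof.
move=> /enorm1_edot nn.
rewrite -(expr_le1 (n := 2))// -normrX ger0_norm ?sqr_ge0// -nn /edot (bigD1 i)//= -expr2 lerDl.
by apply: sumr_ge0 => j _; rewrite -expr2 sqr_ge0.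
Qed.

Lemma prod_le1 (R : realType) (I : Type) (r : seq I) (P : pred I) (f : I -> R) :
  (forall i, 0 <= f i <= 1) -> 0 <= \prod_(i <- r | P i) f i <= 1.
Proof.
move=> h; elim/big_ind: _ => [|x y /andP[x0 x1] /andP[y0 y1]|i _]; rewrite ?ler01 ?lexx//.
by rewrite mulr_ge0// mulr_ile1.
Qed.

Lemma measurable_prod_fin d (T : measurableType d) (R : realType) (I : Type) (r : seq I)
    (P : pred I) (f : I -> T -> R) :
  (forall i, measurable_fun setT (f i)) ->
  measurable_fun setT (fun x => \prod_(i <- r | P i) f i x).
Proof.
move=> mf; elim: r => [|i r IH].
  by under eq_fun do rewrite big_nil; exact: measurable_cst.
under eq_fun do rewrite big_cons.
by case: (P i) => //; exact: measurable_funM.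
Qed.

Lemma integrable_indic_fin d (T : measurableType d) (R : realType)
    (mu : {measure set T -> \bar R}) (A : set T) : measurable A -> (mu A < +oo)%E ->
  mu.-integrable setT (fun x => (\1_A x)%:E).
Proof.
move=> mA A_lty; apply/integrableP; split.
  by apply/measurable_EFinP; exact: measurable_indic.
under eq_integral do rewrite gee0_abs ?lee_fin//.
by rewrite integral_indic// setIT.
Qed.

Lemma cvg_sum_fin (R : realType) (T I : Type) (F : set_system T) (FF : Filter F)
    (r : seq I) (P : pred I) (f : I -> T -> R) (l : I -> R) :
  (forall i, f i x @[x --> F] --> l i) ->
  \sum_(i <- r | P i) f i x @[x --> F] --> \sum_(i <- r | P i) l i.
Proof.
move=> fl; elim: r => [|i r IH].
  by rewrite big_nil; under eq_fun do rewrite big_nil; exact: cvg_cst.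
rewrite big_cons; under eq_fun do rewrite big_cons.
by case: (P i) => //; exact: cvgD.
Qed.

Lemma measurable_line_scaled (R : realType) d (n : 'rV[R]_d) (e : R) :
  measurable_fun [set: 'rV[R]_d * measurableTypeR R]
    (fun p => p.1 + (e * p.2) *: n : 'rV[R]_d).
Proof.
apply: measurable_fun_rV => i; under eq_fun do rewrite !mxE.
apply: measurable_funD.
  exact: (measurableT_comp (@measurable_rV_coord R d i) measurable_fst).
by apply: measurable_funM => //; apply: measurable_funM => //; exact: measurable_snd.
Qed.

(** * Boundary integrals as limits of boundary layers along hyperplanes *)

Section flat_boundary.
Variables (R : realType) (d : nat) (T : set 'rV[R]_d) (I : finType).
Variables (nu : I -> 'rV[R]_d) (c : I -> R) (B : R).
Hypotheses (oT : open T) (TB : T `<=` box 0 B) (nu1 : forall i, enorm (nu i) = 1).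
Hypothesis planes_neq : forall i l, i != l ->
  exists2 y, hyperplane (nu i) (c i) y & ~ hyperplane (nu l) (c l) y.
Hypothesis bT : closure T `\` T `<=` \bigcup_i hyperplane (nu i) (c i).
Local Notation lam := (lebesgue_rV R d).
Local Notation leb := (@lebesgue_measure R).
Local Notation ev := (@evec R d).
Local Notation cutf := (@cutoff R).
Implicit Types (x y : 'rV[R]_d) (e : R).

Definition lev i x : R := edot x (nu i) - c i.
(** Zero within [e / 2] of any of the hyperplanes, one at distance at least [e] from all of them. It
    may also vanish inside [T], along hyperplanes that cross [T]; there the two sides of the layer
    cancel in the limit. *)
Definition chiw e x : R := \prod_(i : I) cutf (e^-1 * lev i x).
Definition dchiw e j x : R :=
  \sum_(i : I) e^-1 * nu i 0 j * dcutoff (e^-1 * lev i x) *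
    \prod_(l | l != i) cutf (e^-1 * lev l x).

Lemma sm_chiw e : sm (chiw e).
Proof.
apply: sm_prod => i; apply: (@sm_aff R d (fun t => cutf (e^-1 * t))).
apply: sm1_comp; first exact: sm1_cutoff.
by apply: sm1_mul; [exact: sm1_cst|exact: sm1_id].
Qed.

Lemma chiw_bound e x : 0 <= chiw e x <= 1.
Proof. by apply: prod_le1 => i; exact: cutoff_bound. Qed.

Lemma is_derive_chiw e j x : is_derive x (ev j) (chiw e) (dchiw e j x).
Proof.
rewrite /chiw.
have h i : is_derive x (ev j) (fun y => cutf (e^-1 * lev i y))
    (e^-1 * nu i 0 j * dcutoff (e^-1 * lev i x)).
  have := @is_derive_aff R d (fun t => cutf (e^-1 * t)) (dcutoff (e^-1 * lev i x) * e^-1) (nu i) x (c i) j.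
  rewrite (mulrC _ e^-1) mulrAC; apply.
  rewrite mulrC; apply: is_derive1_comp; first exact: is_derive_cutoff.
  have := is_deriveM (is_derive_cst e^-1 (lev i x) (1 : R)) (is_derive_id (lev i x) (1 : R)).
  by rewrite scaler0 addr0 /GRing.scale /= mulr1.
exact: is_derive_prod (index_enum_uniq I) h.
Qed.

Definition near_planes e : set 'rV[R]_d := \bigcup_i [set x | `|lev i x| < e / 2].

Lemma continuous_lev i : continuous (lev i).
Proof. by move=> x; exact: (cvgB (@continuous_edot R d (nu i) x) (cvg_cst _)). Qed.

Lemma open_near_planes e : open (near_planes e).
Proof.
apply: bigcup_open => i _.
rewrite (_ : [set x | _] = lev i @^-1` `]- (e / 2), e / 2[%classic); last first.
  by apply/seteqP; split => x /=; rewrite in_itv/= ltr_norml.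
by apply: open_comp => // x _; exact: continuous_lev.
Qed.

Lemma boundary_near_planes e : 0 < e -> closure T `\` T `<=` near_planes e.
Proof.
move=> e0 x /bT[i _ xi]; exists i => //=.
by rewrite /lev xi subrr normr0 divr_gt0.
Qed.

Lemma chiw_near e x : 0 < e -> near_planes e x -> chiw e x = 0.
Proof.
move=> e0 [i _ /= xi]; rewrite /chiw (bigD1 i)//= cutoff_near ?mul0r//.
rewrite normrM gtr0_norm ?invr_gt0// mulrC ler_pdivrMr// mulrC ltW//; lra.
Qed.

Lemma restr1_test (D : set 'rV[R]_d) e (q : 'rV[R]_d -> R) : 0 < e -> T `<=` D ->
  sm q -> test_function D (restr1 T (fun x => chiw e x * q x)).
Proof.
move=> e0 TD sq.
have z y : near_planes e y -> chiw e y * q y = 0.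
  by move=> /(chiw_near e0) ->; rewrite mul0r.
split=> [n|].
  apply: (restr1_Cn oT (@open_near_planes e) (@boundary_near_planes e e0) n z).
  by apply: sm_mul => //; exact: sm_chiw.
(* The boundary of [T] lies in the open set [near_planes e]; removing that set from the bounded set
   [closure T] leaves a compact subset of [T]. *)
exists (closure T `&` ~` near_planes e).
  split; last first.
    move=> x [cx nx]; apply: TD; apply: contrapT => Tx; apply: nx.
    exact: boundary_near_planes.
  have cb : compact (box (0 : 'rV[R]_d) B).
    rewrite (_ : box _ _ = [set v : 'rV[R]_d | forall i, `[- B, B]%classic (v ord0 i)]).
      by apply: (@rV_compact _ _ (fun=> `[- B, B]%classic)) => i; exact: segment_compact.
    by apply/seteqP; split => x h i; have := h i; rewrite /= in_itv/= !mxE subr0 ler_norml.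
  apply: (subclosed_compact _ cb).
    by apply: closedI; [exact: closed_closure|apply: open_closedC; exact: open_near_planes].
  move=> x [cx _]; have /closure_id -> := compact_closed (@norm_hausdorff _ _) cb.
  exact: (closure_subset TB) cx.
move=> x nx; rewrite /restr1 indicE; have [Tx|Tx] := pselect (T x); last by rewrite memNset// mul0r.
have [nnx|nnx] := pselect (near_planes e x); first by rewrite z// mulr0.
by exfalso; apply: nx; split => //; exact: subset_closure.
Qed.

Lemma derive_restr1_test e (q q' : 'rV[R]_d -> R) j : 0 < e ->
  (forall x, is_derive x (ev j) q (q' x)) ->
  (fun x => 'D_(ev j) (restr1 T (fun x => chiw e x * q x)) x) =
  (fun x => restr1 T (fun x => chiw e x * q' x) x + restr1 T (fun x => q x * dchiw e j x) x).
Proof.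
move=> e0 dq; apply/funext => x.
have z y : near_planes e y -> chiw e y * q y = 0.
  by move=> /(chiw_near e0) ->; rewrite mul0r.
have h := is_deriveM (is_derive_chiw e j x) (dq x).
have [_ ->] := restr1_derive oT (@open_near_planes e) (@boundary_near_planes e e0) z h.
by rewrite /restr1 -mulrDr.
Qed.

Section boundary_limit.
(** [Tp i] and [Tm i] are the one-sided limits of the indicator of [T] on the two sides of the i-th
    hyperplane. Continuity of [g] is asked from within [T] only, which is what a field known up to
    the boundary provides. *)
Variables (g : 'rV[R]_d -> R) (M : R) (Tp Tm : I -> 'rV[R]_d -> R) (j : 'I_d).
Hypotheses (mg : measurable_fun setT g) (gM : forall x, `|g x| <= M).
Hypothesis gc : forall y, closure T y -> g x @[x --> within T (nbhs y)] --> g y.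
Hypotheses (mTp : forall i, measurable_fun setT (Tp i))
  (mTm : forall i, measurable_fun setT (Tm i)).
Hypothesis jump : forall i, {ae surface (nu i) (c i), forall y,
  \forall t \near 0^'+, (\1_T (y + t *: nu i) = Tp i y) /\ (\1_T (y - t *: nu i) = Tm i y)}.

Let e_ (k : nat) : R := (k.+1%:R)^-1.

Definition bterm e i x : R :=
  restr1 T (fun x => g x * (e^-1 * nu i 0 j * dcutoff (e^-1 * lev i x) *
    \prod_(l | l != i) cutf (e^-1 * lev l x))) x.

Lemma measurable_bterm e i : measurable_fun setT (bterm e i).
Proof.
have ml l : measurable_fun setT (fun x => e^-1 * lev l x).
  apply: measurable_funM => //; apply: continuous_measurable_rV; exact: continuous_lev.
apply: measurable_funM; first by apply: measurable_indic; exact: open_measurable_rV.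
apply: measurable_funM => //; apply: measurable_funM.
  apply: measurable_funM => //.
  apply: (measurableT_comp _ (ml i)); apply: continuous_measurable_fun.
  exact: sm1_continuous (@sm1_dcutoff R).
apply: measurable_prod_fin => l; apply: (measurableT_comp _ (ml l)).
apply: continuous_measurable_fun; exact: sm1_continuous (@sm1_cutoff R).
Qed.

Lemma bterm_line i e y s : 0 < e -> hyperplane (nu i) (c i) y ->
  e * bterm e i (y + (e * s) *: nu i) =
  restr1 T g (y + (e * s) *: nu i) * (nu i 0 j * dcutoff s) *
    \prod_(l | l != i) cutf (e^-1 * lev l (y + (e * s) *: nu i)).
Proof.
move=> e0 yi; rewrite /bterm /restr1 {1 2}/lev (edot_line _ (nu1 i) yi) addrAC subrr add0r.
rewrite (mulKf (lt0r_neq0 e0)) -/(lev _ _).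
set p := \prod_(_ | _) _; set h := _ + _ *: _.
by field; rewrite gt_eqF.
Qed.

(** The dominating function for the passage to the limit, hence free of [e]. As [e <= 1] and the
    derivative of the cut-off vanishes for [|s| > 1], a point [y] that contributes is at distance at
    most one from the box of [T], in each coordinate. *)
Lemma bterm_line_bound i Mc e y s : 0 < e <= 1 -> hyperplane (nu i) (c i) y ->
  (forall t, `|dcutoff t| <= Mc) ->
  `|e * bterm e i (y + (e * s) *: nu i)| <=
  M * Mc * ((\1_(box 0 (B + 1)) y : R) * (\1_(`[-1, 1]%classic) s : R)).
Proof.
move=> /andP[e0 e1] yi hMc; rewrite bterm_line//.
have M0 : 0 <= M := le_trans (normr_ge0 _) (gM 0).
have Mc0 : 0 <= Mc := le_trans (normr_ge0 _) (hMc 0).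
have R0 : 0 <= M * Mc * ((\1_(box 0 (B + 1)) y : R) * (\1_(`[-1, 1]%classic) s : R)).
  by rewrite !mulr_ge0.
have [s1|s1] := ltP 1 `|s|; first by rewrite dcutoff_far// mulr0 mulr0 mul0r normr0.
rewrite /restr1 indicE; have [Tx|Tx] := pselect (T (y + (e * s) *: nu i)); last first.
  by rewrite memNset// !mul0r normr0.
rewrite mem_set// mul1r (_ : \1_`[-1, 1] s = 1); last by rewrite indicE mem_set//= in_itv/= -ler_norml.
rewrite indicE mem_set ?mulr1; last first.
  move=> a; have := TB Tx a; rewrite !mxE !subr0 => h.
  rewrite (_ : y 0 a = (y 0 a + e * s * nu i 0 a) - e * s * nu i 0 a); last ring.
  apply: (le_trans (ler_normB _ _)); apply: lerD => //.
  rewrite !normrM (gtr0_norm e0) -[leRHS]mulr1; apply: ler_pM => //.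
    by rewrite mulr_ge0// ltW.
    by rewrite mulr_ile1// ltW.
  exact: normal_coord_le1.
have /andP[p0 p1] := prod_le1 (index_enum I) (fun l => l != i)
  (fun l => cutoff_bound (e^-1 * lev l (y + (e * s) *: nu i))).
rewrite normrM (ger0_norm p0) -[leRHS]mulr1; apply: ler_pM => //.
rewrite normrM; apply: ler_pM => //.
by rewrite normrM -[leRHS]mul1r; apply: ler_pM => //; exact: normal_coord_le1.
Qed.

Lemma bterm_line_cvg i y s : hyperplane (nu i) (c i) y ->
  (forall l, l != i -> ~ hyperplane (nu l) (c l) y) ->
  (\forall t \near 0^'+, (\1_T (y + t *: nu i) = Tp i y) /\ (\1_T (y - t *: nu i) = Tm i y)) ->
  e_ k * bterm (e_ k) i (y + (e_ k * s) *: nu i) @[k --> \oo] -->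
  nu i 0 j * g y * (dcutoff s * (if 0 < s then Tp i y else Tm i y)).
Proof.
move=> yi yl jy; have e0 k : 0 < e_ k by rewrite invr_gt0.
have ecvg : e_ k @[k --> \oo] --> (0 : R) by exact: cvg_harmonic.
have [s0|s0] := eqVneq s 0.
  rewrite s0 dcutoff0 mul0r mulr0; apply: cvg_near_cst; apply: nearW => k.
  by rewrite bterm_line// dcutoff0 !(mulr0, mul0r).
set tau := if 0 < s then _ else _.
pose x k : 'rV[R]_d := y + (e_ k * s) *: nu i.
have Hsmall r : 0 < r -> \forall k \near \oo, e_ k < r.
  by move=> r0; move/cvgrPdist_lt : ecvg => /(_ _ r0); apply: filterS => k;
    rewrite sub0r normrN gtr0_norm.
(* For small width the point [x k] lies on the side of the hyperplane given by the sign of [s],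
   where the indicator is constant. *)
have Htau : \forall k \near \oo, \1_T (x k) = tau.
  case: jy => r /= r0 Hr.
  have {}Hr t : 0 < t -> t < r -> \1_T (y + t *: nu i) = Tp i y /\ \1_T (y - t *: nu i) = Tm i y.
    by move=> t0 tr; apply: Hr => //=; rewrite sub0r normrN gtr0_norm.
  have sn : 0 < `|s| by rewrite normr_gt0.
  have := Hsmall _ (divr_gt0 r0 sn); apply: filterS => k; rewrite ltr_pdivlMr// => hk.
  rewrite /tau /x; have [sp|sp] := ltP 0 s.
    by move: hk; rewrite (gtr0_norm sp) => /(Hr _ (mulr_gt0 (e0 k) sp))[].
  have sn0 : s < 0 by rewrite lt_neqAle s0.
  have sN : 0 < - s by rewrite oppr_gt0.
  have := Hr (e_ k * - s) (mulr_gt0 (e0 k) sN).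
  by rewrite -{1}(ltr0_norm sn0) mulrN scaleNr opprK => /(_ hk) [].
(* As [y] is off the other hyperplanes, their cut-offs are eventually one along the sequence. *)
have Hprod : \forall k \near \oo,
    \prod_(l | l != i) cutf ((e_ k)^-1 * lev l (x k)) = 1.
  suff H : \forall k \near \oo, forall l, l != i -> 1 <= `|(e_ k)^-1 * lev l (x k)|.
    by apply: filterS H => k H; apply: big1 => l li; rewrite cutoff_far// H.
  apply: filter_forall => l; have [->|li] := eqVneq l i; first by apply: nearW.
  have ly : 0 < `|lev l y|.
    by rewrite normr_gt0 subr_eq0; apply/eqP => h; exact: (yl l li).
  have K0 : 0 < 1 + `|s * edot (nu i) (nu l)| by rewrite ltr_pwDl.
  have := Hsmall _ (divr_gt0 ly K0); apply: filterS => k hk _.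
  rewrite normrM normfV (gtr0_norm (e0 k)) mulrC ler_pdivlMr// mul1r.
  move: hk; rewrite ltr_pdivlMr// => hk.
  have -> : lev l (x k) = lev l y + e_ k * (s * edot (nu i) (nu l)).
    by rewrite /lev /x edotDl edotZl; ring.
  have := ler_normB (lev l y + e_ k * (s * edot (nu i) (nu l))) (e_ k * (s * edot (nu i) (nu l))).
  rewrite addrK normrM (gtr0_norm (e0 k)); lra.
have xcvg : x k @[k --> \oo] --> y.
  apply/cvg_ballP => r r0; have sn : 0 < `|s| by rewrite normr_gt0.
  have := Hsmall _ (divr_gt0 r0 sn); apply: filterS => k; rewrite ltr_pdivlMr// => hk.
  split => // a b; rewrite (ord1 a) -ball_normE /= !mxE opprD addrA subrr sub0r normrN !normrM.
  apply: le_lt_trans hk; rewrite (gtr0_norm (e0 k)) ler_piMr ?normal_coord_le1//.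
  by rewrite mulr_ge0// ltW.
have fE : \forall k \near \oo, e_ k * bterm (e_ k) i (x k) =
    tau * g (x k) * (nu i 0 j * dcutoff s).
  near=> k; rewrite bterm_line// -/(x k) (near Hprod k)// mulr1 /restr1.
  by rewrite (near Htau k).
(* On the side outside [T] the term vanishes and [g] need not converge; on the other side the points
   are eventually in [T], which puts [y] in its closure and makes the continuity of [g] within [T]
   applicable. *)
have [tau0|tau1] : tau = 0 \/ tau = 1.
  have [k ->] : exists k, tau = \1_T (x k).
    by have [k _ /(_ k (leqnn k)) <-] := Htau; exists k.
  by rewrite indicE; case: (_ \in _); [right|left].
  apply: cvg_near_cst; apply: filterS fE => k ->.
  by rewrite tau0 !mul0r mulr0 mulr0.
have HT : \forall k \near \oo, T (x k).
  apply: filterS Htau => k; rewrite tau1 indicE.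
  by case: (boolP (x k \in T)) => [/set_mem//|_ /eqP]; rewrite eq_sym oner_eq0.
have cy : closure T y.
  move=> U /xcvg HU; near \oo => k; exists (x k); split.
    by near: k.
  by near: k.
have gx : g (x k) @[k --> \oo] --> g y.
  move=> U /(gc cy); rewrite /nbhs /= /within /= => HU.
  have := xcvg _ HU; rewrite /nbhs /= => HU'.
  near=> k; have : T (x k) -> U (g (x k)) by near: k.
  by apply; near: k.
have h : g (x k) * (nu i 0 j * dcutoff s) @[k --> \oo] --> g y * (nu i 0 j * dcutoff s).
  by apply: cvgM; [exact: gx|exact: cvg_cst].
rewrite tau1.
rewrite (_ : nu i 0 j * g y * (dcutoff s * 1) = g y * (nu i 0 j * dcutoff s)); last ring.
apply: cvg_trans h; apply: near_eq_cvg.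
by apply: filterS fE => k ->; rewrite tau1 mul1r.
Unshelve. all: by end_near. Qed.

Lemma bterm_limit i :
  (\int[lam]_x (bterm (e_ k) i x))%R @[k --> \oo] -->
  (\int[surface (nu i) (c i)]_y (nu i 0 j * g y * (Tp i y - Tm i y)))%R.
Proof.
have [Mc Mc0 hMc] := dcutoff_bound R.
have e0 k : 0 < e_ k by rewrite invr_gt0.
have e1 k : e_ k <= 1 by rewrite invf_le1// ler1n.
pose m1 := surfS (c i) (nu1 i).
pose F k (p : 'rV[R]_d * measurableTypeR R) : \bar R :=
  (e_ k * bterm (e_ k) i (p.1 + (e_ k * p.2) *: nu i))%:E.
pose f (p : 'rV[R]_d * measurableTypeR R) : \bar R :=
  (nu i 0 j * g p.1 * (dcutoff p.2 * (if 0 < p.2 then Tp i p.1 else Tm i p.1)))%:E.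
pose G (p : 'rV[R]_d * measurableTypeR R) : \bar R :=
  (M * Mc * ((\1_(box (0 : 'rV[R]_d) (B + 1)) p.1 : R) * (\1_(`[-1, 1]%classic) p.2 : R)))%:E.
have mF k : measurable_fun setT (F k).
  apply/measurable_EFinP; apply: measurable_funM => //.
  exact: (measurableT_comp (measurable_bterm _ i) (measurable_line_scaled (nu i) (e_ k))).
have m1T (h : 'rV[R]_d -> R) : measurable_fun setT h ->
    measurable_fun setT (fun p : 'rV[R]_d * measurableTypeR R => h p.1).
  by move=> mh; apply: (measurableT_comp mh); exact: measurable_fst.
have mf : measurable_fun setT f.
  apply/measurable_EFinP; apply: measurable_funM.
    by apply: measurable_funM => //; exact: m1T.
  apply: measurable_funM.
    apply: (@measurableT_comp _ _ _ _ _ _ (@dcutoff R)); last exact: measurable_snd.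
    by apply: continuous_measurable_fun; exact: sm1_continuous (@sm1_dcutoff R).
  apply: measurable_fun_ifT; [|exact: m1T|exact: m1T].
  by apply: measurable_fun_ltr => //; exact: measurable_snd.
have iG : (m1 \x leb)%E.-integrable setT G.
  have mB : measurable (box (0 : 'rV[R]_d) (B + 1)) := measurable_box _ _.
  have mI : measurable (`[-1, 1]%classic : set (measurableTypeR R)) by exact: measurable_itv.
  rewrite (_ : G = fun p => (M * Mc)%:E * (\1_(box (0 : 'rV[R]_d) (B + 1) `*` `[-1, 1]%classic) p)%:E)%E; last first.
    apply/funext => p; rewrite /G -EFinM !indicE -natrM mulnb; congr (_ * _%:R)%:E.
    by congr nat_of_bool; rewrite in_setX.
  apply: integrableZl => //; apply: integrable_indic_fin; first exact: measurableX.
  rewrite [X in (X < _)%E](_ : _ = m1 (box (0 : 'rV[R]_d) (B + 1)) * leb `[(-1)%R, 1%R]%classic)%E; last exact: product_measure1E.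
  apply: lte_mul_pinfty; first exact: measure_ge0.
    rewrite ge0_fin_numE; last exact: measure_ge0.
    exact: surface_box_lty.
  by rewrite (lebesgue_measure_itv `[-1, 1]) /= lte_fin; case: ifP => _; rewrite ?ltry.
(* Distinct hyperplanes meet in a null set, so almost every [y] lies on the i-th one only. *)
have aeP : {ae (m1 \x leb)%E, forall p : 'rV[R]_d * measurableTypeR R,
    [/\ hyperplane (nu i) (c i) p.1, (forall l, l != i -> ~ hyperplane (nu l) (c l) p.1) &
    \forall t \near 0^'+, (\1_T (p.1 + t *: nu i) = Tp i p.1) /\ (\1_T (p.1 - t *: nu i) = Tm i p.1)]}.
  have H l : {ae surface (nu i) (c i), forall y, l != i -> ~ hyperplane (nu l) (c l) y}.
    have [->|li] := eqVneq l i; first by apply: filterE => y /negP[].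
    exists (hyperplane (nu l) (c l)); split.
    - exact: measurable_hyperplane.
    - by apply: (surface_hyperplane (nu1 i)); apply: planes_neq; rewrite eq_sym.
    - by move=> y /= h; apply: contrapT => h'; apply: h.
  have H' : {ae surface (nu i) (c i), forall y l, l != i -> ~ hyperplane (nu l) (c l) y}.
    exact: filter_forall H.
  have H2 : {ae surface (nu i) (c i), forall y, [/\ hyperplane (nu i) (c i) y,
      (forall l, l != i -> ~ hyperplane (nu l) (c l) y) &
      \forall t \near 0^'+, (\1_T (y + t *: nu i) = Tp i y) /\ (\1_T (y - t *: nu i) = Tm i y)]}.
    by apply: filterS3 (ae_surface_hyperplane (c i) (nu1 i)) H' (jump i) => y h1 h2 h3; split.
  exact: (@ae_prod1 _ _ _ _ R m1 leb _ H2).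
have Fcvg : {ae (m1 \x leb)%E, forall p, setT p -> F ^~ p @ \oo --> f p}.
  apply: filterS aeP => p [h1 h2 h3] _; apply: cvg_EFin; first by apply: nearW.
  have H3 := @bterm_line_cvg i p.1 p.2 h1 h2 h3.
  exact: H3.
have Fdom : {ae (m1 \x leb)%E, forall p n, setT p -> (`|F n p| <= G p)%E}.
  apply: filterS aeP => p [h1 _ _] n _; rewrite lee_fin.
  by apply: bterm_line_bound => //; rewrite e0 e1.
have [fi _ lim] := dominated_convergence measurableT mF mf Fcvg iG Fdom.
have E1 : (fun k => \int[lam]_x (bterm (e_ k) i x)%:E)%E = (fun k => \int[m1 \x leb]_p F k p)%E.
  by apply/funext => k; exact: integral_normal (e0 k) (measurable_bterm _ _).
have E2 : (\int[surface (nu i) (c i)]_y (nu i 0 j * g y * (Tp i y - Tm i y))%:E =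
    \int[m1 \x leb]_p f p)%E.
  rewrite -(integral12_prod_meas1 fi); apply: eq_integral => y _.
  rewrite /fubini_F /f /= mulrBr -integral_dcutoff_jump.
  by apply: eq_integral => s _; congr EFin; case: ifP => _; ring.
apply: fine_cvg; rewrite fineK E2; last exact: integrable_fin_num fi.
rewrite E1; exact: lim.
Qed.

Lemma integrable_bterm k i : lam.-integrable setT (fun x => (bterm (e_ k) i x)%:E).
Proof.
have [Mc Mc0 hMc] := dcutoff_bound R.
have M0 : 0 <= M := le_trans (normr_ge0 _) (gM 0).
apply: (@le_integrable _ _ _ lam setT measurableT _
  (fun x => ((M * (k.+1%:R * Mc))%:E * (\1_(box (0 : 'rV[R]_d) B) x)%:E)%E)).
- by apply/measurable_EFinP; exact: measurable_bterm.
- move=> x _; rewrite -EFinM lee_fin /bterm /restr1 [leRHS]ger0_norm; last first.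
    by rewrite !mulr_ge0.
  rewrite !indicE; have [Tx|Tx] := pselect (T x); last first.
    by rewrite memNset// mul0r normr0 !mulr_ge0.
  rewrite (mem_set Tx) (mem_set (TB Tx)) mul1r mulr1 normrM.
  have /andP[p0 p1] := prod_le1 (index_enum I) (fun l => l != i)
    (fun l => cutoff_bound ((e_ k)^-1 * lev l x)).
  apply: ler_pM => //; rewrite normrM (ger0_norm p0) -[leRHS]mulr1; apply: ler_pM => //.
  rewrite invrK -mulrA normrM (ger0_norm (ler0n _ _)) ler_wpM2l// normrM -[leRHS]mul1r.
  by apply: ler_pM => //; exact: normal_coord_le1.
- apply: integrableZl => //; apply: integrable_indic_fin; first exact: measurable_box.
  have := @lebesgue_rV_box R d 0 `|B| (normr_ge0 _) => h.
  apply: (@le_lt_trans _ _ (lam (box 0 `|B|))); last by rewrite h ltry.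
  apply: le_measure; rewrite ?inE; [exact: measurable_box|exact: measurable_box|].
  by move=> x hx a; exact: le_trans (hx a) (ler_norm _).
Qed.

Lemma boundary_limit :
  (\int[lam]_x (restr1 T (fun x => g x * dchiw (e_ k) j x) x))%R @[k --> \oo] -->
  \sum_(i : I) (\int[surface (nu i) (c i)]_y (nu i 0 j * g y * (Tp i y - Tm i y)))%R.
Proof.
have E k : (\int[lam]_x (restr1 T (fun x => g x * dchiw (e_ k) j x) x))%R =
    \sum_(i : I) (\int[lam]_x (bterm (e_ k) i x))%R.
  rewrite /Rintegral sum_fine//; last by move=> i _; apply: integrable_fin_num => //; exact: integrable_bterm.
  rewrite -integral_sum//; last by move=> i; exact: integrable_bterm.
  congr fine; apply: eq_integral => x _; rewrite sumEFin; congr EFin.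
  by rewrite /restr1 /dchiw mulr_sumr mulr_sumr.
under eq_fun do rewrite E.
by apply: cvg_sum_fin => i; exact: bterm_limit.
Qed.

End boundary_limit.

Lemma chiw_cvg x : (forall i, ~ hyperplane (nu i) (c i) x) ->
  chiw (k.+1%:R^-1) x @[k --> \oo] --> (1 : R).
Proof.
move=> hx; apply: cvg_near_cst.
suff H : \forall k \near \oo, forall l, 1 <= `|(k.+1%:R^-1)^-1 * lev l x|.
  by apply: filterS H => k H; apply: big1 => l li; rewrite cutoff_far// H.
apply: filter_forall => l.
have ly : 0 < `|lev l x|.
  by rewrite normr_gt0 subr_eq0; apply/eqP => h; exact: (hx l).
have ecvg : (k.+1%:R^-1 : R) @[k --> \oo] --> (0 : R) by exact: cvg_harmonic.
move/cvgrPdist_lt : ecvg => /(_ _ ly); apply: filterS => k.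
rewrite sub0r normrN gtr0_norm ?invr_gt0// => hk.
by rewrite normrM normfV (gtr0_norm (_ : 0 < k.+1%:R^-1)) ?invr_gt0// mulrC ler_pdivlMr ?invr_gt0// mul1r ltW.
Qed.

Lemma ae_off_planes : {ae lam, forall x, forall i, ~ hyperplane (nu i) (c i) x}.
Proof.
apply: filter_forall => i; exists (hyperplane (nu i) (c i)); split.
- exact: measurable_hyperplane.
- apply: lebesgue_hyperplane; apply/eqP => h0; have := nu1 i.
  rewrite h0 /enorm /edot big1 ?sqrtr0 => [/eqP|]; first by rewrite eq_sym oner_eq0.
  by move=> a _; rewrite mxE mul0r.
- by move=> y /= h; apply: contrapT => h'; apply: h.
Qed.

Lemma restr1_chiw_limit (h : 'rV[R]_d -> R) : lam.-integrable T (EFin \o h) ->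
  (\int[lam]_x (restr1 T (fun x => chiw (k.+1%:R^-1) x * h x) x))%R @[k --> \oo] -->
  (\int[lam]_(x in T) (h x))%R.
Proof.
move=> ih; have mT : measurable T := open_measurable_rV oT.
have mh : measurable_fun T h by apply/measurable_EFinP; case/integrableP : ih.
pose F k x : \bar R := (chiw (k.+1%:R^-1) x * h x)%:E.
have E k : (\int[lam]_x (restr1 T (fun x => chiw (k.+1%:R^-1) x * h x) x) =
    fine (\int[lam]_(x in T) F k x)%E)%R.
  rewrite /Rintegral [in RHS]integral_mkcond; congr fine; apply: eq_integral => x _.
  by rewrite /restr1 patchE indicE /F; case: ifP => _; rewrite ?mul1r ?mul0r.
under eq_fun do rewrite E.
have mF k : measurable_fun T (F k).
  apply/measurable_EFinP; apply: measurable_funM => //.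
  apply: measurable_funS (continuous_measurable_rV _) => //.
  exact: sm_continuous (sm_chiw _).
have Fcvg : {ae lam, forall x, T x -> F ^~ x @ \oo --> (h x)%:E}.
  apply: filterS ae_off_planes => x hx _; apply: cvg_EFin; first by apply: nearW.
  by rewrite -[h x in X in _ --> X]mul1r; apply: cvgM; [exact: chiw_cvg|exact: cvg_cst].
have ig : lam.-integrable T (fun x => `|(h x)%:E|)%E by exact: integrable_abse ih.
have Fdom : {ae lam, forall x n, T x -> (`|F n x| <= `|(h x)%:E|)%E}.
  apply: filterE => x n _; rewrite lee_fin normrM.
  have /andP[p0 p1] := chiw_bound (n.+1%:R^-1) x.
  by rewrite (ger0_norm p0) ler_piMl.
have mhE : measurable_fun T (EFin \o h) by apply/measurable_EFinP.
have [fi _ lim] := dominated_convergence mT mF mhE Fcvg ig Fdom.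
by apply: fine_cvg; rewrite fineK//; exact: integrable_fin_num ih.
Qed.

End flat_boundary.

Lemma integrable_sumR d (T : measurableType d) (R : realType)
    (mu : {measure set T -> \bar R}) (D : set T) (I : Type) (r : seq I) (P : pred I)
    (f : I -> T -> R) : measurable D -> (forall i, mu.-integrable D (EFin \o f i)) ->
  mu.-integrable D (EFin \o (fun x => \sum_(i <- r | P i) f i x)).
Proof.
move=> mD fi; elim: r => [|i r IH].
  rewrite (_ : EFin \o _ = cst 0%E); first exact: integrable0.
  by apply/funext => x /=; rewrite big_nil.
rewrite (_ : EFin \o _ = if P i then (EFin \o f i) \+ (EFin \o (fun x => \sum_(j <- r | P j) f j x))
  else EFin \o (fun x => \sum_(j <- r | P j) f j x)).
  by case: ifP => // _; exact: integrableD.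
by apply/funext => x /=; rewrite big_cons; case: ifP.
Qed.

Lemma Rintegral_sum d (T : measurableType d) (R : realType)
    (mu : {measure set T -> \bar R}) (D : set T) (I : Type) (r : seq I) (P : pred I)
    (f : I -> T -> R) : measurable D -> (forall i, mu.-integrable D (EFin \o f i)) ->
  (\int[mu]_(x in D) (\sum_(i <- r | P i) f i x) =
   \sum_(i <- r | P i) \int[mu]_(x in D) f i x)%R.
Proof.
move=> mD fi; elim: r => [|i r IH].
  rewrite big_nil; under eq_Rintegral do rewrite big_nil.
  by rewrite /Rintegral integral0.
rewrite big_cons; under eq_Rintegral do rewrite big_cons.
case: ifP => // _; rewrite RintegralD//; first by rewrite IH.
exact: integrable_sumR.
Qed.

Lemma continuous_box_bounded (R : realType) d (q : 'rV[R]_d -> R) (B : R) :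
  continuous q -> exists2 M, 0 <= M & forall x, box 0 B x -> `|q x| <= M.
Proof.
move=> cq.
have cb : compact (box (0 : 'rV[R]_d) B).
  rewrite (_ : box _ _ = [set v : 'rV[R]_d | forall i, `[- B, B]%classic (v ord0 i)]).
    by apply: (@rV_compact _ _ (fun=> `[- B, B]%classic)) => i; exact: segment_compact.
  by apply/seteqP; split => x h i; have := h i; rewrite /= in_itv/= !mxE subr0 ler_norml.
have [M [Mr hM]] : bounded_set (q @` box (0 : 'rV[R]_d) B).
  apply: compact_bounded; apply: continuous_compact => //.
  exact: continuous_subspaceT.
exists (`|M| + 1); first by rewrite addr_ge0.
move=> x xB; apply: hM; first by rewrite (le_lt_trans (ler_norm M))// ltrDl.
by exists x.
Qed.

Lemma bounded_integrable_box (R : realType) d (f : 'rV[R]_d -> R) (M B : R) :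
  measurable_fun setT f -> (forall x, `|f x| <= M) -> (forall x, ~ box 0 B x -> f x = 0) ->
  (lebesgue_rV R d).-integrable setT (EFin \o f).
Proof.
move=> mf fM f0; have M0 : 0 <= M := le_trans (normr_ge0 _) (fM 0).
apply: (@le_integrable _ _ _ (lebesgue_rV R d) setT measurableT _
  (fun x => (M%:E * (\1_(box (0 : 'rV[R]_d) B) x)%:E)%E)).
- by apply/measurable_EFinP.
- move=> x _; rewrite -EFinM lee_fin [leRHS]ger0_norm ?mulr_ge0// indicE.
  have [xB|xB] := pselect (box 0 B x); first by rewrite mem_set// mulr1.
  by rewrite f0// normr0 mulr_ge0.
- apply: integrableZl => //; apply: integrable_indic_fin; first exact: measurable_box.
  have h := @lebesgue_rV_box R d 0 `|B| (normr_ge0 _).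
  apply: (@le_lt_trans _ _ (lebesgue_rV R d (box 0 `|B|))); last by rewrite h ltry.
  apply: le_measure; rewrite ?inE; [exact: measurable_box|exact: measurable_box|].
  by move=> x hx a; exact: le_trans (hx a) (ler_norm _).
Qed.

(** * Integration by parts from a weak divergence *)

Section weak_ibp.
Variables (R : realType) (d : nat) (Om T : set 'rV[R]_d) (I : finType).
Variables (nu : I -> 'rV[R]_d) (c : I -> R) (B : R).
Hypotheses (oT : open T) (TB : T `<=` box 0 B) (nu1 : forall i, enorm (nu i) = 1).
Hypothesis planes_neq : forall i l, i != l ->
  exists2 y, hyperplane (nu i) (c i) y & ~ hyperplane (nu l) (c l) y.
Hypothesis bT : closure T `\` T `<=` \bigcup_i hyperplane (nu i) (c i).
Local Notation lam := (lebesgue_rV R d).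
Local Notation ev := (@evec R d).
Variables (Tp Tm : I -> 'rV[R]_d -> R).
Hypotheses (mTp : forall i, measurable_fun setT (Tp i))
  (mTm : forall i, measurable_fun setT (Tm i)).
Hypothesis jump : forall i, {ae surface (nu i) (c i), forall y,
  \forall t \near 0^'+, (\1_T (y + t *: nu i) = Tp i y) /\ (\1_T (y - t *: nu i) = Tm i y)}.
Variables (a : 'I_d -> 'rV[R]_d -> R) (b : 'rV[R]_d -> R) (M : R).
Hypotheses (ma : forall i, measurable_fun setT (a i)) (aM : forall i x, `|a i x| <= M)
  (a0 : forall i x, ~ box 0 B x -> a i x = 0)
  (ac : forall i y, closure T y -> a i x @[x --> within T (nbhs y)] --> a i y).
Hypothesis ib : lam.-integrable T (EFin \o b).
Hypothesis TOm : T `<=` Om.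
Hypothesis weak : forall phi, test_function Om phi ->
  (\int[lam]_(x in Om) (\sum_i 'D_(ev i) phi x * a i x) =
   - \int[lam]_(x in Om) (phi x * b x))%R.

Lemma Rintegral_restr1 (h : 'rV[R]_d -> R) :
  (\int[lam]_(x in Om) (restr1 T h x) = \int[lam]_x (restr1 T h x))%R.
Proof.
rewrite Rintegral_mkcond; apply: eq_Rintegral => x _.
rewrite patchE; case: ifPn => // /negP xOm.
rewrite /restr1 indicE memNset ?mul0r// => Tx; apply: xOm; rewrite inE; exact: TOm.
Qed.

Lemma weak_ibp (q : 'rV[R]_d -> R) (dq : 'I_d -> 'rV[R]_d -> R) : sm q ->
  (forall i, sm (dq i)) -> (forall i x, is_derive x (ev i) q (dq i x)) ->
  (\sum_i \int[lam]_(x in T) (dq i x * a i x) +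
   \sum_i \sum_(l : I) \int[surface (nu l) (c l)]_y
      (nu l 0 i * (q y * a i y) * (Tp l y - Tm l y)) =
   - \int[lam]_(x in T) (q x * b x))%R.
Proof.
move=> sq sdq hdq.
have mT : measurable T := open_measurable_rV oT.
pose e_ (k : nat) : R := k.+1%:R^-1.
have e0 k : 0 < e_ k by rewrite invr_gt0.
have [Mq Mq0 hMq] := @continuous_box_bounded R d q B (sm_continuous sq).
have mq : measurable_fun setT q := continuous_measurable_rV (sm_continuous sq).
have M0 i : 0 <= M := le_trans (normr_ge0 _) (aM i 0).
have prodb h Mh i : (forall x, box 0 B x -> `|h x| <= Mh) -> 0 <= Mh ->
    forall x, `|h x * a i x| <= Mh * M.
  move=> hh Mh0 x; have [xB|xB] := pselect (box 0 B x).
    by rewrite normrM ler_pM// hh.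
  by rewrite a0// mulr0 normr0 mulr_ge0// (M0 i).
pose g i x := q x * a i x.
have gM i x : `|g i x| <= Mq * M by exact: prodb.
have mg i : measurable_fun setT (g i) by exact: measurable_funM.
have gc i y : closure T y -> g i x @[x --> within T (nbhs y)] --> g i y.
  move=> cy; apply: cvgM; last exact: ac.
  have cqy : q x @[x --> y] --> q y by exact: (@sm_continuous R d q sq y).
  exact: cvg_within_filter cqy.
have ida i : lam.-integrable T (EFin \o (fun x => dq i x * a i x)).
  have [Md Md0 hMd] := @continuous_box_bounded R d (dq i) B (sm_continuous (sdq i)).
  apply: (@integrableS _ _ _ _ setT) => //.
  apply: (@bounded_integrable_box _ _ _ (Md * M) B).
  - by apply: measurable_funM => //; exact: continuous_measurable_rV (sm_continuous (sdq i)).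
  - exact: prodb.
  - by move=> x xB; rewrite a0// mulr0.
have iqb : lam.-integrable T (EFin \o (fun x => q x * b x)).
  have mb : measurable_fun T b by apply/measurable_EFinP; case/integrableP : ib.
  apply: (le_integrable mT _ _ (integrableZl mT Mq (integrable_abse ib))).
    by apply/measurable_EFinP; apply: measurable_funM => //; exact: measurable_funS mq.
  move=> x Tx; rewrite -EFinM lee_fin !normrM normr_id (ger0_norm Mq0).
  by rewrite ler_wpM2r// hMq//; exact: TB.
have L1 i := restr1_chiw_limit c oT nu1 (ida i).
have L2 i := @boundary_limit R d T I nu c B oT TB nu1 planes_neq (g i) (Mq * M) Tp Tm i (mg i) (gM i) (gc i) mTp mTm jump.
have L3 := restr1_chiw_limit c oT nu1 iqb.
pose u k := \sum_i (\int[lam]_x restr1 T (fun x => chiw nu c (e_ k) x * (dq i x * a i x)) x)%R +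
    \sum_i (\int[lam]_x restr1 T (fun x => g i x * dchiw nu c (e_ k) i x) x)%R.
have L12 : u k @[k --> \oo] --> (\sum_i \int[lam]_(x in T) (dq i x * a i x) +
   \sum_i \sum_(l : I) \int[surface (nu l) (c l)]_y
      (nu l 0 i * g i y * (Tp l y - Tm l y)))%R.
  by apply: cvgD; apply: cvg_sum_fin => i; [exact: L1|exact: L2].
(* For a fixed width, [chiw * q] extended by zero is an admissible test function. The product rule
   splits the tested identity into the two sums of [u], which have the limits [L1] and [L2]; the
   right-hand side has the limit [L3]. *)
have K k : u k = - (\int[lam]_x restr1 T (fun x => chiw nu c (e_ k) x * (q x * b x)) x)%R.
  rewrite /u.
  have iA i : lam.-integrable setT (EFin \o restr1 T (fun x => chiw nu c (e_ k) x * (dq i x * a i x))).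
    have h := proj1 (@integrable_mkcond _ _ R lam T (EFin \o (fun x => dq i x * a i x)) mT) (ida i).
    apply: (le_integrable measurableT _ _ h).
      apply/measurable_EFinP; apply: measurable_funM; first exact: measurable_indic.
      apply: measurable_funM; first exact: continuous_measurable_rV (sm_continuous (sm_chiw _ _ _)).
      by apply: measurable_funM => //; exact: continuous_measurable_rV (sm_continuous (sdq i)).
    move=> x _ /=; rewrite /restr1 indicE patchE /=; case: ifPn => xT; last by rewrite mul0r normr0 abse_ge0.
    rewrite mul1r lee_fin normrM; have /andP[p0 p1] := chiw_bound nu c (e_ k) x.
    by rewrite (ger0_norm p0) ler_piMl.
  have iB i : lam.-integrable setT (EFin \o restr1 T (fun x => g i x * dchiw nu c (e_ k) i x)).
    rewrite (_ : restr1 T _ = fun x => \sum_(l : I) bterm T nu c (g i) i (e_ k) l x); last first.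
      by apply/funext => x; rewrite /restr1 /dchiw mulr_sumr mulr_sumr.
    apply: integrable_sumR => // l.
    exact: (integrable_bterm c oT TB nu1 i (mg i) (gM i)).
  have := weak (restr1_test oT TB bT (e0 k) TOm sq).
  rewrite Rintegral_mkcond (_ : _ \_ Om = fun x => \sum_i (restr1 T (fun x => chiw nu c (e_ k) x * (dq i x * a i x)) x +
      restr1 T (fun x => g i x * dchiw nu c (e_ k) i x) x)); last first.
    apply/funext => x; rewrite patchE; case: ifPn => xOm.
      apply: eq_bigr => i _.
      have /(congr1 (fun h => h x)) /= -> := derive_restr1_test oT bT (e0 k) (hdq i).
      rewrite /restr1 /g; ring.
    apply/esym; rewrite big1// => i _; rewrite /restr1 indicE memNset ?mul0r ?addr0// => Tx.
    by move/negP : xOm; apply; rewrite inE; exact: TOm.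
  rewrite Rintegral_sum//; last first.
    by move=> i; exact: (integrableD measurableT (iA i) (iB i)).
  under eq_bigr => i _ do rewrite (RintegralD measurableT (iA i) (iB i)).
  rewrite big_split /= => ->; congr (- _).
  rewrite (_ : (fun x => _) = restr1 T (fun x => chiw nu c (e_ k) x * (q x * b x))); last first.
    by apply/funext => x; rewrite /restr1; ring.
  exact: Rintegral_restr1.
apply: (cvg_unique (@norm_hausdorff _ R) L12).
rewrite (_ : u = fun k => - (\int[lam]_x restr1 T (fun x => chiw nu c (e_ k) x * (q x * b x)) x)%R).
  exact: cvgN L3.
by apply/funext => k; rewrite K.
Qed.

End weak_ibp.

(** * Simplices and mesh geometry *)

Section simplices.
Variables (R : realType) (d : nat).
Implicit Types (S : 'M[R]_(d.+1, d)) (x : 'rV[R]_d) (i j : 'I_d.+1).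

(** With a column of ones in front of the vertices, [l *m bary_mx S] records both the sum of the
    weights and the point they define. Nondegeneracy is invertibility of this matrix, and its
    inverse gives the barycentric coordinates as affine functions. *)
Definition bary_mx S : 'M[R]_d.+1 := row_mx (const_mx 1 : 'cV[R]_d.+1) S.
Definition bary S x : 'rV[R]_d.+1 :=
  (row_mx (const_mx 1 : 'cV[R]_1) x : 'M[R]_(1, 1 + d)) *m invmx (bary_mx S).
Definition bary_grad S i : 'rV[R]_d := \row_k invmx (bary_mx S) (rshift 1 k : 'I_(1 + d)) i.
Definition bary_cst S i : R := invmx (bary_mx S) (lshift d 0 : 'I_(1 + d)) i.

Lemma mul_bary_mx S (l : 'rV[R]_d.+1) :
  l *m bary_mx S = row_mx (const_mx (\sum_i l 0 i) : 'M[R]_1) (l *m S).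
Proof.
rewrite /bary_mx; have -> := @mul_mx_row R 1 d.+1 1 d l (const_mx 1) S.
apply: (congr1 (fun A => @row_mx R 1 1 d A (l *m S))).
by apply/rowP => k; rewrite !mxE; apply: eq_bigr => i _; rewrite !mxE mulr1.
Qed.

Lemma bary_mx_unit S : Defs.nondegenerate S -> bary_mx S \in unitmx.
Proof.
move=> nS; rewrite -row_free_unit -kermx_eq0; apply/rowV0P => l /sub_kermxP.
rewrite mul_bary_mx => h.
have {}h : @row_mx R 1 1 d (const_mx (\sum_i l 0 i)) (l *m S) = row_mx 0 0.
  by rewrite row_mx0 -[RHS]h.
have [h1 h2] := eq_row_mx h.
by apply: nS => //; move/matrixP/(_ 0 0): h1; rewrite !mxE.
Qed.

Lemma baryE S x i : bary S x 0 i = edot x (bary_grad S i) + bary_cst S i.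
Proof.
rewrite /bary mxE (@big_split_ord _ _ _ 1 d) /= big_ord1 addrC; congr (_ + _).
  by apply: eq_bigr => k _; rewrite row_mxEr mxE.
by rewrite row_mxEl mxE mul1r.
Qed.

Lemma bary_unique S x (l : 'rV[R]_d.+1) : Defs.nondegenerate S ->
  l *m S = x -> \sum_i l 0 i = 1 -> l = bary S x.
Proof.
move=> /bary_mx_unit uS lx l1; rewrite /bary -lx.
have -> : (const_mx 1 : 'cV[R]_1) = const_mx (\sum_i l 0 i) by rewrite l1.
by rewrite -mul_bary_mx mulmxK.
Qed.

Lemma bary_mulmx S x : Defs.nondegenerate S ->
  bary S x *m S = x /\ \sum_i bary S x 0 i = 1.
Proof.
move=> /bary_mx_unit uS; have := mul_bary_mx S (bary S x).
rewrite {1}/bary mulmxKV// => h; have [h1 h2] := @eq_row_mx R 1 1 d _ _ _ _ h; split => //.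
by move/matrixP/(_ 0 0): h1; rewrite !mxE.
Qed.

Lemma bary_vertex S i j : Defs.nondegenerate S -> bary S (row i S) 0 j = (i == j)%:R.
Proof.
move=> nS; rewrite -(@bary_unique S (row i S) (delta_mx 0 i))//.
- by rewrite mxE eqxx eq_sym.
- by rewrite -rowE.
- by rewrite (bigD1 i)//= mxE !eqxx big1 ?addr0// => k ki; rewrite mxE (negbTE ki) andbF.
Qed.

Lemma csimplexE S : Defs.nondegenerate S -> csimplex S = [set x | forall i, 0 <= bary S x 0 i].
Proof.
move=> nS; apply/seteqP; split => x /=.
  by move=> [l [l0 l1] lx]; rewrite -(bary_unique nS lx l1).
have [h1 h2] := bary_mulmx x nS; move=> h; exists (bary S x) => //; split => //.
Qed.

Lemma osimplexE S : Defs.nondegenerate S -> osimplex S = [set x | forall i, 0 < bary S x 0 i].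
Proof.
move=> nS; apply/seteqP; split => x /=.
  by move=> [l [[l0 l1] lp] lx]; rewrite -(bary_unique nS lx l1).
have [h1 h2] := bary_mulmx x nS; move=> h; exists (bary S x) => //; split => //; split=> // i.
exact: ltW.
Qed.

Lemma ofaceE S j : Defs.nondegenerate S ->
  oface S j = [set x | bary S x 0 j = 0 /\ forall i, i != j -> 0 < bary S x 0 i].
Proof.
move=> nS; apply/seteqP; split => x /=.
  move=> [l [[l0 l1] lp] lx]; rewrite -(bary_unique nS lx l1); split => [|i ij]; last by rewrite lp.
  by apply/eqP; rewrite eq_le l0 andbT leNgt lp eqxx.
have [h1 h2] := bary_mulmx x nS; move=> [h3 h4]; exists (bary S x) => //; split => //.
  by split=> // i; have [->|ij] := eqVneq i j; [rewrite h3|exact: ltW (h4 _ ij)].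
by move=> i; have [->|ij] := eqVneq i j; [rewrite h3 ltxx|rewrite h4].
Qed.

Lemma continuous_bary S i : continuous (fun x : 'rV[R]_d => bary S x 0 i).
Proof.
rewrite (_ : (fun x => _) = fun x => edot x (bary_grad S i) + bary_cst S i).
  move=> x; exact: (cvgD (@continuous_edot R d (bary_grad S i) x) (cvg_cst _)).
by apply/funext => x; rewrite baryE.
Qed.

Lemma closed_nneg (f : 'rV[R]_d -> R) : continuous f -> closed [set x | 0 <= f x].
Proof.
move=> cf; rewrite (_ : [set x | _] = f @^-1` [set t | 0 <= t]); last by [].
by apply: preimage_closed; [move=> x _; exact: cf|exact: closed_ge].
Qed.

Lemma closed_csimplex S : Defs.nondegenerate S -> closed (csimplex S).
Proof.
move=> nS; rewrite csimplexE// (_ : [set x | _] = \bigcap_i [set x | 0 <= bary S x 0 i]).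
  by apply: closed_bigI => i _; apply: closed_nneg; exact: continuous_bary.
by apply/seteqP; split => x h i; [move=> _|]; exact: h.
Qed.

Lemma open_bary_pos S (P : pred 'I_d.+1) :
  open [set x : 'rV[R]_d | forall i, P i -> 0 < bary S x 0 i].
Proof.
rewrite (_ : [set x | _] = ~` \bigcup_(i in [set i | P i]) [set x | 0 <= - bary S x 0 i]).
  apply: closed_openC; apply: closed_bigcup; first exact: finite_finset.
  move=> i _; apply: closed_nneg => x; exact: (cvgN (@continuous_bary S i x)).
apply/seteqP; split => x /=.
  by move=> h [i /= Pi]; rewrite oppr_ge0 leNgt h.
by move=> h i Pi; rewrite ltNge -oppr_ge0; apply/negP => h'; apply: h; exists i.
Qed.

(** The segment from [x] to the barycentre enters the open simplex at once, and its beginning stays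
    in [U]. *)
Lemma csimplex_meets_osimplex S (U : set 'rV[R]_d) x : Defs.nondegenerate S -> open U ->
  csimplex S x -> U x -> exists2 y, osimplex S y & U y.
Proof.
move=> nS oU; rewrite csimplexE// osimplexE// => /= xS Ux.
pose b : 'rV[R]_d := (const_mx (d.+1%:R^-1) : 'rV[R]_d.+1) *m S.
have bb i : 0 < bary S b 0 i.
  rewrite -(@bary_unique S b (const_mx (d.+1%:R^-1)))//; first by rewrite mxE invr_gt0.
  by under eq_bigr do rewrite mxE; rewrite sumr_const card_ord -[_ *+ _]mulr_natl divff// pnatr_eq0.
pose p (t : R) : 'rV[R]_d := x + t *: (b - x).
have pE t i : bary S (p t) 0 i = (1 - t) * bary S x 0 i + t * bary S b 0 i.
  by rewrite !baryE /p edotDl edotZl edotBl; ring.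
have cp : p t @[t --> (0 : R)] --> p 0.
  apply: (@continuous_rV R d R p) => i t.
  rewrite /p; under eq_fun do rewrite !mxE.
  by apply: cvgD; [exact: cvg_cst|apply: cvgMl; exact: cvg_id].
have pU : \forall t \near (0 : R), U (p t).
  by apply: cp; apply: open_nbhs_nbhs; split => //; rewrite /p scale0r addr0.
case: pU => r /= r0 hr.
pose t := Num.min (r / 2) 1.
have t0 : 0 < t by rewrite lt_min ltr01 andbT divr_gt0.
have t1 : t <= 1 by rewrite ge_min lexx orbT.
have tr : t < r by rewrite gt_min; apply/orP; left; lra.
exists (p t); last by apply: hr; rewrite /= sub0r normrN gtr0_norm.
move=> i; rewrite pE ltr_wpDl ?mulr_gt0// mulr_ge0 ?subr_ge0//; exact: xS.
Qed.

Lemma bary_plane S i : Defs.nondegenerate S ->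
  [set x | bary S x 0 i = 0] = hyperplane (bary_grad S i) (- bary_cst S i).
Proof.
move=> nS; apply/seteqP; split => x; rewrite /hyperplane/= baryE => h; lra.
Qed.

Lemma bary_planes_neq S i j : Defs.nondegenerate S -> i != j ->
  exists2 y, hyperplane (bary_grad S i) (- bary_cst S i) y &
             ~ hyperplane (bary_grad S j) (- bary_cst S j) y.
Proof.
move=> nS ij; exists (row j S).
  by rewrite -bary_plane//= bary_vertex// eq_sym (negbTE ij).
by rewrite -bary_plane//= bary_vertex// eqxx => /eqP; rewrite oner_eq0.
Qed.

End simplices.

Section boxes.
Variables (R : realType) (d : nat).
Implicit Types (x y c : 'rV[R]_d) (A : set 'rV[R]_d).

Lemma closed_box c r : closed (box c r).
Proof.
rewrite (_ : box c r = \bigcap_i [set x : 'rV[R]_d | 0 <= r - `|x 0 i - c 0 i|]).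
  apply: closed_bigI => i _; apply: closed_nneg => x.
  have h : {for x, continuous (fun t : 'rV[R]_d => t 0 i)} by exact: coord_continuous.
  exact: (cvgB (cvg_cst r) (cvg_norm (cvgB h (cvg_cst (c 0 i))))).
apply/seteqP; split => x /= h i; first by move=> _; rewrite /= subr_ge0.
by have := h i I; rewrite /= subr_ge0.
Qed.

Lemma le_coord_norm x i : `|x 0 i| <= `|x|.
Proof. by rewrite [leRHS]/Num.Def.normr /= mx_normrE; apply/bigmax_geP; right => /=; exists (0, i). Qed.

Lemma bounded_box A : bounded_set A -> exists2 B, 0 < B & A `<=` box 0 B.
Proof.
move=> [M [Mr hM]]; exists (`|M| + 1) => [|x Ax i]; first by rewrite ltr_wpDl.
rewrite mxE subr0; apply: le_trans (le_coord_norm x i) _; apply: hM => //.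
by rewrite (le_lt_trans (ler_norm M))// ltrDl.
Qed.

Lemma coord_le_enorm x i : `|x 0 i| <= enorm x.
Proof.
rewrite -sqrtr_sqr ler_sqrt ?edot_ge0// /edot (bigD1 i)//= expr2 lerDl.
by apply: sumr_ge0 => j _; rewrite -expr2 sqr_ge0.
Qed.

Lemma enorm_le_sum x : enorm x <= \sum_i `|x 0 i|.
Proof.
have s0 : 0 <= \sum_i `|x 0 i| by apply: sumr_ge0.
rewrite -(ger0_norm s0) -sqrtr_sqr ler_sqrt ?sqr_ge0// expr2 /edot big_distrl/=.
apply: ler_sum => i _; apply: le_trans (ler_norm _) _; rewrite normrM.
by rewrite ler_wpM2l// (bigD1 i)//= lerDl; apply: sumr_ge0.
Qed.

Lemma box_enorm c y r : box c r y -> enorm (y - c) <= d%:R * r.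
Proof.
move=> h; apply: le_trans (enorm_le_sum _) _.
rewrite -[d in d%:R]card_ord mulr_natl -sumr_const; apply: ler_sum => i _.
by rewrite !mxE; exact: h.
Qed.

Lemma diam_ub A B : A `<=` box 0 B -> has_ubound [set enorm (x - y) | x in A & y in A].
Proof.
move=> AB; exists (d%:R * (B + B)) => _ [x Ax [y Ay <-]].
apply: (@box_enorm y x) => i; have := AB _ Ax i; have := AB _ Ay i; rewrite !mxE !subr0 => h1 h2.
by apply: le_trans (ler_normB _ _) _; rewrite lerD.
Qed.

Lemma diam_box A B x : A `<=` box 0 B -> A x -> A `<=` box x (diam A).
Proof.
move=> AB Ax y Ay i; have := coord_le_enorm (y - x) i; rewrite !mxE => /le_trans; apply.
by apply: ub_le_sup; [exact: diam_ub AB|exists y => //; exists x].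
Qed.

Lemma diam_gt0 A B : (0 < d)%N -> open A -> A !=set0 -> A `<=` box 0 B -> 0 < diam A.
Proof.
move=> d0 oA [x Ax] AB; pose i : 'I_d := Ordinal d0.
have : \forall t \near (0 : R)^'+, A (x + t *: evec R i).
  have h : (x + t *: evec R i) @[t --> (0 : R)] --> x + 0 *: evec R i.
    apply: (@continuous_rV R d R (fun t => x + t *: evec R i)) => j t.
    under eq_fun do rewrite !mxE.
    by apply: cvgD; [exact: cvg_cst|apply: cvgMl; exact: cvg_id].
  apply: cvg_within; apply: h.
  by apply: open_nbhs_nbhs; split => //; rewrite scale0r addr0.
move=> /(filterI (nbhs_right_gt 0)) /filter_ex [t [t0 At]].
have /= h := diam_box AB Ax At i; apply: lt_le_trans h; rewrite !mxE ?eqxx /= ?eqxx mulr1.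
by rewrite [_ + t]addrC addrK gtr0_norm.
Qed.

End boxes.

Section hyperplanes.
Variables (R : realType) (d : nat).
Implicit Types (x y n a : 'rV[R]_d) (b c : R) (A : set 'rV[R]_d).

(** Moving along a direction orthogonal to [n] stays in the first hyperplane, hence in the second.
    Applied to the part of [a] orthogonal to [n], this forces that part to vanish; the point [z]
    excludes [a = 0]. *)
Lemma hyperplane_sub_eq n c a b z : enorm n = 1 -> ~ hyperplane a b z ->
  hyperplane n c `<=` hyperplane a b -> hyperplane a b = hyperplane n c.
Proof.
move=> n1 zab sub.
have nn := enorm1_edot n1.
have cn : hyperplane n c (c *: n) by rewrite /hyperplane/= edotZl nn mulr1.
pose v := a - edot a n *: n.
have vn : edot v n = 0 by rewrite edotBl edotZl nn mulr1 subrr.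
have va : edot v a = 0.
  have := sub _ cn; have : hyperplane n c (c *: n + v) by rewrite /hyperplane/= edotDl vn addr0.
  by move=> /sub; rewrite /hyperplane/= edotDl => + e; rewrite e => /eqP; rewrite -subr_eq0 addrC addKr => /eqP.
have v0 : v = 0 by apply: edot_eq0; rewrite {2}/v edotBr edotZr va vn mulr0 subrr.
have aE : a = edot a n *: n by apply/eqP; rewrite -subr_eq0 -/v v0.
have bE : b = edot a n * c by rewrite -(sub _ cn) edotZl [edot n a]edotC mulrC.
have al0 : edot a n != 0.
  apply/eqP => h; apply: zab; rewrite /hyperplane/= bE h mul0r aE h scale0r.
  by rewrite /edot big1// => i _; rewrite mxE mulr0.
by apply/seteqP; split => [x|//]; rewrite /hyperplane/= {1}aE edotZr bE => /(mulfI al0).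
Qed.

Lemma unit_hyperplane_eq n c n' c' : enorm n = 1 -> enorm n' = 1 ->
  hyperplane n c `<=` hyperplane n' c' ->
  exists2 s : R, s = 1 \/ s = -1 & n' = s *: n /\ c' = s * c.
Proof.
move=> n1 n1' sub.
have nn := enorm1_edot n1; have nn' := enorm1_edot n1'.
have [z hz] : exists z, ~ hyperplane n' c' z.
  exists ((c' + 1) *: n'); rewrite /hyperplane/= edotZl nn' mulr1; lra.
have E := hyperplane_sub_eq n1 hz sub.
have cn : hyperplane n c (c *: n) by rewrite /hyperplane/= edotZl nn mulr1.
pose v := n' - edot n' n *: n.
have vn : edot v n = 0 by rewrite edotBl edotZl nn mulr1 subrr.
have va : edot v n' = 0.
  have := sub _ cn; have : hyperplane n c (c *: n + v) by rewrite /hyperplane/= edotDl vn addr0.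
  by move=> /sub; rewrite /hyperplane/= edotDl => + e; rewrite e => /eqP; rewrite -subr_eq0 addrC addKr => /eqP.
have v0 : v = 0 by apply: edot_eq0; rewrite {2}/v edotBr edotZr va vn mulr0 subrr.
have aE : n' = edot n' n *: n by apply/eqP; rewrite -subr_eq0 -/v v0.
exists (edot n' n); last by split => //; rewrite -(sub _ cn) edotZl [edot n n']edotC mulrC.
have : edot n' n ^+ 2 == 1.
  by move: nn'; rewrite {1 2}aE edotZl edotZr nn mulr1 expr2 => ->.
by rewrite sqrf_eq1 => /orP[/eqP|/eqP]; [left|right].
Qed.

(** Turns almost-everywhere information on a face, such as the outward directions, into a point at
    which it can be read. *)
Lemma ae_point n c A (P : 'rV[R]_d -> Prop) : measurable A ->
  (0 < surface n c A)%E -> {ae surface n c, forall x, P x} -> exists2 x, A x & P x.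
Proof.
move=> mA A0 [N [mN N0 hN]]; apply: contrapT => h.
suff : (surface n c A <= 0)%E by rewrite leNgt A0.
rewrite -N0; apply: le_measure; rewrite ?inE// => x Ax; apply: hN => /= Px.
by apply: h; exists x.
Qed.

Lemma ae_not_hyperplane n c a b : enorm n = 1 ->
  ~ (hyperplane n c `<=` hyperplane a b) -> {ae surface n c, forall x, ~ hyperplane a b x}.
Proof.
move=> n1 h; exists (hyperplane a b); split; first exact: measurable_hyperplane.
  apply: surface_hyperplane => //; apply: contrapT => h'; apply: h => y hy.
  by apply: contrapT => h2; apply: h'; exists y.
by move=> y /= hy; apply: contrapT => h'; apply: hy => h2.
Qed.

(** Facet hyperplanes other than the given one meet it in a null set, so at a generic boundary point
    each vanishing barycentric coordinate belongs to a facet in the given hyperplane. Two such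
    coordinates would make two facet hyperplanes coincide, so exactly one vanishes. *)
Lemma ae_simplex_oface (S : 'M[R]_(d.+1, d)) n c : Defs.nondegenerate S -> enorm n = 1 ->
  {ae surface n c, forall y, csimplex S y -> ~ osimplex S y ->
     exists2 j, oface S j y & hyperplane (bary_grad S j) (- bary_cst S j) = hyperplane n c}.
Proof.
move=> nS n1; pose H j := hyperplane (bary_grad S j) (- bary_cst S j).
have inH j y : bary S y 0 j = 0 <-> H j y.
  have e := bary_plane j nS; split => [h|]; first by rewrite /H -e.
  by rewrite /H -e.
have h1 : {ae surface n c, forall y, forall j, ~ (hyperplane n c `<=` H j) -> ~ H j y}.
  apply: filter_forall => j; have [h|h] := pselect (hyperplane n c `<=` H j).
    by apply: nearW => y /(_ h).
  by apply: filterS (ae_not_hyperplane n1 h).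
apply: filterS h1 => y hy; rewrite csimplexE// osimplexE//= => c0 o0.
have [j j0] : exists j, bary S y 0 j = 0.
  apply: contrapT => h; apply: o0 => j; rewrite lt_neqAle c0 andbT eq_sym.
  by apply/eqP => h'; apply: h; exists j.
have sub : hyperplane n c `<=` H j.
  by apply: contrapT => h; apply: (hy j h); apply/inH.
have [i' ij'] : exists i', ~ H j i'.
  apply: contrapT => hn; have : forall x, bary S x 0 j = 0.
    by move=> x; apply/inH; apply: contrapT => hx; apply: hn; exists x.
  by move/(_ (row j S)); rewrite bary_vertex// eqxx => /eqP; rewrite oner_eq0.
have E := hyperplane_sub_eq n1 ij' sub.
exists j => //; rewrite ofaceE//=; split => // i ij; rewrite lt_neqAle c0 andbT eq_sym.
apply/eqP => i0.
have subi : hyperplane n c `<=` H i.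
  by apply: contrapT => h; apply: (hy i h); apply/inH.
have [z zj zi] := bary_planes_neq nS (negbT (introF eqP (fun e : j = i => negP ij (introT eqP (esym e))))).
by apply: zi; apply: subi; rewrite -E.
Qed.

End hyperplanes.

(** * Elements and faces of a regular mesh *)

Section mesh_geometry.
Variables (R : realType) (d : nat) (Om : set 'rV[R]_d) (Th : mesh R d) (varrho : R).
Hypotheses (d_gt0 : (0 < d)%N) (Omp : polytopal_domain Om) (Thm : is_mesh Om Th)
  (reg : mesh_regularity Om Th varrho) (varrho_gt0 : 0 < varrho).
Implicit Types (T : elt Th) (F : face Th) (x y : 'rV[R]_d).
Local Notation lam := (lebesgue_rV R d).

Lemma polytopal_open (P : set 'rV[R]_d) : polytopal P -> open P.
Proof. by move=> [_ [n [S [_ ->]]]]; exact: open_interior. Qed.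

Lemma elt_open T : open (elt_set T).
Proof. by case: Thm => -[h _ _] _ _; exact: polytopal_open. Qed.

Lemma measurable_elt T : measurable (elt_set T).
Proof. exact: (@open_measurable_rV R d (elt_set T) (@elt_open T)). Qed.

Lemma elt_neq0 T : elt_set T !=set0.
Proof. by case: Thm => -[h _ _] _ _; case: (h T). Qed.

Lemma elt_disjoint T T' x : elt_set T x -> elt_set T' x -> T = T'.
Proof.
case: Thm => -[_ h _] _ _ hT hT'; apply: (h T T' I I); by exists x.
Qed.

Lemma bnd_elt T : bnd (elt_set T) = closure (elt_set T) `\` elt_set T.
Proof. by rewrite /bnd; have /interior_id -> := @elt_open T. Qed.

Lemma closure_elt_sub T : closure (elt_set T) `<=` closure Om.
Proof.
case: Thm => -[_ _ h] _ _ x xT; rewrite -h; by exists T.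
Qed.

(** [elements_ok] relates closures only. The domain is the interior of a finite union of closed
    simplices, which contains its closure; an open set inside that union lies in its interior. *)
Lemma elt_sub_domain T : elt_set T `<=` Om.
Proof.
case: Omp => -[_ [n [S [nS OmE]]]] _ _.
have cl : closed (\bigcup_i csimplex (S i)).
  by apply: closed_bigcup => [|i _]; [exact: finite_finset|exact: closed_csimplex].
rewrite OmE; rewrite -open_subsetE; last exact: (@elt_open T).
move=> x /(@subset_closure _ (elt_set T)) /closure_elt_sub; rewrite OmE.
by move=> /(closure_subset (@interior_subset _ _)); rewrite -(closure_id _).1.
Qed.

Lemma domain_box : exists2 B, 0 < B & closure Om `<=` box 0 B.
Proof.
case: Omp => _ /bounded_box[B B0 hB] _; exists B => //.
by have /closure_id -> := @closed_box R d 0 B; exact: closure_subset.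
Qed.

Lemma face_normal1 F : enorm (face_normal F) = 1.
Proof. by case: Thm => _ _ -[]. Qed.

Lemma face_open F : exists2 U, open U & face_set F = face_plane F `&` U.
Proof. by case: Thm => _ -[h _ _ _] _; case: (h F). Qed.

Lemma face_in_plane F : face_set F `<=` face_plane F.
Proof. by case: Thm => _ -[h _ _ _] _; case: (h F). Qed.

Lemma measurable_face F : measurable (face_set F).
Proof.
have [U oU ->] := face_open F; apply: measurableI; first exact: measurable_hyperplane.
exact: open_measurable_rV.
Qed.

Lemma face_measure_gt0 F : (0 < face_measure F (face_set F))%E.
Proof.
have [x Fx] : face_set F !=set0 by case: Thm => _ -[h _ _ _] _; case: (h F).
have [U oU FE] := face_open F; rewrite FE.
by apply: surface_open_gt0 => //; [exact: face_normal1|exists x; rewrite -FE].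
Qed.

Lemma face_ae_point F (P : 'rV[R]_d -> Prop) : {ae face_measure F, forall x, P x} ->
  exists2 x, face_set F x & P x.
Proof. by apply: ae_point; [exact: measurable_face|exact: face_measure_gt0]. Qed.

Lemma face_disjoint F F' x : face_set F x -> face_set F' x -> F = F'.
Proof.
case: Thm => _ -[_ h _ _] _ hT hT'; apply: (h F F' I I); by exists x.
Qed.

Lemma bnd_elt_faces T :
  bnd (elt_set T) = \bigcup_(F in [set F : face Th | face_of T F]) closure (face_set F).
Proof. by case: Thm => _ -[_ _ _ ->] _. Qed.

Lemma closed_hyperplane (n : 'rV[R]_d) c : closed (hyperplane n c).
Proof.
rewrite (_ : hyperplane n c = (fun x : 'rV[R]_d => edot x n) @^-1` [set c]); last by [].
by apply: preimage_closed; [move=> x _; exact: continuous_edot|exact: closed_eq].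
Qed.

Lemma closure_face_plane F : closure (face_set F) `<=` face_plane F.
Proof.
rewrite /face_plane; have /closure_id -> := @closed_hyperplane (face_normal F) (face_offset F).
by apply: closure_subset; exact: face_in_plane.
Qed.

Lemma outward_face T F : face_of T F ->
  {ae face_measure F, forall x, face_set F x -> \forall t \near 0^'+,
     ~ elt_set T (x + t *: (orient T F *: face_normal F)) /\
     elt_set T (x - t *: (orient T F *: face_normal F))}.
Proof. by case: Thm => _ _ -[_ _ h] /h[]. Qed.

Lemma orient1 T F : face_of T F -> orient T F = 1 \/ orient T F = -1.
Proof. by case: Thm => _ _ -[_ _ h] /h[]. Qed.

(** With equal orientations, a point just behind a generic point of the face would belong to both
    elements. *)
Lemma orient_inj T T' F : face_of T F -> face_of T' F ->
  orient T F = orient T' F -> T = T'.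
Proof.
move=> /outward_face h /outward_face h' e.
have [x Fx [/(_ Fx) g /(_ Fx) g']] := face_ae_point (filterI h h').
have [t [[_ a] [_ a']]] := filter_ex (filterI g g').
by apply: (elt_disjoint a); rewrite e.
Qed.

(** With orientation -1, points of [T] would lie on the side of the face where the outward normal of
    the domain leaves it. *)
Lemma orient_bface T F : bface Om F -> face_of T F -> orient T F = 1.
Proof.
move=> bF TF; have [//|o] := orient1 TF.
have out : outward_on Om (face_normal F) F by case: Thm => _ _ -[_ h _]; exact: h.
have [x Fx [/(_ Fx) g /(_ Fx) g']] := face_ae_point (filterI out (outward_face TF)).
have [t [[a _] [_ a']]] := filter_ex (filterI g g').
exfalso; apply: a; apply: (@elt_sub_domain T); move: a'.
by rewrite o scaleN1r scalerN opprK.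
Qed.

(** By [orient_inj] the orientations of the elements sharing a face are distinct, and there are only
    two values: an interface has exactly two elements, with opposite signs, and its contributions
    cancel. *)
Lemma sum_orient (x : face Th -> R) :
  \sum_(T : elt Th) \sum_(F : face Th | `[< face_of T F >]) orient T F * x F =
  \sum_(F : face Th | `[< bface Om F >]) x F.
Proof.
rewrite (exchange_big_dep xpredT)//= [RHS]big_mkcond/=; apply: eq_bigr => F _.
case: asboolP => [bF|nbF].
  have [_ [T [TF uT]]] := bF.
  rewrite (big_pred1 T) => [|T']; first by rewrite orient_bface// mul1r.
  by apply/asboolP/eqP => [/uT|->].
have [T [T' [TT' TF TF']]] : interface F.
  by case: Thm => _ -[_ _ h _] _; case: (h F).
have o : orient T F + orient T' F = 0.
  have := @orient_inj T T' F TF TF'.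
  by case: (orient1 TF) => ->; case: (orient1 TF') => -> h; rewrite ?subrr ?addNr//;
    case: (TT' (h erefl)).
rewrite (bigD1 T)/=; last exact/asboolP.
rewrite (bigD1 T')/=; last by apply/andP; split; [apply/asboolP|apply/eqP => e; apply: TT'].
rewrite big1 ?addr0; first by rewrite -mulrDl o mul0r.
move=> T2 /andP[/andP[/asboolP TF2 /eqP n1] /eqP n2]; exfalso.
have g1 := @orient_inj T2 T F TF2 TF; have g2 := @orient_inj T2 T' F TF2 TF'.
case: (orient1 TF2) => e2; case: (orient1 TF) => e; case: (orient1 TF') => e';
  (try by apply: n1; apply: g1; rewrite e2); (try by apply: n2; apply: g2; rewrite e2).
- by move: o; rewrite e e' => /eqP; rewrite -?opprD ?oppr_eq0 -mulr2n pnatr_eq0.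
- by move: o; rewrite e e' => /eqP; rewrite -?opprD ?oppr_eq0 -mulr2n pnatr_eq0.
Qed.

Lemma elt_box0 T : exists2 B, 0 < B & elt_set T `<=` box 0 B.
Proof.
have [B B0 hB] := domain_box; exists B => // x xT; apply: hB.
by apply: subset_closure; exact: elt_sub_domain xT.
Qed.

Lemma hT_gt0 T : 0 < hT T.
Proof.
have [B _ hB] := elt_box0 T.
by apply: (diam_gt0 d_gt0 (@elt_open T) (elt_neq0 T) hB).
Qed.

Lemma closure_elt_box T x : elt_set T x -> closure (elt_set T) `<=` box x (hT T).
Proof.
move=> Tx; have [B _ hB] := elt_box0 T.
have /closure_id -> := @closed_box R d x (hT T); apply: closure_subset.
exact: diam_box hB Tx.
Qed.

(** What the closed simplices of [T] leave uncovered in [T] is open. Were it nonempty, it would meet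
    some open simplex of the submesh, which then lies in [T] and was already counted. *)
Lemma elt_cover (I : finType) (S : I -> 'M[R]_(d.+1, d)) T :
  matching_simplicial_submesh Om Th S ->
  closure (elt_set T) `<=` \bigcup_(i in [set i | osimplex (S i) `<=` elt_set T]) csimplex (S i).
Proof.
move=> [nS [disj _] cov sub _].
set CT := \bigcup_(i in _) _.
have clT : closed CT by apply: closed_bigcup => [|i _]; [exact: finite_finset|exact: closed_csimplex].
have /closure_id -> := clT.
apply: closure_subset => x Tx.
apply: contrapT => nx.
have oU : open (elt_set T `&` ~` CT) by apply: openI; [exact: elt_open|exact: closed_openC].
have : closure Om x by apply: (@closure_elt_sub T); exact: subset_closure.
rewrite -cov => -[i _ ix].
have [y iy [Ty nCy]] := csimplex_meets_osimplex (nS i) oU ix (conj Tx nx).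
apply: nCy; exists i => /=.
  have [T' hT'] := sub i; have e := elt_disjoint Ty (hT' _ iy); by rewrite e.
by move: iy; rewrite osimplexE// csimplexE//= => iy j; exact: ltW.
Qed.

Lemma ae_bnd_elt (I : finType) (S : I -> 'M[R]_(d.+1, d)) T n c :
  matching_simplicial_submesh Om Th S -> enorm n = 1 ->
  {ae surface n c, forall y, bnd (elt_set T) y -> exists i j,
     [/\ osimplex (S i) `<=` elt_set T, oface (S i) j y &
         hyperplane (bary_grad (S i) j) (- bary_cst (S i) j) = hyperplane n c]}.
Proof.
move=> sub n1; have [nS _ _ _ _] := sub.
have : {ae surface n c, forall y, forall i, csimplex (S i) y -> ~ osimplex (S i) y ->
     exists2 j, oface (S i) j y & hyperplane (bary_grad (S i) j) (- bary_cst (S i) j) = hyperplane n c}.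
  by apply: filter_forall => i; exact: ae_simplex_oface.
apply: filterS => y hy; rewrite bnd_elt => -[/(elt_cover sub)[i /= iT iy] nTy].
by have [|j j1 j2] := hy i iy; [move=> /iT|exists i, j].
Qed.

Lemma oface_plane (S : 'M[R]_(d.+1, d)) j : Defs.nondegenerate S ->
  oface S j = hyperplane (bary_grad S j) (- bary_cst S j) `&`
              [set x | forall i, predC1 j i -> 0 < bary S x 0 i].
Proof.
move=> nS; rewrite ofaceE// -bary_plane//; apply/seteqP; split => x /=; by case.
Qed.

(** The relative boundary of a face is shown to be null through the submesh. A generic point of the
    hyperplane in [closure (face_set F)] lies in a relatively open facet of a simplex in the same
    hyperplane; that facet meets the face, hence is contained in it. *)
Lemma ae_closure_face F n c : enorm n = 1 -> hyperplane n c = face_plane F ->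
  {ae surface n c, forall y, closure (face_set F) y -> face_set F y}.
Proof.
move=> n1 pl.
have [T TF] : exists T, face_of T F.
  case: Thm => _ -[_ _ h _] _; case: (h F) => [[T [T' []]]|[_ [T []]]]; by exists T.
case: reg => I [S [sub _ _]]; have [nS _ _ _ of_sub] := sub.
apply: filterS (ae_bnd_elt T c sub n1) => y hy yF.
have [i [j [iT ij E]]] : exists i j,
     [/\ osimplex (S i) `<=` elt_set T, oface (S i) j y &
         hyperplane (bary_grad (S i) j) (- bary_cst (S i) j) = hyperplane n c].
  by apply: hy; rewrite bnd_elt_faces; exists F.
have [e|] := of_sub i j F; last exact.
exfalso; move: (ij); rewrite oface_plane// E pl => -[_ yU].
have [z [zF zU]] := yF _ (open_nbhs_nbhs (conj (@open_bary_pos R d (S i) (predC1 j)) yU)).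
have : (oface (S i) j `&` face_set F) z.
  by split => //; rewrite oface_plane// E pl; split => //; exact: face_in_plane.
by rewrite e.
Qed.

(** One factor [varrho] compares a simplex with its element, the other its inradius with its
    diameter. The 2 leaves room below the supremum defining the inradius, and [d.+1] accounts for
    the passage from a Euclidean ball to a box. *)
Definition elt_ratio : R := varrho ^+ 2 / (2 * d.+1%:R).

Lemma elt_ratio_gt0 : 0 < elt_ratio.
Proof. by rewrite divr_gt0 ?exprn_gt0// mulr_gt0. Qed.

Lemma simplex_box (S : 'M[R]_(d.+1, d)) T :
  varrho * diam (osimplex S) <= inradius (osimplex S) ->
  varrho * hT T <= diam (osimplex S) ->
  exists c, box c (elt_ratio * hT T) `<=` osimplex S.
Proof.
move=> h1 h2; have hT0 := hT_gt0 T.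
have h3 : varrho ^+ 2 * hT T <= inradius (osimplex S).
  by apply: le_trans h1; rewrite expr2 -mulrA ler_pM2l.
have h4 : varrho ^+ 2 * hT T / 2 < inradius (osimplex S).
  by apply: lt_le_trans h3; rewrite ltr_pdivrMr// ltr_pMr ?mulr_gt0 ?exprn_gt0// ltr1n.
have [|r [r0 [c hc]] hr] := sup_gt _ h4.
  by exists 0; split => //; exists 0 => y /(le_lt_trans (sqrtr_ge0 _)); rewrite ltxx.
exists c => y yb; apply: hc; apply: le_lt_trans hr; apply: le_trans (box_enorm yb) _.
rewrite /elt_ratio.
have -> : d%:R * (varrho ^+ 2 / (2 * d.+1%:R) * hT T) =
   (d%:R / d.+1%:R) * (varrho ^+ 2 * hT T / 2) :> R.
  by field; rewrite addrC natr1 pnatr_eq0.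
apply: ler_piMl; first by rewrite divr_ge0// mulr_ge0 ?exprn_ge0 ?ltW.
by rewrite ler_pdivrMr// mul1r ler_nat.
Qed.

Lemma elt_box T : exists2 c, elt_set T c & box c (elt_ratio * hT T) `<=` elt_set T.
Proof.
case: reg => I [S [sub h1 h2]]; have [x Tx] := elt_neq0 T.
have [i /= iT _] := elt_cover sub (@subset_closure _ _ _ Tx).
have [c hc] := simplex_box (h1 i) (h2 i T iT).
exists c; last by move=> y /hc /iT.
apply/iT/hc => k; rewrite subrr normr0 mulr_ge0 ?ltW ?elt_ratio_gt0 ?hT_gt0//.
Qed.

(** Comparison of volumes: each simplex of [T] contains a box of half-width [elt_ratio * hT T],
    these boxes are disjoint, and all lie in one box of half-width [hT T]. *)
Lemma card_simplices (I : finType) (S : I -> 'M[R]_(d.+1, d)) T :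
  matching_simplicial_submesh Om Th S ->
  (forall i, varrho * diam (osimplex (S i)) <= inradius (osimplex (S i))) ->
  (forall i T, osimplex (S i) `<=` elt_set T -> varrho * hT T <= diam (osimplex (S i))) ->
  #|[set i | `[< osimplex (S i) `<=` elt_set T >]]%SET|%:R <= elt_ratio ^- d.
Proof.
move=> [_ [disj _] _ _ _] h1 h2; pose A := [set i | `[< osimplex (S i) `<=` elt_set T >]]%SET.
have hT0 := hT_gt0 T; have er0 := elt_ratio_gt0.
have [x Tx] := elt_neq0 T.
have : forall i, exists c, osimplex (S i) `<=` elt_set T -> box c (elt_ratio * hT T) `<=` osimplex (S i).
  move=> i; have [iT|iT] := pselect (osimplex (S i) `<=` elt_set T).
    by have [c hc] := simplex_box (h1 i) (h2 i T iT); exists c.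
  by exists 0.
move=> /choice[c hc].
pose B i : set 'rV[R]_d := if i \in A then box (c i) (elt_ratio * hT T) else set0.
have BS i : B i `<=` osimplex (S i) `&` elt_set T.
  rewrite /B inE; case: asboolP => // iT y yb; have := hc i iT _ yb => yS; split => //; exact: iT.
have dB : trivIset setT B.
  move=> i j _ _ [y [/BS[yi _] /BS[yj _]]]; apply: (disj i j Logic.I Logic.I); by exists y.
have mB i : measurable (B i).
  by rewrite /B; case: ifP => _; [exact: measurable_box|exact: measurable0].
have : (lam (\bigcup_i B i) <= lam (box x (hT T)))%E.
  apply: le_measure; rewrite ?inE; [|exact: measurable_box|].
    by apply: fin_bigcup_measurable => // i _; exact: mB.
  by move=> y [i _ /BS[_ Ty]]; apply: (closure_elt_box Tx); exact: subset_closure.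
rewrite measure_fin_bigcup//; [|exact: finite_finset].
rewrite (@fsbigE _ _ _ _ setT (index_enum I))//; last 2 first.
- exact: index_enum_uniq.
- by move=> i _; rewrite mem_index_enum.
rewrite (eq_bigl xpredT) => [|i]; last by rewrite in_setT.
rewrite (lebesgue_rV_box x (ltW hT0)) => h.
have : (\sum_(i in A) ((2 * (elt_ratio * hT T)) ^+ d)%:E <= ((2 * hT T) ^+ d)%:E)%E.
  apply: le_trans h; rewrite [leRHS](bigID (mem A))/=.
  rewrite [X in (_ <= _ + X)%E]big1 ?adde0; last first.
    by move=> i /negbTE iA; rewrite /B iA measure0.
  apply: lee_sum => i iA; rewrite /B iA lebesgue_rV_box// mulr_ge0 ?ltW//.
rewrite sumEFin lee_fin sumr_const -(mulr_natl _ #|A|).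
have -> : (2 * (elt_ratio * hT T)) ^+ d = elt_ratio ^+ d * (2 * hT T) ^+ d.
  by rewrite -exprMn; congr (_ ^+ _); ring.
rewrite mulrA -[leRHS]mul1r ler_pM2r ?exprn_gt0 ?mulr_gt0//.
by rewrite -ler_pdivlMr ?exprn_gt0// mul1r.
Qed.

(** A generic point of a face lies in a facet of a simplex of [T]. As a facet is contained in every
    face that it meets and faces are disjoint, this injects the faces of [T] into pairs of a simplex
    and one of its [d.+1] facets. *)
Lemma card_faces T :
  #|[set F : face Th | `[< face_of T F >]]%SET|%:R <= d.+1%:R * elt_ratio ^- d.
Proof.
case: reg => I [S [sub h1 h2]]; have [nS _ _ _ of_sub] := sub.
have : forall F, exists ij : I * 'I_d.+1, face_of T F ->
    osimplex (S ij.1) `<=` elt_set T /\ oface (S ij.1) ij.2 `&` face_set F !=set0.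
  move=> F; have [TF|] := pselect (face_of T F); last by have [i _] : exists i : I, True;
    [have [x Tx] := elt_neq0 T; have [i _ _] := elt_cover sub (@subset_closure _ _ _ Tx); exists i|exists (i, ord0)].
  have [y Fy /(_ (TF _ Fy)) [i [j [iT ij _]]]] :=
    face_ae_point (ae_bnd_elt T (face_offset F) sub (face_normal1 F)).
  by exists (i, j) => _; split => //; exists y.
move=> /choice[g hg].
set AF := [set F : face Th | `[< face_of T F >]]%SET; set AI := [set i | `[< osimplex (S i) `<=` elt_set T >]]%SET.
have sub1 : g @: AF \subset finset.setX AI [set: 'I_d.+1]%SET.
  apply/fintype.subsetP => _ /imsetP[F + ->]; rewrite inE => /asboolP TF.
  by rewrite !inE andbT; apply/asboolP; case: (hg F TF).
have gi : {in AF &, injective g}.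
  move=> F F' AFF AFF' e.
  have TF : face_of T F by move: AFF; rewrite inE => /asboolP.
  have TF' : face_of T F' by move: AFF'; rewrite inE => /asboolP.
  have [_ [y [yo Fy]]] := hg F TF; have [_ [y' [yo' Fy']]] := hg F' TF'.
  have [e1|s1] := of_sub (g F).1 (g F).2 F.
    by have : (oface (S (g F).1) (g F).2 `&` face_set F) y by []; rewrite e1.
  by apply: (face_disjoint (s1 y' _) Fy'); rewrite e.
have := subset_leq_card sub1; rewrite card_in_imset// cardsX cardsT card_ord => h.
apply: (@le_trans _ _ ((#|AI| * d.+1)%:R)); first by rewrite ler_nat.
by rewrite natrM mulrC ler_pM2l ?ltr0n//; exact: card_simplices.
Qed.

Lemma face_measure_le T F : face_of T F ->
  (face_measure F (face_set F) <= ((4 * hT T) ^+ d / hT T)%:E)%E.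
Proof.
move=> TF; have [x Tx] := elt_neq0 T.
apply: (@surface_box_le _ _ _ _ x _ _ (face_normal1 F) (hT_gt0 T) (@measurable_face F)).
move=> y Fy; split; first exact: face_in_plane.
by apply: (closure_elt_box Tx); case: (TF _ Fy).
Qed.

End mesh_geometry.

(** * Polynomial inverse inequalities *)

Section poly1.
Variable R : realType.
Implicit Types (p q : {poly R}) (c s x t lambda delta M : R) (k : nat).
Local Notation leb := (@lebesgue_measure R).

Lemma is_derive_horner p x : is_derive x (1 : R) (horner p) (p^`().[x]).
Proof.
elim/poly_ind: p => [|p c IH].
  rewrite deriv0 horner0 (_ : horner 0 = cst 0); first exact: is_derive_cst.
  by apply/funext => y; rewrite horner0.
rewrite (_ : horner (p * 'X + c%:P) = (horner p * id) \+ cst c); last first.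
  by apply/funext => y; rewrite hornerMXaddC.
have h : is_derive x (1 : R) ((horner p * id) \+ cst c) (p.[x] *: 1 + x *: p^`().[x] + 0).
  by apply: is_deriveD.
apply: is_derive_eq h _.
by rewrite derivMXaddC hornerD hornerM hornerX addr0 /GRing.scale/=; ring.
Qed.

(** Each divided difference costs [2 / delta], and the factor [x - t_0] costs [lambda + 1] in units
    of [s]; one more unit accounts for the product rule in the derivative. *)
Fixpoint interp_cst lambda delta k : R :=
  if k is k'.+1 then 1 + (lambda + 2) * (2 / delta) * interp_cst lambda delta k' else 1.

Lemma interp_cst_ge1 lambda delta k : 0 <= lambda -> 0 < delta -> 1 <= interp_cst lambda delta k.
Proof.
move=> l0 d0; elim: k => //= k IH; rewrite lerDl !mulr_ge0 ?addr_ge0//.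
  by rewrite invr_ge0 ltW.
exact: le_trans IH.
Qed.

(* Induction on the degree: p = p(t_0) + (X - t_0) q, and q is controlled at the other nodes by
   the divided differences of p. *)
Lemma interp_bound lambda delta k p c s M (t : nat -> R) x :
  0 <= lambda -> 0 < delta -> 0 < s -> (size p <= k.+1)%N ->
  (forall i, (i <= k)%N -> `|t i - c| <= s) ->
  (forall i j, (i < j <= k)%N -> delta * s <= `|t i - t j|) ->
  (forall i, (i <= k)%N -> `|p.[t i]| <= M) ->
  `|x - c| <= lambda * s ->
  `|p.[x]| <= interp_cst lambda delta k * M /\
  `|p^`().[x]| <= interp_cst lambda delta k * M / s.
Proof.
move=> l0 d0 s0; elim: k => [|k IH] in p M t *.
  move=> /size1_polyC -> _ _ /(_ 0%N isT) M0 _; rewrite !hornerC derivC horner0 normr0 /= mul1r.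
  by move: M0; rewrite hornerC => h; split => //; rewrite divr_ge0 ?(ltW s0)//; exact: le_trans h.
move=> sp tc tsep pM xc.
have M0 : 0 <= M by apply: le_trans (pM 0%N isT).
have : root (p - p.[t 0%N]%:P) (t 0%N) by rewrite rootE !hornerE subrr.
move=> /factor_theorem[q qE].
have pE : p = q * ('X - (t 0%N)%:P) + (p.[t 0%N])%:P by rewrite -qE subrK.
have sq : (size q <= k.+1)%N.
  have [->|q0] := eqVneq q 0; first by rewrite size_poly0.
  have : (size (p - p.[t 0%N]%:P)%R <= k.+2)%N.
    by apply: leq_trans (size_polyD _ _) _; rewrite geq_max sp size_polyN size_polyC; case: eqP.
  by rewrite qE size_Mmonic ?monicXsubC// size_XsubC addn2.
have ds0 : 0 < delta * s by rewrite mulr_gt0.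
have qM i : (i <= k)%N -> `|q.[t i.+1]| <= 2 * M / (delta * s).
  move=> ik; rewrite ler_pdivlMr//.
  have e : p.[t i.+1] - p.[t 0%N] = q.[t i.+1] * (t i.+1 - t 0%N).
    by rewrite [in LHS]pE !hornerE; ring.
  apply: (@le_trans _ _ (`|q.[t i.+1]| * `|t i.+1 - t 0%N|)).
    by apply: ler_wpM2l => //; rewrite distrC; apply: tsep.
  rewrite -normrM -e (le_trans (ler_normB _ _))// mulr2n mulrDl mul1r.
  by apply: lerD; exact: pM.
have [h1 h2] := IH q _ (fun i => t i.+1) sq (fun i ik => tc i.+1 ik)
  (fun i j ij => tsep i.+1 j.+1 ij) qM xc.
have xt : `|x - t 0%N| <= (lambda + 1) * s.
  have -> : x - t 0%N = (x - c) - (t 0%N - c) by ring.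
  by apply: le_trans (ler_normB _ _) _; rewrite mulrDl mul1r; apply: lerD => //; exact: tc.
set K := interp_cst lambda delta k in h1 h2.
have K1 : 1 <= K by exact: interp_cst_ge1.
have K0 : 0 <= K by apply: le_trans K1.
have ls0 : 0 <= (lambda + 1) * s by rewrite mulr_ge0 ?addr_ge0// ltW.
have px : p.[x] = q.[x] * (x - t 0%N) + p.[t 0%N] by rewrite [in LHS]pE !hornerE.
have p'x : p^`().[x] = q^`().[x] * (x - t 0%N) + q.[x].
  have -> : p^`() = q^`() * ('X - (t 0%N)%:P) + q.
    by rewrite [in LHS]pE derivD derivM derivXsubC derivC mulr1 addr0.
  by rewrite !hornerE.
split.
  rewrite px (le_trans (ler_normD _ _))// normrM.
  apply: (@le_trans _ _ (K * (2 * M / (delta * s)) * ((lambda + 1) * s) + M)).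
    by apply: lerD; [exact: ler_pM|exact: pM].
  have -> : K * (2 * M / (delta * s)) * ((lambda + 1) * s) = (lambda + 1) * (2 / delta) * K * M.
    by field; rewrite !gt_eqF.
  rewrite /= -/K [leRHS]mulrDl mul1r addrC lerD2l ler_wpM2r// ler_wpM2r// ler_wpM2r.
  - by [].
  - by rewrite divr_ge0 ?(ltW d0).
  - by rewrite lerD2l ler1n.
rewrite p'x (le_trans (ler_normD _ _))// normrM ler_pdivlMr//.
apply: (@le_trans _ _ ((K * (2 * M / (delta * s)) / s * ((lambda + 1) * s) + K * (2 * M / (delta * s))) * s)).
  by rewrite (ler_wpM2r (ltW s0))//; apply: lerD => //; exact: ler_pM.
have -> : (K * (2 * M / (delta * s)) / s * ((lambda + 1) * s) + K * (2 * M / (delta * s))) * s =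
   (lambda + 2) * (2 / delta) * K * M by field; rewrite !gt_eqF.
by rewrite /= -/K ler_wpM2r// lerDr.
Qed.

Lemma poly_mean_le p a b : a <= b -> exists2 t, a <= t <= b &
  ((p.[t] ^+ 2 * (b - a))%:E <= \int[leb]_(x in `[a, b]) ((p.[x] ^+ 2)%:E))%E.
Proof.
move=> ab; pose f x := p.[x] ^+ 2.
have cf : continuous f.
  move=> x; have h : {for x, continuous (horner p)}.
    by apply: differentiable_continuous; apply/derivable1_diffP; have [] := is_derive_horner p x.
  exact: (cvgM h h).
have [t tab ft] := EVT_min ab (continuous_subspaceT cf).
exists t; first by move: tab; rewrite in_itv.
have -> : ((p.[t] ^+ 2 * (b - a))%:E = \int[leb]_(x in `[a, b]) (p.[t] ^+ 2)%:E)%E.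
  rewrite integral_cst//= [X in (_ * X)%E](lebesgue_measure_itv `[a, b])/= lte_fin.
  move: ab; rewrite le_eqVlt => /orP[/eqP ->|ab']; first by rewrite subrr mulr0 ltxx mule0.
  by rewrite ab' -EFinD -EFinM.
apply: ge0_le_integral => //=.
- by move=> x _; rewrite lee_fin sqr_ge0.
- by apply/measurable_EFinP; apply: measurable_funX; exact: measurable_poly.
Qed.

(** The interval of length [2 * s] is cut into 2k+1 cells of length [node_sep k * s]. Nodes taken
    anywhere in the k+1 cells of even rank are then at least one cell apart. *)
Definition node_sep k : R := 2 / k.*2.+1%:R.
Definition poly_l2_cst lambda k : R := interp_cst lambda (node_sep k) k ^+ 2 / node_sep k.

Lemma node_sep_gt0 k : 0 < node_sep k. Proof. by rewrite divr_gt0. Qed.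

Lemma poly_l2_cst_ge0 lambda k : 0 <= poly_l2_cst lambda k.
Proof. by rewrite divr_ge0 ?sqr_ge0// ltW// node_sep_gt0. Qed.

(** In each cell of even rank the node is a point where [p ^+ 2] is minimal, so that the nodal
    values are controlled by the integral; [interp_bound] then reaches points outside the interval
    as well. *)
Lemma poly_l2 lambda k p c s x : 0 <= lambda -> 0 < s -> (size p <= k.+1)%N ->
  `|x - c| <= lambda * s ->
  ((p.[x] ^+ 2 * s)%:E <=
    (poly_l2_cst lambda k)%:E * \int[leb]_(t in `[(c - s)%R, (c + s)%R]) ((p.[t] ^+ 2)%:E))%E.
Proof.
move=> l0 s0 sp xc; set I := (X in (_ * X)%E).
have d0 := node_sep_gt0 k; set delta := node_sep k in d0 *.
pose a i := c - s + i.*2%:R * (delta * s).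
have ab i : a i <= a i + delta * s by rewrite lerDl ltW// mulr_gt0.
have /choice[t ht] : forall i, exists t, a i <= t <= a i + delta * s /\
  ((p.[t] ^+ 2 * (delta * s))%:E <= \int[leb]_(x in `[a i, (a i + delta * s)%R]) ((p.[x] ^+ 2)%:E))%E.
  by move=> i; have [t h1 h2] := poly_mean_le p (ab i); exists t; split => //; move: h2; rewrite addrAC subrr add0r.
have dE : k.*2.+1%:R * delta = 2 by rewrite /delta /node_sep mulrCA divff ?mulr1// pnatr_eq0.
have ai i : (i <= k)%N -> a i + delta * s <= c + s.
  move=> ik; rewrite /a.
  have : i.*2.+1%:R * delta <= 2 by rewrite -[leRHS]dE (ler_pM2r d0) ler_nat ltnS leq_double.
  move=> /(ler_wpM2r (ltW s0)); rewrite -natr1 mulrDl mul1r mulrDl -mulrA => h; lra.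
have ca i : c - s <= a i by rewrite /a lerDl !mulr_ge0// ltW.
have I0 : (0 <= I)%E by apply: integral_ge0 => y _; rewrite lee_fin sqr_ge0.
have K0 : 0 < interp_cst lambda delta k by apply: lt_le_trans (interp_cst_ge1 k l0 d0).
case: (boolP (I \is a fin_num)) => [If|]; last first.
  rewrite ge0_fin_numE// -leNgt leye_eq => /eqP ->.
  by rewrite gt0_muley ?leey// lte_fin /poly_l2_cst divr_gt0 ?exprn_gt0.
have [r r0 rE] : exists2 r, 0 <= r & I = r%:E.
  by exists (fine I); [exact: fine_ge0|rewrite fineK].
rewrite rE -EFinM lee_fin.
have pt i : (i <= k)%N -> `|p.[t i]| <= Num.sqrt (r / (delta * s)).
  move=> ik; rewrite -sqrtr_sqr ler_sqrt ?divr_ge0 ?mulr_ge0 ?(ltW d0) ?(ltW s0)//.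
  rewrite ler_pdivlMr ?mulr_gt0// -lee_fin -rE; apply: le_trans (ht i).2 _.
  apply: ge0_subset_integral => //.
  - by apply/measurable_EFinP; apply: measurable_funX; exact: measurable_poly.
  - by move=> y _; rewrite lee_fin sqr_ge0.
  - move=> y /=; rewrite !in_itv/= => /andP[y1 y2]; apply/andP; split.
      exact: le_trans (ca i) y1.
    exact: le_trans y2 (ai _ ik).
have [||h _] := @interp_bound lambda delta k p c s _ t x l0 d0 s0 sp _ _ pt xc.
- move=> i ik; have /andP[t1 t2] := (ht i).1; rewrite ler_norml.
  have := ca i; have := ai i ik => h1 h2; apply/andP; split; lra.
- move=> i j /andP[ij jk]; have /andP[_ t2] := (ht i).1; have /andP[t1 _] := (ht j).1.
  rewrite distrC; apply: le_trans (ler_norm _).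
  have : i.+1.*2%:R * (delta * s) <= j.*2%:R * (delta * s).
    by rewrite ler_pM2r ?mulr_gt0// ler_nat leq_double.
  rewrite doubleS -natr1 -natr1 !mulrDl !mul1r.
  by move: t1 t2; rewrite /a => t1 t2 h; lra.
have : p.[x] ^+ 2 <= interp_cst lambda delta k ^+ 2 * (r / (delta * s)).
  rewrite -[p.[x] ^+ 2]real_normK ?num_real// -[r / _]sqr_sqrtr ?divr_ge0 ?mulr_ge0 ?(ltW d0) ?(ltW s0)//.
  by rewrite -exprMn lerXn2r ?nnegrE// mulr_ge0 ?sqrtr_ge0 ?ltW.
move=> /(ler_wpM2r (ltW s0)) h'; apply: (le_trans h').
rewrite /poly_l2_cst -/delta le_eqVlt; apply/orP; left; apply/eqP.
by field; rewrite !gt_eqF.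
Qed.

Lemma poly_deriv_bound k p c s M x lambda : 0 <= lambda -> 0 < s -> (size p <= k.+1)%N ->
  `|x - c| <= lambda * s ->
  (forall t, `|t - c| <= s -> `|p.[t]| <= M) ->
  `|p^`().[x]| <= interp_cst lambda (node_sep k) k * M / s.
Proof.
move=> l0 s0 sp xc pM; have d0 := node_sep_gt0 k.
have dE : k.*2.+1%:R * node_sep k = 2 :> R by rewrite /node_sep mulrCA divff ?mulr1// pnatr_eq0.
pose t i := c - s + i.*2%:R * (node_sep k * s).
have tc i : (i <= k)%N -> `|t i - c| <= s.
  move=> ik; rewrite /t ler_norml.
  have h0 : 0 <= i.*2%:R * (node_sep k * s) by rewrite !mulr_ge0// ltW.
  have : i.*2%:R * node_sep k <= 2 by rewrite -[leRHS]dE (ler_pM2r d0) ler_nat leqW// leq_double.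
  move=> /(ler_wpM2r (ltW s0)); rewrite -mulrA => h; apply/andP; split; lra.
apply: (@interp_bound lambda (node_sep k) k p c s M t x l0 d0 s0 sp tc _ _ xc).2.
- move=> i j /andP[ij jk]; rewrite distrC; apply: le_trans (ler_norm _).
  have : i.+1.*2%:R * (node_sep k * s) <= j.*2%:R * (node_sep k * s).
    by rewrite ler_pM2r ?mulr_gt0// ler_nat leq_double.
  have := mulr_gt0 d0 s0; rewrite doubleS -natr1 -natr1 !mulrDl !mul1r /t => ? ?; lra.
- by move=> i ik; apply: pM; exact: tc.
Qed.

End poly1.

Section polyn.
Variable R : realType.
Local Notation leb := (@lebesgue_measure R).

Definition upd n (x : 'rV[R]_n) (i : 'I_n) (t : R) : 'rV[R]_n :=
  \row_j if j == i then t else x 0 j.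

(** Degree at most [k] in each variable separately: weaker than a bound on the total degree, but
    stable under fixing variables, which is what the induction on the dimension needs. *)
Definition sep_poly n (k : nat) (g : 'rV[R]_n -> R) :=
  forall i x, exists2 p : {poly R}, (size p <= k.+1)%N & forall t, g (upd x i t) = p.[t].

Lemma upd_id n (x : 'rV[R]_n) i : upd x i (x 0 i) = x.
Proof. by apply/rowP => j; rewrite mxE; case: eqVneq => [->|]. Qed.

Lemma measurable_line_slice n (I : set (measurableTypeR R)) (f : 'rV[R]_n.+1 -> \bar R) :
  measurable I -> measurable_fun [set: 'rV[R]_n.+1] f -> (forall y, 0 <= f y)%E ->
  measurable_fun [set: 'rV[R]_n] (fun z => \int[leb]_(t in I) f (rV_cons (z, t)))%E.
Proof.
move=> mI mf f0.
pose F : 'rV[R]_n * measurableTypeR R -> \bar R := (f \o @rV_cons R n) \_ (setT `*` I).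
have mX : measurable (setT `*` I : set ('rV[R]_n * measurableTypeR R)) by exact: measurableX.
have mF : measurable_fun setT F.
  apply/(measurable_restrictT _ mX); apply: measurable_funTS.
  by apply: measurableT_comp => //; exact: measurable_rV_cons.
have F0 p : (0 <= F p)%E by rewrite /F patchE; case: ifP => // _; exact: f0.
have := measurable_fun_fubini_tonelli_F (m2 := leb) _ mF F0.
apply: eq_measurable_fun => z _; rewrite [RHS]integral_mkcond.
by apply: eq_integral => t _; rewrite /F !patchE/= in_setX in_setT.
Qed.

(** Induction on the dimension: the induction hypothesis bounds the value at [x] by an integral over
    the slice through [x], and [poly_l2] in the first variable bounds the integrand on the slice by
    integrals across it. *)
Lemma sep_poly_l2 n k lambda (g : 'rV[R]_n -> R) c s x :
  0 <= lambda -> 0 < s -> sep_poly k g -> measurable_fun [set: 'rV[R]_n] g ->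
  box c (lambda * s) x ->
  ((g x ^+ 2 * s ^+ n)%:E <=
     (poly_l2_cst lambda k ^+ n)%:E * \int[lebesgue_rV R n]_(y in box c s) (g y ^+ 2)%:E)%E.
Proof.
move=> l0 s0; elim: n => [|n IH] in g c x *.
  move=> _ mg _; rewrite !expr0 mulr1 mul1e.
  rewrite (_ : box c s = [set: 'rV[R]_0]); last by apply/seteqP; split => // y _ [].
  rewrite (integral_dirac (0 : 'rV[R]_0) (D := setT))//; last first.
    by apply/measurable_EFinP; exact: measurable_funX.
  by rewrite diracE in_setT mul1e lee_fin (_ : x = 0)//; exact: thinmx0.
move=> gp mg xb.
have mg2 : measurable_fun [set: 'rV[R]_n.+1] (fun y => (g y ^+ 2)%:E).
  by apply/measurable_EFinP; exact: measurable_funX.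
have mb := @measurable_box R n.+1 c s; have mb' := @measurable_box R n (\row_i c 0 (lift ord0 i)) s.
set c' : 'rV[R]_n := \row_i _ in mb'.
pose I : set R := `[c 0 ord0 - s, c 0 ord0 + s]%classic.
have mI : measurable (I : set (measurableTypeR R)) by exact: measurable_itv.
have boxE z t : box c s (rV_cons (z, t)) <-> box c' s z /\ I t.
  split=> [h|[h1 h2] i].
    split => [i|]; first by have := h (lift ord0 i); rewrite rV_consE mxE.
    have := h ord0; rewrite rV_consE /I/= in_itv/= ler_norml => /andP[h1 h2].
    by apply/andP; split; lra.
  case: (unliftP ord0 i) => [j ->|->]; rewrite rV_consE; first by have := h1 j; rewrite mxE.
  by move: h2; rewrite /I/= in_itv/= ler_norml => /andP[h2 h3]; apply/andP; split; lra.
have E : (\int[lebesgue_rV R n.+1]_(y in box c s) (g y ^+ 2)%:E =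
    \int[lebesgue_rV R n]_(z in box c' s) \int[leb]_(t in I) (g (rV_cons (z, t)) ^+ 2)%:E)%E.
  rewrite integral_mkcond integral_rV_cons; last 2 first.
  - by apply/(measurable_restrictT _ mb); exact: measurable_funTS.
  - by move=> y; rewrite patchE; case: ifP => // _; rewrite lee_fin sqr_ge0.
  rewrite [RHS]integral_mkcond; apply: eq_integral => z _.
  rewrite patchE; case: ifPn => [|zb].
    rewrite inE => zb; rewrite [RHS]integral_mkcond; apply: eq_integral => t _.
    rewrite !patchE; congr (if _ then _ else _); apply/idP/idP; rewrite !inE.
      by move/boxE => [].
    by move=> It; apply/boxE.
  apply: integral0_eq => t _; rewrite patchE ifF//; apply/negbTE/negP; rewrite inE => /boxE[zb' _].
  by move/negP: zb; apply; rewrite inE.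
rewrite E.
have xE : x = rV_cons (\row_i x 0 (lift ord0 i), x 0 ord0).
  by apply/rowP => i; case: (unliftP ord0 i) => [j ->|->]; rewrite rV_consE ?mxE.
set z0 : 'rV[R]_n := \row_i _ in xE; set t0 := x 0 ord0 in xE.
have z0b : box c' (lambda * s) z0 by move=> i; rewrite !mxE; exact: xb.
have mgz t : measurable_fun [set: 'rV[R]_n] (fun z => g (rV_cons (z, t))).
  have h : measurable_fun [set: 'rV[R]_n * measurableTypeR R] (g \o @rV_cons R n).
    by apply: measurableT_comp => //; exact: measurable_rV_cons.
  exact: (measurableT_comp h (measurable_pair2 t)).
have gz t : sep_poly k (fun z => g (rV_cons (z, t))).
  move=> i z; have [p sp hp] := gp (lift ord0 i) (rV_cons (z, t)); exists p => // t'; rewrite -hp.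
  congr g; apply/rowP => j; case: (unliftP ord0 j) => [j' ->|->]; rewrite rV_consE !mxE ?rV_consE //.
    by rewrite (inj_eq lift_inj) liftK; case: eqP.
  by rewrite (negbTE (neq_lift _ _)) unlift_none.
have := IH _ _ _ (gz t0) (mgz t0) z0b; rewrite -xE => h.
have C0 := poly_l2_cst_ge0 lambda k.
have mF : measurable_fun [set: 'rV[R]_n] (fun z => \int[leb]_(t in I) (g (rV_cons (z, t)) ^+ 2)%:E)%E.
  by apply: (measurable_line_slice (f := fun y => (g y ^+ 2)%:E) mI mg2) => y; rewrite lee_fin sqr_ge0.
have s0' : (0 <= s%:E)%E by rewrite lee_fin ltW.
rewrite (exprSr s n) mulrA EFinM; apply: le_trans (lee_wpmul2r s0' h) _.
rewrite (exprSr _ n) EFinM -!muleA [X in (_ * X <= _)%E]muleC.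
apply: lee_wpmul2l; first by rewrite lee_fin exprn_ge0.
rewrite -!ge0_integralZl//; last first.
- by move=> z _; rewrite lee_fin sqr_ge0.
- by apply: measurable_funTS; apply/measurable_EFinP; apply: measurable_funX.
- by move=> z _; apply: integral_ge0 => t _; rewrite lee_fin sqr_ge0.
- exact: measurable_funTS.
apply: ge0_le_integral => //.
- by move=> z _; rewrite mule_ge0// lee_fin sqr_ge0.
- by apply: measurable_funTS; apply/measurable_EFinP; apply: measurable_funM => //; apply: measurable_funX.
- by apply: measurable_funTS; exact: measurable_funeM.
move=> z _.
have [p sp hp] := gp ord0 (rV_cons (z, t0)).
have hp' t : g (rV_cons (z, t)) = p.[t].
  rewrite -hp; congr g; apply/rowP => j.
  by case: (unliftP ord0 j) => [j' ->|->]; rewrite rV_consE /upd mxE//= rV_consE.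
rewrite -EFinM mulrC hp'; under eq_integral do rewrite hp'.
by apply: poly_l2 => //; exact: xb.
Qed.

Lemma is_derive_upd n (g : 'rV[R]_n -> R) i x (p : {poly R}) :
  (forall t, g (upd x i t) = p.[t]) -> is_derive x (evec R i) g (p^`().[x 0 i]).
Proof.
move=> hp; have D := is_derive_horner p (x 0 i).
have e : (fun h : R => h^-1 *: ((g \o shift x) (h *: evec R i) - g x)) =
         (fun h : R => h^-1 *: ((horner p \o shift (x 0 i)) (h *: (1 : R)) - p.[x 0 i])).
  apply/funext => h; congr (_ *: (_ - _)); last by rewrite -hp upd_id.
  rewrite /= -hp; congr g; apply/rowP => j; rewrite !mxE /= /GRing.scale/= mulr1.
  by case: eqVneq => [->|]; rewrite /= ?mulr1 ?mulr0 ?add0r.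
case: D => D1 D2; apply: DeriveDef.
  by rewrite /derivable e.
by rewrite /derive e.
Qed.

(** The derivative at [x] is that of a one-variable polynomial along a coordinate line, whose values
    near the centre are bounded by [sep_poly_l2]; differentiating costs one power of [s], squared
    here. *)
Lemma sep_poly_derive_l2 n k lambda (g : 'rV[R]_n -> R) c s x i dg :
  1 <= lambda -> 0 < s -> sep_poly k g -> measurable_fun [set: 'rV[R]_n] g ->
  box c (lambda * s) x -> is_derive x (evec R i) g dg ->
  ((dg ^+ 2 * s ^+ n.+2)%:E <=
     (interp_cst lambda (node_sep R k) k ^+ 2 * poly_l2_cst lambda k ^+ n)%:E *
      \int[lebesgue_rV R n]_(y in box c s) (g y ^+ 2)%:E)%E.
Proof.
move=> l1 s0 gp mg xb Dg.
have l0 : 0 <= lambda by apply: le_trans l1.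
have [p sp hp] := gp i x; have Dp := is_derive_upd hp.
have -> : dg = p^`().[x 0 i] by rewrite -(@derive_val _ _ _ _ _ _ _ Dg) (@derive_val _ _ _ _ _ _ _ Dp).
set J := (X in (_ * X)%E).
set C1 := poly_l2_cst lambda k; set C2 := interp_cst _ _ _.
have C21 : 1 <= C2 by apply: interp_cst_ge1 => //; exact: node_sep_gt0.
have C20 : 0 < C2 by apply: lt_le_trans C21.
have C10 : 0 <= C1 by exact: poly_l2_cst_ge0.
have C1p : 0 < C1 by rewrite /C1 /poly_l2_cst divr_gt0 ?exprn_gt0 ?node_sep_gt0.
have J0 : (0 <= J)%E by apply: integral_ge0 => y _; rewrite lee_fin sqr_ge0.
case: (boolP (J \is a fin_num)) => [Jf|]; last first.
  rewrite ge0_fin_numE// -leNgt leye_eq => /eqP ->.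
  by rewrite gt0_muley ?leey// lte_fin mulr_gt0 ?exprn_gt0.
have [r r0 rE] : exists2 r, 0 <= r & J = r%:E.
  by exists (fine J); [exact: fine_ge0|rewrite fineK].
pose M := Num.sqrt (C1 ^+ n * r / s ^+ n).
have M20 : 0 <= C1 ^+ n * r / s ^+ n by rewrite divr_ge0 ?mulr_ge0 ?exprn_ge0 ?(ltW s0).
have := @poly_deriv_bound R k p (c 0 i) s M (x 0 i) lambda l0 s0 sp (xb i).
have h t : `|t - c 0 i| <= s -> `|p.[t]| <= M.
  move=> tc; rewrite -hp -sqrtr_sqr ler_sqrt// ler_pdivlMr ?exprn_gt0//.
  (* As [lambda >= 1], replacing one coordinate of [x] by a value within [s] of the centre stays in
     the dilated box. *)
  have ub : box c (lambda * s) (upd x i t).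
    move=> j; rewrite mxE; case: eqVneq => [->|_]; last exact: xb.
    by apply: le_trans tc _; rewrite ler_peMl// ltW.
  by have := sep_poly_l2 l0 s0 gp mg ub; rewrite -/J rE -EFinM lee_fin.
move=> /(_ h) {}h; rewrite rE -EFinM lee_fin -/C2 in h *.
have h2 : p^`().[x 0 i] ^+ 2 <= (C2 * M / s) ^+ 2.
  by rewrite -[_.[_] ^+ 2]real_normK ?num_real// lerXn2r ?nnegrE// divr_ge0 ?mulr_ge0 ?sqrtr_ge0 ?(ltW s0) ?(ltW C20).
apply: le_trans (ler_wpM2r (exprn_ge0 n.+2 (ltW s0)) h2) _.
rewrite 2!(@exprMn _ 2) sqr_sqrtr// exprVn le_eqVlt; apply/orP; left; apply/eqP.
have sn : s ^+ n != 0 by rewrite expf_neq0// gt_eqF.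
rewrite -[n.+2]/(2 + n)%N exprD.
by move: (C1 ^+ n) (s ^+ n) sn => a b sn; field; rewrite sn gt_eqF.
Qed.

End polyn.

(** * Square-integrable fields *)

Section complex_entries.
Variable R : realType.
Local Notation C := R[i].
Local Notation Re := (@complex.Re R).
Local Notation Im := (@complex.Im R).
Implicit Types (z w : C).

Lemma ReD z w : Re (z + w) = Re z + Re w. Proof. by case: z; case: w. Qed.
Lemma ImD z w : Im (z + w) = Im z + Im w. Proof. by case: z; case: w. Qed.
Lemma ReN z : Re (- z) = - Re z. Proof. by case: z. Qed.
Lemma ImN z : Im (- z) = - Im z. Proof. by case: z. Qed.
Lemma ReM z w : Re (z * w) = Re z * Re w - Im z * Im w. Proof. by case: z; case: w. Qed.
Lemma ImM z w : Im (z * w) = Re z * Im w + Im z * Re w.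
Proof. by case: z => a b; case: w => c e. Qed.
Lemma ReJ z : Re (conjc z) = Re z. Proof. by case: z. Qed.
Lemma ImJ z : Im (conjc z) = - Im z. Proof. by case: z. Qed.
Lemma ReZ (a : R) z : Re (a%:C%C * z) = a * Re z. Proof. by rewrite ReM/= mul0r subr0. Qed.
Lemma ImZ (a : R) z : Im (a%:C%C * z) = a * Im z. Proof. by rewrite ImM/= mul0r addr0. Qed.
Lemma Re_sum (I : Type) (r : seq I) (P : pred I) (F : I -> C) :
  Re (\sum_(i <- r | P i) F i) = \sum_(i <- r | P i) Re (F i).
Proof. by apply: big_morph => //; exact: ReD. Qed.
Lemma Im_sum (I : Type) (r : seq I) (P : pred I) (F : I -> C) :
  Im (\sum_(i <- r | P i) F i) = \sum_(i <- r | P i) Im (F i).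
Proof. by apply: big_morph => //; exact: ImD. Qed.
Lemma complex_inj z w : Re z = Re w -> Im z = Im w -> z = w.
Proof. by case: z => a b; case: w => c e /= -> ->. Qed.

Lemma discriminant_le (a b c : R) : 0 <= a -> 0 <= c ->
  (forall t, 0 <= a + 2 * b * t + c * t ^+ 2) -> b ^+ 2 <= a * c.
Proof.
move=> a0 c0 h; have [c00|cn] := eqVneq c 0.
  have [->|b0] := eqVneq b 0; first by rewrite expr0n /= mulr_ge0.
  (* When [c] is zero the expression is affine in [t]; this [t] would give it the value -1. *)
  have := h (- (a + 1) / (2 * b)); rewrite c00 mul0r addr0.
  have -> : 2 * b * (- (a + 1) / (2 * b)) = - (a + 1) by field.
  lra.
have cp : 0 < c by rewrite lt_neqAle eq_sym cn.
have := h (- b / c).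
have -> : a + 2 * b * (- b / c) + c * (- b / c) ^+ 2 = a - b ^+ 2 / c by field; lra.
by rewrite subr_ge0 ler_pdivrMr.
Qed.

End complex_entries.

Section rdot.
Variables (R : realType) (p q : nat).
Local Notation C := R[i].
Local Notation Re := (@complex.Re R).
Local Notation Im := (@complex.Im R).
Implicit Types (f g h : 'M[C]_(p, q)).

(** The real scalar product underlying the Hermitian one. It is symmetric and bilinear over the
    reals, so Cauchy-Schwarz reduces to a real discriminant. *)
Definition rdot f g : R := Re (cdot f g).

Lemma cdotE f g : cdot f g = \sum_i \sum_j conjc (g i j) * f i j.
Proof.
rewrite /cdot /mxtrace exchange_big/=; apply: eq_bigr => j _; rewrite mxE.
by apply: eq_bigr => i _; rewrite !mxE.
Qed.

Lemma rdotE f g :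
  rdot f g = \sum_i \sum_j (Re (f i j) * Re (g i j) + Im (f i j) * Im (g i j)).
Proof.
rewrite /rdot cdotE Re_sum; apply: eq_bigr => i _; rewrite Re_sum; apply: eq_bigr => j _.
by rewrite ReM ReJ ImJ; ring.
Qed.

Lemma rdotC f g : rdot f g = rdot g f.
Proof. by rewrite !rdotE; apply: eq_bigr => i _; apply: eq_bigr => j _; ring. Qed.

Lemma rdotDl f g h : rdot (f + g) h = rdot f h + rdot g h.
Proof.
rewrite !rdotE -big_split; apply: eq_bigr => i _; rewrite -big_split; apply: eq_bigr => j _.
by rewrite !mxE ReD ImD /=; ring.
Qed.

Lemma rdotZl (a : R) f g : rdot (a%:C%C *: f) g = a * rdot f g.
Proof.
rewrite !rdotE big_distrr; apply: eq_bigr => i _ /=; rewrite big_distrr; apply: eq_bigr => j _ /=.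
by rewrite !mxE ReZ ImZ; ring.
Qed.

Lemma rdotDr f g h : rdot h (f + g) = rdot h f + rdot h g.
Proof. by rewrite ![rdot h _]rdotC rdotDl. Qed.

Lemma rdotZr (a : R) f g : rdot g (a%:C%C *: f) = a * rdot g f.
Proof. by rewrite ![rdot g _]rdotC rdotZl. Qed.

Lemma rdotNl f g : rdot (- f) g = - rdot f g.
Proof.
rewrite !rdotE -sumrN; apply: eq_bigr => i _; rewrite -sumrN; apply: eq_bigr => j _.
by rewrite !mxE ReN ImN; ring.
Qed.

Lemma rdotNr f g : rdot g (- f) = - rdot g f.
Proof. by rewrite ![rdot g _]rdotC rdotNl. Qed.

Lemma rdotBl f g h : rdot (f - g) h = rdot f h - rdot g h.
Proof. by rewrite rdotDl rdotNl. Qed.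

Lemma rdot0l g : rdot 0 g = 0.
Proof. by rewrite -(subrr (0 : 'M[C]_(p, q))) rdotBl subrr. Qed.

Lemma rdot_ge0 f : 0 <= rdot f f.
Proof.
rewrite rdotE; apply: sumr_ge0 => i _; apply: sumr_ge0 => j _.
by rewrite -!expr2 addr_ge0 ?sqr_ge0.
Qed.

Lemma cnorm_sqr f : cnorm f ^+ 2 = rdot f f.
Proof. by rewrite sqr_sqrtr ?rdot_ge0. Qed.

Lemma cnorm_ge0 f : 0 <= cnorm f. Proof. exact: sqrtr_ge0. Qed.

Lemma cnorm0 : cnorm (0 : 'M[C]_(p, q)) = 0.
Proof. by rewrite /cnorm -/(rdot _ _) rdot0l sqrtr0. Qed.

Lemma entry_le_cnorm f i j : Re (f i j) ^+ 2 + Im (f i j) ^+ 2 <= cnorm f ^+ 2.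
Proof.
rewrite cnorm_sqr rdotE (bigD1 i)//= (bigD1 j)//= -!expr2 -addrA lerDl addr_ge0//.
  by apply: sumr_ge0 => j' _; rewrite -!expr2 addr_ge0 ?sqr_ge0.
by apply: sumr_ge0 => i' _; apply: sumr_ge0 => j' _; rewrite -!expr2 addr_ge0 ?sqr_ge0.
Qed.

Lemma Re_le_cnorm f i j : `|Re (f i j)| <= cnorm f.
Proof.
rewrite -(ler_pXn2r (n := 2))// ?nnegrE ?cnorm_ge0// real_normK ?num_real//.
by apply: le_trans (entry_le_cnorm f i j); rewrite lerDl sqr_ge0.
Qed.

Lemma Im_le_cnorm f i j : `|Im (f i j)| <= cnorm f.
Proof.
rewrite -(ler_pXn2r (n := 2))// ?nnegrE ?cnorm_ge0// real_normK ?num_real//.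
by apply: le_trans (entry_le_cnorm f i j); rewrite lerDr sqr_ge0.
Qed.

Lemma cnorm_eq0 f : cnorm f = 0 -> f = 0.
Proof.
move=> f0; apply/matrixP => i j; rewrite mxE; apply: complex_inj; apply/eqP.
  by rewrite -normr_le0 -f0 Re_le_cnorm.
by rewrite -normr_le0 -f0 Im_le_cnorm.
Qed.

Lemma rdot_cs f g : `|rdot f g| <= cnorm f * cnorm g.
Proof.
rewrite -(ler_pXn2r (n := 2))// ?nnegrE ?mulr_ge0 ?cnorm_ge0// real_normK ?num_real//.
rewrite exprMn !cnorm_sqr; apply: discriminant_le => [||t]; try exact: rdot_ge0.
have := rdot_ge0 (f + t%:C%C *: g); rewrite rdotDl !rdotDr !rdotZl !rdotZr (rdotC g f).
move: (rdot f f) (rdot f g) (rdot g g) => a b c.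
by have -> : a + t * b + (t * b + t * (t * c)) = a + 2 * b * t + c * t ^+ 2 by ring.
Qed.

Lemma cnormD f g : cnorm (f + g) <= cnorm f + cnorm g.
Proof.
rewrite -(ler_pXn2r (n := 2))// ?nnegrE ?addr_ge0 ?cnorm_ge0//.
rewrite cnorm_sqr rdotDl !rdotDr (rdotC g f) sqrrD !cnorm_sqr.
have := rdot_cs f g; rewrite ler_norml => /andP[_ h].
rewrite mulr2n; move: h; move: (rdot f f) (rdot f g) (rdot g g) (cnorm f * cnorm g) => a b c e h.
lra.
Qed.

Lemma cnormZ (a : R) f : cnorm (a%:C%C *: f) = `|a| * cnorm f.
Proof.
rewrite /cnorm -/(rdot _ _) -/(rdot f f) rdotZl rdotZr mulrA -expr2.
by rewrite sqrtrM ?sqr_ge0// sqrtr_sqr.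
Qed.

Lemma cnormN f : cnorm (- f) = cnorm f.
Proof. by rewrite /cnorm -!/(rdot _ _) rdotNl rdotNr opprK. Qed.

Lemma cnorm_le_entries f : cnorm f <= \sum_i \sum_j (`|Re (f i j)| + `|Im (f i j)|).
Proof.
have s0 : 0 <= \sum_i \sum_j (`|Re (f i j)| + `|Im (f i j)|).
  by apply: sumr_ge0 => i _; apply: sumr_ge0 => j _; rewrite addr_ge0.
have le1 i j : `|Re (f i j)| + `|Im (f i j)| <= \sum_i \sum_j (`|Re (f i j)| + `|Im (f i j)|).
  rewrite [leRHS](bigD1 i)//= [X in _ <= X + _](bigD1 j)//= -addrA lerDl addr_ge0//.
    by apply: sumr_ge0 => *; rewrite addr_ge0.
  by apply: sumr_ge0 => *; apply: sumr_ge0 => *; rewrite addr_ge0.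
rewrite -(ler_pXn2r (n := 2))// ?nnegrE ?cnorm_ge0// cnorm_sqr rdotE expr2 [leRHS]big_distrl/=.
apply: ler_sum => i _; rewrite [leRHS]big_distrl/=; apply: ler_sum => j _.
apply: le_trans (ler_wpM2l _ (le1 i j)); last by rewrite addr_ge0.
rewrite -!expr2 -[Re _ ^+ 2]real_normK ?num_real// -[Im _ ^+ 2]real_normK ?num_real//.
by have := mulr_ge0 (normr_ge0 (Re (f i j))) (normr_ge0 (Im (f i j))); rewrite sqrrD mulr2n => ?; lra.
Qed.

End rdot.

Section opnorm.
Variables (R : realType) (p q : nat).
Local Notation C := R[i].
Local Notation Re := (@complex.Re R).
Local Notation Im := (@complex.Im R).
Implicit Types (B : 'M[C]_(p, q)) (xi : 'cV[C]_q).

(** A crude bound of the operator norm. It shows that the supremum in [opnorm] is taken over a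
    bounded set. *)
Definition entry_sum B : R := \sum_i \sum_j 2 * (`|Re (B i j)| + `|Im (B i j)|).

Lemma cnorm_mulmx_entries B xi : cnorm (B *m xi) <= entry_sum B * cnorm xi.
Proof.
apply: le_trans (cnorm_le_entries _) _; rewrite /entry_sum big_distrl/=.
apply: ler_sum => i _; rewrite big_ord1 big_distrl/=.
apply: (@le_trans _ _ (\sum_j (`|Re (B i j * xi j 0)| + `|Im (B i j * xi j 0)|))).
  by rewrite mxE Re_sum Im_sum big_split/=; apply: lerD; exact: ler_norm_sum.
apply: ler_sum => j _; rewrite ReM ImM.
have r := Re_le_cnorm xi j 0; have m := Im_le_cnorm xi j 0.
apply: (@le_trans _ _ (`|Re (B i j)| * `|Re (xi j 0)| + `|Im (B i j)| * `|Im (xi j 0)| +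
  (`|Re (B i j)| * `|Im (xi j 0)| + `|Im (B i j)| * `|Re (xi j 0)|))).
  by apply: lerD; [apply: le_trans (ler_normB _ _) _|apply: le_trans (ler_normD _ _) _];
    rewrite !normrM.
have := ler_wpM2l (normr_ge0 (Re (B i j))) r; have := ler_wpM2l (normr_ge0 (Re (B i j))) m.
have := ler_wpM2l (normr_ge0 (Im (B i j))) r; have := ler_wpM2l (normr_ge0 (Im (B i j))) m.
lra.
Qed.

Lemma entry_sum_ge0 B : 0 <= entry_sum B.
Proof. by apply: sumr_ge0 => *; apply: sumr_ge0 => *; rewrite mulr_ge0// addr_ge0. Qed.

Lemma cnorm_mulmx B xi : cnorm (B *m xi) <= opnorm B * cnorm xi.
Proof.
have [x0|x0] := eqVneq (cnorm xi) 0; first by rewrite (cnorm_eq0 x0) mulmx0 !cnorm0 mulr0.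
have xp : 0 < cnorm xi by rewrite lt_neqAle eq_sym x0 cnorm_ge0.
pose eta := ((cnorm xi)^-1)%:C%C *: xi.
have e1 : cnorm eta = 1 by rewrite cnormZ gtr0_norm ?invr_gt0// mulVf.
have -> : B *m xi = (cnorm xi)%:C%C *: (B *m eta).
  by rewrite /eta -scalemxAr scalerA -rmorphM/= divff// scale1r.
rewrite cnormZ gtr0_norm// mulrC ler_pM2r//.
apply: ub_le_sup; last by exists eta => //=; rewrite e1.
exists (entry_sum B) => _ [z /= z1 <-]; apply: le_trans (cnorm_mulmx_entries B z) _.
by rewrite ler_piMr// entry_sum_ge0.
Qed.

Lemma opnorm_ub B (M : R) : 0 <= M -> (forall xi, cnorm (B *m xi) <= M * cnorm xi) ->
  opnorm B <= M.
Proof.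
move=> M0 h; apply: sup_le_ub.
  by exists (cnorm (B *m (0 : 'cV[C]_q))); exists 0 => //=; rewrite cnorm0.
by move=> _ [z /= z1 <-]; apply: le_trans (h z) _; rewrite ler_piMr.
Qed.

Lemma opnorm_ge0 B : 0 <= opnorm B.
Proof.
apply: (@le_trans _ _ (cnorm (B *m (0 : 'cV[C]_q)))); first exact: cnorm_ge0.
apply: ub_le_sup; last by exists 0 => //=; rewrite cnorm0.
exists (entry_sum B) => _ [z /= z1 <-]; apply: le_trans (cnorm_mulmx_entries B z) _.
by rewrite ler_piMr// entry_sum_ge0.
Qed.

Lemma entry_le_bound B (M : R) i j : (forall xi, cnorm (B *m xi) <= M * cnorm xi) ->
  `|Re (B i j)| <= M /\ `|Im (B i j)| <= M.
Proof.
move=> h; pose e : 'cV[C]_q := delta_mx j 0.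
have e1 : cnorm e = 1.
  rewrite /cnorm -/(rdot _ _) rdotE (bigD1 j)//= big_ord1 !mxE !eqxx/= !mulr1 mulr0 addr0.
  rewrite big1 ?addr0 ?sqrtr1// => k kj; rewrite big_ord1 !mxE (negbTE kj)/=.
  by rewrite !mulr0 addr0.
have E : B i j = (B *m e) i 0 by rewrite -colE mxE.
by have := h e; rewrite e1 mulr1 E => hM; split; apply: le_trans hM;
  [exact: Re_le_cnorm|exact: Im_le_cnorm].
Qed.

Lemma entry_le_opnorm B i j : `|Re (B i j)| <= opnorm B /\ `|Im (B i j)| <= opnorm B.
Proof. by apply: entry_le_bound => xi; exact: cnorm_mulmx. Qed.

End opnorm.

Section Rintegral_ae.
Context d (T : measurableType d) (R : realType) (mu : {measure set T -> \bar R}).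

Lemma Rintegral_ge0_ae (D : set T) (f : T -> R) : measurable D ->
  mu.-integrable D (EFin \o f) -> {ae mu, forall x, D x -> 0 <= f x} ->
  0 <= (\int[mu]_(x in D) f x)%R.
Proof.
move=> mD fi f0; rewrite /Rintegral.
rewrite (ae_eq_integral (fun x => `|f x|%:E))//.
- by apply: fine_ge0; apply: integral_ge0 => x _; rewrite lee_fin.
- by have /integrableP[] := fi.
- by have /integrableP[/measurable_EFinP mf _] := fi; apply/measurable_EFinP; exact: measurableT_comp.
- by apply: filterS f0 => x /= h Dx; rewrite ger0_norm// h.
Qed.

Lemma le_Rintegral_ae (D : set T) (f g : T -> R) : measurable D ->
  mu.-integrable D (EFin \o f) -> mu.-integrable D (EFin \o g) ->
  {ae mu, forall x, D x -> f x <= g x} ->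
  (\int[mu]_(x in D) f x <= \int[mu]_(x in D) g x)%R.
Proof.
move=> mD fi gi fg; rewrite -subr_ge0 -RintegralB//; apply: Rintegral_ge0_ae => //.
  exact: (integrableB mD gi fi).
by apply: filterS fg => x h Dx; rewrite subr_ge0 h.
Qed.

End Rintegral_ae.

Section L2.
Variables (R : realType) (d : nat).
Local Notation C := R[i].
Local Notation Re := (@complex.Re R).
Local Notation Im := (@complex.Im R).
Local Notation rV := 'rV[R]_d.
Variables (mu : {measure set rV -> \bar R}) (D : set rV).
Hypothesis mD : measurable D.

Definition rip p q (f g : rV -> 'M[C]_(p, q)) : R := (\int[mu]_(x in D) rdot (f x) (g x))%R.

Lemma Re_ip p q (f g : rV -> 'M[C]_(p, q)) : Re (ip mu D f g) = rip f g.
Proof. by []. Qed.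

Lemma eq_rip p q (f g f' g' : rV -> 'M[C]_(p, q)) :
  (forall x, D x -> f x = f' x) -> (forall x, D x -> g x = g' x) -> rip f g = rip f' g'.
Proof.
move=> hf hg; apply: eq_Rintegral => x; rewrite inE => Dx; by rewrite hf// hg.
Qed.

Lemma measurable_rdot p q (f g : rV -> 'M[C]_(p, q)) :
  measurable_field D f -> measurable_field D g ->
  measurable_fun D (fun x => rdot (f x) (g x)).
Proof.
move=> mf mg; under eq_fun do rewrite rdotE.
apply: measurable_sum => i; apply: measurable_sum => j.
have [mf1 mf2] := mf i j; have [mg1 mg2] := mg i j.
by apply: measurable_funD; apply: measurable_funM.
Qed.

Lemma measurable_fieldD p q (f g : rV -> 'M[C]_(p, q)) :
  measurable_field D f -> measurable_field D g -> measurable_field D (fun x => f x + g x).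
Proof.
move=> mf mg i j; have [mf1 mf2] := mf i j; have [mg1 mg2] := mg i j.
split; [under eq_fun do rewrite mxE ReD|under eq_fun do rewrite mxE ImD]; exact: measurable_funD.
Qed.

Lemma measurable_fieldZ p q (a : C) (f : rV -> 'M[C]_(p, q)) :
  measurable_field D f -> measurable_field D (fun x => a *: f x).
Proof.
move=> mf i j; have [mf1 mf2] := mf i j.
split; [under eq_fun do rewrite mxE ReM|under eq_fun do rewrite mxE ImM].
  by apply: measurable_funB; apply: measurable_funM.
by apply: measurable_funD; apply: measurable_funM.
Qed.

Lemma measurable_fieldM p q r (f : rV -> 'M[C]_(p, q)) (g : rV -> 'M[C]_(q, r)) :
  measurable_field D f -> measurable_field D g -> measurable_field D (fun x => f x *m g x).
Proof.
move=> mf mg i j; split.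
  under eq_fun do rewrite mxE Re_sum; apply: measurable_sum => k; under eq_fun do rewrite ReM.
  have [mf1 mf2] := mf i k; have [mg1 mg2] := mg k j.
  by apply: measurable_funB; apply: measurable_funM.
under eq_fun do rewrite mxE Im_sum; apply: measurable_sum => k; under eq_fun do rewrite ImM.
have [mf1 mf2] := mf i k; have [mg1 mg2] := mg k j.
by apply: measurable_funD; apply: measurable_funM.
Qed.

Lemma measurable_cnorm p q (f : rV -> 'M[C]_(p, q)) :
  measurable_field D f -> measurable_fun D (fun x => cnorm (f x) ^+ 2).
Proof.
by move=> mf; under eq_fun do rewrite cnorm_sqr; exact: measurable_rdot.
Qed.

Lemma integrable_cnorm2 p q (f : rV -> 'M[C]_(p, q)) : inL2 mu D f ->
  mu.-integrable D (EFin \o (fun x => cnorm (f x) ^+ 2)).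
Proof.
move=> [mf f2]; apply/integrableP; split; first by apply/measurable_EFinP; exact: measurable_cnorm.
apply: le_lt_trans f2; apply: ge0_le_integral => //.
- by apply/measurable_EFinP; apply: measurableT_comp => //; exact: measurable_cnorm.
- by apply/measurable_EFinP; exact: measurable_cnorm.
- by move=> x _; rewrite /= ger0_norm// sqr_ge0.
Qed.

Lemma integrable_rdot p q (f g : rV -> 'M[C]_(p, q)) : inL2 mu D f -> inL2 mu D g ->
  mu.-integrable D (EFin \o (fun x => rdot (f x) (g x))).
Proof.
move=> hf hg.
have h := integrableD mD (integrable_cnorm2 hf) (integrable_cnorm2 hg).
apply: le_integrable h => //; first by apply/measurable_EFinP; apply: measurable_rdot; [case: hf|case: hg].
move=> x _ /=; rewrite lee_fin; apply: le_trans (rdot_cs _ _) _; apply: le_trans (ler_norm _).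
have := sqr_ge0 (cnorm (f x) - cnorm (g x)); rewrite sqrrB => h1.
have := mulr_ge0 (cnorm_ge0 (f x)) (cnorm_ge0 (g x)) => h2; lra.
Qed.

Lemma inL2_le p q p' q' (M : R) (f : rV -> 'M[C]_(p, q)) (g : rV -> 'M[C]_(p', q')) :
  measurable_field D g -> inL2 mu D f ->
  {ae mu, forall x, D x -> cnorm (g x) <= M * cnorm (f x)} -> inL2 mu D g.
Proof.
move=> mg hf gf; split => //.
have h := integrableZl mD (M ^+ 2) (integrable_cnorm2 hf).
have /integrableP[mh hoo] := h.
apply: le_lt_trans hoo; apply: ae_ge0_le_integral => //.
- by move=> x _; rewrite lee_fin sqr_ge0.
- by apply/measurable_EFinP; exact: measurable_cnorm.
- exact: measurableT_comp.
- apply: filterS gf => x h1 Dx; rewrite /= lee_fin; apply: le_trans (ler_norm _).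
  rewrite -exprMn ler_pXn2r// ?nnegrE ?cnorm_ge0//; first exact: h1.
  by apply: le_trans (h1 Dx); exact: cnorm_ge0.
Qed.

Lemma inL2D p q (f g : rV -> 'M[C]_(p, q)) : inL2 mu D f -> inL2 mu D g ->
  inL2 mu D (fun x => f x + g x).
Proof.
move=> hf hg; have mfg : measurable_field D (fun x => f x + g x).
  by apply: measurable_fieldD; [case: hf|case: hg].
split => //.
have h := integrableZl mD 2 (integrableD mD (integrable_cnorm2 hf) (integrable_cnorm2 hg)).
have /integrableP[mh hoo] := h.
apply: le_lt_trans hoo; apply: ge0_le_integral => //.
- by move=> x _; rewrite lee_fin sqr_ge0.
- by apply/measurable_EFinP; exact: measurable_cnorm.
- exact: measurableT_comp.
- move=> x Dx; rewrite /= lee_fin; apply: le_trans (ler_norm _).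
  have h1 := cnormD (f x) (g x).
  apply: (@le_trans _ _ ((cnorm (f x) + cnorm (g x)) ^+ 2)).
    by rewrite ler_pXn2r// ?nnegrE ?addr_ge0 ?cnorm_ge0.
  have := sqr_ge0 (cnorm (f x) - cnorm (g x)); rewrite sqrrB sqrrD => h2; lra.
Qed.

Lemma inL2Z p q (a : C) (f : rV -> 'M[C]_(p, q)) : inL2 mu D f -> inL2 mu D (fun x => a *: f x).
Proof.
move=> hf; apply: (@inL2_le _ _ _ _ (`|Re a| + `|Im a|) f) => //.
  by apply: measurable_fieldZ; case: hf.
apply: aeW => x _.
have E : a *: f x = (Re a)%:C%C *: f x + (Im a)%:C%C *: ('i%C *: f x).
  by rewrite scalerA -scalerDl; congr (_ *: _); rewrite {1}(complexE a) mulrC [_ * 'i%C]mulrC.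
have iE : cnorm ('i%C *: f x) = cnorm (f x).
  rewrite /cnorm -!/(rdot _ _) !rdotE; congr Num.sqrt; apply: eq_bigr => i _; apply: eq_bigr => j _.
  by rewrite mxE ReM ImM /=; ring.
by rewrite E; apply: le_trans (cnormD _ _) _; rewrite !cnormZ iE mulrDl.
Qed.

Lemma inL2N p q (f : rV -> 'M[C]_(p, q)) : inL2 mu D f -> inL2 mu D (fun x => - f x).
Proof. by move=> hf; under eq_fun do rewrite -scaleN1r; exact: inL2Z. Qed.

Lemma inL2B p q (f g : rV -> 'M[C]_(p, q)) : inL2 mu D f -> inL2 mu D g ->
  inL2 mu D (fun x => f x - g x).
Proof. move=> hf hg; exact: (inL2D hf (inL2N hg)). Qed.

Lemma inL2_0 p q : inL2 mu D (fun _ => 0 : 'M[C]_(p, q)).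
Proof.
split; first by move=> a b; split; under eq_fun do rewrite mxE; exact: measurable_cst.
by under eq_integral do rewrite cnorm0 expr0n/=; rewrite integral0 ltry.
Qed.

Lemma inL2_sum p q (I : Type) (s : seq I) (f : I -> rV -> 'M[C]_(p, q)) :
  (forall i, inL2 mu D (f i)) -> inL2 mu D (fun x => \sum_(i <- s) f i x).
Proof.
move=> hf; elim: s => [|i s IH].
  by under eq_fun do rewrite big_nil; exact: inL2_0.
by under eq_fun do rewrite big_cons; apply: inL2D.
Qed.

Lemma bounded_inL2 p q (M : R) (f : rV -> 'M[C]_(p, q)) : (mu D < +oo)%E -> measurable_field D f ->
  (forall x, D x -> cnorm (f x) <= M) -> inL2 mu D f.
Proof.
move=> Doo mf fM; split => //.
apply: (@le_lt_trans _ _ (\int[mu]_(x in D) (M ^+ 2)%:E)%E).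
  apply: ge0_le_integral => //.
  - by move=> x _; rewrite lee_fin sqr_ge0.
  - by apply/measurable_EFinP; exact: measurable_cnorm.
  - move=> x Dx; rewrite lee_fin ler_pXn2r// ?nnegrE ?cnorm_ge0//; first exact: fM.
    by apply: le_trans (fM _ Dx); exact: cnorm_ge0.
rewrite (integral_cst mu mD); apply: lte_mul_pinfty => //; by rewrite lee_fin sqr_ge0.
Qed.

Lemma ripC p q (f g : rV -> 'M[C]_(p, q)) : rip f g = rip g f.
Proof. by rewrite /rip; under eq_Rintegral do rewrite rdotC. Qed.

Lemma ripDl p q (f g h : rV -> 'M[C]_(p, q)) : inL2 mu D f -> inL2 mu D g -> inL2 mu D h ->
  rip (fun x => f x + g x) h = rip f h + rip g h.
Proof.
move=> hf hg hh; rewrite /rip -RintegralD//; try exact: integrable_rdot.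
by apply: eq_Rintegral => x _; rewrite rdotDl.
Qed.

Lemma ripZl p q (a : R) (f g : rV -> 'M[C]_(p, q)) : inL2 mu D f -> inL2 mu D g ->
  rip (fun x => a%:C%C *: f x) g = a * rip f g.
Proof.
move=> hf hg; rewrite /rip -RintegralZl//; last exact: integrable_rdot.
by apply: eq_Rintegral => x _; rewrite rdotZl.
Qed.

Lemma ripNl p q (f g : rV -> 'M[C]_(p, q)) : inL2 mu D f -> inL2 mu D g ->
  rip (fun x => - f x) g = - rip f g.
Proof.
move=> hf hg; transitivity (rip (fun x => (-1)%:C%C *: f x) g).
  by congr (rip _ g); apply/funext => x; rewrite rmorphN rmorph1 scaleN1r.
by rewrite (ripZl _ hf hg) mulN1r.
Qed.

Lemma ripDr p q (f g h : rV -> 'M[C]_(p, q)) : inL2 mu D f -> inL2 mu D g -> inL2 mu D h ->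
  rip h (fun x => f x + g x) = rip h f + rip h g.
Proof. by move=> hf hg hh; rewrite ripC (ripDl hf hg hh) ![rip h _]ripC. Qed.

Lemma ripZr p q (a : R) (f g : rV -> 'M[C]_(p, q)) : inL2 mu D f -> inL2 mu D g ->
  rip g (fun x => a%:C%C *: f x) = a * rip g f.
Proof. by move=> hf hg; rewrite ripC (ripZl a hf hg) ripC. Qed.

Lemma ripNr p q (f g : rV -> 'M[C]_(p, q)) : inL2 mu D f -> inL2 mu D g ->
  rip g (fun x => - f x) = - rip g f.
Proof. by move=> hf hg; rewrite ripC (ripNl hf hg) ripC. Qed.

Lemma ripBl p q (f g h : rV -> 'M[C]_(p, q)) : inL2 mu D f -> inL2 mu D g -> inL2 mu D h ->
  rip (fun x => f x - g x) h = rip f h - rip g h.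
Proof. by move=> hf hg hh; rewrite (ripDl hf (inL2N hg) hh) (ripNl hg hh). Qed.

Lemma ripBr p q (f g h : rV -> 'M[C]_(p, q)) : inL2 mu D f -> inL2 mu D g -> inL2 mu D h ->
  rip h (fun x => f x - g x) = rip h f - rip h g.
Proof. by move=> hf hg hh; rewrite ripC (ripBl hf hg hh) ![rip h _]ripC. Qed.

Lemma rip0l p q (g : rV -> 'M[C]_(p, q)) : rip (fun=> 0) g = 0.
Proof. by rewrite /rip; under eq_Rintegral do rewrite rdot0l; rewrite /Rintegral integral0. Qed.

Lemma rip0r p q (g : rV -> 'M[C]_(p, q)) : rip g (fun=> 0) = 0.
Proof. by rewrite ripC rip0l. Qed.

Lemma rip_suml p q (I : Type) (s : seq I) (f : I -> rV -> 'M[C]_(p, q)) g :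
  (forall i, inL2 mu D (f i)) -> inL2 mu D g ->
  rip (fun x => \sum_(i <- s) f i x) g = \sum_(i <- s) rip (f i) g.
Proof.
move=> hf hg; elim: s => [|i s IH].
  by under [X in rip X _]eq_fun do rewrite big_nil; rewrite big_nil rip0l.
under [X in rip X _]eq_fun do rewrite big_cons.
by rewrite (ripDl (hf i) (inL2_sum s hf) hg) IH big_cons.
Qed.

Lemma rip_ge0 p q (f : rV -> 'M[C]_(p, q)) : 0 <= rip f f.
Proof. by apply: Rintegral_ge0 => x _; exact: rdot_ge0. Qed.

Lemma L2norm_sqr p q (f : rV -> 'M[C]_(p, q)) : L2norm mu D f ^+ 2 = rip f f.
Proof.
rewrite sqr_sqrtr; first by apply: eq_Rintegral => x _; rewrite cnorm_sqr.
by apply: Rintegral_ge0 => x _; exact: sqr_ge0.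
Qed.

Lemma L2norm_ge0 p q (f : rV -> 'M[C]_(p, q)) : 0 <= L2norm mu D f.
Proof. exact: sqrtr_ge0. Qed.

Lemma eq_L2norm p q (f f' : rV -> 'M[C]_(p, q)) :
  (forall x, D x -> f x = f' x) -> L2norm mu D f = L2norm mu D f'.
Proof.
by move=> ff'; congr Num.sqrt; apply: eq_Rintegral => x; rewrite inE => Dx; rewrite ff'.
Qed.

(* Bf and Bg stand for B * f and B * g, with a symmetric field B. *)
Lemma rip_psd_cs p q (Bf Bg f g : rV -> 'M[C]_(p, q)) :
  inL2 mu D f -> inL2 mu D g -> inL2 mu D Bf -> inL2 mu D Bg ->
  rip Bf g = rip Bg f ->
  (forall t : R, 0 <= rip (fun x => Bf x + t%:C%C *: Bg x) (fun x => f x + t%:C%C *: g x)) ->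
  0 <= rip Bf f -> 0 <= rip Bg g ->
  `|rip Bf g| <= Num.sqrt (rip Bf f) * Num.sqrt (rip Bg g).
Proof.
move=> hf hg hBf hBg sym pos f0 g0.
rewrite -sqrtrM// -sqrtr_sqr ler_sqrt ?mulr_ge0//.
apply: discriminant_le => // t; have := pos t.
have hfg := inL2D hf (inL2Z t%:C%C hg).
rewrite (ripDl hBf (inL2Z t%:C%C hBg) hfg) (ripDr hf (inL2Z t%:C%C hg) hBf).
rewrite (ripZl _ hBg hfg) (ripDr hf (inL2Z t%:C%C hg) hBg) (ripZr _ hg hBf) (ripZr _ hg hBg).
rewrite -sym; move: (rip Bf f) (rip Bf g) (rip Bg g) => a b c.
by have -> : a + t * b + t * (b + t * c) = a + 2 * b * t + c * t ^+ 2 by ring.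
Qed.

Lemma rip_cs p q (f g : rV -> 'M[C]_(p, q)) : inL2 mu D f -> inL2 mu D g ->
  `|rip f g| <= L2norm mu D f * L2norm mu D g.
Proof.
move=> hf hg.
have := @rip_psd_cs _ _ f g f g hf hg hf hg (ripC _ _) (fun t => rip_ge0 _) (rip_ge0 _) (rip_ge0 _).
by rewrite -(L2norm_sqr f) -(L2norm_sqr g) 2!sqrtr_sqr (ger0_norm (L2norm_ge0 f)) (ger0_norm (L2norm_ge0 g)).
Qed.

Lemma L2normD p q (f g : rV -> 'M[C]_(p, q)) : inL2 mu D f -> inL2 mu D g ->
  L2norm mu D (fun x => f x + g x) <= L2norm mu D f + L2norm mu D g.
Proof.
move=> hf hg; rewrite -(ler_pXn2r (n := 2))// ?nnegrE ?addr_ge0 ?L2norm_ge0//.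
rewrite L2norm_sqr (ripDl hf hg (inL2D hf hg)) (ripDr hf hg hf) (ripDr hf hg hg).
have := rip_cs hf hg; rewrite ler_norml => /andP[_ h].
rewrite sqrrD (L2norm_sqr f) (L2norm_sqr g) (ripC g f) mulr2n.
move: h; move: (rip f f) (rip f g) (rip g g) (L2norm mu D f * L2norm mu D g) => a b c e; lra.
Qed.

Lemma L2normZ p q (a : R) (f : rV -> 'M[C]_(p, q)) : inL2 mu D f ->
  L2norm mu D (fun x => a%:C%C *: f x) = `|a| * L2norm mu D f.
Proof.
move=> hf; apply/eqP; rewrite -(eqrXn2 (n := 2))// ?mulr_ge0 ?L2norm_ge0//.
rewrite exprMn !L2norm_sqr (ripZl _ hf (inL2Z _ hf)) (ripZr _ hf hf) real_normK ?num_real//.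
by rewrite mulrA -expr2.
Qed.

Lemma L2norm0 p q : L2norm mu D (fun=> 0 : 'M[C]_(p, q)) = 0.
Proof. by apply/eqP; rewrite -sqrf_eq0 L2norm_sqr rip0l. Qed.

Lemma L2norm_sum p q (I : Type) (s : seq I) (f : I -> rV -> 'M[C]_(p, q)) :
  (forall i, inL2 mu D (f i)) ->
  L2norm mu D (fun x => \sum_(i <- s) f i x) <= \sum_(i <- s) L2norm mu D (f i).
Proof.
move=> hf; elim: s => [|i s IH].
  by under [X in L2norm _ _ X]eq_fun do rewrite big_nil; rewrite big_nil L2norm0.
under [X in L2norm _ _ X]eq_fun do rewrite big_cons.
apply: le_trans (L2normD (hf i) (inL2_sum s hf)) _.
by rewrite big_cons lerD2l.
Qed.

Lemma L2norm_le_ae p q p' q' (M : R) (f : rV -> 'M[C]_(p, q)) (g : rV -> 'M[C]_(p', q')) :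
  0 <= M -> measurable_field D g -> inL2 mu D f ->
  {ae mu, forall x, D x -> cnorm (g x) <= M * cnorm (f x)} -> L2norm mu D g <= M * L2norm mu D f.
Proof.
move=> M0 mg hf gf; have hg := inL2_le mg hf gf.
rewrite -(ler_pXn2r (n := 2))// ?nnegrE ?mulr_ge0 ?L2norm_ge0// exprMn !L2norm_sqr.
rewrite -RintegralZl//; last exact: integrable_rdot.
apply: le_Rintegral_ae => //; first exact: integrable_rdot.
  rewrite (_ : EFin \o _ = (cst (M ^+ 2)%:E \* (EFin \o fun x => rdot (f x) (f x)))%E); last by apply/funext.
  by apply: integrableZl => //; exact: integrable_rdot.
apply: filterS gf => x h Dx; rewrite -!cnorm_sqr -exprMn ler_pXn2r ?nnegrE ?cnorm_ge0 ?mulr_ge0 ?cnorm_ge0//.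
exact: h.
Qed.

Lemma L2norm_le_sup p q (M : R) (f : rV -> 'M[C]_(p, q)) : inL2 mu D f -> (mu D < +oo)%E ->
  (forall x, D x -> cnorm (f x) ^+ 2 <= M) -> L2norm mu D f ^+ 2 <= M * fine (mu D).
Proof.
move=> hf Doo fM; rewrite L2norm_sqr.
have -> : M * fine (mu D) = (\int[mu]_(x in D) M)%R by rewrite Rintegral_cst.
apply: le_Rintegral_ae => //; first exact: integrable_rdot.
- apply/integrableP; split; first by apply/measurable_EFinP; exact: measurable_cst.
  by rewrite (_ : (fun x => _) = cst `|M|%:E)// (integral_cst mu mD); apply: lte_mul_pinfty.
- by apply: aeW => x Dx; rewrite -cnorm_sqr; exact: fM.
Qed.

End L2.

Section mulbound.
Variables (R : realType) (d : nat).
Local Notation C := R[i].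
Local Notation rV := 'rV[R]_d.
Implicit Types (mu : {measure set rV -> \bar R}) (D : set rV).

(** An upper bound for the essential supremum that can be added, scaled and restricted pointwise;
    [Linf_mulbound] and [mulbound_Linf] translate from and to [Linf_norm]. *)
Definition mulbound mu D p q (B : rV -> 'M[C]_(p, q)) (M : R) :=
  [/\ measurable_field D B, 0 <= M &
      {ae mu, forall x, D x -> forall xi : 'cV[C]_q, cnorm (B x *m xi) <= M * cnorm xi}].

Lemma Linf_enorm_ge0 mu D p q (f : rV -> 'M[C]_(p, q)) : (0 <= Linf_enorm mu D f)%E.
Proof.
rewrite /Linf_enorm unlock; case: ifPn => // m0; by apply: ess_sup_gee => //; apply: aeW => x; exact: abse_ge0.
Qed.

Lemma Linf_mulbound mu D p q (f : rV -> 'M[C]_(p, q)) : inLinf mu D f ->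
  mulbound mu D f (Linf_norm mu D f).
Proof.
move=> [mf foo]; have f0 := Linf_enorm_ge0 mu D f.
split => //; first exact: fine_ge0.
have : {ae mu, forall x, (`|(opnorm (f x) * \1_D x)%:E| <= Linf_enorm mu D f)%E}.
  rewrite /Linf_enorm unlock; case: ifPn => [m0|]; first exact: ess_sup_ge.
  rewrite -leNgt => m0; exists setT; split => //.
  by apply/eqP; rewrite eq_le m0 measure_ge0.
apply: filterS => x h Dx xi.
apply: le_trans (cnorm_mulmx _ _) _; apply: ler_wpM2r; first exact: cnorm_ge0.
rewrite -lee_fin /Linf_norm fineK ?ge0_fin_numE//; apply: le_trans h.
by rewrite indicE mem_set// mulr1 lee_fin ler_norm.
Qed.

Lemma mulbound_Linf mu D p q (f : rV -> 'M[C]_(p, q)) M : mulbound mu D f M ->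
  inLinf mu D f /\ Linf_norm mu D f <= M.
Proof.
move=> [mf M0 fM].
have h : (Linf_enorm mu D f <= M%:E)%E.
  rewrite /Linf_enorm unlock; case: ifPn => [m0|_]; last by rewrite lee_fin.
  apply/ess_supP; apply: filterS fM => x h /=; rewrite lee_fin indicE.
  have [xD|xD] := boolP (x \in D); last by rewrite mulr0 normr0.
  rewrite mulr1 ger0_norm ?opnorm_ge0//; apply: opnorm_ub => // xi; apply: h.
  by rewrite inE in xD.
split; first by split => //; apply: le_lt_trans h _; rewrite ltry.
rewrite -lee_fin /Linf_norm fineK// ge0_fin_numE ?Linf_enorm_ge0//.
by apply: le_lt_trans h _; rewrite ltry.
Qed.

Lemma mulboundS mu D D' p q (f : rV -> 'M[C]_(p, q)) M : measurable D -> D' `<=` D ->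
  mulbound mu D f M -> mulbound mu D' f M.
Proof.
move=> mD sub [mf M0 fM]; split => //.
  by move=> a b; have [m1 m2] := mf a b; split; apply: measurable_funS sub _.
by apply: filterS fM => x h /sub.
Qed.

Lemma mulboundD mu D p q (f g : rV -> 'M[C]_(p, q)) M N :
  mulbound mu D f M -> mulbound mu D g N -> mulbound mu D (fun x => f x + g x) (M + N).
Proof.
move=> [mf M0 fM] [mg N0 gN]; split; [exact: measurable_fieldD|exact: addr_ge0|].
apply: filterS2 fM gN => x h1 h2 Dx xi; rewrite mulmxDl mulrDl.
by apply: le_trans (cnormD _ _) _; apply: lerD; [exact: h1|exact: h2].
Qed.

Lemma mulboundZ mu D p q (f : rV -> 'M[C]_(p, q)) M (a : R) :
  mulbound mu D f M -> mulbound mu D (fun x => a%:C%C *: f x) (`|a| * M).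
Proof.
move=> [mf M0 fM]; split; [exact: measurable_fieldZ|exact: mulr_ge0|].
apply: filterS fM => x h Dx xi; rewrite -scalemxAl cnormZ -mulrA.
by apply: ler_wpM2l => //; exact: h.
Qed.

Lemma mulbound_sum mu D p q (I : Type) (s : seq I) (f : I -> rV -> 'M[C]_(p, q)) (M : I -> R) :
  (forall i, mulbound mu D (f i) (M i)) ->
  mulbound mu D (fun x => \sum_(i <- s) f i x) (\sum_(i <- s) M i).
Proof.
move=> h; elim: s => [|i s IH].
  rewrite big_nil; split => //.
    move=> a b; split; under eq_fun do rewrite big_nil mxE; exact: measurable_cst.
  by apply: aeW => x _ xi; rewrite big_nil mul0mx cnorm0 mul0r.
rewrite big_cons (_ : (fun x => _) = fun x => f i x + \sum_(i <- s) f i x); last first.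
  by apply/funext => x; rewrite big_cons.
exact: mulboundD.
Qed.

Lemma inL2_mulbound mu D p q (f : rV -> 'M[C]_(p, q)) (v : rV -> 'cV[C]_q) M :
  measurable D -> mulbound mu D f M -> inL2 mu D v ->
  inL2 mu D (fun x => f x *m v x) /\
  L2norm mu D (fun x => f x *m v x) <= M * L2norm mu D v.
Proof.
move=> mD [mf M0 fM] hv.
have mfv : measurable_field D (fun x => f x *m v x) by apply: measurable_fieldM => //; case: hv.
have h : {ae mu, forall x, D x -> cnorm (f x *m v x) <= M * cnorm (v x)}.
  by apply: filterS fM => x h Dx; exact: h.
by split; [apply: inL2_le mfv hv h|apply: L2norm_le_ae M0 mfv hv h].
Qed.

End mulbound.

(** * Polynomial fields and their coefficients *)

Section pfield.
Variables (R : realType) (d k : nat).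
Local Notation C := R[i].
Local Notation Re := (@complex.Re R).
Local Notation Im := (@complex.Im R).
Local Notation rV := 'rV[R]_d.
Local Notation exps := {ffun 'I_d -> 'I_k.+1}.
Local Notation lam := (lebesgue_rV R d).
Implicit Types (al be : exps) (x : rV) (i : 'I_d).

Definition rpoly (cf : exps -> R) x : R :=
  \sum_(al : exps | (\sum_i al i <= k)%N) (\prod_i x 0 i ^+ al i) * cf al.
(** The polynomial on the whole space, without the extension by zero that [Pk] imposes. Derivatives,
    traces and integrals are computed on it, and [prestr] returns to [Pk]. *)
Definition pfield p q (c : exps -> 'M[C]_(p, q)) x : 'M[C]_(p, q) :=
  \sum_(al : exps | (\sum_i al i <= k)%N) (\prod_i x 0 i ^+ al i)%:C%C *: c al.

Lemma Re_pfield p q (c : exps -> 'M[C]_(p, q)) x a b :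
  Re (pfield c x a b) = rpoly (fun al => Re (c al a b)) x.
Proof. by rewrite /pfield summxE Re_sum; apply: eq_bigr => al _; rewrite mxE ReZ. Qed.

Lemma Im_pfield p q (c : exps -> 'M[C]_(p, q)) x a b :
  Im (pfield c x a b) = rpoly (fun al => Im (c al a b)) x.
Proof. by rewrite /pfield summxE Im_sum; apply: eq_bigr => al _; rewrite mxE ImZ. Qed.

Lemma sm_rpoly cf : sm (rpoly cf).
Proof.
have smc i : sm (fun x : rV => x 0 i).
  rewrite (_ : (fun x => _) = fun x : rV => id (edot x (evec R i) - 0)).
    by apply: (@sm_aff R d (fun t => t) (evec R i) 0); exact: sm1_id.
  by apply/funext => x; rewrite edot_evec subr0.
rewrite /rpoly.
apply: sm_sum => al; apply: sm_mul; last exact: sm_cst.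
apply: sm_prod => i; elim: (nat_of_ord (al i)) => [|n IH].
  by rewrite (_ : (fun x => _) = fun=> 1); [exact: sm_cst|apply/funext => x; rewrite expr0].
by under eq_fun do rewrite exprS; exact: sm_mul.
Qed.

Lemma continuous_rpoly cf : continuous (rpoly cf).
Proof. exact: sm_continuous (sm_rpoly cf). Qed.

Lemma measurable_rpoly cf : measurable_fun [set: rV] (rpoly cf).
Proof. exact: (continuous_measurable_rV (@continuous_rpoly cf)). Qed.

Lemma measurable_pfield p q (c : exps -> 'M[C]_(p, q)) D : measurable_field D (pfield c).
Proof.
move=> a b; split.
  by under eq_fun do rewrite Re_pfield; apply: measurable_funTS; exact: measurable_rpoly.
by under eq_fun do rewrite Im_pfield; apply: measurable_funTS; exact: measurable_rpoly.
Qed.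

Lemma pfield_bounded p q (c : exps -> 'M[C]_(p, q)) B :
  exists M, forall x, box 0 B x -> cnorm (pfield c x) <= M.
Proof.
have h a b : exists M : R, forall x, box 0 B x -> `|Re (pfield c x a b)| + `|Im (pfield c x a b)| <= M.
  have [M1 _ h1] := @continuous_box_bounded R d _ B (@continuous_rpoly (fun al => Re (c al a b))).
  have [M2 _ h2] := @continuous_box_bounded R d _ B (@continuous_rpoly (fun al => Im (c al a b))).
  by exists (M1 + M2) => x xB; rewrite Re_pfield Im_pfield lerD ?h1 ?h2.
have /choice[M hM] : forall ab : 'I_p * 'I_q, exists M : R, forall x, box 0 B x ->
    `|Re (pfield c x ab.1 ab.2)| + `|Im (pfield c x ab.1 ab.2)| <= M by move=> ab; exact: h.
exists (\sum_a \sum_b M (a, b)) => x xB; apply: le_trans (cnorm_le_entries _) _.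
by apply: ler_sum => a _; apply: ler_sum => b _; exact: (hM (a, b)).
Qed.

Lemma inL2_pfield (mu : {measure set rV -> \bar R}) D p q (c : exps -> 'M[C]_(p, q)) B :
  measurable D -> (mu D < +oo)%E -> D `<=` box 0 B -> inL2 mu D (pfield c).
Proof.
move=> mD Doo DB; have [M hM] := pfield_bounded c B.
by apply: (bounded_inL2 mD Doo (@measurable_pfield _ _ c D)) => x xD; exact: hM (DB _ xD).
Qed.

Definition line_poly (cf : exps -> R) i x : {poly R} :=
  \sum_(al : exps | (\sum_i al i <= k)%N)
    ((\prod_(j | j != i) x 0 j ^+ al j) * cf al) *: 'X^(al i).

Lemma line_polyE cf i x t : rpoly cf (upd x i t) = (line_poly cf i x).[t].
Proof.
rewrite /line_poly horner_sum; apply: eq_bigr => al _; rewrite hornerZ hornerXn.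
rewrite (bigD1 i)//= mxE eqxx (eq_bigr (fun j => x 0 j ^+ al j)); first by ring.
by move=> j ji; rewrite mxE (negbTE ji).
Qed.

Lemma sep_poly_rpoly cf : sep_poly k (rpoly cf).
Proof.
move=> i x; exists (line_poly cf i x); last by move=> t; rewrite line_polyE.
apply: leq_trans (size_sum _ _ _) _; apply/bigmax_leqP => al _.
by apply: leq_trans (size_scale_leq _ _) _; rewrite size_polyXn ltn_ord.
Qed.

Definition lower i al : exps := [ffun j => if j == i then inord (al i).-1 else al j].

Lemma lowerE i al : lower i al i = (al i).-1 :> nat.
Proof.
by rewrite ffunE eqxx inordK// (leq_ltn_trans (leq_pred _))// ltn_ord.
Qed.

Lemma lower_le i al : (\sum_j al j <= k)%N -> (\sum_j lower i al j <= k)%N.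
Proof.
apply: leq_trans; apply: leq_sum => j _; have [->|ji] := eqVneq j i.
  by rewrite lowerE leq_pred.
by rewrite ffunE (negbTE ji).
Qed.

(** Exponents are lowered rather than raised so as to stay in ['I_k.+1]. When [al i] is zero,
    [lower i al] is [al] itself and the factor [(al i)%:R] removes the term. *)
Definition dcoef (V : lmodType R) i (cf : exps -> V) be : V :=
  \sum_(al : exps | (\sum_i al i <= k)%N) if lower i al == be then (al i)%:R *: cf al else 0.

Lemma is_derive_rpoly cf i x :
  is_derive x (evec R i) (rpoly cf) (rpoly (dcoef (V := R^o) i cf) x).
Proof.
have := is_derive_upd (line_polyE cf i x).
suff -> : (line_poly cf i x)^`().[x 0 i] = rpoly (dcoef (V := R^o) i cf) x by [].
rewrite /rpoly /dcoef.
under [RHS]eq_bigr do rewrite big_distrr/=.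
rewrite [RHS](exchange_big_dep (fun al : exps => (\sum_i al i <= k)%N))//=.
rewrite /line_poly raddf_sum horner_sum; apply: eq_bigr => al hal.
rewrite (bigD1 (lower i al))/=; last by rewrite hal andbT lower_le.
rewrite eqxx [X in _ = _ + X]big1 ?addr0; last first.
  by move=> be /andP[_ bel]; rewrite eq_sym (negbTE bel) mulr0.
rewrite derivZ derivXn hornerZ hornerMn hornerXn [in RHS](bigD1 i)//= lowerE.
rewrite (_ : \prod_(j < d | j != i) x 0 j ^+ lower i al j = \prod_(j < d | j != i) x 0 j ^+ al j).
  by rewrite -mulr_natl /GRing.scale/=; ring.
by apply: eq_bigr => j ji; rewrite ffunE (negbTE ji).
Qed.

Definition dcoefC p q i (c : exps -> 'M[C]_(p, q)) be : 'M[C]_(p, q) :=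
  \sum_(al : exps | (\sum_i al i <= k)%N) if lower i al == be then ((al i)%:R : R)%:C%C *: c al else 0.

Lemma pderiv_pfield p q (c : exps -> 'M[C]_(p, q)) i x :
  pderiv i (pfield c) x = pfield (dcoefC i c) x.
Proof.
apply/matrixP => a b; rewrite mxE; apply: complex_inj => /=.
  rewrite Re_pfield (_ : (fun y => _) = rpoly (fun al => Re (c al a b))); last first.
    by apply/funext => y; rewrite Re_pfield.
  rewrite (@derive_val _ _ _ _ _ _ _ (is_derive_rpoly _ i x)).
  apply: eq_bigr => be _; congr (_ * _); rewrite /dcoef /dcoefC summxE Re_sum.
  by apply: eq_bigr => al _; case: ifP => _; rewrite !mxE ?ReZ.
rewrite Im_pfield (_ : (fun y => _) = rpoly (fun al => Im (c al a b))); last first.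
  by apply/funext => y; rewrite Im_pfield.
rewrite (@derive_val _ _ _ _ _ _ _ (is_derive_rpoly _ i x)).
apply: eq_bigr => be _; congr (_ * _); rewrite /dcoef /dcoefC summxE Im_sum.
by apply: eq_bigr => al _; case: ifP => _; rewrite !mxE ?ImZ.
Qed.

Lemma near_pderiv p q (f g : rV -> 'M[C]_(p, q)) (T : set rV) i x : open T -> T x ->
  (forall y, T y -> f y = g y) -> pderiv i f x = pderiv i g x.
Proof.
move=> oT Tx fg; have nT : \forall y \near x, f y = g y.
  by have : nbhs x T by [apply: open_nbhs_nbhs]; apply: filterS => y /fg.
apply/matrixP => a b; rewrite !mxE; congr Complex.
  by apply: near_eq_derive; apply: filterS nT => y ->.
by apply: near_eq_derive; apply: filterS nT => y ->.
Qed.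

Definition prestr p q (Y : set rV) (c : exps -> 'M[C]_(p, q)) x : 'M[C]_(p, q) :=
  if x \in closure Y then pfield c x else 0.

Lemma Pk_prestr p q (Y : set rV) (c : exps -> 'M[C]_(p, q)) : Pk k Y (prestr Y c).
Proof.
exists c; split => x Yx; rewrite /prestr; first by rewrite mem_set.
by rewrite ifF//; apply/negbTE/negP; rewrite inE.
Qed.

Lemma PkE p q (Y : set rV) (f : rV -> 'M[C]_(p, q)) : Pk k Y f -> exists c, f = prestr Y c.
Proof.
move=> [c [h1 h2]]; exists c; apply/funext => x; rewrite /prestr; case: ifPn => xY.
  by rewrite h1//; rewrite inE in xY.
by rewrite h2// => Yx; move/negP: xY; apply; rewrite inE.
Qed.

Lemma prestrE p q (Y : set rV) (c : exps -> 'M[C]_(p, q)) x : closure Y x ->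
  prestr Y c x = pfield c x.
Proof. by move=> Yx; rewrite /prestr mem_set. Qed.

Lemma pfieldD p q (c c' : exps -> 'M[C]_(p, q)) x :
  pfield (fun al => c al + c' al) x = pfield c x + pfield c' x.
Proof. by rewrite /pfield -big_split; apply: eq_bigr => al _; rewrite scalerDr. Qed.

Lemma pfieldM p q r (A : 'M[C]_(p, q)) (c : exps -> 'M[C]_(q, r)) x :
  pfield (fun al => A *m c al) x = A *m pfield c x.
Proof. by rewrite /pfield mulmx_sumr; apply: eq_bigr => al _; rewrite scalemxAr. Qed.

Lemma pfieldZ p q (a : C) (c : exps -> 'M[C]_(p, q)) x :
  pfield (fun al => a *: c al) x = a *: pfield c x.
Proof. by rewrite /pfield scaler_sumr; apply: eq_bigr => al _; rewrite !scalerA mulrC. Qed.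

Lemma pfield_sum p q (I : Type) (s : seq I) (c : I -> exps -> 'M[C]_(p, q)) x :
  pfield (fun al => \sum_(i <- s) c i al) x = \sum_(i <- s) pfield (c i) x.
Proof. by rewrite /pfield exchange_big/=; apply: eq_bigr => al _; rewrite scaler_sumr. Qed.

Lemma PkZ p q (Y : set rV) (a : C) (f : rV -> 'M[C]_(p, q)) : Pk k Y f ->
  Pk k Y (fun x => a *: f x).
Proof.
move=> /PkE[c ->].
rewrite (_ : (fun x => _) = prestr Y (fun al => a *: c al)); first exact: Pk_prestr.
by apply/funext => x; rewrite /prestr; case: ifP => _; rewrite ?pfieldZ ?scaler0.
Qed.

End pfield.

Section inverse_estimates.
Variables (R : realType) (d k : nat) (theta : R).
Local Notation C := R[i].
Local Notation Re := (@complex.Re R).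
Local Notation Im := (@complex.Im R).
Local Notation rV := 'rV[R]_d.
Local Notation exps := {ffun 'I_d -> 'I_k.+1}.
Local Notation lam := (lebesgue_rV R d).
Hypothesis theta01 : 0 < theta <= 1.

(** The element lies between boxes of half-widths [theta * h] and [h] with a common centre:
    [theta^-1] is the dilation in the box estimates, and the power of [theta] restores the scale
    [h]. *)
Definition sup_cst : R := poly_l2_cst theta^-1 k ^+ d / theta ^+ d.
Definition dsup_cst : R :=
  interp_cst theta^-1 (node_sep R k) k ^+ 2 * poly_l2_cst theta^-1 k ^+ d / theta ^+ d.+2.

Lemma sup_cst_ge0 : 0 <= sup_cst.
Proof.
case/andP: theta01 => t0 _; apply: divr_ge0; last by rewrite exprn_ge0 ?ltW.
by apply: exprn_ge0; exact: poly_l2_cst_ge0.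
Qed.

Lemma dsup_cst_ge0 : 0 <= dsup_cst.
Proof.
case/andP: theta01 => t0 _; apply: divr_ge0; last by rewrite exprn_ge0 ?ltW.
by apply: mulr_ge0; [exact: sqr_ge0|apply: exprn_ge0; exact: poly_l2_cst_ge0].
Qed.

Variables (T : set rV) (h : R) (c0 : rV).
Hypotheses (oT : open T) (h0 : 0 < h) (boxT : box c0 (theta * h) `<=` T)
  (Tbox : closure T `<=` box c0 h).

Let mT : measurable T. Proof. exact: (@open_measurable_rV R d T oT). Qed.

Lemma box_measure_le : (lam T <= ((2 * h) ^+ d)%:E)%E.
Proof.
rewrite -(lebesgue_rV_box c0 (ltW h0)); apply: le_measure; rewrite ?inE//.
  exact: measurable_box.
by apply: subset_trans Tbox; exact: subset_closure.
Qed.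

Lemma lam_lty : (lam T < +oo)%E.
Proof. by apply: le_lt_trans box_measure_le _; rewrite ltry. Qed.

Lemma sub_box0 : exists B, closure T `<=` box 0 B.
Proof.
exists (\sum_i `|c0 0 i| + h) => x /Tbox xb i; rewrite mxE subr0.
have -> : x 0 i = c0 0 i + (x 0 i - c0 0 i) by rewrite addrC subrK.
apply: le_trans (ler_normD _ _) _; apply: lerD; last exact: xb.
by rewrite (bigD1 i)//= lerDl; apply: sumr_ge0.
Qed.

Lemma inL2_elt p q (c : exps -> 'M[C]_(p, q)) : inL2 lam T (pfield c).
Proof.
have [B TB] := sub_box0; apply: (@inL2_pfield R d k lam T p q c B mT lam_lty).
by apply: subset_trans TB; exact: subset_closure.
Qed.

Lemma box_sqr_le p q (c : exps -> 'M[C]_(p, q)) :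
  (\sum_a \sum_b (\int[lam]_(x in box c0 (theta * h)) (rpoly (fun al => Re (c al a b)) x ^+ 2)%:E
     + \int[lam]_(x in box c0 (theta * h)) (rpoly (fun al => Im (c al a b)) x ^+ 2)%:E) <=
   (L2norm lam T (pfield c) ^+ 2)%:E)%E.
Proof.
have mb := @measurable_box R d c0 (theta * h).
have mr cf : measurable_fun (box c0 (theta * h)) (fun x => (rpoly (k := k) cf x ^+ 2)%:E).
  apply/measurable_EFinP; apply: measurable_funX; apply: measurable_funTS; exact: measurable_rpoly.
have p0 (cf : exps -> R) x : box c0 (theta * h) x -> (0 <= (rpoly cf x ^+ 2)%:E)%E.
  by move=> _; rewrite lee_fin sqr_ge0.
have -> : (\sum_a \sum_b (\int[lam]_(x in box c0 (theta * h)) (rpoly (fun al => Re (c al a b)) x ^+ 2)%:E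
     + \int[lam]_(x in box c0 (theta * h)) (rpoly (fun al => Im (c al a b)) x ^+ 2)%:E) =
  \int[lam]_(x in box c0 (theta * h)) (cnorm (pfield c x) ^+ 2)%:E)%E.
  transitivity (\int[lam]_(x in box c0 (theta * h)) (\sum_a \sum_b
     ((rpoly (fun al => Re (c al a b)) x ^+ 2)%:E + (rpoly (fun al => Im (c al a b)) x ^+ 2)%:E)))%E.
    rewrite ge0_integral_sum//; last 2 first.
    - move=> a; apply: emeasurable_sum => b; exact: emeasurable_funD.
    - move=> a x xb; apply: sume_ge0 => b _; apply: adde_ge0; exact: p0.
    apply: eq_bigr => a _; rewrite ge0_integral_sum//; last 2 first.
    - move=> b; exact: emeasurable_funD.
    - move=> b x xb; apply: adde_ge0; exact: p0.
    apply: eq_bigr => b _; apply/esym.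
    exact: (ge0_integralD lam mb (p0 _) (mr _) (p0 _) (mr _)).
  apply: eq_integral => x _; rewrite cnorm_sqr rdotE -sumEFin; apply: eq_bigr => a _.
  by rewrite -sumEFin; apply: eq_bigr => b _; rewrite -EFinD Re_pfield Im_pfield !expr2.
rewrite L2norm_sqr /rip /Rintegral fineK.
  rewrite (@eq_integral _ _ _ _ _ (fun x => (cnorm (pfield c x) ^+ 2)%:E)); last first.
    by move=> x _; rewrite cnorm_sqr.
  apply: ge0_subset_integral => //.
    apply/measurable_EFinP; apply: measurable_cnorm; exact: measurable_pfield.
  by move=> x _; rewrite lee_fin sqr_ge0.
have hi := integrable_rdot mT (inL2_elt c) (inL2_elt c).
have := integrable_fin_num mT hi.
exact.
Qed.

(** The integral over the inner box bounds the values on the dilated box, which contains the closure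
    of [T]: the element enters only through the two boxes. *)
Lemma pfield_sup p q (c : exps -> 'M[C]_(p, q)) x : closure T x ->
  cnorm (pfield c x) ^+ 2 <= sup_cst / h ^+ d * L2norm lam T (pfield c) ^+ 2.
Proof.
move=> /Tbox xb; case/andP: theta01 => t0 t1.
have s0 : 0 < theta * h by rewrite mulr_gt0.
have xb' : box c0 (theta^-1 * (theta * h)) x by rewrite mulrA mulVf ?mul1r// gt_eqF.
have l0 : 0 <= theta^-1 by rewrite invr_ge0 ltW.
have E (cf : exps -> R) := sep_poly_l2 l0 s0 (@sep_poly_rpoly R d k cf) (@measurable_rpoly R d k cf) xb'.
set C1 := poly_l2_cst theta^-1 k ^+ d in E.
have C10 : 0 <= C1 by apply: exprn_ge0; exact: poly_l2_cst_ge0.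
suff : ((cnorm (pfield c x) ^+ 2 * (theta * h) ^+ d)%:E <= C1%:E * (L2norm lam T (pfield c) ^+ 2)%:E)%E.
  rewrite -EFinM lee_fin -ler_pdivlMr ?exprn_gt0// => /le_trans; apply.
  rewrite le_eqVlt /sup_cst -/C1 exprMn; apply/orP; left; apply/eqP.
  have hd : h ^+ d != 0 by rewrite expf_neq0// gt_eqF.
  have td : theta ^+ d != 0 by rewrite expf_neq0// gt_eqF.
  by field; rewrite hd td.
have C1' : (0 <= C1%:E)%E by rewrite lee_fin.
apply: le_trans (lee_wpmul2l C1' (box_sqr_le c)).
rewrite cnorm_sqr rdotE big_distrl/= -sumEFin ge0_sume_distrr; last first.
  move=> a _; apply: sume_ge0 => b _; apply: adde_ge0; apply: integral_ge0 => y _; by rewrite lee_fin sqr_ge0.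
apply: lee_sum => a _; rewrite big_distrl/= -sumEFin ge0_sume_distrr; last first.
  move=> b _; apply: adde_ge0; apply: integral_ge0 => y _; by rewrite lee_fin sqr_ge0.
apply: lee_sum => b _; rewrite ge0_muleDr; last 2 first.
- by apply: integral_ge0 => y _; rewrite lee_fin sqr_ge0.
- by apply: integral_ge0 => y _; rewrite lee_fin sqr_ge0.
by rewrite mulrDl EFinD Re_pfield Im_pfield -!expr2; apply: leeD; exact: E.
Qed.

Lemma pderiv_sup p q (c : exps -> 'M[C]_(p, q)) i x : closure T x ->
  cnorm (pfield (dcoefC i c) x) ^+ 2 <= dsup_cst / h ^+ d.+2 * L2norm lam T (pfield c) ^+ 2.
Proof.
move=> /Tbox xb; case/andP: theta01 => t0 t1.
have s0 : 0 < theta * h by rewrite mulr_gt0.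
have xb' : box c0 (theta^-1 * (theta * h)) x by rewrite mulrA mulVf ?mul1r// gt_eqF.
have l1 : 1 <= theta^-1 by rewrite -invr1 lef_pV2// posrE.
have E (cf : exps -> R) := sep_poly_derive_l2 l1 s0 (@sep_poly_rpoly R d k cf)
   (@measurable_rpoly R d k cf) xb' (is_derive_rpoly cf i x).
set C1 := interp_cst _ _ _ ^+ 2 * _ in E.
have C10 : 0 <= C1.
  by apply: mulr_ge0; [exact: sqr_ge0|apply: exprn_ge0; exact: poly_l2_cst_ge0].
suff : ((cnorm (pfield (dcoefC i c) x) ^+ 2 * (theta * h) ^+ d.+2)%:E <= C1%:E * (L2norm lam T (pfield c) ^+ 2)%:E)%E.
  rewrite -EFinM lee_fin -ler_pdivlMr ?exprn_gt0// => /le_trans; apply.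
  rewrite le_eqVlt /dsup_cst -/C1 exprMn; apply/orP; left; apply/eqP.
  have hd : h ^+ d.+2 != 0 by rewrite expf_neq0// gt_eqF.
  have td : theta ^+ d.+2 != 0 by rewrite expf_neq0// gt_eqF.
  by field; rewrite hd td.
have C1' : (0 <= C1%:E)%E by rewrite lee_fin.
apply: le_trans (lee_wpmul2l C1' (box_sqr_le c)).
rewrite cnorm_sqr rdotE big_distrl/= -sumEFin ge0_sume_distrr; last first.
  move=> a _; apply: sume_ge0 => b _; apply: adde_ge0; apply: integral_ge0 => y _; by rewrite lee_fin sqr_ge0.
apply: lee_sum => a _; rewrite big_distrl/= -sumEFin ge0_sume_distrr; last first.
  move=> b _; apply: adde_ge0; apply: integral_ge0 => y _; by rewrite lee_fin sqr_ge0.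
apply: lee_sum => b _; rewrite ge0_muleDr; last 2 first.
- by apply: integral_ge0 => y _; rewrite lee_fin sqr_ge0.
- by apply: integral_ge0 => y _; rewrite lee_fin sqr_ge0.
have eR : Re (pfield (dcoefC i c) x a b) = rpoly (dcoef (V := R^o) i (fun al => Re (c al a b))) x.
  rewrite Re_pfield; congr (rpoly _ x); apply/funext => be; rewrite /dcoef /dcoefC summxE Re_sum.
  by apply: eq_bigr => al _; case: ifP => _; rewrite !mxE ?ReZ.
have eI : Im (pfield (dcoefC i c) x a b) = rpoly (dcoef (V := R^o) i (fun al => Im (c al a b))) x.
  rewrite Im_pfield; congr (rpoly _ x); apply/funext => be; rewrite /dcoef /dcoefC summxE Im_sum.
  by apply: eq_bigr => al _; case: ifP => _; rewrite !mxE ?ImZ.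
by rewrite mulrDl EFinD eR eI -!expr2; apply: leeD; exact: E.
Qed.

(** The pointwise bound of the derivative, integrated over an element of volume at most
    [(2 * h) ^+ d]. *)
Lemma pfield_inverse p q (c : exps -> 'M[C]_(p, q)) i :
  L2norm lam T (pfield (dcoefC i c)) ^+ 2 <= dsup_cst * 2 ^+ d / h ^+ 2 * L2norm lam T (pfield c) ^+ 2.
Proof.
apply: (@le_trans _ _ (dsup_cst / h ^+ d.+2 * L2norm lam T (pfield c) ^+ 2 * fine (lam T))).
  apply: (@L2norm_le_sup R d lam T mT p q _ (pfield (dcoefC i c)) (inL2_elt _) lam_lty) => x Tx.
  by apply: pderiv_sup; exact: subset_closure.
have fl : fine (lam T) <= (2 * h) ^+ d.
  by rewrite -lee_fin fineK ?box_measure_le// ge0_fin_numE ?lam_lty.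
have D0 := dsup_cst_ge0.
apply: (@le_trans _ _ (dsup_cst / h ^+ d.+2 * L2norm lam T (pfield c) ^+ 2 * (2 * h) ^+ d)).
  apply: ler_wpM2l => //; apply: mulr_ge0; last exact: sqr_ge0.
  by apply: divr_ge0 => //; rewrite exprn_ge0// ltW.
rewrite le_eqVlt exprMn; apply/orP; left; apply/eqP.
have hd : h ^+ d != 0 by rewrite expf_neq0// gt_eqF.
rewrite -[d.+2]/(2 + d)%N exprD; field; by rewrite hd gt_eqF.
Qed.

End inverse_estimates.

(** * Integration by parts on mesh elements *)

Section surface_sign.
Variables (R : realType) (d : nat).
Implicit Types (n x y : 'rV[R]_d) (c s : R).

Lemma hyperplane_sign n c s : s = 1 \/ s = -1 -> hyperplane (s *: n) (s * c) = hyperplane n c.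
Proof.
move=> s1; apply/seteqP; split => y; rewrite /hyperplane/= edotZr.
  by case: s1 => -> h; lra.
by move=> ->.
Qed.

Lemma surface_signE n c s (A : set 'rV[R]_d) : enorm n = 1 -> s = 1 \/ s = -1 -> measurable A ->
  surface (s *: n) (s * c) A = surface n c A.
Proof.
move=> n1 [->|->] mA; first by rewrite scale1r mul1r.
by rewrite scaleN1r mulN1r surface_opp.
Qed.

Lemma ae_surface_sign n c s (P : 'rV[R]_d -> Prop) : enorm n = 1 -> s = 1 \/ s = -1 ->
  {ae surface (s *: n) (s * c), forall x, P x} -> {ae surface n c, forall x, P x}.
Proof.
move=> n1 s1 [N [mN N0 hN]]; exists N; split => //.
by rewrite -N0; apply/esym; exact: surface_signE.
Qed.

Lemma Rintegral_surface_sign n c s (D : set 'rV[R]_d) (f : 'rV[R]_d -> R) :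
  enorm n = 1 -> s = 1 \/ s = -1 -> measurable D ->
  (\int[surface (s *: n) (s * c)]_(x in D) f x = \int[surface n c]_(x in D) f x)%R.
Proof.
move=> n1 s1 mD; rewrite /Rintegral; congr fine; apply: eq_measure_integral => A mA _.
exact: surface_signE.
Qed.

Lemma measurable_within (K : set 'rV[R]_d) (f : 'rV[R]_d -> R) : measurable K ->
  (forall y, K y -> f x @[x --> within K (nbhs y)] --> f y) -> measurable_fun K f.
Proof.
move=> mK cf; apply: (measurability _ (RGenOpens.measurableE R)) => //.
move=> _ [_ [a [b ->] <-]]; set U := `]a, b[%classic.
pose V := interior [set y | K y -> U (f y)].
rewrite (_ : K `&` f @^-1` U = K `&` V).
  by apply: measurableI => //; apply: open_measurable_rV; exact: open_interior.
apply/seteqP; split => y [Ky] Uy; split => //; last by have := interior_subset Uy; exact.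
have oU : open U by exact: interval_open.
exact: (cf y Ky _ (open_nbhs_nbhs (conj oU Uy))).
Qed.

End surface_sign.

(** * Jumps of the indicator of an element across the hyperplanes of its faces *)

Section face_jump.
Variables (R : realType) (d : nat) (Om : set 'rV[R]_d) (Th : mesh R d) (varrho : R).
Hypotheses (Omp : polytopal_domain Om) (Thm : is_mesh Om Th)
  (reg : mesh_regularity Om Th varrho).
Variable T : elt Th.
Implicit Types (F : face Th) (y : 'rV[R]_d).
Local Notation lam := (lebesgue_rV R d).

(** Several faces of [T] may lie in one hyperplane, while [weak_ibp] asks for pairwise distinct
    hyperplanes. The choice depends on the hyperplane only, so coplanar faces of [T] get the same
    representative. *)
Definition plane_rep F : face Th :=
  odflt F [pick F' | `[< face_of T F' /\ face_plane F' = face_plane F >]].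
Definition rep_pred : {pred face Th} := [pred F | `[< face_of T F >] && (plane_rep F == F)].

Lemma plane_repP F : face_of T F ->
  face_of T (plane_rep F) /\ face_plane (plane_rep F) = face_plane F.
Proof.
move=> TF; rewrite /plane_rep; case: pickP => [F' /asboolP//|/(_ F)].
by move/negbT/negP => h; exfalso; apply: h; apply/asboolP.
Qed.

Lemma plane_rep_eq F F' : face_of T F -> face_plane F = face_plane F' -> plane_rep F = plane_rep F'.
Proof.
move=> TF e; rewrite /plane_rep e; case: pickP => // /(_ F).
by move/negbT/negP => h; exfalso; apply: h; apply/asboolP.
Qed.

Lemma plane_rep_in F : face_of T F -> plane_rep F \in rep_pred.
Proof.
move=> TF; have [h1 h2] := plane_repP TF; apply/andP; split; first exact/asboolP.
by apply/eqP; apply: plane_rep_eq.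
Qed.

Definition plane_sign F : R := edot (face_normal F) (face_normal (plane_rep F)).

Lemma plane_signP F : face_of T F ->
  [/\ plane_sign F = 1 \/ plane_sign F = -1,
      face_normal F = plane_sign F *: face_normal (plane_rep F) &
      face_offset F = plane_sign F * face_offset (plane_rep F)].
Proof.
move=> TF; have [_ e] := plane_repP TF.
have n1 := face_normal1 Thm F; have n1' := face_normal1 Thm (plane_rep F).
have [|s s1 [e1 e2]] := @unit_hyperplane_eq R d _ (face_offset (plane_rep F)) _ (face_offset F) n1' n1.
  by move: e; rewrite /face_plane => ->.
suff -> : plane_sign F = s by split.
by rewrite /plane_sign e1 edotZl (enorm1_edot n1') mulr1.
Qed.

(** The one-sided limit of the indicator of [T] at a generic point [y] of the hyperplane of [F]. It
    is one at interior points of [T], and on the coplanar faces where the outward normal of [T] is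
    [a] times the normal of [F]: for [a = 1] it is the limit from behind that normal, for [a = -1]
    the limit from ahead. *)
Definition side (a : R) F y : R :=
  \1_(elt_set T) y + \sum_(F' : face Th | `[< face_of T F' >] && (plane_rep F' == F))
     (if orient T F' * plane_sign F' == a then \1_(face_set F') y else 0).

Lemma measurable_side a F : measurable_fun [set: 'rV[R]_d] (side a F).
Proof.
apply: measurable_funD; first by apply: measurable_indic; exact: (measurable_elt Thm).
under eq_fun do rewrite big_mkcond; apply: measurable_sum => F'.
case: (_ && _); last exact: measurable_cst.
case: (_ == _); last exact: measurable_cst.
by apply: measurable_indic; exact: (measurable_face Thm).
Qed.

Lemma face_off_elt F y : face_of T F -> face_set F y -> ~ elt_set T y.
Proof. by move=> TF /TF; rewrite (bnd_elt Thm) => -[]. Qed.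

Lemma side_jump F : F \in rep_pred ->
  {ae face_measure F, forall y, \forall t \near 0^'+,
    \1_(elt_set T) (y + t *: face_normal F) = side (-1) F y /\
    \1_(elt_set T) (y - t *: face_normal F) = side 1 F y}.
Proof.
move=> /andP[/asboolP TF /eqP rF].
have n1 := face_normal1 Thm F.
(* Outside a null set, a face of [T] whose closure contains [y] is coplanar with [F], contains [y],
   and has its outward direction at [y]. The point [y] is then inside [T], away from its closure, or
   on such a face. *)
have H : {ae face_measure F, forall y, forall F', face_of T F' -> closure (face_set F') y ->
    [/\ face_plane F' = face_plane F, face_set F' y & forall t0 : R, \forall t \near 0^'+,
     ~ elt_set T (y + t *: (orient T F' *: face_normal F')) /\
     elt_set T (y - t *: (orient T F' *: face_normal F'))]}.
  apply: filter_forall => F'; have [TF'|nTF'] := pselect (face_of T F'); last by apply: nearW => y /nTF'.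
  have [e|ne] := pselect (face_plane F' = face_plane F).
    have h1 : {ae face_measure F, forall y, closure (face_set F') y -> face_set F' y}.
      exact: (ae_closure_face Thm reg n1 (esym e)).
    have h2 := outward_face Thm TF'.
    have rF' : plane_rep F' = F by rewrite (plane_rep_eq TF' e).
    have [s1 e1 e2] := plane_signP TF'; rewrite rF' in e1 e2.
    move: h2; rewrite /face_measure {1}e1 {1}e2 => /(ae_surface_sign n1 s1) h2.
    by apply: filterS2 h1 h2 => y g1 g2 _ /g1 yF'; split => // _; exact: g2.
  have : {ae face_measure F, forall y, ~ face_plane F' y}.
    apply: ae_not_hyperplane => // sub; apply: ne.
    have [s s1 [f1 f2]] := unit_hyperplane_eq n1 (face_normal1 Thm F') sub.
    by rewrite /face_plane f1 f2 hyperplane_sign.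
  by apply: filterS => y g _ /(closure_face_plane Thm) /g.
have G y : elt_set T y -> forall n : 'rV[R]_d, \forall t \near (0 : R)^'+, elt_set T (y + t *: n).
  move=> Ty n; have h : (y + t *: n) @[t --> (0 : R)] --> y + 0 *: n.
    apply: (@continuous_rV R d R (fun t => y + t *: n)) => j t.
    under eq_fun do rewrite !mxE.
    by apply: cvgD; [exact: cvg_cst|apply: cvgMl; exact: cvg_id].
  by apply: cvg_within; apply: h; apply: open_nbhs_nbhs; split; [exact: (elt_open Thm)|rewrite scale0r addr0].
have G' y : ~ closure (elt_set T) y -> forall n : 'rV[R]_d, \forall t \near (0 : R)^'+, ~ elt_set T (y + t *: n).
  move=> nTy n; have h : (y + t *: n) @[t --> (0 : R)] --> y + 0 *: n.
    apply: (@continuous_rV R d R (fun t => y + t *: n)) => j t.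
    under eq_fun do rewrite !mxE.
    by apply: cvgD; [exact: cvg_cst|apply: cvgMl; exact: cvg_id].
  have : \forall t \near (0 : R)^'+, (~` closure (elt_set T)) (y + t *: n).
    apply: cvg_within; apply: h; apply: open_nbhs_nbhs; split; last by rewrite scale0r addr0.
    by apply: closed_openC; exact: closed_closure.
  by apply: filterS => t ht /(@subset_closure _ (elt_set T)).
apply: filterS H => y hy.
have [Ty|nTy] := pselect (elt_set T y).
  have sE a : side a F y = 1.
    rewrite /side indicE mem_set// big1 ?addr0// => F' /andP[/asboolP TF' _].
    case: ifP => // _; rewrite indicE memNset// => /(face_off_elt TF'); exact.
  have h1 := G y Ty (face_normal F); have h2 := G y Ty (- face_normal F).
  rewrite !sE; apply: filterS2 h1 h2 => t g1 g2.
  by rewrite !indicE !mem_set// -scalerN.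
have [clTy|nclTy] := pselect (closure (elt_set T) y); last first.
  have sE a : side a F y = 0.
    rewrite /side indicE memNset// add0r big1// => F' /andP[/asboolP TF' _].
    case: ifP => // _; rewrite indicE memNset// => /TF'; rewrite (bnd_elt Thm) => -[].
    by [].
  have h1 := G' y nclTy (face_normal F); have h2 := G' y nclTy (- face_normal F).
  rewrite !sE; apply: filterS2 h1 h2 => t g1 g2.
  by rewrite !indicE !memNset// -scalerN.
have : bnd (elt_set T) y by rewrite (bnd_elt Thm).
rewrite (bnd_elt_faces Thm) => -[F' /= TF' clF'].
have [e yF' out] := hy F' TF' clF'.
have rF' : plane_rep F' = F by rewrite (plane_rep_eq TF' e).
have [s1 e1 _] := plane_signP TF'; rewrite rF' in e1.
have sE a : side a F y = (orient T F' * plane_sign F' == a)%:R.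
  rewrite /side indicE memNset// add0r (bigD1 F')/=; last by rewrite rF' eqxx andbT; apply/asboolP.
  rewrite big1 ?addr0; first by rewrite indicE mem_set//; case: eqP.
  move=> F2 /andP[/andP[/asboolP TF2 _] /eqP n2]; case: ifP => // _.
  by rewrite indicE memNset// => yF2; apply: n2; exact: (face_disjoint Thm yF2 yF').
have nE : orient T F' *: face_normal F' = (orient T F' * plane_sign F') *: face_normal F.
  by rewrite {1}e1 scalerA.
have o : orient T F' * plane_sign F' = 1 \/ orient T F' * plane_sign F' = -1.
  by case: (orient1 Thm TF') => ->; case: s1 => ->;
    rewrite ?mul1r ?mulN1r ?opprK; by [left|right].
have N1 : ((1 : R) == -1) = false by rewrite -subr_eq0 opprK -mulr2n pnatr_eq0.
case: o => o1.
- apply: filterS (out 0) => t; rewrite nE o1 scale1r => -[g1 g2].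
  by rewrite !sE o1 eqxx !indicE (memNset g1) (mem_set g2) N1.
- apply: filterS (out 0) => t; rewrite nE o1 scaleN1r scalerN opprK => -[g1 g2].
  by rewrite !sE o1 eqxx !indicE (memNset g1) (mem_set g2) eq_sym N1.
Qed.

End face_jump.

Section mesh_ibp.
Variables (R : realType) (d : nat) (Om : set 'rV[R]_d) (Th : mesh R d) (varrho : R).
Hypotheses (d_gt0 : (0 < d)%N) (Omp : polytopal_domain Om) (Thm : is_mesh Om Th)
  (reg : mesh_regularity Om Th varrho).
Variable T : elt Th.
Implicit Types (F : face Th) (y : 'rV[R]_d).
Local Notation lam := (lebesgue_rV R d).

Lemma face_measure_lty F : face_of T F -> (face_measure F (face_set F) < +oo)%E.
Proof.
move=> TF; apply: le_lt_trans (face_measure_le d_gt0 Omp Thm TF) _; exact: ltry.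
Qed.

Lemma face_sub_domain F : face_of T F -> face_set F `<=` closure Om.
Proof. by move=> TF y /TF[clT _]; exact: (closure_elt_sub Thm clT). Qed.

Variables (A : 'I_d -> 'rV[R]_d -> R) (b : 'rV[R]_d -> R) (M : R).
Hypotheses (cA : forall i y, closure Om y -> A i x @[x --> within (closure Om) (nbhs y)] --> A i y)
  (AM : forall i y, closure Om y -> `|A i y| <= M)
  (ib : lam.-integrable (elt_set T) (EFin \o b)).
Hypothesis weak : forall phi, test_function Om phi ->
  (\int[lam]_(x in Om) (\sum_i 'D_(evec R i) phi x * A i x) =
   - \int[lam]_(x in Om) (phi x * b x))%R.

Let mcl : measurable (closure Om).
Proof.
rewrite -(setCK (closure Om)); apply: measurableC; apply: open_measurable_rV.
by apply: closed_openC; exact: closed_closure.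
Qed.

(** [weak_ibp] takes globally measurable, bounded functions that vanish outside a box. Extension by
    zero provides them and keeps the limits taken within [T]. *)
Let a i : 'rV[R]_d -> R := (A i) \_ (closure Om).

Let aE i y : closure Om y -> a i y = A i y.
Proof. by move=> h; rewrite /a patchE mem_set. Qed.

Lemma integrable_face F (f : 'rV[R]_d -> R) N : face_of T F -> measurable_fun (face_set F) f ->
  (forall y, face_set F y -> `|f y| <= N) -> (face_measure F).-integrable (face_set F) (EFin \o f).
Proof.
move=> TF mf fN; apply/integrableP; split; first exact/measurable_EFinP.
apply: (@le_lt_trans _ _ (\int[face_measure F]_(y in face_set F) N%:E)%E).
  apply: ge0_le_integral => //; first exact: (measurable_face Thm).
  - by apply/measurable_EFinP; exact: measurableT_comp.
rewrite (integral_cst _ (measurable_face Thm F)); apply: lte_mul_pinfty => //; last exact: face_measure_lty.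
have [y Fy] : face_set F !=set0 by case: Thm => _ -[h _ _ _] _; case: (h F).
by rewrite lee_fin; apply: le_trans (fN _ Fy).
Qed.

Lemma integrable_surface_sign n c s (D : set 'rV[R]_d) (f : 'rV[R]_d -> \bar R) :
  enorm n = 1 -> s = 1 \/ s = -1 -> measurable D ->
  (surface (s *: n) (s * c)).-integrable D f -> (surface n c).-integrable D f.
Proof.
move=> n1 s1 mD /integrableP[mf h]; apply/integrableP; split => //.
rewrite (@eq_measure_integral _ _ _ _ (surface (s *: n) (s * c)))// => X mX _.
by apply/esym; exact: surface_signE.
Qed.

(** The two sides agree inside [T], so that only the faces in the hyperplane of [L] remain, each
    with the sign of its outward normal. The measures of coplanar faces coincide since reversing the
    normal does not change [surface]. *)
Lemma side_integral (L : face Th) (g : 'rV[R]_d -> R) N : L \in rep_pred T ->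
  measurable_fun [set: 'rV[R]_d] g -> (forall F y, face_of T F -> face_set F y -> `|g y| <= N) ->
  (\int[face_measure L]_y (g y * (side T (-1) L y - side T 1 L y)) =
   - \sum_(F : face Th | `[< face_of T F >] && (plane_rep T F == L))
       orient T F * plane_sign T F * \int[face_measure F]_(y in face_set F) g y)%R.
Proof.
move=> Lr mg gN.
have n1 := face_normal1 Thm L.
pose h F y : R := if `[< face_of T F >] && (plane_rep T F == L)
  then - (orient T F * plane_sign T F) * (g \_ (face_set F)) y else 0.
have E y : g y * (side T (-1) L y - side T 1 L y) = \sum_F h F y.
  rewrite /side opprD addrACA subrr add0r -sumrB mulr_sumr big_mkcond; apply: eq_bigr => F _.
  rewrite /h; case: ifP => // /andP[/asboolP TF _].
  have [s1 _ _] := plane_signP Thm TF.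
  have N1 : ((1 : R) == -1) = false by rewrite -subr_eq0 opprK -mulr2n pnatr_eq0.
  have o : orient T F * plane_sign T F = 1 \/ orient T F * plane_sign T F = -1.
    by case: (orient1 Thm TF) => ->; case: s1 => ->; rewrite ?mul1r ?mulN1r ?opprK; by [left|right].
  have -> : (g \_ (face_set F)) y = g y * \1_(face_set F) y.
    by rewrite patchE indicE; case: ifP; rewrite ?mulr1 ?mulr0.
  by case: o => ->; rewrite eqxx ?N1 ?[-1 == 1]eq_sym ?N1 /=; ring.
have hF F : `[< face_of T F >] && (plane_rep T F == L) ->
    (face_measure L).-integrable (face_set F) (EFin \o g) /\
    (\int[face_measure L]_(y in face_set F) g y = \int[face_measure F]_(y in face_set F) g y)%R.
  move=> /andP[/asboolP TF /eqP rF]; have [s1 e1 e2] := plane_signP Thm TF; rewrite rF in e1 e2.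
  have mF := measurable_face Thm F; split; last first.
    by rewrite [in RHS]/face_measure e1 e2 Rintegral_surface_sign.
  apply: (integrable_surface_sign n1 s1 mF); rewrite -e1 -e2.
  apply: (@integrable_face F g N TF) => [|y Fy]; first exact: measurable_funTS.
  exact: gN TF Fy.
have ih F : (face_measure L).-integrable setT (EFin \o h F).
  rewrite /h; case: (boolP (_ && _)) => [/hF[ig _]|_]; last first.
    have := @integrable0 _ _ R (face_measure L) setT; exact.
  have := (integrable_mkcond (EFin \o g) (measurable_face Thm F)).1 ig.
  move=> /(integrableZl measurableT (- (orient T F * plane_sign T F))).
  congr integrable; apply/funext => y /=; rewrite !patchE; by case: ifP; rewrite ?EFinM.
under eq_Rintegral do rewrite E.
rewrite Rintegral_sum// -sumrN [RHS]big_mkcond; apply: eq_bigr => F _.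
have := ih F; rewrite /h; case: ifPn => [/hF[ig <-]|_] _; last first.
  by rewrite Rintegral_cst// mul0r.
rewrite RintegralZl//; first by rewrite mulNr -Rintegral_mkcond.
have := (integrable_mkcond (EFin \o g) (measurable_face Thm F)).1 ig.
by congr integrable; apply/funext => y /=; rewrite !patchE; case: ifP.
Qed.

Lemma mesh_ibp_real (q : 'rV[R]_d -> R) (dq : 'I_d -> 'rV[R]_d -> R) : sm q ->
  (forall i, sm (dq i)) -> (forall i x, is_derive x (evec R i) q (dq i x)) ->
  (\sum_i \int[lam]_(x in elt_set T) (dq i x * A i x) =
   \sum_(F : face Th | `[< face_of T F >]) orient T F *
     \sum_i \int[face_measure F]_(y in face_set F) (face_normal F 0 i * (q y * A i y))
   - \int[lam]_(x in elt_set T) (q x * b x))%R.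
Proof.
move=> sq sdq Dq.
have [B B0 OmB] := domain_box Omp.
have TB : elt_set T `<=` box 0 B by apply: subset_trans OmB; apply: subset_trans (@closure_elt_sub _ _ _ _ Thm T); exact: subset_closure.
pose I := {F : face Th | F \in rep_pred T}.
have M0 : 0 <= M.
  have [y Ty] := elt_neq0 Thm T; have [i0] : exists i : 'I_d, True by exists (Ordinal d_gt0).
  move=> _; apply: le_trans (AM i0 (closure_elt_sub Thm (@subset_closure _ _ _ Ty))); exact: normr_ge0.
have mA i : measurable_fun (closure Om) (A i) by apply: measurable_within => // y; exact: cA.
have ma i : measurable_fun setT (a i) by apply/(measurable_restrictT _ mcl).
have aM i x : `|a i x| <= M.
  rewrite /a patchE; case: ifPn => [|_]; last by rewrite normr0.
  by rewrite inE; exact: AM.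
have a0 i x : ~ box 0 B x -> a i x = 0.
  by move=> nb; rewrite /a patchE memNset// => /OmB.
have clT := @closure_elt_sub _ _ _ _ Thm T.
have ac i y : closure (elt_set T) y -> a i x @[x --> within (elt_set T) (nbhs y)] --> a i y.
  move=> Ty; rewrite aE; last exact: clT.
  have h : A i x @[x --> within (elt_set T) (nbhs y)] --> A i y.
    move=> U /(@cA i y (clT _ Ty) U); rewrite !nbhs_simpl /within /=.
    by apply: filterS => x h Tx; apply: h; apply: clT; exact: subset_closure.
  move=> U /h; rewrite !nbhs_simpl /within/=; apply: filterS => x hx Tx.
  by rewrite aE; [exact: hx|apply: clT; exact: subset_closure].
have pn (i l : I) : i != l -> exists2 y, hyperplane (face_normal (val i)) (face_offset (val i)) y &
     ~ hyperplane (face_normal (val l)) (face_offset (val l)) y.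
  move=> il; apply: contrapT => h; move/eqP: il; apply; apply: val_inj.
  have sub : hyperplane (face_normal (val i)) (face_offset (val i)) `<=`
     hyperplane (face_normal (val l)) (face_offset (val l)).
    by move=> y hy; apply: contrapT => hn; apply: h; exists y.
  have [s s1 [f1 f2]] := unit_hyperplane_eq (face_normal1 Thm (val i)) (face_normal1 Thm (val l)) sub.
  have e : face_plane (val i) = face_plane (val l) by rewrite /face_plane f1 f2 hyperplane_sign.
  have /andP[/asboolP Ti /eqP ri] := valP i; have /andP[_ /eqP rl] := valP l.
  by rewrite -ri -rl; exact: plane_rep_eq.
have bT : closure (elt_set T) `\` elt_set T `<=` \bigcup_(i : I) hyperplane (face_normal (val i)) (face_offset (val i)).
  rewrite -(bnd_elt Thm) (bnd_elt_faces Thm) => y [F /= TF /(closure_face_plane Thm)].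
  have [_ <-] := plane_repP TF; by exists (Sub (plane_rep T F) (plane_rep_in TF)).
have Ja (i : I) := side_jump Thm reg (valP i).
have weak' phi : test_function Om phi ->
  (\int[lam]_(x in Om) (\sum_i 'D_(evec R i) phi x * a i x) =
   - \int[lam]_(x in Om) (phi x * b x))%R.
  move=> /weak <-; apply: eq_Rintegral => x; rewrite inE => Ox; apply: eq_bigr => i _.
  by rewrite aE//; exact: subset_closure.
have := @weak_ibp R d Om (elt_set T) I (fun l => face_normal (val l)) (fun l => face_offset (val l)) B
  (@elt_open _ _ _ _ Thm T) TB (fun l => face_normal1 Thm (val l)) pn bT
  (fun l => side T (-1) (val l)) (fun l => side T 1 (val l))
  (fun l => measurable_side Thm T (-1) (val l)) (fun l => measurable_side Thm T 1 (val l)) Ja a b M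
  ma aM a0 ac ib (@elt_sub_domain _ _ _ _ Omp Thm T) weak' q dq sq sdq Dq.
have -> : (\sum_i \int[lam]_(x in elt_set T) (dq i x * a i x) =
   \sum_i \int[lam]_(x in elt_set T) (dq i x * A i x))%R.
  apply: eq_bigr => i _; apply: eq_Rintegral => x; rewrite inE => Tx.
  by rewrite aE//; apply: clT; exact: subset_closure.
have [Mq Mq0 hMq] := @continuous_box_bounded R d q B (sm_continuous sq).
have mq : measurable_fun [set: 'rV[R]_d] q := continuous_measurable_rV (sm_continuous sq).
have key (l : I) i : (\int[surface (face_normal (val l)) (face_offset (val l))]_y
    (face_normal (val l) 0 i * (q y * a i y) * (side T (-1) (val l) y - side T 1 (val l) y)) =
  - \sum_(F : face Th | `[< face_of T F >] && (plane_rep T F == val l)) orient T F *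
     \int[face_measure F]_(y in face_set F) (face_normal F 0 i * (q y * A i y)))%R.
  rewrite (@side_integral (val l) (fun y => face_normal (val l) 0 i * (q y * a i y)) (`|face_normal (val l) 0 i| * (Mq * M)) (valP l)).
  - congr (- _); apply: eq_bigr => F /andP[/asboolP TF /eqP rF].
    have [s1 e1 e2] := plane_signP Thm TF; rewrite rF in e1.
    rewrite -mulrA -RintegralZl//; last 2 first.
    + exact: (measurable_face Thm).
    + apply: (@integrable_face F _ (`|face_normal (val l) 0 i| * (Mq * M)) TF) => [|y Fy].
        by apply: measurable_funTS; apply: measurable_funM => //; apply: measurable_funM.
      rewrite !normrM; apply: ler_wpM2l => //; apply: ler_pM => //.
      by apply: hMq; apply: OmB; exact: (face_sub_domain TF Fy).
    congr (_ * _); apply: eq_Rintegral => y; rewrite inE => Fy.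
    by rewrite e1 mxE aE; [ring|exact: (face_sub_domain TF Fy)].
  - by apply: measurable_funM => //; apply: measurable_funM.
  - move=> F y TF Fy; rewrite !normrM; apply: ler_wpM2l => //; apply: ler_pM => //.
    by apply: hMq; apply: OmB; exact: (face_sub_domain TF Fy).
under [X in _ + X]eq_bigr => i _ do under eq_bigr => l _ do rewrite key.
have -> : \sum_(i < d) \sum_(l : I) - (\sum_(F : face Th | `[< face_of T F >] && (plane_rep T F == val l))
     orient T F * \int[face_measure F]_(y in face_set F) (face_normal F 0 i * (q y * A i y)))%R =
  - \sum_(F : face Th | `[< face_of T F >]) orient T F *
     (\sum_i \int[face_measure F]_(y in face_set F) (face_normal F 0 i * (q y * A i y)))%R.
  under [X in - X]eq_bigr do rewrite mulr_sumr.
  rewrite [X in _ = - X]exchange_big/= -sumrN; apply: eq_bigr => i _; rewrite sumrN; congr (- _).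
  (* The faces of [T] are regrouped by the representatives of their hyperplanes. *)
  rewrite (partition_big (plane_rep T) (mem (rep_pred T)))/=; last by move=> F /asboolP; exact: plane_rep_in.
  by rewrite (big_sub (rep_pred T)).
by move=> /eqP; rewrite subr_eq => /eqP ->; rewrite addrC.
Qed.

End mesh_ibp.

(** * The fields up to the boundary of the domain *)

Section closure_fields.
Variables (R : realType) (d m : nat) (Om : set 'rV[R]_d) (D : friedrichs R d m).
Hypotheses (Omp : polytopal_domain Om) (Dok : friedrichs_ok Om D).
Local Notation C := R[i].
Local Notation rV := 'rV[R]_d.
Local Notation Re := (@complex.Re R).
Local Notation Im := (@complex.Im R).
Local Notation lam := (lebesgue_rV R d).
Implicit Types (x y : rV) (s : bool).

(** Real and imaginary parts indexed by a boolean, so that scalar integration by parts is applied to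
    both at once and sums can range over them. *)
Definition part s (z : C) : R := if s then Re z else Im z.

Lemma partB s z w : part s (z - w) = part s z - part s w.
Proof. by case: s; rewrite /= ?ReD ?ImD ?ReN ?ImN. Qed.

Lemma part_le_opnorm s (B : 'M[C]_m) a b : `|part s (B a b)| <= opnorm B.
Proof. by have [h1 h2] := entry_le_opnorm B a b; case: s. Qed.

Lemma hoelder_cvg (K : set rV) (f : rV -> R) (L : R) y :
  (forall x, K x -> `|f x - f y| <= L * Num.sqrt (enorm (x - y))) ->
  f x @[x --> within K (nbhs y)] --> f y.
Proof.
move=> hf.
have c1 : (fun x : rV => edot (x - y) (x - y)) x @[x --> y] --> edot (y - y) (y - y).
  have h : continuous (fun x : rV => edot (x - y) (x - y)).
    apply: continuous_sum_fin => i x; under eq_fun do rewrite !mxE.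
    have h : {for x, continuous (fun t : rV => t 0 i)} by exact: coord_continuous.
    exact: (cvgM (cvgB h (cvg_cst _)) (cvgB h (cvg_cst _))).
  exact: h.
have c2 : (fun x : rV => L * Num.sqrt (enorm (x - y))) x @[x --> y] --> (0 : R).
  have -> : (0 : R) = L * Num.sqrt (Num.sqrt (edot (y - y) (y - y))).
    by rewrite subrr (_ : edot 0 0 = 0) ?sqrtr0 ?mulr0// /edot big1// => i _; rewrite mxE mul0r.
  have h2 : Num.sqrt (enorm (x - y)) @[x --> y] --> Num.sqrt (Num.sqrt (edot (y - y) (y - y))).
    have sq (a : R) : {for a, continuous (@Num.sqrt R)} by move=> ?; exact: sqrt_continuous.
    have c3 : Num.sqrt (edot (x - y) (x - y)) @[x --> y] --> Num.sqrt (edot (y - y) (y - y)).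
      exact: (continuous_cvg _ (sq _) c1).
    exact: (continuous_cvg _ (sq _) c3).
  exact: (cvgM (cvg_cst L) h2).
apply/cvgrPdist_lt => e e0.
have := c2; move/cvgrPdist_lt => /(_ e e0) h.
have wK : within K (nbhs y) K by exact: withinT.
have h' : \forall t \near within K (nbhs y), `|0 - L * Num.sqrt (enorm (t - y))| < e.
  by apply: cvg_within; exact: h.
apply: filterS2 wK h' => x Kx {}h; rewrite sub0r normrN in h.
by rewrite distrC; apply: le_lt_trans (hf _ Kx) _; exact: le_lt_trans (ler_norm _) h.
Qed.

Lemma fA_hoelder i : exists L, forall x y s a b, closure Om x -> closure Om y ->
  `|part s (fA D i x a b) - part s (fA D i y a b)| <= L * Num.sqrt (enorm (x - y)).
Proof.
case: Dok => _ /(_ i)[_ _ [L hL]] _ _ _; exists L => x y s a b xO yO.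
rewrite -partB; apply: le_trans (hL _ _ xO yO).
by have := part_le_opnorm s (fA D i x - fA D i y) a b; rewrite !mxE.
Qed.

Lemma fA_cvg i s a b y : closure Om y ->
  part s (fA D i x a b) @[x --> within (closure Om) (nbhs y)] --> part s (fA D i y a b).
Proof.
by move=> yO; have [L hL] := fA_hoelder i; apply: (@hoelder_cvg _ _ L) => x xO; exact: hL.
Qed.

(** The essential bound says nothing on faces, which are null sets; a bound at every point of the
    closure comes from the Hoelder estimate with respect to one point of the bounded domain. *)
Lemma fA_bounded : exists M, forall i y s a b, closure Om y -> `|part s (fA D i y a b)| <= M.
Proof.
have [B B0 OmB] := domain_box Omp.
have [x0 Ox0] : Om !=set0 by case: Omp => -[].
have x0c : closure Om x0 := subset_closure Ox0.
have /choice[L hL] := fA_hoelder.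
pose M i s a b := `|part s (fA D i x0 a b)| + `|L i| * Num.sqrt (d%:R * (2 * B)).
have hM i y s a b : closure Om y -> `|part s (fA D i y a b)| <= M i s a b.
  move=> yO; have -> : part s (fA D i y a b) =
    part s (fA D i x0 a b) + (part s (fA D i y a b) - part s (fA D i x0 a b)) by rewrite addrC subrK.
  apply: le_trans (ler_normD _ _) _; rewrite /M lerD2l; apply: le_trans (hL i _ _ s a b yO x0c) _.
  apply: le_trans (ler_wpM2r (sqrtr_ge0 _) (ler_norm _)) _; apply: ler_wpM2l => //.
  rewrite ler_sqrt ?mulr_ge0 ?(ltW B0)//; apply: box_enorm => j.
  have := OmB _ yO j; have := OmB _ x0c j; rewrite !mxE !subr0 => h1 h2.
  by apply: le_trans (ler_normB _ _) _; rewrite mulrDl mul1r lerD.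
exists (\sum_(j : 'I_d * bool * 'I_m * 'I_m) M j.1.1.1 j.1.1.2 j.1.2 j.2) => i y s a b yO; apply: le_trans (hM _ _ s a b yO) _.
have M0 i' s' a' b' : 0 <= M i' s' a' b' by rewrite addr_ge0// mulr_ge0// sqrtr_ge0.
by rewrite (bigD1 (i, s, a, b))//= lerDl; apply: sumr_ge0 => j _.
Qed.

(** Symmetry is assumed in the open domain only; it reaches the boundary, hence the faces, by
    continuity from within. *)
Lemma fA_herm i x : closure Om x -> adjoint (fA D i x) = fA D i x.
Proof.
move=> xO; have [L hL] := fA_hoelder i.
case: Dok => _ /(_ i)[herm _ _] _ _ _.
have PF : ProperFilter (within Om (nbhs x)) by exact: within_nbhs_proper.
have cv s a b : part s (fA D i y a b) @[y --> within Om (nbhs x)] --> part s (fA D i x a b).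
  by apply: (@hoelder_cvg _ _ L) => y Oy; apply: hL => //; exact: subset_closure.
have E s a b : part s (fA D i x a b) = part s (conjc (fA D i x b a)).
  have c1 := cv s a b.
  have c2 : part s (fA D i y a b) @[y --> within Om (nbhs x)] --> part s (conjc (fA D i x b a)).
    have c3 : part s (conjc (fA D i y b a)) @[y --> within Om (nbhs x)] --> part s (conjc (fA D i x b a)).
      case: s c1 (cv s b a) => _ /=; under [X in X @ _ --> _ -> _]eq_fun do [].
        by move=> c; rewrite ReJ; under eq_fun do rewrite ReJ.
      by move=> c; rewrite ImJ; under eq_fun do rewrite ImJ; apply: cvgN.
    apply: cvg_trans c3; apply: near_eq_cvg; have wO : within Om (nbhs x) Om by exact: withinT.
    by apply: filterS wO => y Oy; rewrite -[in RHS](herm _ Oy) !mxE.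
  exact: (cvg_unique (F := (fun y => part s (fA D i y a b)) @ within Om (nbhs x)) _ c1 c2).
apply/matrixP => a b; rewrite !mxE; apply: complex_inj; [exact: esym (E true a b)|exact: esym (E false a b)].
Qed.

Lemma measurable_closure (Y : set rV) : measurable (closure Y).
Proof.
rewrite -(setCK (closure Y)); apply: measurableC; apply: open_measurable_rV.
by apply: closed_openC; exact: closed_closure.
Qed.

Lemma measurable_fA (Y : set rV) i : Y `<=` closure Om -> measurable_field Y (fA D i).
Proof.
move=> sub a b.
have h s : measurable_fun (closure Om) (fun x => part s (fA D i x a b)).
  by apply: measurable_within; [exact: measurable_closure|move=> y yO; exact: fA_cvg].
by split; [have := h true|have := h false]; apply: measurable_funS => //; exact: measurable_closure.
Qed.

Lemma fA_mulbound (mu : {measure set rV -> \bar R}) (Y : set rV) i : Y `<=` closure Om ->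
  exists M, mulbound mu Y (fA D i) M.
Proof.
move=> sub; have [M hM] := fA_bounded.
exists (\sum_(a < m) \sum_(b < m) 2 * (`|M| + `|M|)); split.
- exact: measurable_fA.
- by apply: sumr_ge0 => a _; apply: sumr_ge0 => b _; rewrite mulr_ge0// addr_ge0.
- apply: aeW => x /sub xO xi; apply: le_trans (cnorm_mulmx_entries _ _) _.
  apply: ler_wpM2r; first exact: cnorm_ge0.
  apply: ler_sum => a _; apply: ler_sum => b _; apply: ler_wpM2l => //; apply: lerD.
    by apply: le_trans (hM i x true a b xO) _; exact: ler_norm.
  by apply: le_trans (hM i x false a b xO) _; exact: ler_norm.
Qed.

Lemma bnd_matrix_mulbound (mu : {measure set rV -> \bar R}) (Y : set rV) n : Y `<=` closure Om ->
  exists M, mulbound mu Y (bnd_matrix D n) M.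
Proof.
move=> sub; have /choice[M hM] := fun i => @fA_mulbound mu Y i sub.
exists (\sum_i `|n 0 i| * M i); apply: mulbound_sum => i; exact: mulboundZ.
Qed.

Lemma bnd_matrix_herm n x : closure Om x -> adjoint (bnd_matrix D n x) = bnd_matrix D n x.
Proof.
move=> xO; apply/matrixP => a b; rewrite /bnd_matrix !mxE !summxE raddf_sum; apply: eq_bigr => i _.
by have /matrixP/(_ a b) := fA_herm i xO; rewrite !mxE => <-; rewrite /= rmorphM/= oppr0.
Qed.

End closure_fields.

Section rdot_mulmx.
Variables (R : realType) (m : nat).
Local Notation C := R[i].
Implicit Types (B : 'M[C]_m) (u w : 'cV[C]_m).

Lemma rdot_mulmx B u w :
  rdot (B *m u) w = \sum_a \sum_b complex.Re (B a b * (u b 0 * conjc (w a 0))).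
Proof.
rewrite /rdot cdotE Re_sum; apply: eq_bigr => a _; rewrite big_ord1 mxE mulr_sumr Re_sum.
by apply: eq_bigr => b _; congr complex.Re; ring.
Qed.

Lemma rdot_herm B u w : adjoint B = B -> rdot (B *m u) w = rdot (B *m w) u.
Proof.
move=> hB; rewrite !rdot_mulmx exchange_big; apply: eq_bigr => a _; apply: eq_bigr => b _.
rewrite -[in LHS]hB !mxE; set z := B a b; rewrite -[LHS]ReJ !rmorphM/= !conjcK.
by congr complex.Re; ring.
Qed.

End rdot_mulmx.

Section complex_ibp.
Variables (R : realType) (d m k : nat) (Om : set 'rV[R]_d) (Th : mesh R d) (varrho : R)
  (D : friedrichs R d m).
Hypotheses (d_gt0 : (0 < d)%N) (Omp : polytopal_domain Om) (Thm : is_mesh Om Th)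
  (reg : mesh_regularity Om Th varrho) (Dok : friedrichs_ok Om D).
Local Notation C := R[i].
Local Notation rV := 'rV[R]_d.
Local Notation Re := (@complex.Re R).
Local Notation Im := (@complex.Im R).
Local Notation lam := (lebesgue_rV R d).
Local Notation exps := {ffun 'I_d -> 'I_k.+1}.
Variables (T : elt Th) (c : exps -> 'cV[C]_m).
Implicit Types (x y : rV) (s : bool).

Let vr a : rV -> R := rpoly (fun al => Re (c al a 0)).
Let vi a : rV -> R := rpoly (fun al => Im (c al a 0)).
Let dvr i a : rV -> R := rpoly (dcoef (V := R^o) i (fun al => Re (c al a 0))).
Let dvi i a : rV -> R := rpoly (dcoef (V := R^o) i (fun al => Im (c al a 0))).

(* The real and imaginary parts of v_b * conj v_a, the latter with the opposite sign. *)
Let q s a b x : R :=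
  if s then vr b x * vr a x + vi b x * vi a x else vr b x * vi a x - vi b x * vr a x.
Let dq s a b i x : R :=
  if s then (dvr i b x * vr a x + vr b x * dvr i a x) + (dvi i b x * vi a x + vi b x * dvi i a x)
  else (dvr i b x * vi a x + vr b x * dvi i a x) - (dvi i b x * vr a x + vi b x * dvr i a x).

Let smN (f : rV -> R) : sm f -> sm (fun x => - f x).
Proof.
by move=> sf; under eq_fun do rewrite -mulN1r; apply: sm_mul => //; exact: sm_cst.
Qed.

Let sm_q s a b : sm (q s a b).
Proof.
have sr a' := @sm_rpoly R d k (fun al => Re (c al a' 0)).
have si a' := @sm_rpoly R d k (fun al => Im (c al a' 0)).
case: s; first exact: (sm_add (sm_mul (sr b) (sr a)) (sm_mul (si b) (si a))).
exact: (sm_add (sm_mul (sr b) (si a)) (smN (sm_mul (si b) (sr a)))).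
Qed.

Let sm_dq s a b i : sm (dq s a b i).
Proof.
have sr cf := @sm_rpoly R d k cf.
case: s.
  exact: (sm_add (sm_add (sm_mul (sr _) (sr _)) (sm_mul (sr _) (sr _)))
                 (sm_add (sm_mul (sr _) (sr _)) (sm_mul (sr _) (sr _)))).
exact: (sm_add (sm_add (sm_mul (sr _) (sr _)) (sm_mul (sr _) (sr _)))
               (smN (sm_add (sm_mul (sr _) (sr _)) (sm_mul (sr _) (sr _))))).
Qed.

Let is_derive_q s a b i x : is_derive x (evec R i) (q s a b) (dq s a b i x).
Proof.
have hr a' : is_derive x (evec R i) (vr a') (dvr i a' x) := is_derive_rpoly _ i x.
have hi a' : is_derive x (evec R i) (vi a') (dvi i a' x) := is_derive_rpoly _ i x.
case: s; rewrite /q /dq.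
  have h := is_deriveD (is_deriveM (hr b) (hr a)) (is_deriveM (hi b) (hi a)).
  by apply: (is_derive_eq h); rewrite /GRing.scale/=; ring.
have h := is_deriveB (is_deriveM (hr b) (hi a)) (is_deriveM (hi b) (hr a)).
by apply: (is_derive_eq h); rewrite /GRing.scale/=; ring.
Qed.

Let rdot_q (B : 'M[C]_m) x :
  rdot (B *m pfield c x) (pfield c x) = \sum_s \sum_a \sum_b part s (B a b) * q s a b x.
Proof.
rewrite rdot_mulmx big_bool/= -big_split; apply: eq_bigr => a _ /=.
rewrite -big_split; apply: eq_bigr => b _ /=.
rewrite ReM ReM ImM ReJ ImJ !Re_pfield !Im_pfield /q -!/(vr _ _) -!/(vi _ _).
by ring.
Qed.

(** Differentiating the quadratic form of a constant Hermitian matrix gives two terms with the same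
    real part, whence the factor 2. *)
Let rdot_dq (B : 'M[C]_m) i x : adjoint B = B ->
  2 * rdot (B *m pfield (dcoefC i c) x) (pfield c x) =
  \sum_s \sum_a \sum_b part s (B a b) * dq s a b i x.
Proof.
move=> hB; have -> : 2 * rdot (B *m pfield (dcoefC i c) x) (pfield c x) =
  rdot (B *m pfield (dcoefC i c) x) (pfield c x) + rdot (B *m pfield c x) (pfield (dcoefC i c) x).
  by rewrite (rdot_herm (pfield c x) _ hB) mulr2n mulrDl mul1r.
have eR a : Re (pfield (dcoefC i c) x a 0) = dvr i a x.
  rewrite Re_pfield; congr (rpoly _ x); apply/funext => be; rewrite /dcoef /dcoefC summxE Re_sum.
  by apply: eq_bigr => al _; case: ifP => _; rewrite !mxE ?ReZ.
have eI a : Im (pfield (dcoefC i c) x a 0) = dvi i a x.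
  rewrite Im_pfield; congr (rpoly _ x); apply/funext => be; rewrite /dcoef /dcoefC summxE Im_sum.
  by apply: eq_bigr => al _; case: ifP => _; rewrite !mxE ?ImZ.
rewrite !rdot_mulmx big_bool/= -!big_split; apply: eq_bigr => a _ /=.
rewrite -!big_split; apply: eq_bigr => b _ /=.
rewrite !ReM !ImM !ReJ !ImJ !eR !eI !Re_pfield !Im_pfield /dq -!/(vr _ _) -!/(vi _ _).
by ring.
Qed.

Lemma fdivA_mulbound : exists M, mulbound lam (elt_set T) (fdivA D) M.
Proof.
case: Dok => _ _ [hG _] _ _; exists (Linf_norm lam Om (fdivA D)).
apply: mulboundS (Linf_mulbound hG); last exact: (@elt_sub_domain _ _ _ _ Omp Thm T).
by apply: open_measurable_rV; case: Omp => /polytopal_open.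
Qed.

Lemma inL2_pfield_face (F : face Th) p (c' : exps -> 'cV[C]_p) : face_of T F ->
  inL2 (face_measure F) (face_set F) (pfield c').
Proof.
move=> TF; have [B B0 OmB] := domain_box Omp.
apply: (@inL2_pfield R d k (face_measure F) (face_set F) p 1 c' B).
- exact: (measurable_face Thm).
- exact: (face_measure_lty d_gt0 Omp Thm TF).
- by apply: subset_trans OmB; exact: (face_sub_domain Thm TF).
Qed.

Lemma lam_elt_lty : (lam (elt_set T) < +oo)%E.
Proof.
have [x Tx] := elt_neq0 Thm T.
apply: (@le_lt_trans _ _ (lam (box x (hT T)))); last first.
  by rewrite lebesgue_rV_box ?ltry// ltW// (hT_gt0 d_gt0 Omp Thm).
apply: le_measure; rewrite ?inE; [exact: (measurable_elt Thm)|exact: measurable_box|].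
by apply: subset_trans (closure_elt_box Omp Thm Tx); exact: subset_closure.
Qed.

Lemma inL2_pfield_elt p q' (c' : exps -> 'M[C]_(p, q')) : inL2 lam (elt_set T) (pfield c').
Proof.
have [B B0 OmB] := domain_box Omp.
apply: (@inL2_pfield R d k lam (elt_set T) p q' c' B).
- exact: (measurable_elt Thm).
- exact: lam_elt_lty.
- apply: subset_trans OmB; apply: subset_trans (@closure_elt_sub _ _ _ _ Thm T); exact: subset_closure.
Qed.

Definition A1p x : 'cV[C]_m := \sum_i fA D i x *m pfield (dcoefC i c) x.

(** The quadratic form of [fA D i] at [v] is a sum of real scalar entries times the polynomials [q];
    [mesh_ibp_real] is applied to each entry with [q] as test polynomial, and [rdot_dq] reassembles
    the volume term. *)
Lemma element_ibp :
  2 * rip lam (elt_set T) A1p (pfield c) =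
  \sum_(F : face Th | `[< face_of T F >]) orient T F *
     rip (face_measure F) (face_set F) (Defs.mulf (Defs.NF D F) (pfield c)) (pfield c)
  - rip lam (elt_set T) (Defs.mulf (fdivA D) (pfield c)) (pfield c).
Proof.
have mT := measurable_elt Thm T.
have TOm : elt_set T `<=` closure Om by apply: subset_trans (@closure_elt_sub _ _ _ _ Thm T); exact: subset_closure.
have [M hM] := fA_bounded Omp Dok.
have [MG [mG MG0 hG]] := fdivA_mulbound.
have hG' s a b : {ae lam, forall x, elt_set T x -> `|part s (fdivA D x a b)| <= MG}.
  apply: filterS hG => x h /h hx; by have [h1 h2] := entry_le_bound a b hx; case: s.
have mGp s a b : measurable_fun (elt_set T) (fun x => part s (fdivA D x a b)).
  by have [h1 h2] := mG a b; case: s.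
have mAp (Y : set rV) i s a b : Y `<=` closure Om -> measurable_fun Y (fun x => part s (fA D i x a b)).
  by move=> sub; have [h1 h2] := measurable_fA Dok i sub a b; case: s.
have [B B0 OmB] := domain_box Omp.
have intT (f : rV -> R) N : measurable_fun (elt_set T) f -> {ae lam, forall x, elt_set T x -> `|f x| <= N} ->
    lam.-integrable (elt_set T) (EFin \o f).
  move=> mf fN; apply/integrableP; split; first exact/measurable_EFinP.
  apply: (@le_lt_trans _ _ (\int[lam]_(y in elt_set T) (`|N|)%:E)%E).
    apply: ae_ge0_le_integral => //.
    - by apply/measurable_EFinP; exact: measurableT_comp.
    - by apply: filterS fN => y h Fy; rewrite lee_fin; apply: le_trans (h Fy) (ler_norm _).
  by rewrite (integral_cst _ mT); apply: lte_mul_pinfty => //; exact: lam_elt_lty.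
have bq s a b := @continuous_box_bounded R d (q s a b) B (sm_continuous (sm_q s a b)).
have bdq s a b i := @continuous_box_bounded R d (dq s a b i) B (sm_continuous (sm_dq s a b i)).
have mq s a b : measurable_fun [set: rV] (q s a b) := continuous_measurable_rV (sm_continuous (sm_q s a b)).
have mdq s a b i : measurable_fun [set: rV] (dq s a b i) := continuous_measurable_rV (sm_continuous (sm_dq s a b i)).
have iT1 s a b i : lam.-integrable (elt_set T) (EFin \o (fun x => dq s a b i x * part s (fA D i x a b))).
  have [N N0 hN] := bdq s a b i.
  apply: (intT _ (N * M)); first by apply: measurable_funM; [exact: measurable_funTS|exact: mAp].
  apply: aeW => x Tx; rewrite normrM; apply: ler_pM => //; last exact: hM (TOm _ Tx).
  by apply: hN; exact: OmB (TOm _ Tx).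
have iT2 s a b : lam.-integrable (elt_set T) (EFin \o (fun x => q s a b x * part s (fdivA D x a b))).
  have [N N0 hN] := bq s a b.
  apply: (intT _ (N * MG)); first by apply: measurable_funM => //; exact: measurable_funTS.
  apply: filterS (hG' s a b) => x h Tx; rewrite normrM; apply: ler_pM => //; last exact: h.
  by apply: hN; exact: OmB (TOm _ Tx).
have iF F s a b i : face_of T F -> (face_measure F).-integrable (face_set F)
    (EFin \o (fun y => face_normal F 0 i * (q s a b y * part s (fA D i y a b)))).
  move=> TF; have [N N0 hN] := bq s a b; have FOm := face_sub_domain Thm TF.
  apply: (integrable_face d_gt0 Omp Thm (N := `|face_normal F 0 i| * (N * M)) TF).
    by apply: measurable_funM => //; apply: measurable_funM; [exact: measurable_funTS|exact: mAp].
  move=> y Fy; rewrite !normrM; apply: ler_wpM2l => //; apply: ler_pM => //; last exact: hM (FOm _ Fy).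
  by apply: hN; exact: OmB (FOm _ Fy).
have ibG s a b : lam.-integrable (elt_set T) (EFin \o (fun x => part s (fdivA D x a b))).
  exact: intT (mGp s a b) (hG' s a b).
have weak s a b phi : test_function Om phi ->
  (\int[lam]_(x in Om) (\sum_i 'D_(evec R i) phi x * part s (fA D i x a b)) =
   - \int[lam]_(x in Om) (phi x * part s (fdivA D x a b)))%R.
  move=> tphi; have [_ _ [_ wd] _ _] := Dok; have := wd _ tphi a b.
  case: s => e.
    move: (congr1 Re e) => /= e'.
    transitivity (\int[lam]_(x in Om) Re (\sum_i ('D_(evec R i) phi x)%:C%C * fA D i x a b))%R.
      by apply: eq_Rintegral => x _; rewrite Re_sum; apply: eq_bigr => i _; rewrite ReZ.
    rewrite e'; congr (- _); by apply: eq_Rintegral => x _; rewrite ReZ.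
  move: (congr1 Im e) => /= e'.
  transitivity (\int[lam]_(x in Om) Im (\sum_i ('D_(evec R i) phi x)%:C%C * fA D i x a b))%R.
    by apply: eq_Rintegral => x _; rewrite Im_sum; apply: eq_bigr => i _; rewrite ImZ.
  rewrite e'; congr (- _); by apply: eq_Rintegral => x _; rewrite ImZ.
have main s a b := @mesh_ibp_real R d Om Th varrho d_gt0 Omp Thm reg T
  (fun i x => part s (fA D i x a b)) (fun x => part s (fdivA D x a b)) M
  (fun i y yO => @fA_cvg _ _ _ _ _ Dok i s a b y yO) (fun i y yO => hM i y s a b yO) (ibG s a b)
  (weak s a b) _ _ (sm_q s a b) (sm_dq s a b) (is_derive_q s a b).
have -> : 2 * rip lam (elt_set T) A1p (pfield c) =
  \sum_s \sum_a \sum_b \sum_i (\int[lam]_(x in elt_set T) (dq s a b i x * part s (fA D i x a b)))%R.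
  have E x : elt_set T x -> rdot (A1p x) (pfield c x) =
    2^-1 * \sum_s \sum_a \sum_b \sum_i dq s a b i x * part s (fA D i x a b).
    move=> Tx; rewrite /A1p.
    have -> : rdot (\sum_i fA D i x *m pfield (dcoefC i c) x) (pfield c x) =
      \sum_i rdot (fA D i x *m pfield (dcoefC i c) x) (pfield c x).
      by apply: (big_morph (fun u => rdot u (pfield c x))); [move=> u w; exact: rdotDl|exact: rdot0l].
    apply: (@mulfI _ 2) => //; rewrite mulrA divff// mul1r mulr_sumr.
    under eq_bigr => i _ do rewrite (rdot_dq _ _ (fA_herm Dok i (TOm _ Tx))).
    rewrite exchange_big; apply: eq_bigr => s _; rewrite exchange_big; apply: eq_bigr => a _.
    rewrite exchange_big; apply: eq_bigr => b _; by apply: eq_bigr => i _; rewrite mulrC.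
  rewrite /rip (@eq_Rintegral _ _ _ _ _ (fun x => 2^-1 * \sum_s \sum_a \sum_b \sum_i dq s a b i x * part s (fA D i x a b))); last first.
    by move=> x; rewrite inE => /E.
  have i1 s a b := integrable_sumR (index_enum _) xpredT mT (iT1 s a b).
  have i2 s a := integrable_sumR (index_enum _) xpredT mT (i1 s a).
  have i3 s := integrable_sumR (index_enum _) xpredT mT (i2 s).
  have i4 := integrable_sumR (index_enum _) xpredT mT i3.
  rewrite RintegralZl// mulrA divff// mul1r Rintegral_sum//; apply: eq_bigr => s _.
  rewrite Rintegral_sum//; apply: eq_bigr => a _.
  rewrite Rintegral_sum//; apply: eq_bigr => b _.
  by rewrite Rintegral_sum.
under eq_bigr => s _ do under eq_bigr => a _ do under eq_bigr => b _ do rewrite main.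
have -> : rip lam (elt_set T) (Defs.mulf (fdivA D) (pfield c)) (pfield c) =
  \sum_s \sum_a \sum_b (\int[lam]_(x in elt_set T) (q s a b x * part s (fdivA D x a b)))%R.
  have i2 s a := integrable_sumR (index_enum _) xpredT mT (iT2 s a).
  have i3 s := integrable_sumR (index_enum _) xpredT mT (i2 s).
  rewrite /rip (@eq_Rintegral _ _ _ _ _ (fun x => \sum_s \sum_a \sum_b q s a b x * part s (fdivA D x a b))); last first.
    move=> x _; rewrite /Defs.mulf rdot_q; apply: eq_bigr => s _; apply: eq_bigr => a _; apply: eq_bigr => b _.
    by rewrite mulrC.
  rewrite Rintegral_sum//; apply: eq_bigr => s _.
  by rewrite Rintegral_sum//; apply: eq_bigr => a _; rewrite Rintegral_sum.
have FE F : face_of T F -> rip (face_measure F) (face_set F) (Defs.mulf (Defs.NF D F) (pfield c)) (pfield c) =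
  \sum_s \sum_a \sum_b \sum_i (\int[face_measure F]_(y in face_set F) (face_normal F 0 i * (q s a b y * part s (fA D i y a b))))%R.
  move=> TF; have mF := measurable_face Thm F.
  have i1 s a b := integrable_sumR (index_enum _) xpredT mF (fun i => iF F s a b i TF).
  have i2 s a := integrable_sumR (index_enum _) xpredT mF (i1 s a).
  have i3 s := integrable_sumR (index_enum _) xpredT mF (i2 s).
  rewrite /rip (@eq_Rintegral _ _ _ _ _ (fun x => \sum_s \sum_a \sum_b \sum_i face_normal F 0 i * (q s a b x * part s (fA D i x a b)))); last first.
    move=> x _; rewrite /Defs.mulf rdot_q; apply: eq_bigr => s _; apply: eq_bigr => a _; apply: eq_bigr => b _.
    rewrite /Defs.NF /bnd_matrix summxE.
    have -> : part s (\sum_i ((face_normal F 0 i)%:C%C *: fA D i x) a b) = \sum_i face_normal F 0 i * part s (fA D i x a b).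
      by case: s; rewrite /= ?Re_sum ?Im_sum; apply: eq_bigr => i _; rewrite mxE ?ReZ ?ImZ.
    by rewrite mulr_suml; apply: eq_bigr => i _; rewrite -mulrA; congr (_ * _); rewrite mulrC.
  rewrite Rintegral_sum//; apply: eq_bigr => s _.
  rewrite Rintegral_sum//; apply: eq_bigr => a _.
  rewrite Rintegral_sum//; apply: eq_bigr => b _.
  by rewrite Rintegral_sum// => i; exact: iF.
under [in RHS]eq_bigr => F /asboolP TF do rewrite (FE F TF).
under eq_bigr => s _ do under eq_bigr => a _ do rewrite sumrB.
under eq_bigr => s _ do rewrite sumrB.
rewrite sumrB; congr (_ - _).
under [RHS]eq_bigr do rewrite mulr_sumr.
rewrite [RHS]exchange_big; apply: eq_bigr => s _.
under [RHS]eq_bigr do rewrite mulr_sumr.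
rewrite [RHS]exchange_big; apply: eq_bigr => a _.
under [RHS]eq_bigr do rewrite mulr_sumr.
by rewrite [RHS]exchange_big.
Qed.

End complex_ibp.

(** * Element estimates *)

Section real_inequalities.
Variable R : realType.
Implicit Types (a b c X E S Z L K rho : R).

Lemma sum_cs (I : finType) (P : pred I) (x y : I -> R) :
  \sum_(i | P i) x i * y i <= Num.sqrt (\sum_(i | P i) x i ^+ 2) * Num.sqrt (\sum_(i | P i) y i ^+ 2).
Proof.
have x0 : 0 <= \sum_(i | P i) x i ^+ 2 by apply: sumr_ge0 => i _; exact: sqr_ge0.
have y0 : 0 <= \sum_(i | P i) y i ^+ 2 by apply: sumr_ge0 => i _; exact: sqr_ge0.
apply: le_trans (ler_norm _) _; rewrite -sqrtrM// -sqrtr_sqr ler_sqrt ?mulr_ge0//.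
apply: discriminant_le => // t.
rewrite mulr_sumr !mulr_suml -!big_split/=; apply: sumr_ge0 => i _.
have -> : x i ^+ 2 + 2 * (x i * y i) * t + y i ^+ 2 * t ^+ 2 = (x i + t * y i) ^+ 2 by ring.
exact: sqr_ge0.
Qed.

(** Absorption by Young's inequality. With [G = E + S] and [P = rho + K1 + K2], the remainders are
    at most [P X G + P^2 G^2]; half of [X^2] absorbs the first, and [G^2 <= 2 (E^2 + S^2)] turns the
    resulting 3 into 6. *)
Lemma streamline_real X E S Z L K1 K2 rho : 0 <= X -> 0 <= E -> 0 <= S -> 0 <= K1 -> 0 <= K2 ->
  0 <= rho -> Z <= X + K1 * E ->
  X ^+ 2 - K1 * X * E - Z * (rho * E + K2 * E + K2 * S) <= L ->
  X ^+ 2 <= 2 * L + 6 * (rho + K1 + K2) ^+ 2 * (E ^+ 2 + S ^+ 2).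
Proof.
move=> X0 E0 S0 K10 K20 r0 hZ hL.
pose G := E + S; pose P := rho + K1 + K2.
have G0 : 0 <= G by rewrite addr_ge0.
have P0 : 0 <= P by rewrite !addr_ge0.
have EG : E <= G by rewrite lerDl.
have SG : S <= G by rewrite lerDr.
have h1 : Z * (rho * E + K2 * E + K2 * S) <= (X + K1 * G) * ((rho + K2) * G).
  apply: (@le_trans _ _ ((X + K1 * E) * (rho * E + K2 * E + K2 * S))).
    by apply: ler_wpM2r => //; rewrite !addr_ge0 ?mulr_ge0.
  apply: ler_pM; rewrite ?addr_ge0 ?mulr_ge0// ?lerD2l ?ler_wpM2l//.
  rewrite mulrDl -addrA; apply: lerD; first exact: ler_wpM2l.
  by rewrite /G mulrDr.
have h2 : K1 * X * E <= K1 * X * G by apply: ler_wpM2l => //; exact: mulr_ge0.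
have h3 : (X + K1 * G) * ((rho + K2) * G) + K1 * X * G <= P * X * G + P ^+ 2 * G ^+ 2.
  have -> : (X + K1 * G) * ((rho + K2) * G) + K1 * X * G = P * X * G + K1 * (rho + K2) * G ^+ 2.
    by rewrite /P; ring.
  rewrite lerD2l; apply: ler_wpM2r; first exact: sqr_ge0.
  rewrite expr2; apply: ler_pM => //; rewrite ?addr_ge0// /P; clear -r0 K10 K20; lra.
have h4 : G ^+ 2 <= 2 * (E ^+ 2 + S ^+ 2).
  have := sqr_ge0 (E - S); rewrite /G !expr2 => ?; nra.
have h5 : P * X * G <= 2^-1 * X ^+ 2 + 2^-1 * (P ^+ 2 * G ^+ 2).
  have := sqr_ge0 (X - P * G); rewrite !expr2 => ?; nra.
have h6 : P ^+ 2 * G ^+ 2 <= P ^+ 2 * (2 * (E ^+ 2 + S ^+ 2)).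
  by apply: ler_wpM2l => //; exact: sqr_ge0.
rewrite -/P.
have -> : 6 * P ^+ 2 * (E ^+ 2 + S ^+ 2) = 3 * (P ^+ 2 * (2 * (E ^+ 2 + S ^+ 2))) by ring.
move: h6 h5 h3 h2 h1 hL.
move: (P ^+ 2 * (2 * (E ^+ 2 + S ^+ 2))) (P ^+ 2 * G ^+ 2) (P * X * G) (K1 * X * E) (K1 * X * G)
  ((X + K1 * G) * ((rho + K2) * G)) (Z * (rho * E + K2 * E + K2 * S)) (X ^+ 2) => *.
lra.
Qed.

Lemma eq_Rintegral_ae d (T : measurableType d) (mu : {measure set T -> \bar R}) (D : set T)
    (f g : T -> R) : measurable D -> mu.-integrable D (EFin \o f) -> mu.-integrable D (EFin \o g) ->
  {ae mu, forall x, D x -> f x = g x} -> (\int[mu]_(x in D) f x = \int[mu]_(x in D) g x)%R.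
Proof.
move=> mD fi gi fg; apply/eqP; rewrite eq_le; apply/andP; split; apply: le_Rintegral_ae => //.
  by apply: filterS fg => x h Dx; rewrite h.
by apply: filterS fg => x h Dx; rewrite h.
Qed.

End real_inequalities.

Section psd_fields.
Variables (R : realType) (d m : nat) (mu : {measure set 'rV[R]_d -> \bar R}) (Y : set 'rV[R]_d)
  (S : 'rV[R]_d -> 'M[R[i]]_m).
Hypotheses (mY : measurable Y) (hS : inLinf mu Y S)
  (psd : {ae mu, forall x, Y x -> hermitian_psd (S x)}).

Lemma inL2_Linf (f : 'rV[R]_d -> 'cV[R[i]]_m) : inL2 mu Y f -> inL2 mu Y (Defs.mulf S f).
Proof. by move=> hf; have [] := inL2_mulbound mY (Linf_mulbound hS) hf. Qed.

Lemma rip_psd_ge0 (f : 'rV[R]_d -> 'cV[R[i]]_m) : inL2 mu Y f ->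
  0 <= rip mu Y (Defs.mulf S f) f.
Proof.
move=> hf; apply: Rintegral_ge0_ae => //; first exact: integrable_rdot (inL2_Linf hf) hf.
apply: filterS psd => x h /h[_ /(_ (f x))]; rewrite lecE => /andP[_].
exact.
Qed.

Lemma rip_psd_le (f g : 'rV[R]_d -> 'cV[R[i]]_m) : inL2 mu Y f -> inL2 mu Y g ->
  `|rip mu Y (Defs.mulf S f) g| <=
  Num.sqrt (rip mu Y (Defs.mulf S f) f) * Num.sqrt (rip mu Y (Defs.mulf S g) g).
Proof.
move=> hf hg; apply: (rip_psd_cs mY hf hg (inL2_Linf hf) (inL2_Linf hg)).
- apply: eq_Rintegral_ae => //.
  + exact: integrable_rdot (inL2_Linf hf) hg.
  + exact: integrable_rdot (inL2_Linf hg) hf.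
  + by apply: filterS psd => x h /h[hx _]; exact: rdot_herm.
- move=> t; have hfg := inL2D mY hf (inL2Z mY t%:C%C hg).
  have -> : (fun x => Defs.mulf S f x + t%:C%C *: Defs.mulf S g x) =
            Defs.mulf S (fun x => f x + t%:C%C *: g x).
    by apply/funext => x; rewrite /Defs.mulf mulmxDr scalemxAr.
  exact: rip_psd_ge0 hfg.
- exact: rip_psd_ge0.
- exact: rip_psd_ge0.
Qed.

End psd_fields.

(** * Means of the fields on an element *)

Section mean_field.
Variables (R : realType) (d m : nat) (Om : set 'rV[R]_d) (Th : mesh R d) (D : friedrichs R d m) (CA : R).
Hypotheses (d_gt0 : (0 < d)%N) (Omp : polytopal_domain Om) (Thm : is_mesh Om Th)
  (Dok : friedrichs_ok Om D) (CA0 : 0 <= CA) (hCA : hoelder_constant D Th CA).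
Local Notation C := R[i].
Local Notation rV := 'rV[R]_d.
Local Notation lam := (lebesgue_rV R d).
Variable T : elt Th.

Let mT : measurable (elt_set T). Proof. exact: (measurable_elt Thm T). Qed.

Lemma elt_sub_closure : elt_set T `<=` closure Om.
Proof. by apply: subset_trans (@closure_elt_sub _ _ _ _ Thm T); exact: subset_closure. Qed.

Lemma lam_elt_gt0 : (0 < lam (elt_set T))%E.
Proof. apply: measure_open_gt0; [exact: (elt_open Thm)|exact: (elt_neq0 Thm)]. Qed.

Definition meanA i : 'M[C]_m := \matrix_(a, b)
  Complex ((\int[lam]_(x in elt_set T) complex.Re (fA D i x a b))%R / fine (lam (elt_set T)))
          ((\int[lam]_(x in elt_set T) complex.Im (fA D i x a b))%R / fine (lam (elt_set T))).

Lemma fine_lam_gt0 : 0 < fine (lam (elt_set T)).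
Proof. by apply: fine_gt0; rewrite lam_elt_gt0 (lam_elt_lty d_gt0 Omp Thm). Qed.

Lemma integrable_fA i s a b :
  lam.-integrable (elt_set T) (EFin \o (fun x => part s (fA D i x a b))).
Proof.
have [M hM] := fA_bounded Omp Dok.
apply/integrableP; split.
  by apply/measurable_EFinP; have [h1 h2] := measurable_fA Dok i elt_sub_closure a b; case: s.
apply: (@le_lt_trans _ _ (\int[lam]_(y in elt_set T) (`|M|)%:E)%E).
  apply: ge0_le_integral => //.
  - apply/measurable_EFinP; apply: measurableT_comp => //.
    by have [h1 h2] := measurable_fA Dok i elt_sub_closure a b; case: s.
  - by move=> y Ty; rewrite lee_fin; apply: le_trans (hM i y s a b (elt_sub_closure Ty)) (ler_norm _).
by rewrite (integral_cst _ mT); apply: lte_mul_pinfty => //; exact: (lam_elt_lty d_gt0 Omp Thm).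
Qed.

Lemma integrable_elt_cst (e : R) : lam.-integrable (elt_set T) (EFin \o cst e).
Proof.
apply/integrableP; split; first by apply/measurable_EFinP; exact: measurable_cst.
rewrite (_ : (fun x => _) = cst `|e|%:E)// (integral_cst _ mT).
by apply: lte_mul_pinfty => //; exact: (lam_elt_lty d_gt0 Omp Thm).
Qed.

Lemma pfield0 p q (c : {ffun 'I_d -> 'I_1} -> 'M[C]_(p, q)) x :
  pfield c x = c [ffun=> ord0].
Proof.
rewrite /pfield (big_pred1 [ffun=> ord0]) => [|al].
  by rewrite big1 ?scale1r// => i _; rewrite ffunE expr0.
have -> : al = [ffun=> ord0] by apply/ffunP => i; rewrite ffunE; exact: ord1.
by rewrite /= eqxx big1// => i _; rewrite ffunE.
Qed.

(** [hoelder_constant] speaks of any function satisfying [is_L2proj], so the mean has to be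
    exhibited as one before the bound can be used. *)
Lemma mean_is_L2proj i : is_L2proj lam 0 (elt_set T) (fA D i)
  (prestr (elt_set T) (fun _ : {ffun 'I_d -> 'I_1} => meanA i)).
Proof.
split => [|Q /PkE[c ->]]; first exact: Pk_prestr.
set q := c [ffun=> ord0].
have E x : elt_set T x -> cdot (fA D i x - prestr (elt_set T) (fun _ : {ffun 'I_d -> 'I_1} => meanA i) x)
    (prestr (elt_set T) c x) = \sum_a \sum_b conjc (q a b) * (fA D i x a b - meanA i a b).
  move=> Tx; have cT := @subset_closure _ (elt_set T) _ Tx.
  by rewrite !prestrE// !pfield0 cdotE; apply: eq_bigr => a _; apply: eq_bigr => b _; rewrite !mxE.
have lT := fine_lam_gt0.
have Z s a b : (\int[lam]_(x in elt_set T) (part s (fA D i x a b) - part s (meanA i a b)) = 0)%R.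
  have ic := integrable_elt_cst (part s (meanA i a b)).
  rewrite RintegralB//; last exact: integrable_fA.
  rewrite Rintegral_cst//; case: s {ic} => /=; by rewrite mxE /= divfK ?subrr// gt_eqF.
have iZ s a b : lam.-integrable (elt_set T) (EFin \o (fun x => part s (fA D i x a b) - part s (meanA i a b))).
  have ic := integrable_elt_cst (part s (meanA i a b)).
  exact: (integrableB mT (integrable_fA i s a b) ic).
have Zl s a b (e : R) : lam.-integrable (elt_set T) (EFin \o (fun x => e * (part s (fA D i x a b) - part s (meanA i a b)))).
  exact: (integrableZl mT e (iZ s a b)).
have Z0 s a b (e : R) : (\int[lam]_(x in elt_set T) (e * (part s (fA D i x a b) - part s (meanA i a b))) = 0)%R.
  by rewrite RintegralZl// Z mulr0.
apply: complex_inj => /=.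
  rewrite (@eq_Rintegral _ _ _ _ _ (fun x => \sum_a \sum_b
     (complex.Re (q a b) * (part true (fA D i x a b) - part true (meanA i a b)) +
      complex.Im (q a b) * (part false (fA D i x a b) - part false (meanA i a b))))); last first.
    move=> x; rewrite inE => /E ->; rewrite Re_sum; apply: eq_bigr => a _; rewrite Re_sum; apply: eq_bigr => b _.
    by rewrite ReM ReJ ImJ ReD ReN ImD ImN /=; ring.
  have i1 a b := integrableD mT (Zl true a b (complex.Re (q a b))) (Zl false a b (complex.Im (q a b))).
  have i2 a := integrable_sumR (index_enum _) xpredT mT (i1 a).
  rewrite Rintegral_sum//; apply: big1 => a _.
rewrite Rintegral_sum//; last exact: i1 a.
apply: big1 => b _.
  by rewrite RintegralD// !Z0 addr0.
rewrite (@eq_Rintegral _ _ _ _ _ (fun x => \sum_a \sum_b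
     (complex.Re (q a b) * (part false (fA D i x a b) - part false (meanA i a b)) +
      (- complex.Im (q a b)) * (part true (fA D i x a b) - part true (meanA i a b))))); last first.
  move=> x; rewrite inE => /E ->; rewrite Im_sum; apply: eq_bigr => a _; rewrite Im_sum; apply: eq_bigr => b _.
  by rewrite ImM ReJ ImJ ReD ReN ImD ImN /=; ring.
have i1 a b := integrableD mT (Zl false a b (complex.Re (q a b))) (Zl true a b (- complex.Im (q a b))).
have i2 a := integrable_sumR (index_enum _) xpredT mT (i1 a).
rewrite Rintegral_sum//; apply: big1 => a _.
rewrite Rintegral_sum//; last exact: i1 a.
apply: big1 => b _.
by rewrite RintegralD// !Z0 addr0.
Qed.

Lemma mulbound_le (mu : {measure set rV -> \bar R}) Y p q (B : rV -> 'M[C]_(p, q)) M N :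
  M <= N -> mulbound mu Y B M -> mulbound mu Y B N.
Proof.
move=> MN [mB M0 hB]; split => //; first exact: le_trans MN.
by apply: filterS hB => x h Yx xi; apply: le_trans (h Yx xi) _; rewrite ler_wpM2r// cnorm_ge0.
Qed.

Lemma mulbound_cst (mu : {measure set rV -> \bar R}) Y p q (B : 'M[C]_(p, q)) : measurable Y ->
  mulbound mu Y (fun=> B) (opnorm B).
Proof.
move=> mY; split.
- by move=> a b; split; exact: measurable_cst.
- exact: opnorm_ge0.
- by apply: aeW => x _ xi; exact: cnorm_mulmx.
Qed.

Lemma eq_mulbound (mu : {measure set rV -> \bar R}) Y p q (B B' : rV -> 'M[C]_(p, q)) M :
  (forall x, Y x -> B x = B' x) -> mulbound mu Y B M -> mulbound mu Y B' M.
Proof.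
move=> BB [mB M0 hB]; split; [|exact: M0|].
  move=> a b; have [m1 m2] := mB a b; split; [move: m1|move: m2]; apply: eq_measurable_fun => x;
    by rewrite inE => Yx; rewrite (BB x Yx).
by apply: filterS hB => x h Yx xi; rewrite -(BB x Yx); exact: (h Yx xi).
Qed.

Lemma mean_diff_bound i : mulbound lam (elt_set T) (fun x => fA D i x - meanA i)
  (CA * Num.sqrt (rflat D * aT D T * hT T)).
Proof.
have [M hM] := fA_mulbound Omp Dok lam i elt_sub_closure.
pose P : rV -> 'M[C]_m := prestr (elt_set T) (fun _ : {ffun 'I_d -> 'I_1} => meanA i).
have PE x : elt_set T x -> P x = meanA i.
  by move=> Tx; rewrite /P prestrE ?pfield0//; exact: subset_closure.
(* Some finite bound comes first: [Linf_norm] is the [fine] part of an extended real, and says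
   nothing about the field as long as that could be infinite. *)
have hP : mulbound lam (elt_set T) (fun x => P x - fA D i x) (opnorm (meanA i) + `|-1| * M).
  apply: (@eq_mulbound _ _ _ _ (fun x => meanA i + (-1)%:C%C *: fA D i x)).
    by move=> x Tx; rewrite PE// rmorphN rmorph1 scaleN1r.
  apply: mulboundD; [exact: mulbound_cst|exact: mulboundZ].
have [iP _] := mulbound_Linf hP.
have := mulbound_le (hCA (mean_is_L2proj i)) (Linf_mulbound iP).
move=> /(mulboundZ (-1)); rewrite normrN1 mul1r.
by apply: eq_mulbound => x Tx; rewrite -/P PE// rmorphN rmorph1 scaleN1r opprB.
Qed.

Lemma aT_mulbound i : mulbound lam (elt_set T) (fA D i) (aT D T).
Proof.
have [M hM] := fA_mulbound Omp Dok lam i elt_sub_closure.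
have [iA _] := mulbound_Linf hM.
apply: mulbound_le (Linf_mulbound iA).
by rewrite /aT (bigD1 i)//= le_max lexx.
Qed.

End mean_field.

Section element_real.
Variable R : realType.
Implicit Types (t r a h x y q s : R).

Lemma complex_normE (z : R[i]) :
  complex.Re `|z| = Num.sqrt (complex.Re z ^+ 2 + complex.Im z ^+ 2).
Proof. by case: z. Qed.

Lemma Re_le_norm (z : R[i]) : complex.Re z <= complex.Re `|z|.
Proof.
rewrite complex_normE; apply: le_trans (ler_norm _) _.
by rewrite -sqrtr_sqr ler_sqrt ?addr_ge0 ?sqr_ge0// lerDl sqr_ge0.
Qed.

Lemma Re_abs_le_norm (z : R[i]) : `|complex.Re z| <= complex.Re `|z|.
Proof.
by rewrite complex_normE -sqrtr_sqr ler_sqrt ?addr_ge0 ?sqr_ge0// lerDl sqr_ge0.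
Qed.

Lemma sqrt_sqr_le x y : 0 <= y -> x ^+ 2 <= y -> x <= Num.sqrt y.
Proof.
move=> y0 h; apply: le_trans (ler_norm _) _.
by rewrite -sqrtr_sqr ler_sqrt.
Qed.

Lemma le_of_sqr x y : 0 <= y -> x ^+ 2 <= y ^+ 2 -> x <= y.
Proof. by move=> y0 h; apply: le_trans (sqrt_sqr_le _ h) _; rewrite ?sqr_ge0// sqrtr_sqr ger0_norm. Qed.

Lemma sqrt_bound q x y : 0 <= q -> 0 <= x -> y <= q * x ^+ 2 -> Num.sqrt y <= Num.sqrt q * x.
Proof.
move=> q0 x0 hy; apply: le_trans (ler_wsqrtr hy) _.
by rewrite sqrtrM// sqrtr_sqr ger0_norm.
Qed.

Lemma sqrt_prod x y q : 0 <= x ->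
  x * (Num.sqrt y * Num.sqrt q) = Num.sqrt (x * y) * Num.sqrt (x * q).
Proof. by move=> x0; rewrite !sqrtrM// -{1}(sqr_sqrtr x0); ring. Qed.

Lemma sqrt_mul_le r x y : 0 <= r -> 0 <= y -> r * x ^+ 2 <= y ^+ 2 -> Num.sqrt r * x <= y.
Proof. by move=> r0 y0 h; apply: le_of_sqr => //; rewrite exprMn sqr_sqrtr. Qed.

Lemma sqrt_split r x y q : 0 < r -> x * y * q = x / r * (Num.sqrt r * y) * (Num.sqrt r * q).
Proof.
move=> r0; have s0 : Num.sqrt r != 0 by rewrite sqrtr_eq0 -ltNge.
by move: (sqr_sqrtr (ltW r0)) s0; move: (Num.sqrt r) => s <- s0; field.
Qed.

Lemma half_lower x y : 0 <= x -> - x <= y -> - x <= 2^-1 * y.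
Proof. lra. Qed.

Lemma streamline_terms (X rho V E S q c K z cs a1 a2 a3 a4 a5 : R) :
  X ^+ 2 - K * X * V <= a2 -> - (rho * V * z) <= a1 -> a3 <= q * E * z ->
  - (cs * q * S * z) <= a4 -> a5 <= c * q * S * z -> K * X * V <= K * X * E ->
  rho * V * z <= rho * E * z -> 0 <= q * (cs + c) * E * z -> 0 <= q * S * z ->
  X ^+ 2 - K * X * E - z * (rho * E + q * (1 + cs + c) * E + q * (1 + cs + c) * S) <=
  a1 + a2 - a3 + a4 - a5.
Proof.
rewrite !mulrDr !mulrDl !mulrDr !mulr1.
have -> : z * (rho * E) = rho * E * z by ring.
have -> : z * (q * E) = q * E * z by ring.
have -> : z * (q * S) = q * S * z by ring.
have -> : z * (q * cs * E) = q * cs * E * z by ring.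
have -> : z * (q * c * E) = q * c * E * z by ring.
have -> : z * (q * cs * S) = cs * q * S * z by ring.
have -> : z * (q * c * S) = c * q * S * z by ring.
move: (X ^+ 2) (K * X * V) (rho * V * z) (q * E * z) (cs * q * S * z) (c * q * S * z) (K * X * E)
  (rho * E * z) (q * S * z) (q * cs * E * z) (q * c * E * z) => *; lra.
Qed.

(** The two properties for which the reference time is defined: it compensates the reaction rate,
    and, times the advection speed, it is at most the element size, which compensates one inverse
    inequality. *)
Lemma time_scale a h r : 0 <= a -> 0 < h -> 0 < r ->
  let t := (Num.max (a * h^-1) r)^-1 in [/\ 0 < t, t * r <= 1 & t * a <= h].
Proof.
move=> a0 h0 r0 /=; set M := Num.max _ _.
have M0 : 0 < M by rewrite lt_max r0 orbT.
have t0 : 0 < M^-1 by rewrite invr_gt0.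
split => //; first by rewrite -[X in _ <= X](mulVf (lt0r_neq0 M0)) ler_wpM2l ?(ltW t0)// /M le_max lexx orbT.
have : a * h^-1 <= M by rewrite /M le_max lexx.
rewrite ler_pdivrMr// => /(ler_wpM2l (ltW t0)).
by rewrite mulrA mulVf ?lt0r_neq0// mul1r.
Qed.

End element_real.

Section stabilization_mono.
Variables (R : realType) (d m : nat) (Om : set 'rV[R]_d) (D : friedrichs R d m) (Th : mesh R d)
  (Si : elt Th -> face Th -> 'rV[R]_d -> 'M[R[i]]_m) (Sb : face Th -> 'rV[R]_d -> 'M[R[i]]_m).

Lemma aT_ge0 T : 0 <= @aT R d m D Th T.
Proof.
rewrite /aT; elim/big_ind: _ => [|x y x0 _|i _]; [exact: lexx|by rewrite le_max x0|].
by apply: fine_ge0; exact: Linf_enorm_ge0.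
Qed.

(** Lets the stabilization constant be taken nonnegative. *)
Lemma stabilization_le k CS CS' : CS <= CS' ->
  stabilization_ok Om D Si Sb k CS -> stabilization_ok Om D Si Sb k CS'.
Proof.
move=> le [h0 h1 h2 h3 h4]; split => //.
- move=> T F TF v hv; apply: le_trans (h1 T F TF v hv) _.
  by rewrite ler_wpM2r ?sqr_ge0// ler_wpM2r ?aT_ge0.
- move=> T F TF w v hw hv; apply: le_trans (h2 T F TF w v hw hv) _.
  by rewrite ler_wpM2r ?sqrtr_ge0// ler_wpM2r ?sqrtr_ge0// ler_wpM2r ?sqrtr_ge0.
- move=> T F bF TF w v hw hv; apply: le_trans (h4 T F bF TF w v hw hv) _.
  by rewrite ler_wpM2r ?sqrtr_ge0// ler_wpM2r ?sqrtr_ge0// ler_wpM2r ?sqrtr_ge0.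
Qed.

End stabilization_mono.

Lemma measurable_domain (R : realType) d (Om : set 'rV[R]_d) : polytopal_domain Om -> measurable Om.
Proof. by case=> P _ _; exact: (@open_measurable_rV R d Om (polytopal_open P)). Qed.

(** * Streamline estimate on one element *)

Section element_estimates.
Variables (R : realType) (d m k : nat) (Om : set 'rV[R]_d) (Th : mesh R d) (varrho CA CS : R)
  (D : friedrichs R d m)
  (Si : elt Th -> face Th -> 'rV[R]_d -> 'M[R[i]]_m) (Sb : face Th -> 'rV[R]_d -> 'M[R[i]]_m).
Hypotheses (d_gt0 : (0 < d)%N) (Omp : polytopal_domain Om) (Thm : is_mesh Om Th)
  (varrho01 : 0 < varrho < 1) (reg : mesh_regularity Om Th varrho) (Dok : friedrichs_ok Om D)
  (CA0 : 0 <= CA) (hCA : hoelder_constant D Th CA)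
  (CS0 : 0 <= CS) (hS : stabilization_ok Om D Si Sb k CS).
Local Notation C := R[i].
Local Notation rV := 'rV[R]_d.
Local Notation lam := (lebesgue_rV R d).
Local Notation exps := {ffun 'I_d -> 'I_k.+1}.
Local Notation theta := (elt_ratio d varrho).

Let varrho_gt0 : 0 < varrho. Proof. by case/andP: varrho01. Qed.

Let theta01 : 0 < theta <= 1.
Proof.
rewrite elt_ratio_gt0//= /elt_ratio ler_pdivrMr ?mulr_gt0//.
have v1 : varrho ^+ 2 <= 1 by case/andP: varrho01 => v0 v1; rewrite expr_le1 ?ltW.
apply: le_trans v1 _; rewrite mul1r -natrM ler1n//.
Qed.

Definition inv_cst : R := Num.sqrt (dsup_cst d k theta * 2 ^+ d).
(** The number of faces of an element, times the pointwise bound of a polynomial, times the bound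
    [(4 * h) ^+ d / h] of a face measure. *)
Definition trace_cst : R := d.+1%:R / theta ^+ d * (4 ^+ d * sup_cst d k theta).
Definition mean_cst : R := d%:R * CA * inv_cst.

Lemma inv_cst_ge0 : 0 <= inv_cst. Proof. exact: sqrtr_ge0. Qed.

Lemma trace_cst_ge0 : 0 <= trace_cst.
Proof.
have [t0 t1] := andP theta01.
rewrite /trace_cst; have := sup_cst_ge0 d k theta01; move: (sup_cst _ _ _) => s s0.
by rewrite !mulr_ge0 ?invr_ge0 ?exprn_ge0 ?(ltW t0).
Qed.

Lemma mean_cst_ge0 : 0 <= mean_cst. Proof. by rewrite /mean_cst !mulr_ge0 ?inv_cst_ge0. Qed.

Variable T : elt Th.
Local Notation h := (hT T).
Local Notation a := (aT D T).
Local Notation t := (tT D T).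
Local Notation r := (rflat D).
Local Notation nT := (L2norm lam (elt_set T)).
Local Notation nF F := (L2norm (face_measure F) (face_set F)).
Local Notation ripF F := (rip (face_measure F) (face_set F)).
Local Notation onT := (fun F : face Th => `[< face_of T F >]).

Let mT : measurable (elt_set T). Proof. exact: (measurable_elt Thm T). Qed.
Let mF (F : face Th) : measurable (face_set F). Proof. exact: (measurable_face Thm F). Qed.
Let h0 : 0 < h. Proof. exact: (hT_gt0 d_gt0 Omp Thm T). Qed.
Let a0 : 0 <= a. Proof. exact: aT_ge0. Qed.
Let r0 : 0 < r. Proof. by have [_ _ _ []] := Dok. Qed.
Let ts : [/\ 0 < t, t * r <= 1 & t * a <= h]. Proof. exact: (time_scale a0 h0 r0). Qed.

Lemma elt_inverse (c : exps -> 'cV[C]_m) i :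
  nT (pfield (dcoefC i c)) <= inv_cst / h * nT (pfield c).
Proof.
have [c0 Tc0 boxT] := elt_box d_gt0 Omp Thm reg varrho_gt0 T.
have := pfield_inverse theta01 (@elt_open _ _ _ _ Thm T) h0 boxT (closure_elt_box Omp Thm Tc0) c i.
move=> H; apply: le_of_sqr.
  by rewrite !mulr_ge0 ?inv_cst_ge0 ?invr_ge0 ?(ltW h0) ?L2norm_ge0.
have E : inv_cst ^+ 2 = dsup_cst d k theta * 2 ^+ d.
  by rewrite sqr_sqrtr//; apply: mulr_ge0; [exact: dsup_cst_ge0|exact: exprn_ge0].
by apply: le_trans H _; rewrite !exprMn exprVn E.
Qed.

Lemma elt_trace (c : exps -> 'cV[C]_m) :
  \sum_(F | onT F) nF F (pfield c) ^+ 2 <= trace_cst / h * nT (pfield c) ^+ 2.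
Proof.
have [c0 Tc0 boxT] := elt_box d_gt0 Omp Thm reg varrho_gt0 T.
set N := nT (pfield c) ^+ 2; have N0 : 0 <= N by exact: sqr_ge0.
have s0 : 0 <= sup_cst d k theta by exact: sup_cst_ge0.
set M := 4 ^+ d * sup_cst d k theta / h * N.
have M0 : 0 <= M 
  by apply: mulr_ge0 N0; apply: divr_ge0 (ltW h0); apply: mulr_ge0 s0; exact: exprn_ge0.
have hF F : onT F -> nF F (pfield c) ^+ 2 <= M.
  move=> /asboolP TF.
  have hs x : face_set F x -> cnorm (pfield c x) ^+ 2 <= sup_cst d k theta / h ^+ d * N.
    move=> Fx; apply: (pfield_sup theta01 (@elt_open _ _ _ _ Thm T) h0 boxT (closure_elt_box Omp Thm Tc0)).
    by case: (TF _ Fx).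
  have fl := face_measure_lty d_gt0 Omp Thm TF.
  apply: le_trans (L2norm_le_sup (mF F) (inL2_pfield_face d_gt0 Omp Thm c TF) fl hs) _.
  have fle : fine (face_measure F (face_set F)) <= (4 * h) ^+ d / h.
    rewrite -lee_fin fineK ?(face_measure_le d_gt0 Omp Thm TF)//.
    by rewrite ge0_fin_numE.
  have p0 : 0 <= sup_cst d k theta / h ^+ d * N.
    by apply: mulr_ge0 N0; apply: divr_ge0 s0 _; exact: exprn_ge0 (ltW h0).
  apply: le_trans (ler_wpM2l p0 fle) _.
  rewrite /M exprMn le_eqVlt; apply/orP; left; apply/eqP; field.
  by rewrite expf_neq0 ?(lt0r_neq0 h0).
apply: le_trans (ler_sum _ hF) _.
rewrite sumr_const.
have cardE : #|[pred F : face Th | onT F]| = #|[set F : face Th | `[< face_of T F >]]%SET|.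
  by apply: eq_card => F; rewrite inE inE.
have := card_faces d_gt0 Omp Thm reg varrho_gt0 T; rewrite -cardE => /(ler_wpM2r M0).
rewrite -[M *+ _]mulr_natl => H; apply: le_trans H _.
rewrite /M /trace_cst le_eqVlt; apply/orP; left; apply/eqP; ring.
Qed.

Lemma inL2_A1p (c : exps -> 'cV[C]_m) : inL2 lam (elt_set T) (A1p D c).
Proof.
apply: inL2_sum => // i.
by have [] := inL2_mulbound mT (aT_mulbound Omp Thm Dok T i) (inL2_pfield_elt d_gt0 Omp Thm T (dcoefC i c)).
Qed.

Definition Amean (c : exps -> 'cV[C]_m) (x : rV) : 'cV[C]_m :=
  \sum_i meanA D T i *m pfield (dcoefC i c) x.

Lemma norm_A1p_le (c : exps -> 'cV[C]_m) :
  nT (A1p D c) <= d%:R * inv_cst * (a / h) * nT (pfield c).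
Proof.
have hi i := inL2_mulbound mT (aT_mulbound Omp Thm Dok T i)
  (inL2_pfield_elt d_gt0 Omp Thm T (dcoefC i c)).
apply: le_trans (L2norm_sum mT (index_enum _) (fun i => (hi i).1)) _.
apply: (@le_trans _ _ (\sum_(i < d) a * (inv_cst / h * nT (pfield c)))).
  apply: ler_sum => i _; apply: le_trans (hi i).2 _.
  by apply: ler_wpM2l; [exact: a0|exact: elt_inverse].
rewrite sumr_const card_ord -mulr_natl le_eqVlt; apply/orP; left; apply/eqP; ring.
Qed.

(** The inverse inequality loses a full power of [h] and the Hoelder bound gains only half of one;
    since [t * a <= h], the weight [Num.sqrt t] supplies the other half and leaves [Num.sqrt r], a
    quantity controlled by the energy. *)
Lemma norm_A1p_mean (c : exps -> 'cV[C]_m) :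
  Num.sqrt t * nT (fun x => A1p D c x - Amean c x) <=
  mean_cst * (Num.sqrt r * nT (pfield c)).
Proof.
have hi i := inL2_mulbound mT (mean_diff_bound d_gt0 Omp Thm Dok hCA T i)
  (inL2_pfield_elt d_gt0 Omp Thm T (dcoefC i c)).
have [t0 tr1 tah] := ts.
have E : nT (fun x => A1p D c x - Amean c x) <=
    d%:R * (CA * Num.sqrt (r * a * h) * (inv_cst / h * nT (pfield c))).
  have -> : (fun x => A1p D c x - Amean c x) =
      (fun x => \sum_i (fA D i x - meanA D T i) *m pfield (dcoefC i c) x).
    by apply/funext => x; rewrite /A1p /Amean -sumrB; apply: eq_bigr => i _; rewrite mulmxBl.
  apply: le_trans (L2norm_sum mT (index_enum _) (fun i => (hi i).1)) _.
  apply: (@le_trans _ _ (\sum_(i < d) CA * Num.sqrt (r * a * h) * (inv_cst / h * nT (pfield c)))).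
    apply: ler_sum => i _; apply: le_trans (hi i).2 _.
    by apply: ler_wpM2l; [rewrite mulr_ge0 ?sqrtr_ge0|exact: elt_inverse].
  by rewrite sumr_const card_ord mulr_natl.
have s0 : 0 <= Num.sqrt t by exact: sqrtr_ge0.
apply: le_trans (ler_wpM2l s0 E) _.
have H : Num.sqrt t * Num.sqrt (r * a * h) / h <= Num.sqrt r.
  rewrite ler_pdivrMr// -sqrtrM ?(ltW t0)//.
  have -> : Num.sqrt r * h = Num.sqrt (r * h ^+ 2).
    by rewrite sqrtrM ?(ltW r0)// sqrtr_sqr (ger0_norm (ltW h0)).
  have rh0 : 0 <= r * h ^+ 2 by apply: mulr_ge0; [exact: ltW|exact: sqr_ge0].
  rewrite ler_sqrt//.
  have -> : t * (r * a * h) = (r * h) * (t * a) by ring.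
  have -> : r * h ^+ 2 = (r * h) * h by ring.
  by apply: ler_wpM2l => //; apply: mulr_ge0; exact: ltW.
rewrite /mean_cst.
have n0 : 0 <= nT (pfield c) by exact: L2norm_ge0.
have i0 := inv_cst_ge0.
have P0 : 0 <= d%:R * CA * inv_cst * nT (pfield c) by rewrite !mulr_ge0.
move: (ler_wpM2l P0 H); move: (Num.sqrt t) (Num.sqrt (r * a * h)) (Num.sqrt r) (nT _) => x1 x2 x3 x4 H1.
have -> : x1 * (d%:R * (CA * x2 * (inv_cst / h * x4))) = d%:R * CA * inv_cst * x4 * (x1 * x2 / h) by ring.
by apply: le_trans H1 _; rewrite le_eqVlt; apply/orP; left; apply/eqP; ring.
Qed.

Lemma ripS_poly (c : exps -> 'cV[C]_m) F : face_of T F ->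
  ripF F (Defs.mulf (Si T F) (pfield c)) (pfield c) <= CS * a * nF F (pfield c) ^+ 2.
Proof.
move=> TF; have [_ h1 _ _ _] := hS.
have pE x : face_set F x -> prestr (face_set F) c x = pfield c x.
  by move=> Fx; apply: prestrE; exact: subset_closure.
have := h1 T F TF _ (Pk_prestr (face_set F) c).
have -> : normF F (prestr (face_set F) c) = nF F (pfield c) by exact: eq_L2norm.
rewrite Re_ip; have -> : rip (face_measure F) (face_set F)
    (Defs.mulf (Si T F) (prestr (face_set F) c)) (prestr (face_set F) c) =
  ripF F (Defs.mulf (Si T F) (pfield c)) (pfield c).
  by apply: eq_rip => // x Fx; rewrite /Defs.mulf pE.
exact.
Qed.

Variable c : exps -> 'cV[C]_m.

(* A^i is replaced by its mean so that the test function is a polynomial. *)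
Definition ctest (al : exps) : 'cV[C]_m := t%:C%C *: \sum_i meanA D T i *m dcoefC i c al.

Lemma ctestE x : pfield ctest x = t%:C%C *: Amean c x.
Proof.
rewrite /ctest pfieldZ pfield_sum; congr (_ *: _); apply: eq_bigr => i _.
by rewrite pfieldM.
Qed.

Lemma inL2_Amean : inL2 lam (elt_set T) (Amean c).
Proof.
have -> : Amean c = pfield (fun al => \sum_i meanA D T i *m dcoefC i c al).
  by apply/funext => x; rewrite pfield_sum; apply: eq_bigr => i _; rewrite pfieldM.
exact: (inL2_pfield_elt d_gt0 Omp Thm).
Qed.

Let v := pfield c.
Let w := pfield ctest.
Let Z := Num.sqrt t * nT (Amean c).
Let W := \sum_(F | onT F) nF F w ^+ 2.

Let Z0 : 0 <= Z. Proof. by rewrite mulr_ge0 ?sqrtr_ge0 ?L2norm_ge0. Qed.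
Let hv : inL2 lam (elt_set T) v. Proof. exact: (inL2_pfield_elt d_gt0 Omp Thm). Qed.
Let hw : inL2 lam (elt_set T) w. Proof. exact: (inL2_pfield_elt d_gt0 Omp Thm). Qed.
Let hwF F : face_of T F -> inL2 (face_measure F) (face_set F) w.
Proof. exact: (inL2_pfield_face d_gt0 Omp Thm). Qed.

Lemma ctest_norm : nT w = Num.sqrt t * Z.
Proof.
have [t0 _ _] := ts.
have -> : nT w = nT (fun x => t%:C%C *: Amean c x).
  by apply: eq_L2norm => x _; exact: ctestE.
rewrite (L2normZ mT t inL2_Amean) (ger0_norm (ltW t0)) /Z mulrA -expr2 sqr_sqrtr//.
exact: ltW.
Qed.

(** The test function has norm [Num.sqrt t * Z] on the element and a trace larger by at most
    [h ^ (-1/2)] up to a constant; each weight [r], [r * h], [a] is then compensated by [t * r <= 1]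
    or [t * a <= h]. *)
Lemma ctest_size : [/\ r * nT w ^+ 2 <= Z ^+ 2, r * h * W <= trace_cst * Z ^+ 2 &
  a * W <= trace_cst * Z ^+ 2].
Proof.
have [t0 tr1 tah] := ts; have C0 := trace_cst_ge0.
have E : nT w ^+ 2 = t * Z ^+ 2 by rewrite ctest_norm exprMn sqr_sqrtr// (ltW t0).
have hW : W <= trace_cst / h * (t * Z ^+ 2) by rewrite -E; exact: elt_trace.
have z0 := sqr_ge0 Z.
have P0 : 0 <= trace_cst * Z ^+ 2 by exact: mulr_ge0.
move: (trace_cst) (Z ^+ 2) (W) C0 hW z0 P0 E => Q z x C0 hW z0 P0 E.
split.
- rewrite E mulrA -[X in _ <= X]mul1r; apply: ler_wpM2r => //; by rewrite mulrC.
- have := ler_wpM2l (mulr_ge0 (ltW r0) (ltW h0)) hW => H; apply: le_trans H _.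
  have -> : r * h * (Q / h * (t * z)) = (t * r) * (Q * z) by field; exact: lt0r_neq0.
  by rewrite -[X in _ <= X]mul1r; exact: ler_wpM2r.
- have := ler_wpM2l a0 hW => H; apply: le_trans H _.
  have -> : a * (Q / h * (t * z)) = (t * a) / h * (Q * z) by field; exact: lt0r_neq0.
  by rewrite -[X in _ <= X]mul1r; apply: ler_wpM2r => //; rewrite ler_pdivrMr// mul1r.
Qed.

(** One term for each part of the norm of the test function: cell, jumps, stabilization and
    transport. The boundary part is zero because the face components are. *)
Definition test_cst : R := 1 + trace_cst + CS * trace_cst + (d%:R * inv_cst) ^+ 2.

Lemma ctest_hnorm :
  r * (nT w ^+ 2 + h * W) + \sum_(F | onT F) ripF F (Defs.mulf (Si T F) w) w
    + t * nT (A1p D ctest) ^+ 2 <= test_cst * Z ^+ 2.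
Proof.
have [t0 tr1 tah] := ts; have [s1 s2 s3] := ctest_size.
have hs : \sum_(F | onT F) ripF F (Defs.mulf (Si T F) w) w <= CS * (a * W).
  rewrite mulrA /W mulr_sumr; apply: ler_sum => F /asboolP TF; exact: ripS_poly.
have ha : t * nT (A1p D ctest) ^+ 2 <= (d%:R * inv_cst) ^+ 2 * Z ^+ 2.
  have H := norm_A1p_le ctest; rewrite -/w ctest_norm in H.
  have H2 : nT (A1p D ctest) ^+ 2 <= (d%:R * inv_cst * (a / h) * (Num.sqrt t * Z)) ^+ 2.
    by rewrite !expr2; apply: ler_pM; rewrite ?L2norm_ge0.
  apply: le_trans (ler_wpM2l (ltW t0) H2) _.
  have -> : t * (d%:R * inv_cst * (a / h) * (Num.sqrt t * Z)) ^+ 2 =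
     (t * a / h) ^+ 2 * ((d%:R * inv_cst) ^+ 2 * Z ^+ 2).
    have Et : Num.sqrt t ^+ 2 = t by rewrite sqr_sqrtr// ltW.
    rewrite -{1 3}Et; ring.
  rewrite -[X in _ <= X]mul1r; apply: ler_wpM2r.
    by apply: mulr_ge0; exact: sqr_ge0.
  apply: exprn_ile1; first by apply: divr_ge0 (ltW h0); apply: mulr_ge0 a0; exact: ltW.
  by rewrite ler_pdivrMr// mul1r.
have hs' := le_trans hs (ler_wpM2l CS0 s3).
have -> : r * (nT w ^+ 2 + h * W) = r * nT w ^+ 2 + r * h * W by ring.
have -> : test_cst * Z ^+ 2 = Z ^+ 2 + trace_cst * Z ^+ 2 + CS * (trace_cst * Z ^+ 2)
   + (d%:R * inv_cst) ^+ 2 * Z ^+ 2 by rewrite /test_cst; ring.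
by rewrite !lerD.
Qed.

(** Stands for the face unknown minus the trace of the cell unknown, so that the estimates refer to
    a single element. *)
Variable J : face Th -> rV -> 'cV[C]_m.
Hypothesis hJ : forall F, face_of T F -> inL2 (face_measure F) (face_set F) (J F).

Let E2 := r * (nT v ^+ 2 + h * \sum_(F | onT F) nF F (J F) ^+ 2).
Let S2 := \sum_(F | onT F) ripF F (Defs.mulf (Si T F) (J F)) (J F).
Let Q := \sum_(F | onT F) nF F (J F) ^+ 2.

Let Si_inf F : face_of T F -> inLinf (face_measure F) (face_set F) (Si T F).
Proof. by move=> TF; have [[h1 _] _ _ _ _] := hS; have [] := h1 T F TF. Qed.
Let Si_psd F : face_of T F -> {ae face_measure F, forall x, face_set F x -> hermitian_psd (Si T F x)}.
Proof. by move=> TF; have [[h1 _] _ _ _ _] := hS; have [] := h1 T F TF. Qed.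

Let Q0 : 0 <= Q. Proof. by apply: sumr_ge0 => F _; exact: sqr_ge0. Qed.
Let S20 : 0 <= S2.
Proof.
by apply: sumr_ge0 => F /asboolP TF; exact: (rip_psd_ge0 (mF F) (Si_inf TF) (Si_psd TF) (hJ TF)).
Qed.

(** The condition bounding the flux matrix by [Si] trades the flux of the jump for its stabilization
    energy, at the price of [Num.sqrt a] on the trace of the test function, which [ctest_size]
    absorbs. *)
Lemma elt_flux_le :
  - (CS * Num.sqrt trace_cst * Num.sqrt S2 * Z) <=
  2^-1 * \sum_(F | onT F) orient T F * ripF F (Defs.mulf (Defs.NF D F) (J F)) w.
Proof.
have [s1 s2 s3] := ctest_size.
have hF F : onT F -> `|orient T F * ripF F (Defs.mulf (Defs.NF D F) (J F)) w| <=
    (CS * Num.sqrt a * nF F w) * Num.sqrt (ripF F (Defs.mulf (Si T F) (J F)) (J F)).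
  move=> /asboolP TF; have [_ _ h2 _ _] := hS.
  have -> : `|orient T F * ripF F (Defs.mulf (Defs.NF D F) (J F)) w| =
      `|complex.Re (ipF F w (Defs.mulf (Defs.NF D F) (J F)))|.
    by rewrite Re_ip ripC normrM; case: (orient1 Thm TF) => ->; rewrite ?normrN normr1 mul1r.
  apply: le_trans (Re_abs_le_norm _) _.
  by have := h2 T F TF w (J F) (hwF TF) (hJ TF); rewrite Re_ip.
have H : \sum_(F | onT F) `|orient T F * ripF F (Defs.mulf (Defs.NF D F) (J F)) w| <=
    CS * Num.sqrt a * (Num.sqrt W * Num.sqrt S2).
  apply: le_trans (ler_sum _ hF) _.
  have -> : \sum_(F | onT F) (CS * Num.sqrt a * nF F w) * Num.sqrt (ripF F (Defs.mulf (Si T F) (J F)) (J F)) =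
    CS * Num.sqrt a * \sum_(F | onT F) nF F w * Num.sqrt (ripF F (Defs.mulf (Si T F) (J F)) (J F)).
    by rewrite mulr_sumr; apply: eq_bigr => F _; rewrite mulrA.
  apply: ler_wpM2l; first by rewrite mulr_ge0 ?sqrtr_ge0.
  apply: le_trans (sum_cs _ _ _) _; apply: ler_wpM2l; first exact: sqrtr_ge0.
  rewrite le_eqVlt; apply/orP; left; apply/eqP; congr Num.sqrt; apply: eq_bigr => F /asboolP TF.
  by rewrite sqr_sqrtr//; exact: (rip_psd_ge0 (mF F) (Si_inf TF) (Si_psd TF) (hJ TF)).
have H3 : Num.sqrt a * Num.sqrt W <= Num.sqrt trace_cst * Z.
  by rewrite -(sqrtrM _ a0); exact: (sqrt_bound trace_cst_ge0 Z0 s3).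
have H5 := le_trans (ler_norm_sum _ _ _) H.
have H6 : CS * Num.sqrt a * (Num.sqrt W * Num.sqrt S2) <= CS * Num.sqrt trace_cst * Num.sqrt S2 * Z.
  have -> : CS * Num.sqrt a * (Num.sqrt W * Num.sqrt S2) = CS * Num.sqrt S2 * (Num.sqrt a * Num.sqrt W) by ring.
  have -> : CS * Num.sqrt trace_cst * Num.sqrt S2 * Z = CS * Num.sqrt S2 * (Num.sqrt trace_cst * Z) by ring.
  by apply: ler_wpM2l => //; rewrite mulr_ge0 ?sqrtr_ge0.
have := le_trans H5 H6; rewrite ler_norml => /andP[H7 _].
have P0 : 0 <= CS * Num.sqrt trace_cst * Num.sqrt S2 * Z.
  by rewrite !mulr_ge0 ?sqrtr_ge0.
exact: half_lower P0 H7.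
Qed.

(** Cauchy-Schwarz for the positive field [Si]; the factor with the test function is then bounded by
    the condition on polynomials, in which [CS] appears under a square root. *)
Lemma elt_stab_le :
  \sum_(F | onT F) ripF F (Defs.mulf (Si T F) (J F)) w <=
  Num.sqrt CS * Num.sqrt trace_cst * Num.sqrt S2 * Z.
Proof.
have [s1 s2 s3] := ctest_size.
have hF F : onT F -> ripF F (Defs.mulf (Si T F) (J F)) w <=
    Num.sqrt (ripF F (Defs.mulf (Si T F) (J F)) (J F)) * (Num.sqrt (CS * a) * nF F w).
  move=> /asboolP TF; apply: le_trans (ler_norm _) _.
  apply: le_trans (rip_psd_le (mF F) (Si_inf TF) (Si_psd TF) (hJ TF) (hwF TF)) _.
  apply: ler_wpM2l; first exact: sqrtr_ge0.
  apply: (sqrt_bound (mulr_ge0 CS0 a0)); first exact: L2norm_ge0.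
  exact: ripS_poly.
apply: le_trans (ler_sum _ hF) _.
apply: le_trans (sum_cs _ _ _) _.
have -> : \sum_(F | onT F) Num.sqrt (ripF F (Defs.mulf (Si T F) (J F)) (J F)) ^+ 2 = S2.
  apply: eq_bigr => F /asboolP TF.
  by rewrite sqr_sqrtr//; exact: (rip_psd_ge0 (mF F) (Si_inf TF) (Si_psd TF) (hJ TF)).
have -> : \sum_(F | onT F) (Num.sqrt (CS * a) * nF F w) ^+ 2 = CS * (a * W).
  rewrite mulrA /W mulr_sumr; apply: eq_bigr => F _.
  by rewrite exprMn sqr_sqrtr// mulr_ge0.
have -> : Num.sqrt CS * Num.sqrt trace_cst * Num.sqrt S2 * Z =
  Num.sqrt S2 * (Num.sqrt CS * Num.sqrt trace_cst * Z) by ring.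
apply: ler_wpM2l; first exact: sqrtr_ge0.
rewrite (sqrtrM _ CS0) -mulrA; apply: ler_wpM2l; first exact: sqrtr_ge0.
exact: (sqrt_bound trace_cst_ge0 Z0 s3).
Qed.

Lemma elt_jump_le :
  r * h * \sum_(F | onT F) ripF F (J F) w <= Num.sqrt trace_cst * Num.sqrt E2 * Z.
Proof.
have [s1 s2 s3] := ctest_size.
have rh0 : 0 <= r * h by apply: mulr_ge0; exact: ltW.
have H : \sum_(F | onT F) ripF F (J F) w <= Num.sqrt Q * Num.sqrt W.
  apply: le_trans (_ : \sum_(F | onT F) nF F (J F) * nF F w <= _); last exact: sum_cs.
  apply: ler_sum => F /asboolP TF; apply: le_trans (ler_norm _) _.
  exact: (@rip_cs R d (face_measure F) (face_set F) (mF F) m 1%N (J F) w (hJ TF) (hwF TF)).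
apply: le_trans (ler_wpM2l rh0 H) _.
have -> : r * h * (Num.sqrt Q * Num.sqrt W) = Num.sqrt (r * h * Q) * Num.sqrt (r * h * W).
  exact: sqrt_prod.
have -> : Num.sqrt trace_cst * Num.sqrt E2 * Z = Num.sqrt E2 * (Num.sqrt trace_cst * Z) by ring.
apply: ler_pM; rewrite ?sqrtr_ge0//.
  apply: ler_wsqrtr; rewrite /E2 mulrDr mulrA lerDr.
  by apply: mulr_ge0 (sqr_ge0 _); exact: ltW.
exact: (sqrt_bound trace_cst_ge0 Z0 s2).
Qed.

Lemma rsharp_ge0 : 0 <= rsharp Om D.
Proof. by apply: addr_ge0; apply: fine_ge0; exact: Linf_enorm_ge0. Qed.

(** The ratio rho enters here: [fK] is bounded by [rsharp], while each of the two functions is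
    measured with the weight [Num.sqrt r]. *)
Lemma elt_reaction_ge :
  - (rsharp Om D / r * (Num.sqrt r * nT v) * Z) <=
  rip lam (elt_set T) (Defs.mulf (fK D) v) w.
Proof.
have [s1 s2 s3] := ctest_size.
have [iK _ [iG _] _ _] := Dok.
have [B _ hB] := domain_box Omp.
have mOm : measurable Om by exact: measurable_domain Omp.
have hK := mulboundS mOm (@elt_sub_domain _ _ _ _ Omp Thm T) (Linf_mulbound iK).
have [iKv nKv] := inL2_mulbound mT hK hv.
have Kr : Linf_norm lam Om (fK D) <= rsharp Om D.
  by rewrite lerDl; apply: fine_ge0; exact: Linf_enorm_ge0.
have H := @rip_cs R d lam (elt_set T) mT m 1%N (Defs.mulf (fK D) v) w iKv hw.
have H2 : `|rip lam (elt_set T) (Defs.mulf (fK D) v) w| <= rsharp Om D * nT v * nT w.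
  apply: le_trans H _; apply: ler_wpM2r; first exact: L2norm_ge0.
  apply: le_trans nKv _; apply: ler_wpM2r => //; exact: L2norm_ge0.
have H3 : Num.sqrt r * nT w <= Z.
  exact: (sqrt_mul_le (ltW r0) Z0 s1).
have H4 : rsharp Om D * nT v * nT w <= rsharp Om D / r * (Num.sqrt r * nT v) * Z.
  have -> : rsharp Om D * nT v * nT w =
     rsharp Om D / r * (Num.sqrt r * nT v) * (Num.sqrt r * nT w).
    exact: sqrt_split.
  exact: (ler_wpM2l (mulr_ge0 (divr_ge0 rsharp_ge0 (ltW r0))
    (mulr_ge0 (sqrtr_ge0 r) (L2norm_ge0 lam (elt_set T) v))) H3).
by have := le_trans H2 H4; rewrite ler_norml => /andP[].
Qed.

(** With the true field in place of its mean this would be an equality without remainder; the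
    remainder is [t] times the product of [A1 v] with the error of the mean, bounded by
    [norm_A1p_mean]. *)
Lemma elt_transport_ge :
  t * nT (A1p D c) ^+ 2 - mean_cst * (Num.sqrt t * nT (A1p D c)) * (Num.sqrt r * nT v) <=
  rip lam (elt_set T) (A1p D c) w.
Proof.
have [t0 tr1 tah] := ts.
have hA := inL2_A1p c; have hM := inL2_Amean.
have hD := inL2B mT hA hM.
have E : rip lam (elt_set T) (A1p D c) w =
    t * (nT (A1p D c) ^+ 2 - rip lam (elt_set T) (A1p D c) (fun x => A1p D c x - Amean c x)).
  have -> : rip lam (elt_set T) (A1p D c) w =
      rip lam (elt_set T) (A1p D c) (fun x => t%:C%C *: Amean c x).
    by apply: eq_rip => // x _; exact: ctestE.
  rewrite (ripZr mT t hM hA); congr (_ * _).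
  by rewrite L2norm_sqr (ripBr mT hA hM hA) subKr.
have H := le_trans (ler_norm _) (@rip_cs R d lam (elt_set T) mT m 1%N _ _ hA hD).
have H2 := norm_A1p_mean c; rewrite -/v in H2.
have n0 := L2norm_ge0 lam (elt_set T) (A1p D c).
have st0 : 0 <= Num.sqrt t * nT (A1p D c) by apply: mulr_ge0 n0; exact: sqrtr_ge0.
have H3 := ler_wpM2l st0 H2; have H4 := ler_wpM2l (ltW t0) H.
rewrite E mulrBr lerD2l lerN2; apply: le_trans H4 _.
rewrite -{1}(sqr_sqrtr (ltW t0)) mulrC; apply: le_trans (le_trans _ H3) _.
  by rewrite le_eqVlt; apply/orP; left; apply/eqP; ring.
by rewrite mulrCA mulrA.
Qed.

Lemma Z_le : Z <= Num.sqrt t * nT (A1p D c) + mean_cst * (Num.sqrt r * nT v).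
Proof.
have hA := inL2_A1p c; have hM := inL2_Amean; have hD := inL2B mT hA hM.
have s0 : 0 <= Num.sqrt t by exact: sqrtr_ge0.
have -> : Z = Num.sqrt t * nT (fun x => A1p D c x + (- 1)%:C%C *: (A1p D c x - Amean c x)).
  by congr (_ * _); apply: eq_L2norm => x _; rewrite rmorphN rmorph1 scaleN1r opprB addrC subrK.
apply: le_trans (ler_wpM2l s0 (L2normD mT hA (inL2Z mT _ hD))) _.
rewrite mulrDr lerD2l (L2normZ mT _ hD) normrN1 mul1r; exact: norm_A1p_mean.
Qed.

Definition flux_cst : R := Num.sqrt trace_cst * (1 + CS + Num.sqrt CS).

Lemma flux_cst_ge0 : 0 <= flux_cst.
Proof. by apply: mulr_ge0; rewrite ?sqrtr_ge0// !addr_ge0 ?sqrtr_ge0. Qed.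

(** The contribution of one element to the form when the test function is [ctest] on the element and
    zero on the faces. Its jump is minus its trace, whence the negative signs, and half of its trace
    multiplies the flux. *)
Definition elt_form : R := rip lam (elt_set T) (Defs.mulf (fK D) v) w
  + rip lam (elt_set T) (A1p D c) w
  - r * h * \sum_(F | onT F) ripF F (J F) w
  + 2^-1 * \sum_(F | onT F) orient T F * ripF F (Defs.mulf (Defs.NF D F) (J F)) w
  - \sum_(F | onT F) ripF F (Defs.mulf (Si T F) (J F)) w.

Lemma elt_streamline :
  t * nT (A1p D c) ^+ 2 <= 2 * elt_form
    + 6 * (rsharp Om D / r + mean_cst + flux_cst) ^+ 2 * (E2 + S2).
Proof.
have [t0 tr1 tah] := ts.
have E20 : 0 <= E2.
  by apply: mulr_ge0 (ltW r0) _; apply: addr_ge0 (sqr_ge0 _) _; exact: mulr_ge0 (ltW h0) Q0.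
have EX : (Num.sqrt t * nT (A1p D c)) ^+ 2 = t * nT (A1p D c) ^+ 2.
  by rewrite exprMn (sqr_sqrtr (ltW t0)).
have vE : Num.sqrt r * nT v <= Num.sqrt E2.
  apply: sqrt_sqr_le => //; rewrite exprMn (sqr_sqrtr (ltW r0)) /E2.
  apply: ler_wpM2l; first exact: ltW.
  by rewrite lerDl; exact: mulr_ge0 (ltW h0) Q0.
have X0 : 0 <= Num.sqrt t * nT (A1p D c).
  by apply: mulr_ge0; [exact: sqrtr_ge0|exact: L2norm_ge0].
have rho0 : 0 <= rsharp Om D / r by apply: divr_ge0 (ltW r0); exact: rsharp_ge0.
have M0 := mean_cst_ge0.
rewrite -EX -(sqr_sqrtr E20) -(sqr_sqrtr S20).
apply: (@streamline_real _ _ _ _ Z) => //; rewrite ?sqrtr_ge0 ?flux_cst_ge0//.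
  by apply: le_trans Z_le _; rewrite lerD2l; exact: ler_wpM2l.
rewrite /elt_form.
have h1 := elt_transport_ge; have h2 := elt_reaction_ge; have h3 := elt_jump_le.
have h4 := elt_flux_le; have h5 := elt_stab_le.
have h6 := ler_wpM2l (mulr_ge0 M0 X0) vE.
have h7 : rsharp Om D / r * (Num.sqrt r * nT v) * Z <= rsharp Om D / r * Num.sqrt E2 * Z.
  exact: (ler_wpM2r Z0 (ler_wpM2l rho0 vE)).
have e0 := sqrtr_ge0 E2; have s0 := sqrtr_ge0 S2; have q0 := sqrtr_ge0 trace_cst.
have c0 := sqrtr_ge0 CS.
have h8 : 0 <= Num.sqrt trace_cst * (CS + Num.sqrt CS) * Num.sqrt E2 * Z.
  exact: (mulr_ge0 (mulr_ge0 (mulr_ge0 q0 (addr_ge0 CS0 c0)) e0) Z0).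
have h9 := mulr_ge0 (mulr_ge0 q0 s0) Z0.
move: h1 h2 h3 h4 h5 h6 h7 h8 h9; rewrite -EX /flux_cst.
move: (Num.sqrt t * nT (A1p D c)) (rsharp Om D / r) (Num.sqrt r * nT v) (Num.sqrt E2) (Num.sqrt S2)
  (Num.sqrt trace_cst) (Num.sqrt CS) (mean_cst) Z => X rho V E S q c' K z.
move: (rip _ _ _ _) (rip _ _ _ _) (\sum_(F | _) _) (\sum_(F | _) _) (\sum_(F | _) _) => a1 a2 a3 a4 a5.
exact: streamline_terms.
Qed.

End element_estimates.

(** * Polynomials vanishing almost everywhere *)

Section vanishing_polynomials.
Variables (R : realType) (d k : nat).
Local Notation C := R[i].
Local Notation rV := 'rV[R]_d.
Local Notation exps := {ffun 'I_d -> 'I_k.+1}.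
Implicit Types (mu : {measure set rV -> \bar R}) (Y : set rV).

Lemma L2norm_eq0 mu Y p q (f : rV -> 'M[C]_(p, q)) : measurable Y -> inL2 mu Y f ->
  L2norm mu Y f = 0 -> {ae mu, forall x, Y x -> f x = 0}.
Proof.
move=> mY hf n0; have [mf foo] := hf.
have mc : measurable_fun Y (EFin \o (fun x => cnorm (f x) ^+ 2)).
  by apply/measurable_EFinP; exact: measurable_cnorm.
have fin : (\int[mu]_(x in Y) (cnorm (f x) ^+ 2)%:E)%E \is a fin_num.
  by rewrite ge0_fin_numE//; apply: integral_ge0 => x _; rewrite lee_fin sqr_ge0.
have I0 : (\int[mu]_(x in Y) `|(EFin \o (fun x => (cnorm (f x) ^+ 2)%R)) x|)%E = 0%E.
  under eq_integral do rewrite /= ger0_norm ?sqr_ge0//.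
  rewrite -(fineK fin); congr (_%:E).
  have : L2norm mu Y f ^+ 2 = 0 by rewrite n0 expr0n.
  rewrite sqr_sqrtr//; apply: fine_ge0; apply: integral_ge0 => x _; by rewrite lee_fin sqr_ge0.
have /(ae_eq_integral_abs mu mY mc) H := I0.
apply: filterS H => x h Yx; apply: cnorm_eq0; apply/eqP; rewrite -sqrf_eq0.
by have /= [->] := h Yx.
Qed.

(** Where a continuous function is nonzero it is so on a relatively open set, which the hypothesis
    prevents from being negligible. The form covers elements with the Lebesgue measure and faces
    with the hyperplane measure. *)
Lemma rpoly_vanish mu Y (cf : exps -> R) :
  (forall W, open W -> Y `&` W !=set0 -> ~ mu.-negligible (Y `&` W)) ->
  {ae mu, forall x, Y x -> rpoly cf x = 0} -> forall x, closure Y x -> rpoly cf x = 0.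
Proof.
move=> hY h0.
pose W := rpoly cf @^-1` [set r | r != 0].
have oW : open W.
  apply: open_comp; first by move=> x _; exact: continuous_rpoly.
  have -> : [set r : R | r != 0] = ~` [set 0].
    by apply/seteqP; split=> r /=; [move/eqP|move=> h; apply/eqP].
  by apply: closed_openC; exact: closed_eq.
move=> x cx; apply: contrapT => /eqP nx.
have [y [Yy Wy]] := cx W (open_nbhs_nbhs (conj oW nx)).
apply: (hY W oW); first by exists y.
apply: negligibleS h0 => z [Yz Wz] /= h.
by move/eqP: Wz; apply; exact: h.
Qed.

Lemma pfield_vanish mu Y p q (c : exps -> 'M[C]_(p, q)) : measurable Y ->
  (forall W, open W -> Y `&` W !=set0 -> ~ mu.-negligible (Y `&` W)) ->
  inL2 mu Y (pfield c) -> L2norm mu Y (pfield c) = 0 -> prestr Y c = (fun=> 0).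
Proof.
move=> mY hY hc c0; have ae0 := L2norm_eq0 mY hc c0.
apply/funext => x; rewrite /prestr; case: ifPn => // /set_mem cx.
apply/matrixP => a b; rewrite mxE; apply: complex_inj => /=.
  rewrite Re_pfield; apply: (rpoly_vanish hY) cx.
  by apply: filterS ae0 => y h Yy; rewrite -Re_pfield h// mxE.
rewrite Im_pfield; apply: (rpoly_vanish hY) cx.
by apply: filterS ae0 => y h Yy; rewrite -Im_pfield h// mxE.
Qed.

Lemma negligible_gt0 mu A : measurable A -> (0 < mu A)%E -> ~ mu.-negligible A.
Proof.
move=> mA A0 [B [mB B0 sB]].
have : (mu A <= mu B)%E by apply: le_measure => //; rewrite inE.
by rewrite B0 leNgt A0.
Qed.

End vanishing_polynomials.

Section infsup_real.
Variable R : realType.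

(** [a1] and [a2] are the form tested with the unknown and with the streamline test function. Both
    are at most a multiple of [s * H], so one factor [H] is divided out; [rho >= 1] puts both terms
    under [rho ^+ 2]. *)
Lemma infsup_final (A B rho H s a1 a2 Hw : R) : 0 <= A -> 0 <= B -> 1 <= rho -> 0 <= H -> 0 <= s ->
  H ^+ 2 <= A * rho ^+ 2 * a1 + 2 * a2 -> a1 <= s * H -> a2 <= s * Hw -> Hw <= B * H ->
  H <= (A + 2 * B) * rho ^+ 2 * s.
Proof.
move=> A0 B0 r1 H0 s0 h h1 h2 h3; have ler0n_2 : 0 <= 2 :> R by [].
have r2 : 1 <= rho ^+ 2 by rewrite expr_ge1// (le_trans ler01).
have r20 := le_trans ler01 r2.
have [->|Hn] := eqVneq H 0; first exact: (mulr_ge0 (mulr_ge0 (addr_ge0 A0 (mulr_ge0 ler0n_2 B0)) r20) s0).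
have Hp : 0 < H by rewrite lt_neqAle eq_sym Hn.
rewrite -(ler_pM2r Hp) -expr2; apply: le_trans h _.
have e1 : A * rho ^+ 2 * a1 <= A * rho ^+ 2 * (s * H) by apply: ler_wpM2l => //; exact: mulr_ge0.
have e2 : a2 <= s * (B * H) by apply: le_trans h2 _; exact: ler_wpM2l.
have e3 : s * (B * H) <= rho ^+ 2 * (s * (B * H)) by rewrite ler_peMl// !mulr_ge0.
have -> : (A + 2 * B) * rho ^+ 2 * s * H = A * rho ^+ 2 * (s * H) + 2 * (rho ^+ 2 * (s * (B * H))) by ring.
move: e1 e2 e3; move: (A * rho ^+ 2 * a1) (A * rho ^+ 2 * (s * H)) (s * (B * H)) (rho ^+ 2 * (s * (B * H))) => *.
lra.
Qed.

End infsup_real.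

(** * Linear algebra for the discrete problem *)

Section bilinear_forms.
Variables (R : realType) (N : nat).
Implicit Types (x y z : 'rV[R]_N) (B : 'rV[R]_N -> 'rV[R]_N -> R) (L : 'rV[R]_N -> R).

Definition linear_form L := forall c y z, L (c *: y + z) = c * L y + L z.
Definition bilinear_form B := forall y, linear_form (B y) /\ linear_form (B^~ y).

Lemma linear_formE L y : linear_form L -> L y = \sum_i y 0 i * L (delta_mx 0 i).
Proof.
move=> lL; have L0 : L 0 = 0.
  by have := lL 1 0 0; rewrite scaler0 addr0 mul1r -{1}[L 0]addr0 => /addrI.
rewrite {1}(row_sum_delta y); elim/big_rec2 : _ => [|i a b _ <-]; first by [].
exact: lL.
Qed.

Lemma bilinear_formE B x y : bilinear_form B ->
  B x y = (x *m (\matrix_(i, j) B (delta_mx 0 i) (delta_mx 0 j)) *m y^T) 0 0.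
Proof.
move=> hB; rewrite (linear_formE y (hB x).1) mxE; apply: eq_bigr => j _.
rewrite (linear_formE x (hB _).2) !mxE mulrC; congr (_ * _).
by apply: eq_bigr => i _; rewrite mxE.
Qed.

(* The kernel condition replaces the injectivity of B because an element of U_h^k
   does not determine its coefficients. *)
Lemma linear_form_representable B L : bilinear_form B -> linear_form L ->
  (forall y, (forall x, B x y = 0) -> L y = 0) -> exists u, forall y, B u y = L y.
Proof.
move=> hB hL ker.
set M := \matrix_(i, j) B (delta_mx 0 i) (delta_mx 0 j).
pose b : 'rV_N := \row_j L (delta_mx 0 j).
have LE y : L y = (b *m y^T) 0 0.
  by rewrite (linear_formE y hL) mxE; apply: eq_bigr => j _; rewrite !mxE mulrC.
(* Membership in the row space is tested against the cokernel, each column of which is a [y] with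
   [B x y = 0] for all [x]. *)
have : (b <= M)%MS.
  rewrite submxE; apply/eqP/matrixP => i j; rewrite ord1 mxE.
  have K : L (col j (cokermx M))^T = 0.
    apply: ker => x; rewrite (bilinear_formE _ _ hB) -/M trmxK colE mulmxA -(mulmxA x).
    by rewrite mulmx_coker mulmx0 mul0mx mxE.
  move: K; rewrite LE trmxK mxE => K; rewrite [RHS]mxE; apply: etrans K.
  by apply: eq_bigr => l _; congr (_ * _); rewrite [RHS]mxE.
move=> /submxP[u bu]; exists u => y.
by rewrite (bilinear_formE _ _ hB) -/M -bu LE.
Qed.

Lemma bilinear_formD B B' : bilinear_form B -> bilinear_form B' ->
  bilinear_form (fun x y => B x y + B' x y).
Proof.
by move=> h h' y; split=> c x z; rewrite ?(h _).1 ?(h' _).1 ?(h _).2 ?(h' _).2; ring.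
Qed.

Lemma bilinear_formB B B' : bilinear_form B -> bilinear_form B' ->
  bilinear_form (fun x y => B x y - B' x y).
Proof.
by move=> h h' y; split=> c x z; rewrite ?(h _).1 ?(h' _).1 ?(h _).2 ?(h' _).2; ring.
Qed.

Lemma bilinear_formZ B a : bilinear_form B -> bilinear_form (fun x y => a * B x y).
Proof. by move=> h y; split=> c x z; rewrite ?(h _).1 ?(h _).2; ring. Qed.

Lemma bilinear_form_sum (I : finType) (P : pred I) (B : I -> 'rV[R]_N -> 'rV[R]_N -> R) :
  (forall i, P i -> bilinear_form (B i)) -> bilinear_form (fun x y => \sum_(i | P i) B i x y).
Proof.
move=> h y; split=> c x z; rewrite mulr_sumr -big_split; apply: eq_bigr => i Pi.
  exact: (h i Pi y).1.
exact: (h i Pi y).2.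
Qed.

Lemma linear_form_sum (I : finType) (L : I -> 'rV[R]_N -> R) :
  (forall i, linear_form (L i)) -> linear_form (fun x => \sum_i L i x).
Proof. by move=> h c x z; rewrite mulr_sumr -big_split; apply: eq_bigr => i _; exact: h. Qed.

Section linear_fields.
Variables (d : nat) (mu : {measure set 'rV[R]_d -> \bar R}) (Y : set 'rV[R]_d).
Hypothesis mY : measurable Y.
Local Notation C := R[i].

Definition linear_field p q (f : 'rV[R]_N -> 'rV[R]_d -> 'M[C]_(p, q)) :=
  (forall y, inL2 mu Y (f y)) /\
  forall c y z (x : 'rV[R]_d), f (c *: y + z) x = c%:C%C *: f y x + f z x.

Lemma linear_field_rip p q (f g : 'rV[R]_N -> 'rV[R]_d -> 'M[C]_(p, q)) :
  linear_field f -> linear_field g -> bilinear_form (fun y z => rip mu Y (f y) (g z)).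
Proof.
move=> [if_ lf] [ig lg] w; split=> c y z.
  rewrite -(ripZr mY c (ig y) (if_ w)) -(ripDr mY (inL2Z mY _ (ig y)) (ig z) (if_ w)).
  by apply: eq_rip => // x _; exact: lg.
rewrite -(ripZl mY c (if_ y) (ig w)) -(ripDl mY (inL2Z mY _ (if_ y)) (if_ z) (ig w)).
by apply: eq_rip => // x _; exact: lf.
Qed.

Lemma linear_form_rip p q f (g : 'rV[R]_N -> 'rV[R]_d -> 'M[C]_(p, q)) :
  inL2 mu Y f -> linear_field g -> linear_form (fun z => rip mu Y f (g z)).
Proof.
move=> hf [ig lg] c y z.
rewrite -(ripZr mY c (ig y) hf) -(ripDr mY (inL2Z mY _ (ig y)) (ig z) hf).
by apply: eq_rip => // x _; exact: lg.
Qed.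

Lemma linear_fieldD p q (f g : 'rV[R]_N -> 'rV[R]_d -> 'M[C]_(p, q)) :
  linear_field f -> linear_field g -> linear_field (fun y (x : 'rV[R]_d) => f y x + g y x).
Proof.
move=> [if_ lf] [ig lg]; split=> [y|c y z x]; first exact: inL2D.
by rewrite lf lg scalerDr addrACA.
Qed.

Lemma linear_fieldB p q (f g : 'rV[R]_N -> 'rV[R]_d -> 'M[C]_(p, q)) :
  linear_field f -> linear_field g -> linear_field (fun y (x : 'rV[R]_d) => f y x - g y x).
Proof.
move=> [if_ lf] [ig lg]; split=> [y|c y z x]; first exact: inL2B.
by rewrite lf lg scalerBr opprD addrACA.
Qed.

Lemma linear_fieldZ p q (f : 'rV[R]_N -> 'rV[R]_d -> 'M[C]_(p, q)) a :
  linear_field f -> linear_field (fun y (x : 'rV[R]_d) => a *: f y x).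
Proof.
move=> [if_ lf]; split=> [y|c y z x]; first exact: inL2Z.
by rewrite lf scalerDr !scalerA mulrC.
Qed.

Lemma linear_field_mulf m (B : 'rV[R]_d -> 'M[C]_m) (f : 'rV[R]_N -> 'rV[R]_d -> 'cV[C]_m) :
  (forall v, inL2 mu Y v -> inL2 mu Y (Defs.mulf B v)) ->
  linear_field f -> linear_field (fun y => Defs.mulf B (f y)).
Proof.
move=> hB [if_ lf]; split=> [y|c y z x]; first exact: hB.
by rewrite /Defs.mulf lf mulmxDr scalemxAr.
Qed.

End linear_fields.
End bilinear_forms.

Section imaginary_parts.
Variables (R : realType) (d m : nat).
Local Notation C := R[i].
Local Notation rV := 'rV[R]_d.
Local Notation I := (Complex 0 1 : C).

Lemma cdot_iscale p q (f g : 'M[C]_(p, q)) : cdot f (I *: g) = conjc I * cdot f g.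
Proof.
rewrite !cdotE mulr_sumr; apply: eq_bigr => a _; rewrite mulr_sumr; apply: eq_bigr => b _.
by rewrite mxE rmorphM mulrA.
Qed.

Lemma Re_ip_iscale (mu : {measure set rV -> \bar R}) Y p q (f g : rV -> 'M[C]_(p, q)) :
  complex.Re (ip mu Y f (fun x => I *: g x)) = complex.Im (ip mu Y f g).
Proof.
rewrite /ip /cint /=; apply: eq_Rintegral => x _.
by rewrite cdot_iscale ReM ReJ ImJ /= mul0r sub0r mulN1r opprK.
Qed.

Variables (Om : set rV) (D : friedrichs R d m) (Th : mesh R d)
  (Si : elt Th -> face Th -> rV -> 'M[C]_m) (Sb : face Th -> rV -> 'M[C]_m).
Implicit Types u v : hybrid m Th.

Definition iscale v : hybrid m Th :=
  Hybrid (fun T x => I *: ucell v T x) (fun F x => I *: uface v F x).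

Lemma Uh_iscale k v : Uh k v -> Uh k (iscale v).
Proof. by move=> [vT vF]; split=> [T|F]; exact: PkZ. Qed.

Lemma vh_iscale v : vh (iscale v) = (fun x => I *: vh v x).
Proof.
apply/funext => x; rewrite /vh scaler_sumr; apply: eq_bigr => T _.
by rewrite !scalerA mulrC.
Qed.

(* An equality of sesquilinear forms is thus an equality of their real parts. *)
Lemma Re_ah_iscale u v :
  complex.Re (ah Om D Si Sb u (iscale v)) = complex.Im (ah Om D Si Sb u v).
Proof.
have half : (2^-1 : C) = (2^-1)%:C%C by rewrite fmorphV rmorph_nat.
have jumpi T F : jump (iscale v) T F = (fun x => I *: jump v T F x).
  by apply/funext => x; rewrite /jump /= scalerBr.
rewrite /ah /jh half !ReD !ImD; congr (_ + _ + _ + _ + _).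
- by rewrite Re_sum Im_sum; apply: eq_bigr => T _; exact: Re_ip_iscale.
- rewrite ReZ ImZ Re_sum Im_sum; congr (_ * _); apply: eq_bigr => T _.
  rewrite ReZ ImZ Re_sum Im_sum; congr (_ * _); apply: eq_bigr => F _.
  by rewrite jumpi; exact: Re_ip_iscale.
- rewrite Re_sum Im_sum; apply: eq_bigr => T _; rewrite Re_sum Im_sum; apply: eq_bigr => F _.
  rewrite ReZ ImZ; congr (_ * _); rewrite -Re_ip_iscale; congr (complex.Re (ip _ _ _ _)).
  by apply/funext => x /=; rewrite -scalerDr !scalerA mulrC.
- rewrite ReZ ImZ Re_sum Im_sum; congr (_ * _); apply: eq_bigr => F _; exact: Re_ip_iscale.
- rewrite Re_sum Im_sum; apply: eq_bigr => T _; rewrite Re_sum Im_sum; apply: eq_bigr => F _.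
  by rewrite jumpi; exact: Re_ip_iscale.
Qed.

End imaginary_parts.

Section restriction.
Variables (R : realType) (d : nat) (mu : {measure set 'rV[R]_d -> \bar R}) (Y Z : set 'rV[R]_d).
Hypotheses (mY : measurable Y) (mZ : measurable Z) (ZY : Z `<=` Y).
Local Notation C := R[i].
Local Notation rV := 'rV[R]_d.

Lemma inL2S p q (f : rV -> 'M[C]_(p, q)) : inL2 mu Y f ->
  inL2 mu Z f /\ L2norm mu Z f <= L2norm mu Y f.
Proof.
move=> hf; have [mf foo] := hf.
have mc : measurable_fun Y (EFin \o (fun x => cnorm (f x) ^+ 2)).
  by apply/measurable_EFinP; exact: measurable_cnorm.
have c0 x : (0 <= (cnorm (f x) ^+ 2)%:E)%E by rewrite lee_fin sqr_ge0.
have le : (\int[mu]_(x in Z) (cnorm (f x) ^+ 2)%:E <= \int[mu]_(x in Y) (cnorm (f x) ^+ 2)%:E)%E.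
  by apply: ge0_subset_integral.
have Zoo := le_lt_trans le foo.
split.
  split=> // a b; have [m1 m2] := mf a b.
  by split; [apply: measurable_funS m1|apply: measurable_funS m2].
apply: ler_wsqrtr; apply: fine_le => //; rewrite ge0_fin_numE//; exact: integral_ge0.
Qed.

Lemma measurable_indic_field p q (f : rV -> 'M[C]_(p, q)) : measurable_field Y f ->
  measurable_field Y (fun x => (\1_Z x : R)%:C%C *: f x).
Proof.
move=> mf a b; have [m1 m2] := mf a b; have m3 : measurable_fun Y (\1_Z : rV -> R).
  by apply: measurable_funTS; exact: measurable_indic.
split; under eq_fun do rewrite mxE ?ReZ ?ImZ; exact: measurable_funM.
Qed.

Lemma inL2_indic p q (f : rV -> 'M[C]_(p, q)) : inL2 mu Y f ->
  inL2 mu Y (fun x => (\1_Z x : R)%:C%C *: f x).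
Proof.
move=> hf; apply: (inL2_le mY (M := 1) _ hf); first exact: (measurable_indic_field hf.1).
apply: aeW => x _; rewrite cnormZ mul1r indicE; case: (x \in Z).
  by rewrite normr1 mul1r.
by rewrite normr0 mul0r cnorm_ge0.
Qed.

Lemma rip_indic p q (f g : rV -> 'M[C]_(p, q)) :
  rip mu Y f (fun x => (\1_Z x : R)%:C%C *: g x) = rip mu Z f g.
Proof.
rewrite /rip -[in RHS](setIidr ZY) Rintegral_mkcondr; apply: eq_Rintegral => x _.
rewrite rdotZr patchE indicE; case: (x \in Z); first by rewrite mul1r.
by rewrite mul0r.
Qed.

End restriction.

(** * Stability and well-posedness *)

Lemma coercive_sum (R : realType) (a b c e f g h j : R) : a <= b - c ->
  a + e + f + g <= b + h + e + (j - (h + c)) + (f - j) + g.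
Proof. lra. Qed.

Lemma sum_lin (R : realType) (I : finType) (P : pred I) (a : R) (x y : I -> R) :
  \sum_(i | P i) (a * x i - a * y i) = a * \sum_(i | P i) x i - a * \sum_(i | P i) y i.
Proof. by rewrite sumrB !mulr_sumr. Qed.

Lemma sqr_sum_le (R : realType) (s n c q p : R) :
  (s * n + c * (q * p)) ^+ 2 <= 2 * (s ^+ 2 * n ^+ 2) + 2 * c ^+ 2 * (q ^+ 2 * p ^+ 2).
Proof.
rewrite -subr_ge0.
have -> : 2 * (s ^+ 2 * n ^+ 2) + 2 * c ^+ 2 * (q ^+ 2 * p ^+ 2) - (s * n + c * (q * p)) ^+ 2 =
  (s * n - c * (q * p)) ^+ 2 by ring.
exact: sqr_ge0.
Qed.

Lemma graph_sum_le (R : realType) (c g e x : R) : 0 <= c -> 0 <= g -> 0 <= e -> x <= e ->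
  2 * g + 2 * c * x <= 2 * (1 + c) * (e + g).
Proof. by move=> c0 g0 e0 xe; nra. Qed.

(** Adds the energy bound to the transport bound. As [rho >= 1], the constants can be pulled out of
    [(rho + K1 + K2) ^+ 2], leaving exactly [rho ^+ 2]. *)
Lemma stability_real (R : realType) (rho K1 K2 e f g w : R) : 1 <= rho -> 0 <= K1 -> 0 <= K2 ->
  0 <= e -> e <= f -> g <= 2 * w + 6 * (rho + K1 + K2) ^+ 2 * e ->
  e + g <= (1 + 6 * (1 + K1 + K2) ^+ 2) * rho ^+ 2 * f + 2 * w.
Proof.
move=> r1 K10 K20 e0 ef gw.
have r0 : 0 <= rho by exact: le_trans ler01 r1.
have h1 : rho + K1 + K2 <= (1 + K1 + K2) * rho by nra.
have h2 : (rho + K1 + K2) ^+ 2 <= (1 + K1 + K2) ^+ 2 * rho ^+ 2.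
  by rewrite -exprMn !expr2; apply: ler_pM => //; rewrite !addr_ge0.
have h3 : 1 <= rho ^+ 2 by rewrite expr_ge1.
have f0 := le_trans e0 ef.
have h4 : (rho + K1 + K2) ^+ 2 * e <= (1 + K1 + K2) ^+ 2 * rho ^+ 2 * f.
  by apply: ler_pM => //; exact: sqr_ge0.
have h5 : e <= rho ^+ 2 * f by rewrite -[e]mul1r; apply: ler_pM.
have -> : (1 + 6 * (1 + K1 + K2) ^+ 2) * rho ^+ 2 * f =
  rho ^+ 2 * f + 6 * ((1 + K1 + K2) ^+ 2 * rho ^+ 2 * f) by ring.
move: h4 h5 gw; rewrite -[6 * _ * e]mulrA.
move: ((rho + K1 + K2) ^+ 2 * e) ((1 + K1 + K2) ^+ 2 * rho ^+ 2 * f) (rho ^+ 2 * f) => *; lra.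
Qed.

Lemma sum2_lin (R : realType) (I : finType) (a b c : R) (x y : I -> R) :
  \sum_i (a * x i + b * (c * y i)) = a * \sum_i x i + b * (c * \sum_i y i).
Proof. by rewrite big_split -!mulr_sumr. Qed.

Lemma sum3_le (R : realType) (I : finType) (a b : R) (x y z w : I -> R) :
  (forall i, a * x i + y i + z i <= b * w i) ->
  a * (\sum_i x i) + \sum_i y i + \sum_i z i <= b * \sum_i w i.
Proof. by move=> h; rewrite !mulr_sumr -!big_split; apply: ler_sum => i _; exact: h. Qed.

Lemma coercivity_rho (R : realType) (n r p q a b : R) : 0 < n ^+ 2 -> 0 <= n ->
  2 * r * n ^+ 2 <= 2 * p - q -> p <= a * n * n -> - q <= b * n * n -> 0 <= b -> r <= a + b.
Proof.
move=> n2 n0 h1 h2 h3 b0; rewrite -(ler_pM2r n2) mulrDl.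
have b2 : 0 <= b * n ^+ 2 by apply: mulr_ge0 => //; exact: ltW.
move: h1 h2 h3 b2; rewrite -!mulrA -!expr2; move: (r * _) (a * _) (b * _) => *; lra.
Qed.

Lemma eq_terms_le (R : realType) (r x h z a b a' b' : R) : a = a' -> b = b' ->
  r * (x + h * a) + b + z <= r * (x + h * a') + b' + z.
Proof. by move=> -> ->. Qed.

Lemma flux_sum (R : realType) (a b c e : R) : 2 * b = c - e ->
  2^-1 * a - 2^-1 * c = 2^-1 * a - (b + 2^-1 * e).
Proof. by move=> H; lra. Qed.

Lemma ripE (R : realType) d (mu : {measure set 'rV[R]_d -> \bar R}) Y p q (f g : 'rV[R]_d -> 'M[R[i]]_(p, q)) :
  rip mu Y f g = (\int[mu]_(x in Y) rdot (f x) (g x))%R.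
Proof. by []. Qed.

Lemma pfield_eq0 (R : realType) d k p q (x : 'rV[R]_d) :
  pfield (fun _ : {ffun 'I_d -> 'I_k.+1} => 0 : 'M[R[i]]_(p, q)) x = 0.
Proof. by rewrite /pfield big1// => al _; rewrite scaler0. Qed.

Lemma pfield_cst (R : realType) d k p q (a : 'M[R[i]]_(p, q)) (x : 'rV[R]_d) :
  pfield (fun al : {ffun 'I_d -> 'I_k.+1} => if al == [ffun=> ord0] then a else 0) x = a.
Proof.
rewrite /pfield (bigD1 [ffun=> ord0])/=; last by rewrite big1// => i _; rewrite ffunE.
rewrite eqxx big1 => [|i _]; last by rewrite ffunE expr0.
by rewrite rmorph1 scale1r big1 ?addr0// => al /andP[_ /negbTE ->]; rewrite scaler0.
Qed.

Lemma energy_cells (R : realType) (r s b j : R) : 0 < r -> 0 <= s -> 0 <= b -> 0 <= j ->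
  r * s + 2^-1 * b + j = 0 -> s = 0.
Proof. by move=> r0 s0 b0 j0 e; have rs : 0 <= r * s := mulr_ge0 (ltW r0) s0; nra. Qed.

Lemma sum_ge0_eq0 (R : realType) (a b : R) : 0 = a + b -> 0 <= a -> 0 <= b -> a == 0.
Proof. by move=> e a0 b0; apply/eqP; lra. Qed.

Lemma sum_sqr_eq0 (R : realType) (n h s : R) : 0 < h -> 0 <= s -> n ^+ 2 + h * s = 0 ->
  n = 0 /\ s = 0.
Proof.
move=> h0 s0 /eqP; rewrite paddr_eq0 ?sqr_ge0 ?mulr_ge0 ?(ltW h0)//.
by rewrite sqrf_eq0 mulf_eq0 (gt_eqF h0)/= => /andP[/eqP -> /eqP ->].
Qed.

Section stability.
#[local] Opaque rip L2norm pfield.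
Variables (R : realType) (d m k : nat) (Om : set 'rV[R]_d) (Th : mesh R d) (varrho CA CS : R)
  (D : friedrichs R d m)
  (Si : elt Th -> face Th -> 'rV[R]_d -> 'M[R[i]]_m) (Sb : face Th -> 'rV[R]_d -> 'M[R[i]]_m).
Hypotheses (d_gt0 : (0 < d)%N) (Omp : polytopal_domain Om) (Thm : is_mesh Om Th)
  (varrho01 : 0 < varrho < 1) (reg : mesh_regularity Om Th varrho) (Dok : friedrichs_ok Om D)
  (CA0 : 0 <= CA) (hCA : hoelder_constant D Th CA)
  (CS0 : 0 <= CS) (hS : stabilization_ok Om D Si Sb k CS).
Local Notation C := R[i].
Local Notation rV := 'rV[R]_d.
Local Notation lam := (lebesgue_rV R d).
Local Notation exps := {ffun 'I_d -> 'I_k.+1}.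
Local Notation r := (rflat D).
Local Notation ripT T := (rip lam (elt_set T)).
Local Notation nT T := (L2norm lam (elt_set T)).
Local Notation nF F := (L2norm (face_measure F) (face_set F)).
Local Notation ripF F := (rip (face_measure F) (face_set F)).
Local Notation onT T := (fun F : face Th => `[< face_of T F >]).
Local Notation onB := (fun F : face Th => `[< bface Om F >]).
Implicit Types (T : elt Th) (F : face Th) (cT eT : elt Th -> exps -> 'cV[C]_m)
  (cF eF : face Th -> exps -> 'cV[C]_m).

Let mT T : measurable (elt_set T). Proof. exact: (measurable_elt Thm T). Qed.
Let mF F : measurable (face_set F). Proof. exact: (measurable_face Thm F). Qed.
Let r0 : 0 < r. Proof. by have [_ _ _ []] := Dok. Qed.

Definition hyb cT cF : hybrid m Th :=
  Hybrid (fun T => prestr (elt_set T) (cT T)) (fun F => prestr (face_set F) (cF F)).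

Lemma Uh_hyb cT cF : Uh k (hyb cT cF).
Proof. by split=> [T|F]; exact: Pk_prestr. Qed.

Lemma UhE v : Uh k v -> exists cT cF, v = hyb cT cF.
Proof.
case: v => vT vF [/= hT hF].
have /choice[cT hcT] : forall T, exists c : exps -> 'cV[C]_m, vT T = prestr (elt_set T) c by move=> T; exact: (PkE (hT T)).
have /choice[cF hcF] : forall F, exists c : exps -> 'cV[C]_m, vF F = prestr (face_set F) c by move=> F; exact: (PkE (hF F)).
by exists cT, cF; rewrite /hyb; congr Hybrid; apply/funext.
Qed.

Definition pjump cT cF T F (x : rV) : 'cV[C]_m := pfield (cF F) x - pfield (cT T) x.

Lemma ucell_hyb cT cF T x : elt_set T x -> ucell (hyb cT cF) T x = pfield (cT T) x.
Proof. by move=> Tx; apply: prestrE; exact: subset_closure. Qed.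

Lemma uface_hyb cT cF F x : face_set F x -> uface (hyb cT cF) F x = pfield (cF F) x.
Proof. by move=> Fx; apply: prestrE; exact: subset_closure. Qed.

Lemma ucell_hyb_face cT cF T F x : face_of T F -> face_set F x ->
  ucell (hyb cT cF) T x = pfield (cT T) x.
Proof. by move=> TF Fx; apply: prestrE; case: (TF _ Fx). Qed.

Lemma jump_hyb cT cF T F x : face_of T F -> face_set F x ->
  jump (hyb cT cF) T F x = pjump cT cF T F x.
Proof. by move=> TF Fx; rewrite /jump uface_hyb// (ucell_hyb_face _ _ TF). Qed.

Lemma A1_hyb cT cF T x : elt_set T x -> A1 D (ucell (hyb cT cF) T) x = A1p D (cT T) x.
Proof.
move=> Tx; apply: eq_bigr => i _; congr (_ *m _).
rewrite (near_pderiv (g := pfield (cT T)) i (@elt_open _ _ _ _ Thm T) Tx) ?pderiv_pfield//.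
by move=> y Ty; exact: (ucell_hyb cT cF).
Qed.

Lemma face_elt F : exists T, face_of T F.
Proof.
have [_ [_ _ h _] _] := Thm; case: (h F) => [[T [_ [_ + _]]]|[_ [T [+ _]]]]; by exists T.
Qed.

Lemma inL2_face cF F : inL2 (face_measure F) (face_set F) (pfield (cF F)).
Proof. by have [T TF] := face_elt F; exact: (inL2_pfield_face d_gt0 Omp Thm (cF F) TF). Qed.

Lemma inL2_trace cT T F : face_of T F -> inL2 (face_measure F) (face_set F) (pfield (cT T)).
Proof. exact: (inL2_pfield_face d_gt0 Omp Thm). Qed.

Lemma inL2_pjump cT cF T F : face_of T F -> inL2 (face_measure F) (face_set F) (pjump cT cF T F).
Proof. by move=> TF; exact: (inL2B (mF F) (inL2_face cF F) (inL2_trace cT TF)). Qed.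

Lemma inL2_cell cT T : inL2 lam (elt_set T) (pfield (cT T)).
Proof. exact: (inL2_pfield_elt d_gt0 Omp Thm). Qed.

Lemma fK_mulbound T : mulbound lam (elt_set T) (fK D) (Linf_norm lam Om (fK D)).
Proof.
have [iK _ _ _ _] := Dok.
exact: (mulboundS (measurable_domain Omp) (@elt_sub_domain _ _ _ _ Omp Thm T) (Linf_mulbound iK)).
Qed.

Lemma inL2_fK T f : inL2 lam (elt_set T) f -> inL2 lam (elt_set T) (Defs.mulf (fK D) f).
Proof. by move=> hf; have [] := inL2_mulbound (mT T) (fK_mulbound T) hf. Qed.

Lemma inL2_fdivA T f : inL2 lam (elt_set T) f -> inL2 lam (elt_set T) (Defs.mulf (fdivA D) f).
Proof.
move=> hf; have [M hM] := fdivA_mulbound Omp Thm Dok T.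
by have [] := inL2_mulbound (mT T) hM hf.
Qed.

Lemma inL2_NF F f : inL2 (face_measure F) (face_set F) f ->
  inL2 (face_measure F) (face_set F) (Defs.mulf (Defs.NF D F) f).
Proof.
move=> hf; have [T TF] := face_elt F.
have [M hM] := bnd_matrix_mulbound Omp Dok (face_measure F) (face_normal F)
  (face_sub_domain Thm TF).
by have [] := inL2_mulbound (mF F) hM hf.
Qed.

Lemma bface_boundary F : bface Om F ->
  face_set F `<=` bnd Om `&` hyperplane (face_normal F) (face_offset F).
Proof. by move=> [bF _] x Fx; split; [exact: bF|exact: (face_in_plane Thm)]. Qed.

Lemma measurable_boundary n c : measurable (bnd Om `&` hyperplane n c).
Proof.
apply: measurableI.
  apply: measurableD; first exact: measurable_closure.
  exact: (@open_measurable_rV R d _ (@open_interior _ Om)).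
exact: measurable_hyperplane.
Qed.

Lemma inL2_MSF F f : bface Om F -> inL2 (face_measure F) (face_set F) f ->
  inL2 (face_measure F) (face_set F) (Defs.mulf (MSF D Sb F) f).
Proof.
move=> bF hf; have [_ _ _ _ /(_ _ (face_offset F) (face_normal1 Thm F)) [iM _ _]] := Dok.
have [[_ /(_ F bF)[iS _]] _ _ _ _] := hS.
have hM := mulboundD (mulboundS (measurable_boundary _ _) (bface_boundary bF) (Linf_mulbound iM))
  (Linf_mulbound iS).
by have [] := inL2_mulbound (mF F) hM hf.
Qed.

Lemma MSF_ge0 F f : bface Om F -> inL2 (face_measure F) (face_set F) f ->
  0 <= ripF F (Defs.mulf (MSF D Sb F) f) f.
Proof.
move=> bF hf; have [_ _ _ _ /(_ _ (face_offset F) (face_normal1 Thm F)) [_ pM _]] := Dok.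
have [[_ /(_ F bF)[_ pS]] _ _ _ _] := hS.
rewrite ripE; apply: (Rintegral_ge0_ae (mF F)); first exact: (integrable_rdot (mF F) (inL2_MSF bF hf) hf).
apply: filterS2 pM pS => x hM hS' Fx.
rewrite /Defs.mulf /MSF mulmxDl rdotDl; apply: addr_ge0.
  exact: (hM (bface_boundary bF Fx)).
by have [_ /(_ (f x))] := hS' Fx; rewrite lecE => /andP[].
Qed.

Lemma Si_ge0 T F f : face_of T F -> inL2 (face_measure F) (face_set F) f ->
  0 <= ripF F (Defs.mulf (Si T F) f) f.
Proof.
move=> TF hf; have [[/(_ T F TF)[iS pS] _] _ _ _ _] := hS.
exact: (rip_psd_ge0 (mF F) iS pS hf).
Qed.

Lemma inL2_Si T F f : face_of T F -> inL2 (face_measure F) (face_set F) f ->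
  inL2 (face_measure F) (face_set F) (Defs.mulf (Si T F) f).
Proof.
move=> TF hf; have [[/(_ T F TF)[iS pS] _] _ _ _ _] := hS.
exact: (inL2_Linf (mF F) iS hf).
Qed.

(** The real part of [ah] on unknowns given by their coefficients, with polynomials on the whole
    space in place of their restrictions and with the volume and boundary terms split into
    square-integrable pieces. *)
Definition rform cT cF eT eF : R :=
  \sum_T (ripT T (Defs.mulf (fK D) (pfield (cT T))) (pfield (eT T)) +
          ripT T (A1p D (cT T)) (pfield (eT T)))
  + r * (\sum_T hT T * \sum_(F | onT T F) ripF F (pjump cT cF T F) (pjump eT eF T F))
  + \sum_T \sum_(F | onT T F) orient T F *
      ripF F (Defs.mulf (Defs.NF D F) (pjump cT cF T F))
        (fun x => (2^-1)%:C%C *: (pfield (eF F) x + pfield (eT T) x))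
  + 2^-1 * (\sum_(F | onB F)
      (ripF F (Defs.mulf (MSF D Sb F) (pfield (cF F))) (pfield (eF F)) -
       ripF F (Defs.mulf (Defs.NF D F) (pfield (cF F))) (pfield (eF F))))
  + \sum_T \sum_(F | onT T F)
      ripF F (Defs.mulf (Si T F) (pjump cT cF T F)) (pjump eT eF T F).

Lemma Re_jh cT cF eT eF : complex.Re (jh Si (hyb cT cF) (hyb eT eF)) =
  \sum_T \sum_(F | onT T F)
      ripF F (Defs.mulf (Si T F) (pjump cT cF T F)) (pjump eT eF T F).
Proof.
rewrite Re_sum; apply: eq_bigr => T _; rewrite Re_sum; apply: eq_bigr => F /asboolP TF.
rewrite Re_ip; apply: eq_rip => x Fx; last exact: jump_hyb.
by rewrite /Defs.mulf jump_hyb.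
Qed.

Lemma Re_ah cT cF eT eF :
  complex.Re (ah Om D Si Sb (hyb cT cF) (hyb eT eF)) = rform cT cF eT eF.
Proof.
have half : (2^-1 : C) = (2^-1)%:C%C by rewrite fmorphV rmorph_nat.
rewrite /ah /rform !ReD Re_jh; congr (_ + _ + _ + _ + _).
- rewrite Re_sum; apply: eq_bigr => T _; rewrite Re_ip.
  rewrite -(ripDl (mT T) (inL2_fK (inL2_cell cT T))
    (inL2_A1p d_gt0 Omp Thm Dok T (cT T)) (inL2_cell eT T)).
  apply: eq_rip => x Tx; last exact: ucell_hyb.
  by rewrite /Aop A1_hyb// ucell_hyb.
- rewrite ReZ; congr (_ * _); rewrite Re_sum; apply: eq_bigr => T _; rewrite ReZ; congr (_ * _).
  rewrite Re_sum; apply: eq_bigr => F /asboolP TF; rewrite Re_ip.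
  by apply: eq_rip => x Fx; exact: jump_hyb.
- rewrite Re_sum; apply: eq_bigr => T _; rewrite Re_sum; apply: eq_bigr => F /asboolP TF.
  rewrite ReZ Re_ip; apply: (congr1 (fun z => orient T F * z)); apply: eq_rip => x Fx.
    by rewrite /Defs.mulf jump_hyb.
  by rewrite half (uface_hyb _ _ Fx) (ucell_hyb_face _ _ TF Fx).
- rewrite half ReZ; congr (_ * _); rewrite Re_sum; apply: eq_bigr => F /asboolP bF.
  rewrite Re_ip -(ripBl (mF F) (inL2_MSF bF (inL2_face cF F)) (inL2_NF (inL2_face cF F)) (inL2_face eF F)).
  apply: eq_rip => x Fx; last exact: uface_hyb.
  by rewrite /Defs.mulf uface_hyb// mulmxBl.
Qed.

Definition bound_energy cF : R :=
  \sum_(F | onB F) ripF F (Defs.mulf (MSF D Sb F) (pfield (cF F))) (pfield (cF F)).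

Definition energy cT cF : R :=
  r * (\sum_T (nT T (pfield (cT T)) ^+ 2 +
       hT T * \sum_(F | onT T F) nF F (pjump cT cF T F) ^+ 2))
  + 2^-1 * bound_energy cF
  + \sum_T \sum_(F | onT T F) ripF F (Defs.mulf (Si T F) (pjump cT cF T F)) (pjump cT cF T F).

Definition graph_energy cT : R := \sum_T tT D T * nT T (A1p D (cT T)) ^+ 2.

Lemma flat_norm2_hyb cT cF : flat_norm2 Om D Si Sb (hyb cT cF) = energy cT cF.
Proof.
have cell T : local_norm2 (hyb cT cF) T = nT T (pfield (cT T)) ^+ 2 +
    hT T * \sum_(F | onT T F) nF F (pjump cT cF T F) ^+ 2.
  rewrite /local_norm2 (@eq_L2norm R d lam (elt_set T) _ _ _ _ (fun x => @ucell_hyb cT cF T x)).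
  apply: (congr1 (fun z => _ + hT T * z)); apply: eq_bigr => F /asboolP TF.
  by rewrite /normF (@eq_L2norm R d (face_measure F) (face_set F) _ _ _ _ (fun x => @jump_hyb cT cF T F x TF)).
have bound : bnorm2 Om D Sb (hyb cT cF) = bound_energy cF.
  apply: eq_bigr => F /asboolP bF; rewrite Re_ip; apply: eq_rip => x Fx; last exact: uface_hyb.
  by rewrite /Defs.mulf uface_hyb.
have cells : \sum_T local_norm2 (hyb cT cF) T = \sum_T (nT T (pfield (cT T)) ^+ 2 +
    hT T * \sum_(F | onT T F) nF F (pjump cT cF T F) ^+ 2) := eq_bigr _ (fun T _ => cell T).
by rewrite /flat_norm2 Re_jh bound cells.
Qed.

Lemma tT_gt0 T : 0 < tT D T.
Proof. by have [] := time_scale (@aT_ge0 _ _ _ D Th T) (hT_gt0 d_gt0 Omp Thm T) r0. Qed.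

Lemma bound_energy_ge0 cF : 0 <= bound_energy cF.
Proof. by apply: sumr_ge0 => F /asboolP bF; exact: (MSF_ge0 bF (inL2_face cF F)). Qed.

Lemma stab_energy_ge0 cT cF : 0 <= \sum_T \sum_(F | onT T F)
  ripF F (Defs.mulf (Si T F) (pjump cT cF T F)) (pjump cT cF T F).
Proof.
by apply: sumr_ge0 => T _; apply: sumr_ge0 => F /asboolP TF; exact: (Si_ge0 TF (inL2_pjump cT cF TF)).
Qed.

Lemma cell_energy_ge0 cT cF T : 0 <= nT T (pfield (cT T)) ^+ 2 +
       hT T * \sum_(F | onT T F) nF F (pjump cT cF T F) ^+ 2.
Proof.
apply: addr_ge0; first exact: sqr_ge0.
apply: mulr_ge0; first exact: (ltW (hT_gt0 d_gt0 Omp Thm T)).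
by apply: sumr_ge0 => F _; exact: sqr_ge0.
Qed.

Lemma energy_ge0 cT cF : 0 <= energy cT cF.
Proof.
apply: addr_ge0; last exact: stab_energy_ge0.
apply: addr_ge0; last by apply: mulr_ge0; [rewrite invr_ge0|exact: bound_energy_ge0].
apply: mulr_ge0; first exact: ltW.
by apply: sumr_ge0 => T _; exact: cell_energy_ge0.
Qed.

Lemma graph_energy_ge0 cT : 0 <= graph_energy cT.
Proof. by apply: sumr_ge0 => T _; apply: mulr_ge0 (sqr_ge0 _); exact: (ltW (tT_gt0 T)). Qed.

Lemma hnorm_hyb cT cF :
  hnorm Om D Si Sb (hyb cT cF) = Num.sqrt (energy cT cF + graph_energy cT).
Proof.
rewrite /hnorm flat_norm2_hyb; apply: (congr1 (fun z => Num.sqrt (_ + z))).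
by apply: eq_bigr => T _; rewrite (@eq_L2norm R d lam (elt_set T) _ _ _ _ (fun x => @A1_hyb cT cF T x)).
Qed.

Lemma hnorm_sqr cT cF : hnorm Om D Si Sb (hyb cT cF) ^+ 2 = energy cT cF + graph_energy cT.
Proof. by rewrite hnorm_hyb sqr_sqrtr// addr_ge0 ?energy_ge0 ?graph_energy_ge0. Qed.

Lemma rdot_adjoint (B : 'M[C]_m) (u : 'cV[C]_m) : rdot (adjoint B *m u) u = rdot (B *m u) u.
Proof.
rewrite !rdot_mulmx exchange_big; apply: eq_bigr => a _; apply: eq_bigr => b _.
rewrite !mxE -[LHS]ReJ !rmorphM/= !conjcK.
by congr complex.Re; ring.
Qed.

Lemma dissipation : {ae lam, forall x, Om x -> forall xi : 'cV[C]_m,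
  2 * r * rdot xi xi <= 2 * rdot (fK D x *m xi) xi - rdot (fdivA D x *m xi) xi}.
Proof.
have [_ _ _ [_ h] _] := Dok; apply: filterS h => x hx Ox xi.
have := hx Ox xi; rewrite lecE => /andP[_]; rewrite ReZ.
rewrite /qform mulmxBl mulmxDl -!/(rdot _ _) rdotBl rdotDl rdot_adjoint => H.
by rewrite [2 * rdot (_ *m _) _]mulr_natl mulr2n.
Qed.

Lemma reaction_coercive cT T : 2 * r * nT T (pfield (cT T)) ^+ 2 <=
  2 * ripT T (Defs.mulf (fK D) (pfield (cT T))) (pfield (cT T))
  - ripT T (Defs.mulf (fdivA D) (pfield (cT T))) (pfield (cT T)).
Proof.
set v := pfield (cT T); have hv : inL2 lam (elt_set T) v := inL2_cell cT T.
have hK := inL2_fK hv; have hG := inL2_fdivA hv.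
have h2 : (2 : C) = (2 : R)%:C%C by rewrite rmorph_nat.
rewrite L2norm_sqr -(ripZl (mT T) (2 * r) hv hv) -(ripZl (mT T) 2 hK hv).
rewrite -(ripBl (mT T) (inL2Z (mT T) _ hK) hG hv).
rewrite !ripE; apply: (le_Rintegral_ae (mT T)).
- exact: (integrable_rdot (mT T) (inL2Z (mT T) _ hv) hv).
- exact: (integrable_rdot (mT T) (inL2B (mT T) (inL2Z (mT T) _ hK) hG) hv).
- apply: filterS dissipation => x hx Tx.
  rewrite rdotBl !rdotZl; exact: (hx (@elt_sub_domain _ _ _ _ Omp Thm T x Tx)).
Qed.

(** A difference of squares: the two cross terms cancel because the flux matrix is Hermitian at
    every point of the face. This is what the average in the flux term of the form is designed
    for. *)
Lemma flux_polarize cT cF T F : face_of T F ->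
  ripF F (Defs.mulf (Defs.NF D F) (pjump cT cF T F))
        (fun x => (2^-1)%:C%C *: (pfield (cF F) x + pfield (cT T) x)) =
  2^-1 * (ripF F (Defs.mulf (Defs.NF D F) (pfield (cF F))) (pfield (cF F)) -
          ripF F (Defs.mulf (Defs.NF D F) (pfield (cT T))) (pfield (cT T))).
Proof.
move=> TF; have hf := inL2_face cF F; have ht := inL2_trace cT TF.
have Nf := inL2_NF hf; have Nt := inL2_NF ht.
rewrite (ripZr (mF F) _ (inL2D (mF F) hf ht) (inL2_NF (inL2_pjump cT cF TF))); congr (_ * _).
have -> : Defs.mulf (Defs.NF D F) (pjump cT cF T F) =
    (fun x => Defs.mulf (Defs.NF D F) (pfield (cF F)) x - Defs.mulf (Defs.NF D F) (pfield (cT T)) x).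
  by apply/funext => x; rewrite /Defs.mulf /pjump mulmxBr.
rewrite (ripBl (mF F) Nf Nt (inL2D (mF F) hf ht)) (ripDr (mF F) hf ht Nf) (ripDr (mF F) hf ht Nt).
have -> : ripF F (Defs.mulf (Defs.NF D F) (pfield (cF F))) (pfield (cT T)) =
          ripF F (Defs.mulf (Defs.NF D F) (pfield (cT T))) (pfield (cF F)).
  rewrite !ripE; apply: eq_Rintegral => x; rewrite inE => Fx; apply: rdot_herm.
  exact: (bnd_matrix_herm Dok _ (face_sub_domain Thm TF Fx)).
by rewrite opprD addrA addrK.
Qed.

Lemma elt_flux cT cF T : \sum_(F | onT T F) orient T F *
      ripF F (Defs.mulf (Defs.NF D F) (pjump cT cF T F))
        (fun x => (2^-1)%:C%C *: (pfield (cF F) x + pfield (cT T) x)) =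
    2^-1 * (\sum_(F | onT T F) orient T F *
      ripF F (Defs.mulf (Defs.NF D F) (pfield (cF F))) (pfield (cF F))) -
    (ripT T (A1p D (cT T)) (pfield (cT T)) +
        2^-1 * ripT T (Defs.mulf (fdivA D) (pfield (cT T))) (pfield (cT T))).
Proof.
have pol F : onT T F -> orient T F *
      ripF F (Defs.mulf (Defs.NF D F) (pjump cT cF T F))
        (fun x => (2^-1)%:C%C *: (pfield (cF F) x + pfield (cT T) x)) =
    2^-1 * (orient T F * ripF F (Defs.mulf (Defs.NF D F) (pfield (cF F))) (pfield (cF F))) -
    2^-1 * (orient T F * ripF F (Defs.mulf (Defs.NF D F) (pfield (cT T))) (pfield (cT T))).
  move=> /asboolP TF; rewrite flux_polarize// mulrCA mulrBr mulrBr; congr (_ - _).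
apply: (eq_trans (eq_bigr _ pol)); apply: (eq_trans (sum_lin _ _ _ _)).
exact: (flux_sum _ (element_ibp d_gt0 Omp Thm reg Dok T (cT T))).
Qed.

(** The face squares sum to the boundary faces by [sum_orient], where they cancel against the flux
    matrix in the boundary term. The trace squares cancel the transport term by [element_ibp], up to
    half of the divergence, which joins the reaction. *)
Lemma coercive cT cF : energy cT cF <= rform cT cF cT cF.
Proof.
rewrite /rform (eq_bigr _ (fun T _ => elt_flux cT cF T)) sumrB -mulr_sumr (sum_orient Omp Thm).
rewrite /energy sumrB !big_split/=.
have jumps : \sum_T hT T * (\sum_(F | onT T F) ripF F (pjump cT cF T F) (pjump cT cF T F)) =
   \sum_T hT T * (\sum_(F | onT T F) nF F (pjump cT cF T F) ^+ 2).
  apply: eq_bigr => T _; apply: (congr1 (fun z => hT T * z)).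
  by apply: eq_bigr => F _; rewrite L2norm_sqr.
rewrite jumps {jumps}.
have react : r * (\sum_T nT T (pfield (cT T)) ^+ 2) <=
  \sum_T ripT T (Defs.mulf (fK D) (pfield (cT T))) (pfield (cT T)) -
  \sum_T 2^-1 * ripT T (Defs.mulf (fdivA D) (pfield (cT T))) (pfield (cT T)).
  rewrite mulr_sumr -sumrB; apply: ler_sum => T _; have := reaction_coercive cT T.
  rewrite -mulrA; move: (rflat D * _) (rip _ _ _ _) (rip _ _ _ _) => a b c; lra.
by rewrite mulrDr mulrBr; exact: coercive_sum.
Qed.

(** At a generic point the dissipation inequality, tested on a nonzero vector, bounds [2 r] by twice
    the norm of [fK] plus the norm of [fdivA]. *)
Lemma rho_ge1 : (0 < m)%N -> 1 <= rsharp Om D / r.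
Proof.
move=> m0; rewrite ler_pdivlMr// mul1r.
have [iK _ [iG _] _ _] := Dok.
have [_ _ hK] := Linf_mulbound iK; have [_ _ hG] := Linf_mulbound iG.
have [x [Ox [hx [hKx hGx]]]] : exists x, Om x /\
    ((forall xi : 'cV[C]_m, 2 * r * rdot xi xi <= 2 * rdot (fK D x *m xi) xi - rdot (fdivA D x *m xi) xi) /\
    ((forall xi : 'cV[C]_m, cnorm (fK D x *m xi) <= Linf_norm lam Om (fK D) * cnorm xi) /\
     (forall xi : 'cV[C]_m, cnorm (fdivA D x *m xi) <= Linf_norm lam Om (fdivA D) * cnorm xi))).
  (* The bounds hold almost everywhere only; a point satisfying all of them exists because the
     domain has positive measure. *)
  apply: contrapT => N; have Omgt : (0 < lam Om)%E.
    by case: Omp => P _ _; apply: measure_open_gt0; [exact: (polytopal_open P)|case: P].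
  have [B [mB B0 sB]] : lam.-negligible Om.
    have H : {ae lam, forall x, Om x -> False}.
      apply: filterS3 dissipation hK hG => x h1 h2 h3 Ox; apply: N; exists x; split => //.
      by split; [exact: h1|split; [exact: h2|exact: h3]].
    by apply: negligibleS H => x Ox /(_ Ox).
  have : (lam Om <= lam B)%E by apply: le_measure => //; rewrite inE//; exact: measurable_domain.
  by rewrite B0 leNgt Omgt.
pose xi : 'cV[C]_m := const_mx 1.
have x0 : 0 < rdot xi xi.
  rewrite lt_neqAle rdot_ge0 andbT eq_sym; apply/eqP => E.
  have /cnorm_eq0 : cnorm xi = 0 by rewrite /cnorm -/(rdot _ _) E sqrtr0.
  by move=> /matrixP/(_ (Ordinal m0) ord0)/eqP; rewrite !mxE oner_eq0.
have nx := cnorm_sqr xi.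
have h1 := le_trans (ler_norm _) (rdot_cs (fK D x *m xi) xi).
have h2 := le_trans (ler_norm _) (rdot_cs (- fdivA D x *m xi) xi).
have n0 := cnorm_ge0 xi.
have h3 := ler_wpM2r n0 (hKx xi); have h4 := ler_wpM2r n0 (hGx xi).
move: h2; rewrite mulNmx rdotNl cnormN => h2.
have gE : 0 <= Linf_norm lam Om (fdivA D) by apply: fine_ge0; exact: Linf_enorm_ge0.
have hxx := hx xi; rewrite -nx in hxx x0.
exact: (coercivity_rho x0 n0 hxx (le_trans h1 h3) (le_trans h2 h4) gE).
Qed.

Definition ctestT cT T : exps -> 'cV[C]_m := ctest D T (cT T).

Lemma pjump_ctest eT T F x : pjump eT (fun _ _ => 0) T F x = - pfield (eT T) x.
Proof. by rewrite /pjump pfield_eq0 sub0r. Qed.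

Lemma ripF_pjump0 eT T F f : face_of T F -> inL2 (face_measure F) (face_set F) f ->
  ripF F f (pjump eT (fun _ _ => 0) T F) = - ripF F f (pfield (eT T)).
Proof.
move=> TF hf; rewrite -(ripNr (mF F) (inL2_trace eT TF) hf).
by apply: eq_rip => // x _; exact: pjump_ctest.
Qed.

(** With zero face components the boundary terms disappear and nothing couples neighbouring elements
    through the test function, so the form is a sum of independent [elt_form]. *)
Lemma rform_ctest cT cF eT :
  (forall T, eT T = ctestT cT T) ->
  rform cT cF eT (fun _ _ => 0) = \sum_T elt_form D Si T (cT T) (pjump cT cF T).
Proof.
move=> eTE.
have bd : \sum_(F | onB F)
      (ripF F (Defs.mulf (MSF D Sb F) (pfield (cF F))) (pfield (fun _ : exps => 0 : 'cV[C]_m)) -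
       ripF F (Defs.mulf (Defs.NF D F) (pfield (cF F))) (pfield (fun _ : exps => 0))) = 0.
  have z : pfield (fun _ : exps => 0 : 'cV[C]_m) = fun _ : rV => 0 by apply/funext => x; exact: pfield_eq0.
  by rewrite z; apply: big1 => F _; rewrite !rip0r subrr.
rewrite /rform bd mulr0 addr0.
have e1 T : r * (hT T * \sum_(F | onT T F) ripF F (pjump cT cF T F) (pjump eT (fun _ _ => 0) T F)) =
    - (r * hT T * \sum_(F | onT T F) ripF F (pjump cT cF T F) (pfield (ctest D T (cT T)))).
  rewrite mulrA -mulrN -sumrN; apply: (congr1 (fun z => r * hT T * z)).
  by apply: eq_bigr => F /asboolP TF; rewrite (ripF_pjump0 _ TF (inL2_pjump cT cF TF)) eTE.
have e2 T : \sum_(F | onT T F) orient T F *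
      ripF F (Defs.mulf (Defs.NF D F) (pjump cT cF T F))
        (fun x => (2^-1)%:C%C *: (pfield (fun _ : exps => 0) x + pfield (eT T) x)) =
    2^-1 * \sum_(F | onT T F) orient T F *
      ripF F (Defs.mulf (Defs.NF D F) (pjump cT cF T F)) (pfield (ctest D T (cT T))).
  rewrite mulr_sumr; apply: eq_bigr => F /asboolP TF; rewrite [RHS]mulrCA.
  apply: (congr1 (fun z => orient T F * z)).
  rewrite -(ripZr (mF F) _ (inL2_trace (ctestT cT) TF) (inL2_NF (inL2_pjump cT cF TF))).
  by apply: eq_rip => // x _; rewrite pfield_eq0 add0r eTE.
have e3 T : \sum_(F | onT T F)
      ripF F (Defs.mulf (Si T F) (pjump cT cF T F)) (pjump eT (fun _ _ => 0) T F) =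
    - \sum_(F | onT T F) ripF F (Defs.mulf (Si T F) (pjump cT cF T F)) (pfield (ctest D T (cT T))).
  rewrite -sumrN; apply: eq_bigr => F /asboolP TF.
  by rewrite (ripF_pjump0 _ TF (inL2_Si TF (inL2_pjump cT cF TF))) eTE.
rewrite mulr_sumr (eq_bigr _ (fun T _ => e1 T)) (eq_bigr _ (fun T _ => e2 T)) (eq_bigr _ (fun T _ => e3 T)).
rewrite -!big_split; apply: eq_bigr => T _; rewrite eTE.
exact: erefl.
Qed.

Lemma energy_ctest cT :
  energy (ctestT cT) (fun _ _ => 0) + graph_energy (ctestT cT) <=
  test_cst d k varrho CS * \sum_T (Num.sqrt (tT D T) * nT T (Amean D T (cT T))) ^+ 2.
Proof.
have bd : bound_energy (fun _ _ => 0) = 0.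
  have z : pfield (fun _ : exps => 0 : 'cV[C]_m) = fun _ : rV => 0 by apply/funext => x; exact: pfield_eq0.
  by rewrite /bound_energy z; apply: big1 => F _; rewrite rip0r.
have e1 T F : onT T F -> nF F (pjump (ctestT cT) (fun _ _ => 0) T F) ^+ 2 =
    nF F (pfield (ctest D T (cT T))) ^+ 2.
  move=> /asboolP TF; rewrite !L2norm_sqr (ripF_pjump0 _ TF (inL2_pjump _ (fun _ _ => 0) TF)) ripC.
  by rewrite (ripF_pjump0 _ TF (inL2_trace (ctestT cT) TF)) opprK.
have e2 T F : onT T F ->
    ripF F (Defs.mulf (Si T F) (pjump (ctestT cT) (fun _ _ => 0) T F)) (pjump (ctestT cT) (fun _ _ => 0) T F) =
    ripF F (Defs.mulf (Si T F) (pfield (ctest D T (cT T)))) (pfield (ctest D T (cT T))).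
  move=> /asboolP TF; have hw := inL2_trace (ctestT cT) TF.
  rewrite (ripF_pjump0 _ TF (inL2_Si TF (inL2_pjump _ (fun _ _ => 0) TF))).
  have -> : ripF F (Defs.mulf (Si T F) (pjump (ctestT cT) (fun _ _ => 0) T F)) (pfield (ctestT cT T)) =
      - ripF F (Defs.mulf (Si T F) (pfield (ctestT cT T))) (pfield (ctestT cT T)).
    rewrite -(ripNl (mF F) (inL2_Si TF hw) hw); apply: eq_rip => // x _.
    by rewrite /Defs.mulf pjump_ctest mulmxN.
  by rewrite opprK.
rewrite /energy bd mulr0 addr0 /graph_energy; apply: sum3_le => T.
apply: le_trans (ctest_hnorm d_gt0 Omp Thm varrho01 reg Dok CS0 hS T (cT T)).
have E1 : \sum_(F | onT T F) nF F (pjump (ctestT cT) (fun _ _ => 0) T F) ^+ 2 =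
    \sum_(F | onT T F) nF F (pfield (ctest D T (cT T))) ^+ 2 := eq_bigr _ (e1 T).
have E2 : \sum_(F | onT T F) ripF F (Defs.mulf (Si T F) (pjump (ctestT cT) (fun _ _ => 0) T F))
      (pjump (ctestT cT) (fun _ _ => 0) T F) =
    \sum_(F | onT T F) ripF F (Defs.mulf (Si T F) (pfield (ctest D T (cT T)))) (pfield (ctest D T (cT T)))
  := eq_bigr _ (e2 T).
exact: (eq_terms_le _ _ _ _ E1 E2).
Qed.

Definition stab_cst1 : R := 1 + 6 * (1 + mean_cst d k varrho CA + flux_cst d k varrho CS) ^+ 2.
Definition stab_cst2 : R := Num.sqrt (2 * test_cst d k varrho CS * (1 + mean_cst d k varrho CA ^+ 2)).

(** The sizes of the local test functions are compared with the unknown through [Z_le]: the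
    transport term controls them up to the error of the mean, which is part of the energy. *)
Lemma ctest_bound cT cF :
  hnorm Om D Si Sb (hyb (ctestT cT) (fun _ _ => 0)) <= stab_cst2 * hnorm Om D Si Sb (hyb cT cF).
Proof.
set K1 := mean_cst d k varrho CA; set K3 := test_cst d k varrho CS.
have K30 : 0 <= K3.
  have t0 := @trace_cst_ge0 R d k varrho varrho01.
  by rewrite /K3 /test_cst !addr_ge0 ?sqr_ge0//; exact: mulr_ge0.
have Zb : \sum_T (Num.sqrt (tT D T) * nT T (Amean D T (cT T))) ^+ 2 <=
    2 * (1 + K1 ^+ 2) * (energy cT cF + graph_energy cT).
  have zb T : (Num.sqrt (tT D T) * nT T (Amean D T (cT T))) ^+ 2 <=
      2 * (tT D T * nT T (A1p D (cT T)) ^+ 2) + 2 * K1 ^+ 2 * (r * nT T (pfield (cT T)) ^+ 2).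
    have hz := Z_le d_gt0 Omp Thm varrho01 reg Dok CA0 hCA T (cT T).
    have z0 : 0 <= Num.sqrt (tT D T) * nT T (Amean D T (cT T)).
      by apply: mulr_ge0; [exact: sqrtr_ge0|exact: L2norm_ge0].
    have H : (Num.sqrt (tT D T) * nT T (Amean D T (cT T))) ^+ 2 <= (Num.sqrt (tT D T) * nT T (A1p D (cT T))
       + K1 * (Num.sqrt r * nT T (pfield (cT T)))) ^+ 2 by rewrite !expr2; exact: ler_pM.
    apply: le_trans H _.
    rewrite -{2}(sqr_sqrtr (ltW (tT_gt0 T))) -{2}(sqr_sqrtr (ltW r0)).
    exact: sqr_sum_le.
  apply: le_trans (ler_sum _ (fun T _ => zb T)) _.
  rewrite sum2_lin.
  have eb : r * (\sum_T nT T (pfield (cT T)) ^+ 2) <= energy cT cF.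
    rewrite /energy -addrA; apply: le_trans (_ : r * (\sum_T (nT T (pfield (cT T)) ^+ 2 +
       hT T * \sum_(F | onT T F) nF F (pjump cT cF T F) ^+ 2)) <= _).
      apply: ler_wpM2l; first exact: ltW.
      apply: ler_sum => T _; rewrite lerDl; apply: mulr_ge0; first exact: (ltW (hT_gt0 d_gt0 Omp Thm T)).
      by apply: sumr_ge0 => F _; exact: sqr_ge0.
    rewrite lerDl; apply: addr_ge0 (stab_energy_ge0 cT cF).
    by apply: mulr_ge0 (bound_energy_ge0 cF).
  exact: (graph_sum_le (sqr_ge0 K1) (graph_energy_ge0 cT) (energy_ge0 cT cF) eb).
apply: le_of_sqr; first by apply: mulr_ge0; exact: sqrtr_ge0.
rewrite hnorm_sqr exprMn hnorm_sqr sqr_sqrtr; last first.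
  apply: mulr_ge0; first by apply: mulr_ge0.
  by apply: addr_ge0 => //; exact: sqr_ge0.
apply: le_trans (energy_ctest cT) _; apply: le_trans (ler_wpM2l K30 Zb) _.
rewrite -/K1 -/K3 !mulrA [K3 * 2]mulrC; exact: lexx.
Qed.

(** The two test functions, the unknown itself and [ctest], are kept apart instead of being combined
    into one; each value of the form is later bounded by the supremum times the norm of its own test
    function. *)
Lemma stability cT cF : (0 < m)%N ->
  hnorm Om D Si Sb (hyb cT cF) ^+ 2 <=
  stab_cst1 * (rsharp Om D / r) ^+ 2 * rform cT cF cT cF
  + 2 * rform cT cF (ctestT cT) (fun _ _ => 0).
Proof.
move=> m0; have rho1 := rho_ge1 m0; set rho := rsharp Om D / r.
rewrite -/rho in rho1; rewrite hnorm_sqr.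
set K1 := mean_cst d k varrho CA; set K2 := flux_cst d k varrho CS.
have K10 : 0 <= K1 by exact: mean_cst_ge0.
have K20 : 0 <= K2 by exact: flux_cst_ge0.
have main : graph_energy cT <= 2 * rform cT cF (ctestT cT) (fun _ _ => 0)
    + 6 * (rho + K1 + K2) ^+ 2 * energy cT cF.
  rewrite (rform_ctest cF (fun T => erefl)) /graph_energy.
  have P0 : 0 <= 6 * (rho + K1 + K2) ^+ 2 by apply: mulr_ge0 => //; exact: sqr_ge0.
  have eb : \sum_T (r * (nT T (pfield (cT T)) ^+ 2 + hT T * \sum_(F | onT T F) nF F (pjump cT cF T F) ^+ 2) +
      \sum_(F | onT T F) ripF F (Defs.mulf (Si T F) (pjump cT cF T F)) (pjump cT cF T F)) <= energy cT cF.
    rewrite big_split -mulr_sumr /energy addrAC lerDl.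
    by apply: mulr_ge0 (bound_energy_ge0 cF).
  apply: le_trans (ler_sum _ (fun T _ => elt_streamline d_gt0 Omp Thm varrho01 reg Dok CA0 hCA CS0 hS (T := T)
    (cT T) (fun F TF => inL2_pjump cT cF TF))) _.
  by rewrite big_split -!mulr_sumr lerD2l; exact: (ler_wpM2l P0 eb).
have co := coercive cT cF; have e0 := energy_ge0 cT cF.
exact: (stability_real rho1 K10 K20 e0 co main).
Qed.

Lemma hyb0 : hyb (fun _ _ => 0) (fun _ _ => 0) = hybrid0 m Th.
Proof.
have z Y : prestr Y (fun _ : exps => 0 : 'cV[C]_m) = fun _ : rV => 0.
  by apply/funext => x; rewrite /prestr pfield_eq0 if_same.
rewrite /hyb /hybrid0; apply: (f_equal2 (@Hybrid R d m Th)).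
  by apply/funext => T; rewrite z.
by apply/funext => F; rewrite z.
Qed.

Lemma rform0 cT cF : rform cT cF (fun _ _ => 0) (fun _ _ => 0) = 0.
Proof.
have z : pfield (fun _ : exps => 0 : 'cV[C]_m) = fun _ : rV => 0 by apply/funext => x; exact: pfield_eq0.
have zj T F : pjump (fun _ _ => 0) (fun _ _ => 0) T F = fun _ : rV => 0.
  by apply/funext => x; rewrite /pjump z subr0.
have zh : (fun x : rV => (2^-1)%:C%C *: (pfield (fun _ : exps => 0 : 'cV[C]_m) x
    + pfield (fun _ : exps => 0 : 'cV[C]_m) x)) = fun _ : rV => 0.
  by apply/funext => x; rewrite z addr0 scaler0.
have s1 : \sum_T (ripT T (Defs.mulf (fK D) (pfield (cT T))) (pfield (fun _ : exps => 0 : 'cV[C]_m)) +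
          ripT T (A1p D (cT T)) (pfield (fun _ : exps => 0 : 'cV[C]_m))) = 0.
  by apply: big1 => T _; rewrite z !rip0r addr0.
have s2 : \sum_T hT T * \sum_(F | onT T F) ripF F (pjump cT cF T F)
    (pjump (fun _ _ => 0) (fun _ _ => 0) T F) = 0.
  apply: big1 => T _; rewrite big1 ?mulr0// => F _; by rewrite zj rip0r.
have s3 : \sum_T \sum_(F | onT T F) orient T F *
      ripF F (Defs.mulf (Defs.NF D F) (pjump cT cF T F))
        (fun x => (2^-1)%:C%C *: (pfield (fun _ : exps => 0 : 'cV[C]_m) x + pfield (fun _ : exps => 0 : 'cV[C]_m) x)) = 0.
  by apply: big1 => T _; apply: big1 => F _; rewrite zh rip0r mulr0.
have s4 : \sum_(F | onB F)
      (ripF F (Defs.mulf (MSF D Sb F) (pfield (cF F))) (pfield (fun _ : exps => 0 : 'cV[C]_m)) -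
       ripF F (Defs.mulf (Defs.NF D F) (pfield (cF F))) (pfield (fun _ : exps => 0 : 'cV[C]_m))) = 0.
  by apply: big1 => F _; rewrite z !rip0r subrr.
have s5 : \sum_T \sum_(F | onT T F)
      ripF F (Defs.mulf (Si T F) (pjump cT cF T F)) (pjump (fun _ _ => 0) (fun _ _ => 0) T F) = 0.
  by apply: big1 => T _; apply: big1 => F _; rewrite zj rip0r.
by rewrite /rform s1 s2 s3 s4 s5 !mulr0 !addr0.
Qed.

Lemma elt_dense T W : open W -> elt_set T `&` W !=set0 -> ~ lam.-negligible (elt_set T `&` W).
Proof.
move=> oW TW; have oTW := openI (@elt_open _ _ _ _ Thm T) oW.
by apply: negligible_gt0; [exact: open_measurable_rV|exact: measure_open_gt0].
Qed.

Lemma face_dense F W : open W -> face_set F `&` W !=set0 ->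
  ~ (face_measure F).-negligible (face_set F `&` W).
Proof.
have [U oU ->] := face_open Thm F; move=> oW; rewrite -setIA => UW; have oUW := openI oU oW.
apply: negligible_gt0; last exact: (surface_open_gt0 (face_normal1 Thm F) oUW UW).
by apply: measurableI; [exact: measurable_hyperplane|exact: open_measurable_rV].
Qed.

(** The cell terms make the cell components vanish; the jumps then reduce to the face components,
    which vanish in turn. The conclusion concerns the restricted polynomials, not their
    coefficients. *)
Lemma energy_eq0 cT cF : energy cT cF = 0 -> hyb cT cF = hybrid0 m Th.
Proof.
move=> e0.
have c0 : \sum_T (nT T (pfield (cT T)) ^+ 2 +
       hT T * \sum_(F | onT T F) nF F (pjump cT cF T F) ^+ 2) = 0.
  have s0 : 0 <= \sum_T (nT T (pfield (cT T)) ^+ 2 +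
       hT T * \sum_(F | onT T F) nF F (pjump cT cF T F) ^+ 2).
    by apply: sumr_ge0 => T _; exact: cell_energy_ge0.
  exact: (energy_cells r0 s0 (bound_energy_ge0 cF) (stab_energy_ge0 cT cF) e0).
have cell0 T : nT T (pfield (cT T)) ^+ 2 +
       hT T * \sum_(F | onT T F) nF F (pjump cT cF T F) ^+ 2 = 0.
  by apply: (psumr_eq0P _ c0) => // T' _; exact: cell_energy_ge0.
have h0 T := hT_gt0 d_gt0 Omp Thm T.
have sF0 T : 0 <= \sum_(F | onT T F) nF F (pjump cT cF T F) ^+ 2.
  by apply: sumr_ge0 => F _; exact: sqr_ge0.
have T0 T : prestr (elt_set T) (cT T) = fun _ => 0.
  apply: (pfield_vanish (mT T) (@elt_dense T) (inL2_cell cT T)).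
  exact: (sum_sqr_eq0 (h0 T) (sF0 T) (cell0 T)).1.
have F0 F : prestr (face_set F) (cF F) = fun _ => 0.
  have [T TF] := face_elt F.
  apply: (pfield_vanish (mF F) (@face_dense F) (inL2_face cF F)).
  have j0 := (sum_sqr_eq0 (h0 T) (sF0 T) (cell0 T)).2.
  have J0 : nF F (pjump cT cF T F) ^+ 2 = 0.
    by apply: (psumr_eq0P _ j0) => [F' _|]; [exact: sqr_ge0|exact/asboolP].
  apply/eqP; rewrite -sqrf_eq0 -J0; apply/eqP; congr (_ ^+ 2); apply: eq_L2norm => x Fx.
  rewrite /pjump; have -> : pfield (cT T) x = 0; last by rewrite subr0.
  have cx : closure (elt_set T) x by case: (TF _ Fx).
  by rewrite -(prestrE (cT T) cx) T0.
rewrite -hyb0 /hyb; apply: (f_equal2 (@Hybrid R d m Th)); apply/funext => Y.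
  by rewrite T0; apply/funext => x; rewrite /prestr pfield_eq0 if_same.
by rewrite F0; apply/funext => x; rewrite /prestr pfield_eq0 if_same.
Qed.

Lemma hnorm_gt0 cT cF : hyb cT cF <> hybrid0 m Th -> 0 < hnorm Om D Si Sb (hyb cT cF).
Proof.
move=> v0; rewrite lt_neqAle sqrtr_ge0 andbT eq_sym; apply/eqP => h0; apply: v0.
have := hnorm_sqr cT cF; rewrite h0 expr0n/= => E; apply: energy_eq0.
by apply/eqP; move: E (energy_ge0 cT cF) (graph_energy_ge0 cT); exact: sum_ge0_eq0.
Qed.

Lemma Uh_neq0 : (0 < m)%N -> exists cT cF, hyb cT cF <> hybrid0 m Th.
Proof.
move=> m0; pose c (al : exps) : 'cV[C]_m := if al == [ffun=> ord0] then const_mx 1 else 0.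
exists (fun _ => c), (fun _ _ => 0) => E.
have [[[x Ox] _] _ _] := Omp; have [[_ _ cov] _ _] := Thm.
have : closure Om x by exact: subset_closure.
rewrite -cov => -[T _ cx].
have : ucell (hyb (fun _ => c) (fun _ _ => 0)) T x = 0 by rewrite E.
rewrite /= prestrE// pfield_cst => /matrixP/(_ (Ordinal m0) ord0)/eqP.
by rewrite !mxE oner_eq0.
Qed.

Lemma inf_sup_hybrid : (0 < m)%N ->
  inf_sup Om D Si Sb k ((stab_cst1 + 2 * stab_cst2) * (rsharp Om D / r) ^+ 2).
Proof.
move=> m0 v /UhE[cT [cF ->]] {v}; set v := hyb cT cF.
have rho1 := rho_ge1 m0.
have A1c : 0 < stab_cst1 by rewrite ltr_wpDr// mulr_ge0// sqr_ge0.
have B0 : 0 <= stab_cst2 by exact: sqrtr_ge0.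
have c0 : 0 < (stab_cst1 + 2 * stab_cst2) * (rsharp Om D / r) ^+ 2.
  apply: mulr_gt0; first by apply: ltr_wpDr => //; exact: mulr_ge0.
  by apply: exprn_gt0; exact: lt_le_trans rho1.
set S := [set _ | _ in _].
(* A nonzero test function, so that the supremum is not that of the empty set. *)
have [eT [eF e0]] := Uh_neq0 m0.
have ub cT' cF' : hyb cT' cF' <> hybrid0 m Th ->
    ((complex.Re `|ah Om D Si Sb v (hyb cT' cF')| / hnorm Om D Si Sb (hyb cT' cF'))%:E <= ereal_sup S)%E.
  move=> w0; apply: ereal_sup_ubound; exists (hyb cT' cF') => //; split => //; exact: Uh_hyb.
have ge0 w : 0 <= complex.Re `|ah Om D Si Sb v w| / hnorm Om D Si Sb w.
  by apply: divr_ge0; [rewrite complex_normE; exact: sqrtr_ge0|exact: sqrtr_ge0].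
(* The value minus infinity is excluded by that test function, and for plus infinity the bound is
   trivial because the constant is positive. *)
case E : (ereal_sup S) ub => [s||] ub; last first.
- by have := ub _ _ e0; rewrite leNgt ltNye.
- by rewrite gt0_muley ?lte_fin// leey.
rewrite -EFinM lee_fin.
have s0 : 0 <= s by apply: le_trans (ge0 (hyb eT eF)) _; rewrite -lee_fin; exact: ub.
have bd cT' cF' : rform cT cF cT' cF' <= s * hnorm Om D Si Sb (hyb cT' cF').
  rewrite -Re_ah; have [w0|w0] := pselect (hyb cT' cF' = hybrid0 m Th).
    by rewrite w0 -hyb0 Re_ah rform0 mulr_ge0// sqrtr_ge0.
  apply: le_trans (Re_le_norm _) _.
  by rewrite -ler_pdivrMr ?hnorm_gt0// -lee_fin; exact: ub.
exact: (infsup_final (ltW A1c) B0 rho1 (sqrtr_ge0 _) s0 (stability cT cF m0) (bd cT cF)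
  (bd (ctestT cT) (fun _ _ => 0)) (ctest_bound cT cF)).
Qed.

(** Real and imaginary parts of all coefficients. The parametrization is redundant: exponents of
    total degree beyond [k] do not contribute, and different polynomials in [d] variables can agree
    on a flat face. *)
Definition dofs : finType := ((elt Th + face Th) * exps * 'I_m * bool)%type.
Local Notation dofV := 'rV[R]_#|{: dofs}|.
Implicit Types y z : dofV.

Definition dof y (i : dofs) : R := y 0 (enum_rank i).

Definition cell_coef y T (al : exps) : 'cV[C]_m :=
  \col_a Complex (dof y (inl T, al, a, true)) (dof y (inl T, al, a, false)).
Definition face_coef y F (al : exps) : 'cV[C]_m :=
  \col_a Complex (dof y (inr F, al, a, true)) (dof y (inr F, al, a, false)).

Definition dhyb y := hyb (cell_coef y) (face_coef y).

Lemma coefs_surj cT cF : exists y, cT = cell_coef y /\ cF = face_coef y.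
Proof.
pose g (i : dofs) : R := let: (Y, al, a, s) := i in
  part s (match Y with inl T => cT T al a 0 | inr F => cF F al a 0 end).
have dofg i : dof (\row_j g (enum_val j)) i = g i by rewrite /dof mxE enum_rankK.
exists (\row_j g (enum_val j)); split; apply/funext => Y; apply/funext => al; apply/matrixP => a b.
  by rewrite mxE !dofg (ord1 b) /=; case: (cT Y al a 0).
by rewrite mxE !dofg (ord1 b) /=; case: (cF Y al a 0).
Qed.

Lemma cell_coef_lin c y z T : cell_coef (c *: y + z) T =
  fun al => c%:C%C *: cell_coef y T al + cell_coef z T al.
Proof.
apply/funext => al; apply/matrixP => a b; rewrite !mxE /dof !mxE.
by apply: complex_inj; rewrite /= ?mul0r ?subr0 ?addr0.
Qed.

Lemma face_coef_lin c y z F : face_coef (c *: y + z) F =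
  fun al => c%:C%C *: face_coef y F al + face_coef z F al.
Proof.
apply/funext => al; apply/matrixP => a b; rewrite !mxE /dof !mxE.
by apply: complex_inj; rewrite /= ?mul0r ?subr0 ?addr0.
Qed.

Lemma cell_linear T : linear_field lam (elt_set T) (fun y => pfield (cell_coef y T)).
Proof.
split=> [y|c y z x]; first exact: inL2_cell.
by rewrite cell_coef_lin pfieldD pfieldZ.
Qed.

Lemma trace_linear T F : face_of T F ->
  linear_field (face_measure F) (face_set F) (fun y => pfield (cell_coef y T)).
Proof.
move=> TF; split=> [y|c y z x]; first exact: inL2_trace.
by rewrite cell_coef_lin pfieldD pfieldZ.
Qed.

Lemma face_linear F :
  linear_field (face_measure F) (face_set F) (fun y => pfield (face_coef y F)).
Proof.
split=> [y|c y z x]; first exact: inL2_face.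
by rewrite face_coef_lin pfieldD pfieldZ.
Qed.

Lemma pjump_linear T F : face_of T F ->
  linear_field (face_measure F) (face_set F) (fun y => pjump (cell_coef y) (face_coef y) T F).
Proof. by move=> TF; exact: (linear_fieldB (mF F) (face_linear F) (trace_linear TF)). Qed.

Lemma A1p_linear T : linear_field lam (elt_set T) (fun y => A1p D (cell_coef y T)).
Proof.
split=> [y|c y z x]; first exact: (inL2_A1p d_gt0 Omp Thm Dok).
rewrite /A1p scaler_sumr -big_split/=; apply: eq_bigr => i _.
rewrite scalemxAr -mulmxDr; congr (_ *m _); rewrite -pfieldZ -pfieldD.
congr (pfield _ x); apply/funext => be; rewrite cell_coef_lin /dcoefC scaler_sumr -big_split/=.
apply: eq_bigr => al _; case: ifP => _; last by rewrite scaler0 addr0.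
by rewrite scalerDr !scalerA [in LHS]mulrC.
Qed.

Definition dform y z : R := rform (cell_coef y) (face_coef y) (cell_coef z) (face_coef z).

Lemma dform_bilinear : bilinear_form dform.
Proof.
rewrite /dform /rform.
apply: bilinear_formD; last first.
  apply: bilinear_form_sum => T _; apply: bilinear_form_sum => F /asboolP TF.
  apply: (linear_field_rip (mF F)); last exact: pjump_linear.
  by apply: linear_field_mulf (pjump_linear TF) => v hv; exact: inL2_Si.
apply: bilinear_formD; last first.
  apply: bilinear_formZ; apply: bilinear_form_sum => F /asboolP bF.
  apply: bilinear_formB; last first.
    apply: (linear_field_rip (mF F)); last exact: face_linear.
    by apply: linear_field_mulf (face_linear F) => v hv; exact: inL2_NF.
  apply: (linear_field_rip (mF F)); last exact: face_linear.
  by apply: linear_field_mulf (face_linear F) => v hv; exact: inL2_MSF.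
apply: bilinear_formD; last first.
  apply: bilinear_form_sum => T _; apply: bilinear_form_sum => F /asboolP TF.
  apply: bilinear_formZ; apply: (linear_field_rip (mF F)).
    by apply: linear_field_mulf (pjump_linear TF) => v hv; exact: inL2_NF.
  exact: (linear_fieldZ (mF F) _ (linear_fieldD (mF F) (face_linear F) (trace_linear TF))).
apply: bilinear_formD; last first.
  apply: bilinear_formZ; apply: bilinear_form_sum => T _; apply: bilinear_formZ.
  apply: bilinear_form_sum => F /asboolP TF; exact: (linear_field_rip (mF F)) (pjump_linear TF) (pjump_linear TF).
apply: bilinear_form_sum => T _; apply: bilinear_formD.
  apply: (linear_field_rip (mT T)); last exact: cell_linear.
  by apply: linear_field_mulf (cell_linear T) => v hv; exact: inL2_fK.
exact: (linear_field_rip (mT T) (A1p_linear T) (cell_linear T)).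
Qed.

(** * Solvability for a given right-hand side *)

Section load.
Variable f : rV -> 'cV[C]_m.
Hypothesis hf : inL2 lam Om f.

Definition load cT : R := \sum_T ripT T f (pfield (cT T)).

Lemma load_cell T : inL2 lam (elt_set T) f /\ nT T f <= L2norm lam Om f.
Proof. exact: (inL2S (measurable_domain Omp) (mT T) (@elt_sub_domain _ _ _ _ Omp Thm T) hf). Qed.

Lemma Re_load cT cF : complex.Re (ip lam Om f (vh (hyb cT cF))) = load cT.
Proof.
have mOm := measurable_domain Omp; have [B B0 hB] := domain_box Omp.
have OmB : Om `<=` box 0 B by move=> x Ox; apply: hB; exact: subset_closure.
have Omoo : (lam Om < +oo)%E.
  apply: (@le_lt_trans _ _ (lam (box 0 B))); last by rewrite lebesgue_rV_box ?ltry// ltW.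
  by apply: le_measure => //; rewrite inE//; exact: measurable_box.
have hg T : inL2 lam Om (fun x => (\1_(elt_set T) x : R)%:C%C *: pfield (cT T) x).
  by apply: (inL2_indic mOm (mT T)); apply: (inL2_pfield _ mOm Omoo OmB).
have -> : vh (hyb cT cF) = (fun x => \sum_T (\1_(elt_set T) x : R)%:C%C *: pfield (cT T) x).
  apply/funext => x; apply: eq_bigr => T _; rewrite indicE; case: (boolP (x \in elt_set T)).
    by move=> /set_mem Tx; rewrite ucell_hyb.
  by rewrite !scale0r.
rewrite Re_ip ripC (rip_suml mOm _ hg hf); apply: eq_bigr => T _; rewrite ripC.
exact: (rip_indic _ (@elt_sub_domain _ _ _ _ Omp Thm T)).
Qed.

Lemma load_linear : linear_form (fun y => load (cell_coef y)).
Proof.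
by apply: linear_form_sum => T; exact: (linear_form_rip (mT T) (load_cell T).1 (cell_linear T)).
Qed.

(** Each cell is bounded separately, whence the number of elements; for the continuous dependence
    required by [well_posed] any constant independent of [f] will do. *)
Lemma load_le cT cF : load cT <=
  #|elt Th|%:R * L2norm lam Om f / Num.sqrt r * hnorm Om D Si Sb (hyb cT cF).
Proof.
have s0 : 0 < Num.sqrt r by rewrite sqrtr_gt0.
have H0 : 0 <= hnorm Om D Si Sb (hyb cT cF) by exact: sqrtr_ge0.
have hT T : ripT T f (pfield (cT T)) <= L2norm lam Om f * (hnorm Om D Si Sb (hyb cT cF) / Num.sqrt r).
  have [i1 n1] := load_cell T.
  apply: le_trans (ler_norm _) _; apply: le_trans (rip_cs (mT T) i1 (inL2_cell cT T)) _.
  apply: ler_pM => //; try exact: L2norm_ge0.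
  rewrite ler_pdivlMr// mulrC; apply: (sqrt_mul_le (ltW r0) H0).
  rewrite hnorm_sqr; apply: le_trans (_ : energy cT cF <= _); last by rewrite lerDl graph_energy_ge0.
  rewrite /energy -addrA; apply: le_trans (_ : r * (\sum_T (nT T (pfield (cT T)) ^+ 2 +
       hT T * \sum_(F | onT T F) nF F (pjump cT cF T F) ^+ 2)) <= _); last first.
    rewrite lerDl; apply: addr_ge0 (stab_energy_ge0 cT cF).
    by apply: mulr_ge0 (bound_energy_ge0 cF).
  apply: ler_wpM2l; first exact: ltW.
  rewrite (bigD1 T)//=.
  apply: le_trans (_ : nT T (pfield (cT T)) ^+ 2 +
       hT T * \sum_(F | onT T F) nF F (pjump cT cF T F) ^+ 2 <= _).
    rewrite lerDl; apply: mulr_ge0; first exact: (ltW (hT_gt0 d_gt0 Omp Thm T)).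
    by apply: sumr_ge0 => F _; exact: sqr_ge0.
  by rewrite lerDl; apply: sumr_ge0 => T' _; exact: cell_energy_ge0.
apply: le_trans (ler_sum _ (fun T _ => hT T)) _.
rewrite sumr_const -mulr_natl le_eqVlt; apply/orP; left; apply/eqP; ring.
Qed.

(** Equality of real parts for all test functions suffices: applied to the test function multiplied
    by the imaginary unit, it gives equality of imaginary parts. *)
Lemma solvesP y : solves Om D Si Sb k f (dhyb y) <-> forall z, dform y z = load (cell_coef z).
Proof.
split=> [[_ h] z|h].
  by rewrite /dform -Re_ah h ?Re_load//; exact: Uh_hyb.
have hR v : Uh k v -> complex.Re (ah Om D Si Sb (dhyb y) v) = complex.Re (ip lam Om f (vh v)).
  move=> /UhE[cT [cF ->]]; have [z [-> ->]] := coefs_surj cT cF.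
  by rewrite Re_ah Re_load -h.
split=> [|v hv]; first exact: Uh_hyb.
apply: complex_inj; first exact: hR.
rewrite -Re_ah_iscale hR; last exact: Uh_iscale.
by rewrite vh_iscale Re_ip_iscale.
Qed.

Lemma dform_eq0 y : dform y y = 0 -> dhyb y = hybrid0 m Th.
Proof.
move=> h; apply: energy_eq0; apply/eqP; rewrite eq_le energy_ge0 andbT -h.
exact: coercive.
Qed.

Lemma solution_exists : exists u, solves Om D Si Sb k f u.
Proof.
have [y|u hu] := linear_form_representable dform_bilinear load_linear.
  (* An element of the kernel is paired with itself; coercivity makes its cell functions vanish on
     the elements, and the load depends on nothing else. *)
  move=> /(_ y)/dform_eq0 h0; apply: big1 => T _.
  have -> : ripT T f (pfield (cell_coef y T)) = ripT T f (ucell (dhyb y) T).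
    by apply: eq_rip => // x Tx; rewrite ucell_hyb.
  by rewrite h0 /= rip0r.
by exists (dhyb u); apply/solvesP.
Qed.

Lemma solution_unique u u' : solves Om D Si Sb k f u -> solves Om D Si Sb k f u' -> u = u'.
Proof.
move=> su su'; have [/UhE[cT [cF E]] _] := su; have [/UhE[cT' [cF' E']] _] := su'.
have [y [Ey Fy]] := coefs_surj cT cF; have [y' [Ey' Fy']] := coefs_surj cT' cF'.
rewrite E Ey Fy -/(dhyb y) in su *; rewrite E' Ey' Fy' -/(dhyb y') in su' *.
have [hy hy'] := ((solvesP y).1 su, (solvesP y').1 su').
pose z := (-1) *: y' + y.
have z0 : dhyb z = hybrid0 m Th.
  by apply: dform_eq0; rewrite {1}/z (dform_bilinear z).2 hy hy' mulN1r addNr.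
have lin Y (c c' : exps -> 'cV[C]_m) : prestr Y (fun al => (-1)%:C%C *: c' al + c al) = (fun=> 0) ->
    prestr Y c = prestr Y c'.
  move=> e; apply/funext => x; have := congr1 (fun h => h x) e; rewrite /prestr.
  case: ifP => // _; rewrite pfieldD pfieldZ rmorphN rmorph1 scaleN1r addrC => /eqP.
  by rewrite subr_eq0 => /eqP.
rewrite /dhyb /hyb; apply: (f_equal2 (@Hybrid R d m Th)); apply/funext => Y; apply: lin.
  by rewrite -cell_coef_lin; have := congr1 (fun v => ucell v Y) z0.
by rewrite -face_coef_lin; have := congr1 (fun v => uface v Y) z0.
Qed.

(** The inf-sup argument again, with the bound of the load in the role of the supremum. *)
Lemma solution_bound u : (0 < m)%N -> solves Om D Si Sb k f u -> hnorm Om D Si Sb u <=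
  (stab_cst1 + 2 * stab_cst2) * (rsharp Om D / r) ^+ 2 * (#|elt Th|%:R / Num.sqrt r) * L2norm lam Om f.
Proof.
move=> m0 [/UhE[cT [cF ->]] h].
have bd cT' cF' : rform cT cF cT' cF' <=
    #|elt Th|%:R * L2norm lam Om f / Num.sqrt r * hnorm Om D Si Sb (hyb cT' cF').
  by rewrite -Re_ah h ?Re_load; [exact: load_le|exact: Uh_hyb].
have A1c : 0 <= stab_cst1 by rewrite /stab_cst1 addr_ge0// mulr_ge0// sqr_ge0.
have s0 : 0 <= #|elt Th|%:R * L2norm lam Om f / Num.sqrt r.
  by apply: divr_ge0; [apply: mulr_ge0 => //; exact: L2norm_ge0|exact: sqrtr_ge0].
have H : hnorm Om D Si Sb (hyb cT cF) <= (stab_cst1 + 2 * stab_cst2) * (rsharp Om D / r) ^+ 2 *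
    (#|elt Th|%:R * L2norm lam Om f / Num.sqrt r) := infsup_final A1c (sqrtr_ge0 _) (rho_ge1 m0)
  (sqrtr_ge0 _) s0 (stability cT cF m0) (bd cT cF) (bd (ctestT cT) (fun _ _ => 0)) (ctest_bound cT cF).
apply: le_trans H _; rewrite le_eqVlt; apply/orP; left; apply/eqP; ring.
Qed.

End load.

Lemma well_posed_hybrid : (0 < m)%N -> well_posed Om D Si Sb k.
Proof.
move=> m0; split=> [f hf|].
  have [u su] := solution_exists hf; exists u; split=> // u' su'.
  exact: (solution_unique hf su su').
exists ((stab_cst1 + 2 * stab_cst2) * (rsharp Om D / r) ^+ 2 * (#|elt Th|%:R / Num.sqrt r)).
by move=> f u hf su; exact: (solution_bound hf m0 su).
Qed.

End stability.

Theorem lemma9 (R : realType) (d : nat) (Om : set 'rV[R]_d)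
    (varrho CA : R) (k : nat) (CS : R) :
  (0 < d)%N -> polytopal_domain Om -> 0 < varrho < 1 -> 0 < CA ->
  exists2 C : R, 0 < C &
    forall (m : nat) (D : friedrichs R d m) (Th : mesh R d)
      (Si : elt Th -> face Th -> 'rV[R]_d -> 'M[R[i]]_m)
      (Sb : face Th -> 'rV[R]_d -> 'M[R[i]]_m),
      (0 < m)%N -> friedrichs_ok Om D ->
      is_mesh Om Th -> mesh_regularity Om Th varrho ->
      hoelder_constant D Th CA ->
      stabilization_ok Om D Si Sb k CS ->
      inf_sup Om D Si Sb k (C * (rsharp Om D / rflat D) ^+ 2) /\
      well_posed Om D Si Sb k.
Proof.
(* The estimates take square roots and products of a nonnegative stabilization constant; enlarging
   [CS] to [CS'] preserves the stabilization conditions and depends on [CS] alone. *)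
move=> d0 Omp v01 /ltW CA0; pose CS' := Num.max CS 0.
have CS0 : 0 <= CS' by rewrite le_max lexx orbT.
exists (stab_cst1 d k varrho CA CS' + 2 * stab_cst2 d k varrho CA CS').
  by apply: ltr_wpDr; [rewrite mulr_ge0 ?sqrtr_ge0|rewrite ltr_wpDr// mulr_ge0// sqr_ge0].
move=> m D Th Si Sb m0 Dok Thm reg hCA hS.
have hS' : stabilization_ok Om D Si Sb k CS'.
  by apply: stabilization_le hS; rewrite le_max lexx.
split; first exact: (inf_sup_hybrid d0 Omp Thm v01 reg Dok CA0 hCA CS0 hS' m0).
exact: (well_posed_hybrid d0 Omp Thm v01 reg Dok CA0 hCA CS0 hS' m0).
Qed.
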